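(* Let $\Omega\subseteq\mathbb{R}^n$ be open, $R\in\hat{\mathcal E}(\Omega)$ and $X\in C^\infty(\Omega,\mathbb{R}^n)$. Then (a) $R\in\hat{\mathcal E}_m(\Omega)$ implies $\hat{\mathrm L}_XR\in\hat{\mathcal E}_m(\Omega)$; (b) $R\in\hat{\mathcal N}(\Omega)$ implies $\hat{\mathrm L}_XR\in\hat{\mathcal N}(\Omega)$.
   Context: Notation. $I=(0,1]$. $\mathcal D(\Omega)$ is the space of test functions on an open set $\Omega\subseteq\mathbb{R}^n$. $A\subset\subset B$ means that $A$ is compact and contained in the interior of $B$. $B_r(x)$ is the open Euclidean ball. Smoothness of maps on or into locally convex spaces is in the sense of convenient calculus (Kriegl–Michor). $f(\varepsilon)=O(g(\varepsilon))$ means: there are $\varepsilon_0>0$, $C>0$ with $|f(\varepsilon)|\le Cg(\varepsilon)$ for all $\varepsilon\le\varepsilon_0$. $\partial_{x+y}^\alpha=(\partial_x+\partial_y)^\alpha$ (expanded by the binomial theorem). Smoothing kernels. $\widetilde{\mathcal A}_q(\Omega)$ ($q\in\mathbb{N}_0$) is the set of all $\tilde\phi\in C^\infty(I\times\Omega,\mathcal D(\Omega))$, $(\varepsilon,x)\mapsto[y\mapsto\tilde\phi_{\varepsilon,x}(y)]$, such that (LSK1) $\forall K\subset\subset\Omega$ $\exists\varepsilon_0,C>0$ $\forall x\in K$ $\forall\varepsilon<\varepsilon_0$: $\operatorname{supp}\tilde\phi_{\varepsilon,x}\subseteq B_{C\varepsilon}(x)$; (LSK2) $\forall K\subset\subset\Omega$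 $\forall\alpha,\beta\in\mathbb{N}_0^n$: $(\partial_{x+y}^\alpha\partial_y^\beta\tilde\phi)_{\varepsilon,x}(y)=O(\varepsilon^{-n-|\beta|})$ uniformly for $x\in K$, $y\in\Omega$; (LSK3) $\forall K\subset\subset\Omega$ $\forall\alpha\in\mathbb{N}_0^n$ $\forall f\in C^\infty(\Omega)$: $\int_\Omega f(y)(\partial_x^\alpha\tilde\phi)_{\varepsilon,x}(y)\,dy=(\partial^\alpha f)(x)+O(\varepsilon^{q+1})$ uniformly for $x\in K$. Basic space: $\hat{\mathcal E}(\Omega)=C^\infty(\mathcal D(\Omega)\times\Omega)$, the smooth (scalar-valued) functions $R\colon(\varphi,x)\mapsto R(\varphi,x)$. Derivative: $(\hat{\mathrm L}_XR)(\varphi,x)=-\mathrm d_1R(\varphi,x)(\mathrm L_X\varphi)+(\mathrm D_X^xR)(\varphi,x)$, where $\mathrm d_1$ is the differential in the first variable, $\mathrm D_X^x$ the directional derivative along $X$ in the variable $x$, and $\mathrm L_X\varphi=\mathrm D_X\varphi+(\operatorname{div}X)\varphi$ for $\varphi\in\mathcal D(\Omega)$. Moderateness: $\hat{\mathcal E}_m(\Omega)$ is the set of $R\in\hat{\mathcal E}(\Omega)$ such that $\forall K\subset\subset\Omega$ $\forall\alpha\in\mathbb{N}_0^n$ $\exists q\in\mathbb{N}_0$ $\exists N\in\mathbb{N}$ $\forall\tilde\phi\in\widetilde{\mathcal A}_q(\Omega)$: $\sup_{x\in K}|\partial_x^\alpha(R(\tilde\phi_{\varepsilon,x},x))|=O(\varepsilon^{-N})$.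 Negligibility: $\hat{\mathcal N}(\Omega)$ is the set of $R\in\hat{\mathcal E}(\Omega)$ such that $\forall K\subset\subset\Omega$ $\forall\alpha\in\mathbb{N}_0^n$ $\forall m\in\mathbb{N}$ $\exists q\in\mathbb{N}_0$ $\forall\tilde\phi\in\widetilde{\mathcal A}_q(\Omega)$: $\sup_{x\in K}|\partial_x^\alpha(R(\tilde\phi_{\varepsilon,x},x))|=O(\varepsilon^m)$. *)

(* Defs.v *)
From HB Require Import structures.
From mathcomp Require Import all_boot all_order all_algebra.
From mathcomp Require Import all_classical all_reals all_analysis.
From mathcomp Require Import complex.

Set Implicit Arguments.
Unset Strict Implicit.
Unset Printing Implicit Defensive.

Import Order.TTheory GRing.Theory Num.Theory.
Import numFieldNormedType.Exports.

Local Open Scope classical_set_scope.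
Local Open Scope ring_scope.

(* Scalars. The scalar field is either the reals or the complex numbers; in   *)
(* both cases it is regarded as a normed space over R. For the complex field  *)
(* we use Rcomplex R, i.e. R[i] as an R-module, normed by the modulus.        *)

Section Rcomplex_normedModType.
Variable R : realType.

HB.instance Definition _ :=
  PseudoMetric.copy (Rcomplex R) (pseudoMetric_normed (Rcomplex R)).
HB.instance Definition _ := isPointed.Build (Rcomplex R) 0.
HB.instance Definition _ :=
  NormedZmod_PseudoMetric_eq.Build R (Rcomplex R) erefl.

Lemma Rcomplex_normrZ (l : R) (x : Rcomplex R) : `|l *: x| = `|l| * `|x|.
Proof.
case: x => a b.
rewrite /Num.norm/= /Normc.normc/= !exprMn -mulrDr sqrtrM ?sqr_ge0//.
by rewrite sqrtr_sqr.
Qed.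

HB.instance Definition _ :=
  PseudoMetricNormedZmod_Lmodule_isNormedModule.Build R (Rcomplex R)
    Rcomplex_normrZ.

End Rcomplex_normedModType.

Variant scalar_kind := RealScalars | ComplexScalars.

Definition scalars (R : realType) (F : scalar_kind) : normedModType R :=
  match F with
  | RealScalars => R
  | ComplexScalars => Rcomplex R
  end.

Definition scalar_mul (R : realType) (F : scalar_kind) :
    scalars R F -> scalars R F -> scalars R F :=
  match F with
  | RealScalars => fun a b : R => a * b
  | ComplexScalars => fun a b : Rcomplex R => a * b
  end.

(* Integration over R^n, by iterated Lebesgue integrals; it will only be      *)
(* applied to continuous functions with compact support.                      *)

Fixpoint Rn_integral (R : realType) (n : nat) : ('rV[R]_n -> R) -> R :=
  match n with
  | 0%N => fun f => f 0
  | n'.+1 => fun f =>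
      \int[@lebesgue_measure R]_t
        Rn_integral (fun y : 'rV[R]_n' => f (row_mx (t%:M : 'rV[R]_1) y))
  end.

Definition Rn_integral_on (R : realType) (n : nat) (Om : set 'rV[R]_n)
    (g : 'rV[R]_n -> R) : R := Rn_integral (g \_ Om).

Definition scalar_integral (R : realType) (n : nat) (F : scalar_kind)
    (Om : set 'rV[R]_n) : ('rV[R]_n -> scalars R F) -> scalars R F :=
  match F return ('rV[R]_n -> scalars R F) -> scalars R F with
  | RealScalars => fun g : 'rV[R]_n -> R => Rn_integral_on Om g
  | ComplexScalars => fun g : 'rV[R]_n -> Rcomplex R =>
      Complex (Rn_integral_on Om (fun y => complex.Re (g y)))
              (Rn_integral_on Om (fun y => complex.Im (g y)))
  end.

Section multiindices.
Variables (R : realType) (n : nat).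

Definition mindex_order (al : 'I_n -> nat) : nat := (\sum_i al i)%N.

(* D^al for a family of (commuting) operators D_0, ..., D_(n-1) on T *)
Definition mindex_iter (T : Type) (D : 'I_n -> T -> T) (al : 'I_n -> nat)
    (f : T) : T :=
  foldr (fun i g => iter (al i) (D i) g) f (enum 'I_n).

Definition basisv (i : 'I_n) : 'rV[R]_n := delta_mx 0 i.

Definition pderiv (W : normedModType R) (i : 'I_n) (f : 'rV[R]_n -> W) :
    'rV[R]_n -> W := 'D_(basisv i) f.

Definition mpderiv (W : normedModType R) (al : 'I_n -> nat)
    (f : 'rV[R]_n -> W) : 'rV[R]_n -> W :=
  mindex_iter (@pderiv W) al f.

(* partial derivatives in an arbitrary order: the directions listed in s *)
Definition pderivs (W : normedModType R) (s : seq 'I_n) (f : 'rV[R]_n -> W) :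
    'rV[R]_n -> W := foldr (@pderiv W) f s.

(* C^infty(A, W), A open: all iterated partial derivatives exist and are      *)
(* Frechet differentiable on A. Values outside of A are irrelevant.           *)
Definition smooth_on (W : normedModType R) (A : set 'rV[R]_n)
    (f : 'rV[R]_n -> W) : Prop :=
  forall (s : seq 'I_n) (x : 'rV[R]_n), A x -> differentiable (pderivs s f) x.

End multiindices.

Section smooth_theory.
Variables (R : realType) (n : nat).
Local Notation V := 'rV[R]_n.
Implicit Types W : normedModType R.

Lemma near_differentiable W (f g : V -> W) x :
  (\near x, f x = g x) -> differentiable f x -> differentiable g x.
Proof.
move=> fg /diff_locallyP [cf df].
have fx : f x = g x by exact: (nbhs_singleton fg).
have H : g \o shift x = cst (g x) + 'd f x +o_ 0 id.
  rewrite -fx; apply/eqaddoP => e e0.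
  move/eqaddoP : df => /(_ e e0) dfe.
  have fg0 : \forall h \near (0 : V), f (h + x) = g (h + x).
    move: fg; rewrite (near_shift 0 x); apply: filterS => h /=.
    by rewrite subr0.
  by apply: filterS2 fg0 dfe => h /= fgh; rewrite !fctE /= fgh.
apply/diff_locallyP.
by have -> : 'd g x = 'd f x :> (V -> W) by exact: diff_unique.
Qed.

Lemma scale_is_bilinear W :
  bilinear_for
    (GRing.Scale.Law.clone _ _ *:%R _) (GRing.Scale.Law.clone _ _ *:%R _)
    ( *:%R : R -> W -> W).
Proof.
split=> [u'|u] a x y /=; first by rewrite scalerDl scalerA.
by rewrite scalerDr !scalerA mulrC.
Qed.

HB.instance Definition _ W :=
  bilinear_isBilinear.Build R R W W _ _ ( *:%R : R -> W -> W)
    (@scale_is_bilinear W).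

Lemma is_diff_scale W (a da : V -> R) (f df : V -> W) x :
  is_diff x a da -> is_diff x f df ->
  is_diff x (fun z => a z *: f z) (fun v => a x *: df v + da v *: f x).
Proof.
move=> dax dfx.
have cs : continuous (fun p : R * W => p.1 *: p.2) by exact: scale_continuous.
have d2 : is_diff (a x, f x) (fun p : R * W => p.1 *: p.2)
    (fun q => (a x, f x).1 *: q.2 + q.1 *: (a x, f x).2).
  apply: DiffDef; first exact: (@differentiable_bilin _ _ _ _ ( *:%R)).
  exact: (@diff_bilin _ _ _ _ ( *:%R)).
exact: (@is_diff_comp _ _ _ _ (fun z => (a z, f z)) _
  (fun p : R * W => p.1 *: p.2)).
Qed.

Definition Csmooth W (k : nat) (A : set V) (f : V -> W) :=
  forall (s : seq 'I_n) (x : V), (size s <= k)%N -> A x ->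
    differentiable (pderivs s f) x.

Lemma smooth_onP W (A : set V) (f : V -> W) :
  smooth_on A f <-> forall k, Csmooth k A f.
Proof.
by split=> [sf k s x _ Ax|sf s x Ax]; [exact: sf|exact: (sf (size s))].
Qed.

Lemma CsmoothS W (k : nat) (A : set V) (f : V -> W) :
  Csmooth k.+1 A f <->
  (forall x, A x -> differentiable f x) /\ forall i, Csmooth k A (pderiv i f).
Proof.
split=> [sf|[df sf] s x].
  split=> [x Ax|i s x sk Ax]; first exact: (sf [::]).
  have := sf (rcons s i) x; rewrite size_rcons ltnS => /(_ sk Ax).
  by rewrite /pderivs foldr_rcons.
case/lastP: s => [_ /df//|s i]; rewrite size_rcons ltnS => sk Ax.
by rewrite /pderivs foldr_rcons; exact: sf.
Qed.

Lemma CsmoothW W (k : nat) (A : set V) (f : V -> W) :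
  Csmooth k.+1 A f -> Csmooth k A f.
Proof. by move=> sf s x sk; apply: sf; exact: leqW. Qed.

Lemma Csmooth0 W (A : set V) (f : V -> W) :
  Csmooth 0 A f <-> forall x, A x -> differentiable f x.
Proof.
split=> [sf x|df s x]; first exact: (sf [::]).
by rewrite leqn0 size_eq0 => /eqP -> /df.
Qed.

Lemma Csmooth_diff W k (A : set V) (f : V -> W) x :
  Csmooth k A f -> A x -> differentiable f x.
Proof. by move=> sf; exact: (sf [::]). Qed.

Lemma Csmooth_eq W k (A : set V) (f g : V -> W) :
  open A -> (forall x, A x -> f x = g x) -> Csmooth k A f -> Csmooth k A g.
Proof.
move=> oA; elim: k f g => [|k ih] f g fg.
  move=> /Csmooth0 df; apply/Csmooth0 => x Ax.
  apply: near_differentiable (df _ Ax).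
  by near=> y; apply: fg; near: y; exact: open_nbhs_nbhs.
move=> /CsmoothS[df sf]; apply/CsmoothS; split=> [x Ax|i].
  apply: near_differentiable (df _ Ax).
  by near=> y; apply: fg; near: y; exact: open_nbhs_nbhs.
apply: ih (sf i) => x Ax; apply: near_eq_derive.
by near=> y; apply: fg; near: y; exact: open_nbhs_nbhs.
Unshelve. all: by end_near. Qed.

Lemma CsmoothD W k (A : set V) (f g : V -> W) : open A ->
  Csmooth k A f -> Csmooth k A g -> Csmooth k A (f + g).
Proof.
move=> oA; elim: k f g => [|k ih] f g.
  by rewrite !Csmooth0 => df dg x Ax; apply: differentiableD; auto.
move=> /CsmoothS[df sf] /CsmoothS[dg sg]; apply/CsmoothS; split=> [x Ax|i].
  by apply: differentiableD; auto.
apply: Csmooth_eq (ih _ _ (sf i) (sg i)) => // x Ax.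
by rewrite /pderiv deriveD//; apply: diff_derivable; auto.
Qed.

Lemma Csmooth_cst W k (A : set V) (w : W) : open A -> Csmooth k A (cst w).
Proof.
move=> oA; elim: k w => [|k ih] w; first by apply/Csmooth0.
apply/CsmoothS; split=> [x Ax//|i].
by apply: Csmooth_eq (ih 0) => // x Ax; rewrite /pderiv derive_cst.
Qed.

Lemma Csmooth_scale W k (A : set V) (a : V -> R) (f : V -> W) : open A ->
  Csmooth k A a -> Csmooth k A f -> Csmooth k A (fun z => a z *: f z).
Proof.
move=> oA.
have ds (b : V -> R) (g : V -> W) x : differentiable b x -> differentiable g x ->
    is_diff x (fun z => b z *: g z : W)
      (fun v => b x *: 'd g x v + 'd b x v *: g x).
  by move=> /differentiableP db /differentiableP dg; exact: is_diff_scale.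
elim: k a f => [|k ih] a f.
  rewrite !Csmooth0 => da df x Ax.
  by have [] := ds _ _ _ (da _ Ax) (df _ Ax).
move=> sa sf; have /CsmoothS[da sa'] := sa; have /CsmoothS[df sf'] := sf.
apply/CsmoothS; split=> [x Ax|i].
  by have [] := ds _ _ _ (da _ Ax) (df _ Ax).
have H := CsmoothD oA (ih _ _ (CsmoothW sa) (sf' i))
                      (ih _ _ (sa' i) (CsmoothW sf)).
apply: Csmooth_eq H => // x Ax; rewrite /pderiv.
have [dsx dsE] := ds _ _ _ (da _ Ax) (df _ Ax).
by rewrite (deriveE _ dsx) dsE -(deriveE _ (da x Ax)) -(deriveE _ (df x Ax)).
Qed.

Lemma Csmooth_sum W k (A : set V) m (f : 'I_m -> V -> W) : open A ->
  (forall i, Csmooth k A (f i)) -> Csmooth k A (fun z => \sum_i f i z).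
Proof.
move=> oA sf; have -> : (fun z => \sum_i f i z) = \sum_i f i.
  by apply/funext => z; rewrite fct_sumE.
by elim/big_ind : _ => [|g h|i _]; [exact: Csmooth_cst|exact: CsmoothD|].
Qed.

Lemma Csmooth_coord m k (A : set V) (X : V -> 'rV[R]_m) (j : 'I_m) : open A ->
  Csmooth k A X -> Csmooth k A (fun z => X z 0 j).
Proof.
move=> oA.
pose c := (fun u : 'rV[R]_m => u 0 j : R).
have dc (Y : V -> 'rV[R]_m) x : differentiable Y x ->
    differentiable (fun z => Y z 0 j) x.
  by move=> dY; apply: (@differentiable_comp _ _ _ _ Y c) => //;
    exact: differentiable_coord.
elim: k X => [|k ih] X; first by rewrite !Csmooth0 => dX x Ax; exact/dc/dX.
move=> /CsmoothS[dX sX]; apply/CsmoothS; split=> [x Ax|i]; first exact/dc/dX.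
apply: Csmooth_eq (ih _ (sX i)) => // x Ax; rewrite /pderiv.
have @l : {linear 'rV[R]_m -> R}.
  by exists c; do 2![eexists]; do ?[constructor];
     rewrite /c ?mxE// => ? *; rewrite ?mxE//; move=> ?; rewrite !mxE.
have cl : continuous l by exact: coord_continuous.
have dXx := dX _ Ax.
have dl : differentiable l (X x) by exact: linear_differentiable.
rewrite deriveE// deriveE; last exact: dc.
rewrite -[fun z => X z 0 j]/(l \o X) (diff_comp dXx dl).
by have /= := congr1 (fun h => h ('d X x (basisv R i))) (esym (diff_lin (X x) cl)).
Qed.

End smooth_theory.

Section test_functions.
Variables (R : realType) (n : nat) (W : normedModType R) (Om : set 'rV[R]_n).
Local Notation V := 'rV[R]_n.

Definition supp (f : V -> W) : set V := closure [set x | f x != 0].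

(* D(Om): the functions on Om are extended by 0 to R^n *)
Definition testfuns : {pred V -> W} :=
  mem [set f : V -> W | [/\ smooth_on setT f, compact (supp f) & supp f `<=` Om]].

Lemma supp0 (f : V -> W) x : ~ supp f x -> f x = 0.
Proof.
by move=> fx; apply: contrapT => /eqP fx0; apply: fx; exact: subset_closure.
Qed.

Lemma near_supp0 (f : V -> W) x : ~ supp f x -> \forall y \near x, f y = 0.
Proof.
move=> fx; have : open (~` supp f) by apply: closed_openC; exact: closed_closure.
move=> oC; have : nbhs x (~` supp f) by exact: open_nbhs_nbhs.
by apply: filterS => y; exact: supp0.
Qed.

Lemma testfuns_sub (A : set V) (f : V -> W) : smooth_on setT f ->
  compact A -> A `<=` Om -> (forall x, f x != 0 -> A x) -> f \in testfuns.
Proof.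
move=> sf cA AO fA.
have sA : supp f `<=` A.
  have -> : A = closure A.
    by apply/closure_id; apply: compact_closed => //; exact: norm_hausdorff.
  exact: closure_subset.
apply/mem_set; split=> //; last exact: subset_trans AO.
by apply: subclosed_compact cA sA; exact: closed_closure.
Qed.

Lemma testfuns_submod_closed : submod_closed testfuns.
Proof.
split=> [|a f g].
  apply: (@testfuns_sub set0) => //.
  - by apply/smooth_onP => k; apply: (@Csmooth_cst _ _ _ k setT 0); exact: openT.
  - exact: compact0.
  - by move=> x /eqP.
move=> /set_mem[/smooth_onP sf cf fO] /set_mem[/smooth_onP sg cg gO].
apply: (@testfuns_sub (supp f `|` supp g)); last first.
- move=> x; apply: contraPP => /not_orP[/supp0 fx /supp0 gx].
  apply/negP; rewrite negbK -[(_ + _) x]/(a *: f x + g x).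
  by rewrite fx gx scaler0 addr0.
- by rewrite subUset.
- exact: compactU.
apply/smooth_onP => k; apply: CsmoothD => //; first exact: openT.
by apply: (@Csmooth_scale _ _ _ _ _ (cst a)) => //;
  [exact: openT|apply: Csmooth_cst; exact: openT].
Qed.

HB.instance Definition _ :=
  GRing.isSubmodClosed.Build _ _ testfuns testfuns_submod_closed.

Record testfun := TestFun { tf_val :> V -> W ; _ : tf_val \in testfuns }.

HB.instance Definition _ := [isSub for tf_val].
HB.instance Definition _ := [Choice of testfun by <:].
HB.instance Definition _ := [SubChoice_isSubLmodule of testfun by <:].
HB.instance Definition _ := isPointed.Build testfun 0.

Lemma testfunP (f : testfun) :
  [/\ smooth_on setT f, compact (supp f) & supp f `<=` Om].
Proof. by apply: set_mem; exact: (valP f). Qed.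

(* The topology of D(Om): a seminorm is continuous iff its restriction to     *)
(* each D_A(Om), A compact, is bounded by a multiple of some C^m-norm. This   *)
(* is the finest locally convex topology which makes all the inclusions       *)
(* D_A(Om) -> D(Om) continuous.                                               *)
Definition lf_seminorm (p : testfun -> R) : Prop :=
  [/\ forall f g, p (f + g) <= p f + p g,
      forall a f, p (a *: f) = `|a| * p f &
      forall A, compact A -> A `<=` Om -> exists (m : nat) (C : R),
        forall (f : testfun) (M : R), supp f `<=` A ->
        (forall (s : seq 'I_n) (x : V), (size s <= m)%N ->
           `|pderivs s f x| <= M) ->
        p f <= C * M].

Definition lf_ball (p : testfun -> R) (f : testfun) (e : R) : set testfun :=
  [set g | p (g - f) < e].

Definition lf_nbhs (f : testfun) : set_system testfun :=
  [set U | exists p : testfun -> R, lf_seminorm p /\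
           exists2 e : R, 0 < e & lf_ball p f e `<=` U].

HB.instance Definition _ := hasNbhs.Build testfun lf_nbhs.

Lemma lf_seminorm0 p : lf_seminorm p -> p 0 = 0.
Proof. by move=> [_ pZ _]; rewrite -(scale0r 0) pZ normr0 mul0r. Qed.

Lemma lf_seminormN p f : lf_seminorm p -> p (- f) = p f.
Proof. by move=> [_ pZ _]; rewrite -scaleN1r pZ normrN1 mul1r. Qed.

Lemma lf_seminorm_ge0 p f : lf_seminorm p -> 0 <= p f.
Proof.
move=> hp; have [pD _ _] := hp.
have := pD f (- f); rewrite subrr lf_seminorm0// lf_seminormN//.
by rewrite -mulr2n pmulrn_lge0.
Qed.

Lemma lf_seminorm_cst0 : lf_seminorm (cst 0).
Proof.
split=> [f g|a f|A _ _]; [by rewrite addr0|by rewrite mulr0|].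
by exists 0%N, 0 => f M _ _; rewrite mul0r.
Qed.

Lemma lf_seminormD p q : lf_seminorm p -> lf_seminorm q ->
  lf_seminorm (fun f => p f + q f).
Proof.
move=> [pD pZ pA] [qD qZ qA]; split=> [f g|a f|A cA AO].
- by rewrite addrACA lerD.
- by rewrite pZ qZ mulrDr.
- have [m1 [C1 H1]] := pA A cA AO; have [m2 [C2 H2]] := qA A cA AO.
  exists (maxn m1 m2), (C1 + C2) => f M fA fM; rewrite mulrDl lerD//.
    by apply: H1 => // s x sm; apply: fM; rewrite leq_max sm.
  by apply: H2 => // s x sm; apply: fM; rewrite leq_max sm orbT.
Qed.

Lemma lf_ball_center p f e : lf_seminorm p -> 0 < e -> lf_ball p f e f.
Proof. by move=> hp e0; rewrite /lf_ball/= subrr lf_seminorm0. Qed.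

Lemma lf_nbhs_ball p (f : testfun) e : lf_seminorm p -> 0 < e -> nbhs f (lf_ball p f e).
Proof. by move=> hp e0; exists p; split=> //; exists e. Qed.

Lemma lf_nbhs_filter (f : testfun) : ProperFilter (nbhs f).
Proof.
constructor.
  by move=> [p [hp [e e0 /(_ f)]]]; apply; exact: lf_ball_center.
split.
- exists (cst 0); split; first exact: lf_seminorm_cst0.
  by exists 1.
- move=> P Q [p [hp [d d0 pP]]] [q [hq [e e0 qQ]]].
  exists (fun f => p f + q f); split; first exact: lf_seminormD.
  exists (Num.min d e) => [|g]; first by rewrite lt_min d0.
  rewrite /lf_ball/= lt_min => /andP[gd ge]; split.
    by apply: pP; apply: le_lt_trans gd; rewrite lerDl lf_seminorm_ge0.
  by apply: qQ; apply: le_lt_trans ge; rewrite lerDr lf_seminorm_ge0.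
- move=> P Q PQ [p [hp [e e0 pP]]]; exists p; split=> //; exists e => //.
  exact: subset_trans PQ.
Qed.

Lemma lf_ball_open p (f : testfun) e (g : testfun) : lf_seminorm p -> lf_ball p f e g ->
  nbhs g (lf_ball p f e).
Proof.
move=> hp gf; exists p; split=> //; exists (e - p (g - f)).
  by rewrite subr_gt0.
move=> h; rewrite /lf_ball/= ltrBrDr; apply: le_lt_trans.
by have [pD _ _] := hp; rewrite -[h - f](subrKA g) pD.
Qed.

Lemma lf_nbhs_singleton (f : testfun) (U : set testfun) : nbhs f U -> U f.
Proof. by move=> [p [hp [e e0]]]; apply; exact: lf_ball_center. Qed.

Lemma lf_nbhs_nbhs (f : testfun) (U : set testfun) :
  nbhs f U -> nbhs f (nbhs^~ U).
Proof.
move=> [p [hp [e e0 pU]]]; exists p; split=> //; exists e => // g gf.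
have := lf_ball_open hp gf.
by apply: (@filterS _ _ (lf_nbhs_filter g)).
Qed.

HB.instance Definition _ := Nbhs_isNbhsTopological.Build testfun
  lf_nbhs_filter lf_nbhs_singleton lf_nbhs_nbhs.

Lemma testfun_add_continuous :
  continuous (fun x : testfun * testfun => x.1 + x.2).
Proof.
move=> [f g] U /= [p [hp [e e0 pU]]].
have e20 : 0 < e / 2 by rewrite divr_gt0.
exists (lf_ball p f (e / 2), lf_ball p g (e / 2)).
  by split; exact: lf_nbhs_ball.
move=> [f' g'] /= [ff' gg']; apply: pU; rewrite /lf_ball/= opprD addrACA.
have [pD _ _] := hp; apply: le_lt_trans (pD _ _) _.
by rewrite [ltRHS]splitr ltrD.
Qed.

Lemma testfun_scale_continuous :
  continuous (fun z : R^o * testfun => z.1 *: z.2).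
Proof.
move=> [a f] U /= [p [hp [e e0 pU]]].
have [pD pZ _] := hp.
have pf0 : 0 < p f + 1 by rewrite ltr_wpDl// lf_seminorm_ge0.
have a0 : 0 < `|a| + 1 by rewrite ltr_wpDl.
pose d := Num.min 1 (e / 2 / (p f + 1)).
have d0 : 0 < d by rewrite lt_min ltr01 !divr_gt0.
exists (ball (a : R^o) d, lf_ball p f (e / 2 / (`|a| + 1))).
  split; first exact: nbhsx_ballx.
  by apply: lf_nbhs_ball => //; rewrite !divr_gt0.
move=> [b g] /= [ab fg]; apply: pU; rewrite /lf_ball/=.
move: ab; rewrite /ball/= lt_min => /andP[ab1 abe].
have -> : b *: g - a *: f = b *: (g - f) + (b - a) *: f.
  by rewrite scalerBr scalerBl addrA subrK.
apply: le_lt_trans (pD _ _) _; rewrite !pZ [ltRHS]splitr ltr_leD//.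
  have ba : `|b| <= `|a| + 1.
    rewrite -[b](subrK a) addrC (le_trans (ler_normD _ _))// lerD2l distrC.
    exact: ltW.
  apply: (@le_lt_trans _ _ ((`|a| + 1) * p (g - f))).
    by rewrite ler_wpM2r// lf_seminorm_ge0.
  by rewrite mulrC -ltr_pdivlMr.
apply: (@le_trans _ _ (`|b - a| * (p f + 1))).
  by rewrite ler_wpM2l// lerDl.
by rewrite -ler_pdivlMr// distrC ltW.
Qed.

Lemma testfun_locally_convex : exists2 B : set_system testfun,
  (forall b, b \in B -> convex_set b) & basis B.
Proof.
exists [set b | exists p f e, [/\ lf_seminorm p, 0 < e & b = lf_ball p f e]].
  move=> b /set_mem[p [f [e [hp e0 ->]]]].
  have [pD pZ _] := hp.
  apply/convex_setW => g h /set_mem gf /set_mem hf l l0 l1; apply/mem_set.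
  rewrite /lf_ball/=.
  suff -> : (conv l g h : testfun) - f = l%:num *: (g - f) + (1 - l%:num) *: (h - f).
    have l10 : 0 < (1 - l%:num) by rewrite subr_gt0.
    apply: le_lt_trans (pD _ _) _; rewrite !pZ !gtr0_norm//.
    rewrite [ltRHS](_ : _ = l%:num * e + (1 - l%:num) * e); last first.
      by rewrite -mulrDl addrC subrK mul1r.
    by rewrite ltrD// ltr_pM2l.
  rewrite [X in X - f](_ : _ = l%:num *: g + (1 - l%:num) *: h)//.
  by rewrite !scalerBr addrACA -opprD -scalerDl [l%:num + _]addrC subrK scale1r.
split=> [b [p [f [e [hp e0 ->]]]]|f U [p [hp [e e0 pU]]]].
  by rewrite openE => g gf; exact: lf_ball_open.
exists (lf_ball p f e) => //; split; first by exists p, f, e.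
exact: lf_ball_center.
Qed.

HB.instance Definition _ := PreTopologicalLmod_isTvs.Build R testfun
  testfun_add_continuous testfun_scale_continuous testfun_locally_convex.
HB.instance Definition _ :=
  PreTopologicalNmodule_isTopologicalNmodule.Build testfun
    testfun_add_continuous.
HB.instance Definition _ :=
  TopologicalNmodule_isTopologicalLmodule.Build R testfun
    testfun_scale_continuous.
HB.instance Definition _ :=
  Uniform_isTvs.Build R testfun testfun_locally_convex.

End test_functions.

Section lie_derivative.
Variables (R : realType) (n : nat) (W : normedModType R) (Om : set 'rV[R]_n).
Local Notation V := 'rV[R]_n.

Definition divergence (X : V -> V) (x : V) : R :=
  \sum_i pderiv i (fun y => X y 0 i) x.

Definition lie_fun (X : V -> V) (f : V -> W) (x : V) : W :=
  'D_(X x) f x + divergence X x *: f x.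

Lemma deriv_testfunP (i : 'I_n) (f : testfun W Om) :
  pderiv i f \in testfuns Om.
Proof.
have [sf cf fO] := testfunP f.
apply: (testfuns_sub (A := supp f)) => //.
  apply/smooth_onP => k; move/smooth_onP : sf => /(_ k.+1) /CsmoothS[_]; exact.
move=> x; apply: contraPP => /near_supp0 fx; apply/negP; rewrite negbK.
by rewrite /pderiv (near_eq_derive (g := cst 0))// derive_cst.
Qed.

Definition testfun_pderiv (i : 'I_n) (f : testfun W Om) : testfun W Om :=
  TestFun (deriv_testfunP i f).

Hypotheses (oOm : open Om).
Variables (X : V -> V).
Hypothesis sX : smooth_on Om X.

Lemma lie_testfunP (f : testfun W Om) : lie_fun X f \in testfuns Om.
Proof.
have [sf cf fO] := testfunP f.
have lie0 x : ~ supp f x -> lie_fun X f x = 0.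
  move=> fx; have fx0 := near_supp0 fx.
  rewrite /lie_fun (near_eq_derive (g := cst 0))// derive_cst.
  by rewrite (supp0 fx) scaler0 addr0.
apply: (testfuns_sub (A := supp f)) => //; last first.
  by move=> x; apply: contraPP => /lie0 ->; rewrite eqxx.
have sOm k : Csmooth k Om f by move=> s x _ _; exact: sf.
have dOm i k : Csmooth k Om (pderiv i f) by have /CsmoothS[_] := sOm k.+1.
have sXk k : Csmooth k Om X by move: k; exact/smooth_onP.
have lieOm k : Csmooth k Om (lie_fun X f).
  have H1 : Csmooth k Om (fun x => \sum_i X x 0 i *: pderiv i f x).
    apply: Csmooth_sum => // i; apply: Csmooth_scale => //.
    exact: Csmooth_coord.
  have H2 : Csmooth k Om (fun x => divergence X x *: f x).
    apply: Csmooth_scale => //; apply: Csmooth_sum => // i.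
    by have /CsmoothS[_] := Csmooth_coord i oOm (sXk k.+1); exact.
  apply: Csmooth_eq (CsmoothD oOm H1 H2) => // x Ox.
  rewrite /lie_fun -[LHS]/(_ + _); congr (_ + _).
  have df : differentiable f x := sf [::] x I.
  rewrite deriveE// [in RHS](row_sum_delta (X x)) linear_sum.
  by apply: eq_bigr => i _; rewrite linearZ /pderiv deriveE.
apply/smooth_onP => k s x sk _.
have [/fO Ox|fx] := pselect (supp f x); first exact: lieOm.
have oC : open (~` supp f) by apply: closed_openC; exact: closed_closure.
have : Csmooth k (~` supp f) (lie_fun X f).
  have H : Csmooth k (~` supp f) (cst (0 : W)) by exact: Csmooth_cst.
  by apply: Csmooth_eq H => // y /lie0 ->.
exact.
Qed.

Definition lie_testfun (f : testfun W Om) : testfun W Om :=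
  TestFun (lie_testfunP f).

End lie_derivative.

Section convenient_calculus.
Variable R : realType.
Implicit Types E F : tvsType R.

(* Curves with derivatives of all orders; d k is the k-th derivative of c *)
Definition smooth_curve E (c : R -> E) : Prop :=
  exists d : nat -> R -> E, d 0%N = c /\
    forall k (t : R),
      h^-1 *: (d k (t + h) - d k t) @[h --> 0^'] --> d k.+1 t.

(* Smoothness in the sense of Kriegl and Michor, for possibly non-open A: f    *)
(* maps the smooth curves with values in A to smooth curves.                  *)
Definition csmooth E F (A : set E) (f : E -> F) : Prop :=
  forall c : R -> E, smooth_curve c -> (forall t, A (c t)) ->
    smooth_curve (f \o c).

(* directional derivative, 0 if the limit does not exist *)
Definition tderive E F (f : E -> F) (x v : E) : F :=
  xget 0 [set l | h^-1 *: (f (x + h *: v) - f x) @[h --> 0^'] --> l].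

End convenient_calculus.

Section kernels.
Variables (R : realType) (n : nat) (F : scalar_kind) (Om : set 'rV[R]_n).
Local Notation V := 'rV[R]_n.
Local Notation K := (scalars R F).
Local Notation D := (testfun K Om).

(* A kernel (e, x) |-> phi e x; its values outside of ]0, 1] x Om are         *)
(* irrelevant.                                                                *)
Definition kernel_smooth (phi : R -> V -> D) : Prop :=
  csmooth [set p : R * V | [/\ 0 < p.1, p.1 <= 1 & Om p.2]]
    (fun p : R * V => phi p.1 p.2).

(* derivative of phi e : R^n -> D(Om), the limit being taken in D(Om) *)
Definition kernel_dx (i : 'I_n) (phi : R -> V -> D) : R -> V -> D :=
  fun e x => tderive (phi e) x (basisv R i).

Definition kernel_dy (i : 'I_n) (phi : R -> V -> D) : R -> V -> D :=
  fun e x => testfun_pderiv i (phi e x).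

(* the commuting operators d_(x_i) + d_(y_i), whose iterates are d_(x+y)^al *)
Definition kernel_dxy (i : 'I_n) (phi : R -> V -> D) : R -> V -> D :=
  fun e x => kernel_dx i phi e x + kernel_dy i phi e x.

Definition ccompact (A : set V) : Prop := compact A /\ A `<=` Om°.

Definition eball (x : V) (r : R) : set V :=
  [set y | Num.sqrt (\sum_i (y 0 i - x 0 i) ^+ 2) < r].

(* f e x = O(g e), e in ]0, 1], uniformly for x in A *)
Definition bigO_unif (T : Type) (U : normedModType R) (A : set T)
    (f : R -> T -> U) (g : R -> R) : Prop :=
  exists e0 C : R, [/\ 0 < e0, 0 < C &
    forall (e : R) (x : T), 0 < e -> e <= 1 -> e <= e0 -> A x ->
      `|f e x| <= C * g e].

Definition LSK1 (phi : R -> V -> D) : Prop :=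
  forall A, ccompact A -> exists e0 C : R, [/\ 0 < e0, 0 < C &
    forall (x : V) (e : R), A x -> 0 < e -> e <= 1 -> e < e0 ->
      supp (phi e x) `<=` eball x (C * e)].

Definition LSK2 (phi : R -> V -> D) : Prop :=
  forall A, ccompact A -> forall al be : 'I_n -> nat,
    bigO_unif (A `*` Om)
      (fun (e : R) (p : V * V) =>
         mindex_iter kernel_dxy al (mindex_iter kernel_dy be phi) e p.1 p.2)
      (fun e => e ^- (n + mindex_order be)).

Definition LSK3 (q : nat) (phi : R -> V -> D) : Prop :=
  forall A, ccompact A -> forall (al : 'I_n -> nat) (f : V -> K),
    smooth_on Om f ->
    bigO_unif A
      (fun (e : R) (x : V) =>
         scalar_integral Om
           (fun y => scalar_mul (f y) (mindex_iter kernel_dx al phi e x y))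
         - mpderiv al f x)
      (fun e => e ^+ q.+1).

Definition smoothing_kernel (q : nat) (phi : R -> V -> D) : Prop :=
  [/\ kernel_smooth phi, LSK1 phi, LSK2 phi & LSK3 q phi].

(* Elements of the basic space are represented by total functions; only the   *)
(* values on D(Om) x Om are relevant.                                         *)
Definition hat_basic (S : D * V -> K) : Prop := csmooth ([set: D] `*` Om) S.

Definition hat_moderate (S : D * V -> K) : Prop :=
  hat_basic S /\
  forall A, ccompact A -> forall al : 'I_n -> nat,
    exists (q N : nat), (0 < N)%N /\
      forall phi, smoothing_kernel q phi ->
        bigO_unif A (fun (e : R) => mpderiv al (fun x => S (phi e x, x)))
          (fun e => e ^- N).

Definition hat_negligible (S : D * V -> K) : Prop :=
  hat_basic S /\
  forall A, ccompact A -> forall (al : 'I_n -> nat) (m : nat), (0 < m)%N ->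
    exists q : nat,
      forall phi, smoothing_kernel q phi ->
        bigO_unif A (fun (e : R) => mpderiv al (fun x => S (phi e x, x)))
          (fun e => e ^+ m).

Definition hat_lie (oOm : open Om) (X : V -> V) (sX : smooth_on Om X)
    (S : D * V -> K) : D * V -> K :=
  fun p => - tderive (fun f : D => S (f, p.2)) p.1 (lie_testfun oOm sX p.1)
           + 'D_(X p.2) (fun x => S (p.1, x)) p.2.

End kernels.

(* Main.v *)
(* Let psi be the Lie derivative of the kernel phi along X, acting on x as on a
   point and on y as on a density. The chain rule gives
     (L_X R)(phi_x, x) = D_X [R(phi_x, x)] - d/dt R(phi_x + t psi_x, x) at t = 0.
   The derivatives of the first term are bounded by hypothesis. For the second,
   psi satisfies the growth conditions of a smoothing kernel and all its moments
   are O(e^(q+1)), hence phi + la psi is again in A_q for every smooth la(e, x)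
   all of whose x-derivatives are bounded. Take la(e, x) = (x_i - a(e))^(k+1):
   at the points with x_i = a(e), the derivative d_i^(2k+1) of
   R(phi_x + la psi_x, x) - R(phi_x, x) is a nonzero multiple of d_i^k applied to
   d/dt R(phi_x + t psi_x, x) at t = 0. As a is an arbitrary bounded smooth
   function, it can be made to run through any sequence at which the desired
   estimate is assumed to fail.
   Smoothness in the sense of convenient calculus is reduced to smoothness along
   curves; partial derivatives of such functions are again of this kind by
   Boman's theorem, and a curve c in D(Om) is smooth iff (t, y) |-> c t y is
   smooth along curves and the supports of c t are locally contained in a
   fixed compact set. *)

Require Import Defs.
From HB Require Import structures.
From mathcomp Require Import all_boot all_order all_algebra.
From mathcomp Require Import all_classical all_reals all_analysis.
From mathcomp Require Import complex lra ring zify.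
Import Order.TTheory GRing.Theory Num.Theory.
Import numFieldNormedType.Exports.
Set Implicit Arguments.
Unset Strict Implicit.
Unset Printing Implicit Defensive.
Local Open Scope classical_set_scope.
Local Open Scope ring_scope.

(** * Smooth curves *)

(** The hypotheses bound R along each kernel separately, with constants that depend on the kernel.
    Nothing is uniform in t along the kernels phi + t psi, so their bounds cannot be differentiated
    in t. The weight la trades the t-derivative for x-derivatives, at the price of seeing the first
    variation only where x_i = a(e). Since one kernel comprises all e, this hyperplane may move with
    e; and since smoothness in e is required only for 0 < e <= 1, a may oscillate without limit as e
    tends to 0, so that a single kernel meets a whole sequence of bad points. The price is the order
    of differentiation: order m for L_X R uses orders up to 2m + 1 for R. These are finitely many
    derivatives, hence one q serves them all. One direction i suffices for a multi-index, because
    derivatives in the other directions do not touch la. The Lie derivative of phi in x alone or in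
    y alone would not do as psi: either may grow like e^(-n-1) and has nonzero moments. Both defects
    cancel in the sum. *)

Section one_variable.
Variable R : realType.
Implicit Types (W : normedModType R) (U : set R) (k : nat).

(* A synonym of is_derive that is not a class, to block instance resolution. *)
Definition isd W (f : R -> W) (t : R) (l : W) : Prop := is_derive t 1 f l.

Lemma isdP W (f : R -> W) (t : R) l :
  isd f t l <-> h^-1 *: (f (t + h) - f t) @[h --> 0^'] --> l.
Proof.
have E : (fun h : R => h^-1 *: ((f \o shift t) (h *: 1) - f t)) =
         (fun h => h^-1 *: (f (t + h) - f t)).
  by apply/funext => h /=; rewrite [h *: 1]mulr1 [h + t]addrC.
split=> [[df <-]|fl]; first by rewrite /derive E; move: df; rewrite /derivable E.
have cf : cvg (h^-1 *: ((f \o shift t) (h *: 1) - f t) @[h --> 0^']).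
  by rewrite E; apply/cvg_ex; exists l.
by split=> //; rewrite /derive E; apply/cvg_lim.
Qed.

Lemma isd_eq W (f : R -> W) (t : R) l : isd f t l -> (derive1 f) t = l.
Proof. by rewrite derive1E => -[_ <-]. Qed.

Lemma isd_derive1 W (f : R -> W) (t : R) : derivable f t 1 -> isd f t (derive1 f t).
Proof. by move=> df; rewrite derive1E; exact: derivableP. Qed.

Lemma isd_scale W (a : R -> R) (f : R -> W) (t : R) da df :
  isd a t da -> isd f t df ->
  isd (fun s => a s *: f s) t (a t *: df + da *: f t).
Proof.
move=> Da Df.
have dfa : differentiable a t by apply/derivable1_diffP; case: Da.
have dff : differentiable f t by apply/derivable1_diffP; case: Df.
have d2 : is_diff (a t, f t) (fun p : R * W => p.1 *: p.2)
    (fun q => (a t, f t).1 *: q.2 + q.1 *: (a t, f t).2).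
  have cs : continuous (fun p : R * W => p.1 *: p.2) by exact: scale_continuous.
  apply: DiffDef; first exact: (@differentiable_bilin _ _ _ _ ( *:%R)).
  exact: (@diff_bilin _ _ _ _ ( *:%R)).
have := @is_diff_comp _ _ _ _ (fun z => (a z, f z)) _
  (fun p : R * W => p.1 *: p.2) _ t
  (is_diff_pair (differentiableP dfa) (differentiableP dff)) d2.
move=> [D E].
have E1 : (fun s => a s *: f s) =
    (fun p : R * W => p.1 *: p.2) \o (fun z => (a z, f z)) by [].
rewrite E1; apply: DeriveDef; first exact/derivable1_diffP.
rewrite deriveE// E /= -!deriveE//.
by rewrite (@derive_val _ _ _ _ _ _ _ Da) (@derive_val _ _ _ _ _ _ _ Df).
Qed.

Lemma isd_comp W (a : R -> R) (f : R -> W) (t : R) da df :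
  isd a t da -> isd f (a t) df ->
  isd (f \o a) t (da *: df).
Proof.
move=> Da Df.
have dfa : differentiable a t by apply/derivable1_diffP; case: Da.
have dff : differentiable f (a t) by apply/derivable1_diffP; case: Df.
apply: DeriveDef; first exact/derivable1_diffP/differentiable_comp.
rewrite deriveE; last exact: differentiable_comp.
rewrite diff_comp//= -(deriveE _ dfa) (@derive_val _ _ _ _ _ _ _ Da).
rewrite -[X in 'd f (a t) X]mulr1 -[X in 'd f (a t) X]/(da *: (1 : R)).
by rewrite linearZ -(deriveE _ dff) (@derive_val _ _ _ _ _ _ _ Df).
Qed.

Lemma isdD W (f g : R -> W) t a b : isd f t a -> isd g t b -> isd (fun s => f s + g s) t (a + b).
Proof. by move=> fa gb; exact: is_deriveD. Qed.

Lemma isdZ W c (f : R -> W) t a : isd f t a -> isd (fun s => c *: f s) t (c *: a).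
Proof. by move=> fa; exact: is_deriveZ. Qed.

Lemma isd_cst W (w : W) t : isd (fun=> w) t 0.
Proof. exact: is_derive_cst. Qed.

Fixpoint smk W U k (c : R -> W) : Prop :=
  if k is k'.+1 then (forall t, U t -> derivable c t 1) /\ smk U k' (derive1 c)
  else True.

Definition smo W U (c : R -> W) := forall k, smk U k c.
Definition sm W (c : R -> W) := smo setT c.

Lemma near_derive1_eq W (f g : R -> W) t :
  (\near t, f t = g t) -> (derive1 f) t = (derive1 g) t.
Proof. by move=> fg; rewrite !derive1E; exact: near_eq_derive. Qed.

Lemma smk_eq W U k (f g : R -> W) : open U -> (forall t, U t -> f t = g t) ->
  smk U k f -> smk U k g.
Proof.
move=> oU; elim: k f g => //= k ih f g fg [df sf].
have nfg t : U t -> \near t, f t = g t.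
  by move=> Ut; apply: filterS fg _; exact: open_nbhs_nbhs.
split=> [t Ut|]; last first.
  by apply: ih sf => t Ut; apply: near_derive1_eq; exact: nfg.
by apply: near_eq_derivable (df _ Ut); exact: nfg.
Qed.

Lemma smo_eq W U (f g : R -> W) : open U -> (forall t, U t -> f t = g t) ->
  smo U f -> smo U g.
Proof. by move=> oU fg sf k; exact: smk_eq (sf k). Qed.

Lemma sm_ext W (f g : R -> W) : f =1 g -> sm f -> sm g.
Proof. by move=> /funext ->. Qed.

Lemma smkW W U k (f : R -> W) : smk U k.+1 f -> smk U k f.
Proof. by elim: k f => //= k ih f [df /ih]. Qed.

Lemma smk_sub W (U U' : set R) k (f : R -> W) : U' `<=` U -> smk U k f -> smk U' k f.
Proof. by move=> UU'; elim: k f => //= k ih f [df /ih]; split=> // t /UU'/df. Qed.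

Lemma smo_sub W (U U' : set R) (f : R -> W) : U' `<=` U -> smo U f -> smo U' f.
Proof. by move=> UU' sf k; exact: smk_sub (sf k). Qed.

Lemma smkS W U k (f : R -> W) : open U -> forall df,
  (forall t, U t -> isd f t (df t)) -> smk U k df -> smk U k.+1 f.
Proof.
move=> oU df fdf sdf; split=> [t /fdf[]//|].
by apply: smk_eq sdf => // t /fdf /isd_eq.
Qed.

Lemma smo_derivable W U (f : R -> W) t : smo U f -> U t -> derivable f t 1.
Proof. by move=> /(_ 1%N)[+ _]; exact. Qed.

Lemma smo_isd W U (f : R -> W) t : smo U f -> U t -> isd f t (derive1 f t).
Proof. by move=> sf Ut; apply/isd_derive1/(smo_derivable sf). Qed.

Lemma smo_derive1 W U (f : R -> W) : smo U f -> smo U (derive1 f).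
Proof. by move=> sf k; have [] := sf k.+1. Qed.

Lemma smo_derive1n W U n (f : R -> W) : smo U f -> smo U (derive1n n f).
Proof. by move=> sf; elim: n => // n ih; rewrite derive1nS; exact: smo_derive1. Qed.

Lemma smo_derivable_continuous W U (f : R -> W) t : smo U f -> U t ->
  {for t, continuous f}.
Proof.
by move=> sf Ut; apply/differentiable_continuous/derivable1_diffP/(smo_derivable sf).
Qed.

Lemma smk_seq W U (d : nat -> R -> W) : open U ->
  (forall k t, U t -> isd (d k) t (d k.+1 t)) -> smo U (d 0%N).
Proof.
move=> oU dd k; move: (0%N) => j; elim: k j => // k ih j.
exact: smkS (dd j) (ih _).
Qed.

Lemma smk_cst W U k (w : W) : open U -> smk U k (fun=> w).
Proof.
move=> oU; elim: k w => // k ih w.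
by apply: (@smkS _ _ _ _ oU (fun=> 0)) => // t _; exact: is_derive_cst.
Qed.

Lemma smo_cst W U (w : W) : open U -> smo U (fun=> w).
Proof. by move=> oU k; exact: smk_cst. Qed.

Lemma smkD W U k (f g : R -> W) : open U -> smk U k f -> smk U k g ->
  smk U k (fun t => f t + g t).
Proof.
move=> oU; elim: k f g => // k ih f g [df sf] [dg sg].
apply: (@smkS _ _ _ _ oU (fun t => (derive1 f) t + (derive1 g) t)) => [t Ut|]; last exact: ih.
have ? := isd_derive1 (df _ Ut); have ? := isd_derive1 (dg _ Ut).
exact: is_deriveD.
Qed.

Lemma smk_scale W U k (a : R -> R) (f : R -> W) : open U -> smk U k a ->
  smk U k f -> smk U k (fun t => a t *: f t).
Proof.
move=> oU; elim: k a f => // k ih a f sa sf.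
have [da sa'] := sa; have [df sf'] := sf.
apply: (@smkS _ _ _ _ oU (fun t => a t *: (derive1 f) t + (derive1 a) t *: f t)) => [t Ut|].
  exact: isd_scale (isd_derive1 (da _ Ut)) (isd_derive1 (df _ Ut)).
by apply: smkD => //; apply: ih => //; exact: smkW.
Qed.

Lemma smoD W U (f g : R -> W) : open U -> smo U f -> smo U g ->
  smo U (fun t => f t + g t).
Proof. by move=> oU sf sg k; exact: smkD. Qed.

Lemma smo_scale W U (a : R -> R) (f : R -> W) : open U -> smo U a ->
  smo U f -> smo U (fun t => a t *: f t).
Proof. by move=> oU sa sf k; exact: smk_scale. Qed.

Lemma smoZ W U (a : R) (f : R -> W) : open U ->
  smo U f -> smo U (fun t => a *: f t).
Proof. by move=> oU; apply: smo_scale => //; exact: smo_cst. Qed.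

Lemma smoN W U (f : R -> W) : open U -> smo U f -> smo U (fun t => - f t).
Proof.
move=> oU sf; apply: smo_eq (smoZ (-1) oU sf) => // t _.
by rewrite scaleN1r.
Qed.

Lemma smoB W U (f g : R -> W) : open U -> smo U f -> smo U g ->
  smo U (fun t => f t - g t).
Proof. by move=> oU sf sg; apply: smoD => //; exact: smoN. Qed.

Lemma smoM U (f g : R -> R) : open U -> smo U f -> smo U g ->
  smo U (fun t => f t * g t).
Proof. exact: (@smo_scale R). Qed.

Lemma smoX U (f : R -> R) n : open U -> smo U f -> smo U (fun t => f t ^+ n).
Proof.
move=> oU sf; elim: n => [|n ih]; first exact: smo_cst.
by apply: smo_eq (smoM oU sf ih) => // t _; rewrite exprS.
Qed.

Lemma smo_sum W U (I : Type) (r : seq I) (P : pred I) (f : I -> R -> W) : open U ->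
  (forall i, smo U (f i)) -> smo U (fun t => \sum_(i <- r | P i) f i t).
Proof.
move=> oU sf; elim: r => [|i r ih].
  by apply: smo_eq (smo_cst 0 oU) => // t _; rewrite big_nil.
have [Pi|Pi] := boolP (P i); last first.
  by apply: smo_eq ih => // t _; rewrite big_cons (negbTE Pi).
by apply: smo_eq (smoD oU (sf i) ih) => // t _; rewrite big_cons Pi.
Qed.

Lemma smo_id U : open U -> smo U (fun t : R => t).
Proof.
move=> oU [|k]//; apply: (@smkS R U k id oU (fun=> (1 : R))) => [t _|].
  exact: is_derive_id.
exact: smk_cst.
Qed.

Lemma smk_comp W (U U' : set R) k (a : R -> R) (f : R -> W) : open U' ->
  (forall t, U' t -> U (a t)) -> smk U' k a -> smk U k f -> smk U' k (fun t => f (a t)).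
Proof.
move=> oU aU; elim: k f => // k ih f sa sf.
have [da sa'] := sa; have [df sf'] := sf.
apply: (@smkS _ _ _ _ oU (fun t => (derive1 a) t *: (derive1 f) (a t))) => [t Ut|].
  exact: isd_comp (isd_derive1 (da _ Ut)) (isd_derive1 (df _ (aU _ Ut))).
by apply: smk_scale => //; apply: ih => //; exact: smkW.
Qed.

Lemma smo_comp W (U U' : set R) (a : R -> R) (f : R -> W) : open U' ->
  (forall t, U' t -> U (a t)) -> smo U' a -> smo U f -> smo U' (fun t => f (a t)).
Proof. by move=> oU aU sa sf k; exact: (smk_comp oU aU (sa k) (sf k)). Qed.

Lemma sm_comp W (a : R -> R) (f : R -> W) : sm a -> sm f -> sm (fun t => f (a t)).
Proof. by move=> sa sf; apply: (smo_comp _ _ sa sf) => //; exact: openT. Qed.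

Lemma smoV U (f : R -> R) : open U -> (forall t, U t -> f t != 0) -> smo U f ->
  smo U (fun t => (f t)^-1).
Proof.
move=> oU f0 sf; elim=> // k ih.
apply: (@smkS _ _ _ _ oU (fun t => (- (derive1 f) t) *: ((f t)^-1 *: (f t)^-1))) => [t Ut|].
  apply: is_derive_eq; first exact: is_deriveV (f0 _ Ut) (smo_isd sf Ut).
  by rewrite -![_ *: _]/(_ * _); rewrite mulrC mulNr mulrN expr2 invfM.
have sf' : smk U k (fun t => - (derive1 f) t).
  by apply: smoN => //; exact: smo_derive1.
by apply: smk_scale => //; apply: smk_scale.
Qed.

Lemma sm_local W (f : R -> W) U :
  open U -> (forall t, U t -> exists2 V, open V /\ V t & smo V f) -> smo U f.
Proof.
move=> oU loc k; elim: k f loc => // k ih f loc; split=> [t /loc[V [oV Vt] sf]|].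
  exact: (smo_derivable sf Vt).
by apply: ih => t /loc[V oV sf]; exists V => //; exact: smo_derive1.
Qed.

Lemma smooth_curveP W (c : R -> W) : smooth_curve c <-> sm c.
Proof.
split=> [[d [<- dd]]|sc].
  apply: smk_seq; first exact: openT.
  by move=> k t _; exact/isdP.
exists (fun k => derive1n k c); split=> // k t; apply/isdP.
by rewrite derive1nS; apply/isd_derive1/(smo_derivable (smo_derive1n k sc)).
Qed.

Lemma isd_eps W (f : R -> W) (t : R) l : isd f t l <->
  forall e, 0 < e -> exists2 d : R, 0 < d &
    forall h, `|h| < d -> `|f (t + h) - f t - h *: l| <= e * `|h|.
Proof.
rewrite isdP; split=> [/cvgrPdist_le fl e e0|fl].
  have /nbhs_ballP[d /= d0 dP] := fl e e0.
  exists d => // h hd; have [->|h0] := eqVneq h 0.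
    by rewrite addr0 subrr scale0r subrr !(normr0, mulr0).
  have := dP h; rewrite /ball/= sub0r normrN => /(_ hd h0) H.
  rewrite -[_ - h *: l]scale1r -(divff h0) -scalerA normrZ mulrC.
  rewrite ler_wpM2r// scalerBr scalerA mulVf// scale1r.
  by rewrite distrC.
apply/cvgrPdist_le => e e0; have [d d0 dP] := fl e e0.
apply/nbhs_ballP; exists d => //= h; rewrite /ball/= sub0r normrN => hd h0.
have hn0 : 0 < `|h| by rewrite normr_gt0.
rewrite distrC -(ler_pM2r hn0); apply: le_trans (dP h hd).
by rewrite mulrC -normrZ scalerBr scalerA divff// scale1r.
Qed.

(** The form in which Taylor estimates are turned into derivatives: the constant [C] may be
    arbitrary, since one spare factor [h] beats any prescribed [e]. *)
Lemma isd_quad W (f : R -> W) (t : R) l d C : 0 < d ->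
  (forall h, `|h| < d -> `|f (t + h) - f t - h *: l| <= C * `|h| ^+ 2) ->
  isd f t l.
Proof.
move=> d0 H; apply/isd_eps => e e0.
have C0 : 0 < `|C| + 1 by rewrite ltr_wpDl.
exists (Num.min d (e / (`|C| + 1))) => [|h].
  by rewrite lt_min d0 divr_gt0.
rewrite lt_min => /andP[hd he]; apply: le_trans (H h hd) _.
rewrite expr2 mulrA ler_wpM2r//.
apply: (@le_trans _ _ ((`|C| + 1) * `|h|)).
  by rewrite ler_wpM2r// (le_trans (ler_norm _))// lerDl.
by rewrite mulrC -ler_pdivlMr// ltW.
Qed.

(** Values are vectors, so no mean value equality is available. The set of points up to which the
    estimate holds has a supremum; the estimate passes to it and then beyond it, the slack [e]
    absorbing the error of the first-order approximation. *)
Lemma mvi0 W (f : R -> W) (a b M e : R) : a <= b -> 0 < e ->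
  (forall t, a <= t <= b -> derivable f t 1) ->
  (forall t, a <= t <= b -> `|derive1 f t| <= M) ->
  `|f b - f a| <= (M + e) * (b - a).
Proof.
move=> ab e0 df fM.
have M0 : 0 <= M by apply: le_trans (fM a _); rewrite ?lexx ?ab.
pose P s := `|f s - f a| <= (M + e) * (s - a).
have loc s : a <= s <= b -> exists2 d : R, 0 < d &
    forall t, `|t - s| < d -> `|f t - f s| <= (M + e) * `|t - s|.
  move=> sab; have /isd_eps/(_ e e0)[d d0 dP] := isd_derive1 (df s sab).
  exists d => // t td; have := dP _ td; rewrite [s + _]addrC subrK => H.
  rewrite -[f t - f s](subrK ((t - s) *: derive1 f s)).
  apply: le_trans (ler_normD _ _) _; rewrite mulrDl addrC lerD//.
  by rewrite normrZ mulrC ler_wpM2r// fM.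
pose S := [set t | a <= t <= b /\ forall s, a <= s <= t -> P s].
have Sa : S a.
  split=> [|s /le_anti <-]; first by rewrite lexx.
  by rewrite /P !subrr normr0 mulr0.
have hS : has_sup S.
  by split; [exists a|exists b => t [/andP[]]].
pose s0 := sup S.
have as0 : a <= s0 by exact: ub_le_sup hS.2 _ Sa.
have s0b : s0 <= b by apply: ge_sup; [exists a|move=> t [/andP[]]].
have Plt s : a <= s -> s < s0 -> P s.
  move=> as_ ss0; have s0s : 0 < s0 - s by rewrite subr_gt0.
  have [t St st] := sup_adherent s0s hS.
  by apply: St.2; rewrite as_ ltW//; move: st; rewrite -/s0 subKr.
have s0ub t : S t -> t <= s0 by move=> St; exact: ub_le_sup hS.2 _ St.
clearbody s0.
have [d d0 dP] := loc s0 (introT andP (conj as0 s0b)).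
have Ps0 : P s0.
  have [as0'|as0'] := eqVneq a s0.
    by rewrite /P -as0' !subrr normr0 mulr0.
  have as0lt : a < s0 by rewrite lt_neqAle as0'.
  pose s := Num.max a (s0 - d / 2).
  have ss0 : s < s0 by rewrite gt_max as0lt ltrBlDr ltrDl divr_gt0.
  have as_ : a <= s by rewrite le_max lexx.
  have := Plt s as_ ss0; rewrite /P => Ps.
  have := dP s; rewrite distrC gtr0_norm ?subr_gt0// => H.
  have sd : s0 - s < d.
    have : s0 - d / 2 <= s by rewrite le_max lexx orbT.
    by move: d0; lra.
  have := H sd; rewrite distrC => H2.
  rewrite -[f s0](subrK (f s)) -addrA; apply: le_trans (ler_normD _ _) _.
  by rewrite (le_trans (lerD H2 Ps))// -mulrDr addrA subrK.
have [<-|s0b'] := eqVneq s0 b; first exact: Ps0.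
have s0b2 : s0 < b by rewrite lt_neqAle s0b'.
pose s1 := Num.min b (s0 + d / 2).
have s01 : s0 < s1 by rewrite lt_min s0b2 ltrDl divr_gt0.
suff Ss1 : S s1 by have := s0ub _ Ss1; rewrite leNgt s01.
split=> [|s /andP[as_ ss1]]; first by rewrite ge_min lexx (le_trans as0 (ltW s01)).
have [ss0|ss0] := ltP s s0; first exact: Plt.
have s1d : s1 <= s0 + d / 2 by rewrite ge_min lexx orbT.
have := dP s; rewrite ger0_norm ?subr_ge0// => H.
have {}H : `|f s - f s0| <= (M + e) * (s - s0).
  by apply: H; move: d0 s1d ss1; lra.
rewrite /P -[f s](subrK (f s0)) -addrA; apply: le_trans (ler_normD _ _) _.
by rewrite (le_trans (lerD H Ps0))// -mulrDr addrA subrK.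
Qed.

(** Subtracting the linear function with slope [w] reduces this to [mvi0], whose slack then tends to
    0. *)
Lemma mvi W (f : R -> W) (a b : R) (w : W) (M : R) : a <= b ->
  (forall t, a <= t <= b -> derivable f t 1) ->
  (forall t, a <= t <= b -> `|derive1 f t - w| <= M) ->
  `|f b - f a - (b - a) *: w| <= M * (b - a).
Proof.
move=> ab df fM.
have dg t : a <= t <= b -> isd (fun s => f s - s *: w) t (derive1 f t - w).
  move=> tab; have ? := isd_derive1 (df t tab).
  have ? : is_derive t 1 (fun s : R => s *: w) w.
    have := isd_scale (is_derive_id t 1) (is_derive_cst w t 1).
    by rewrite scaler0 add0r scale1r.
  exact: (@is_deriveB R R W f _ t 1).
have H e : 0 < e -> `|f b - f a - (b - a) *: w| <= M * (b - a) + e * (b - a).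
  move=> e0; have := @mvi0 W (fun s => f s - s *: w) a b M e ab e0.
  rewrite mulrDl scalerBl !opprD !opprK addrACA; apply=> [t /dg[]//|t tab].
  by rewrite (isd_eq (dg t tab)) fM.
have [<-|anb] := eqVneq a b.
  by rewrite !subrr scale0r subr0 normr0 mulr0.
have ab0 : 0 < b - a by rewrite subr_gt0 lt_neqAle anb.
apply/ler_addgt0Pr => e e0.
by rewrite (le_trans (H (e / (b - a)) _)) ?divr_gt0// divfK// gt_eqF.
Qed.

End one_variable.

(** * Flat functions, bumps, and smooth curves through fast converging sequences *)

Section special_curves.
Variable R : realType.
Implicit Types (W : normedModType R) (U : set R) (k : nat).

Lemma open_pos : open [set t : R | 0 < t].
Proof. exact: open_gt. Qed.

Lemma nbhs_norm_lt (t d : R) : 0 < d -> \forall s \near t, `|s - t| < d.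
Proof.
move=> d0; apply/nbhs_ballP; exists d => //= s.
by rewrite /ball/= distrC.
Qed.

Lemma isd_near W (f g : R -> W) (t : R) l : (\near t, f t = g t) ->
  isd f t l -> isd g t l.
Proof. by move=> fg [df <-]; split; [exact: near_eq_derivable df|apply/esym/near_eq_derive]. Qed.

Lemma isd_inv (s : R) : s != 0 -> isd (fun t : R => t^-1) s (- s^-1 ^+ 2).
Proof.
move=> s0; apply: is_derive_eq; first exact: (is_deriveV s0 (is_derive_id s 1)).
by rewrite -[_ *: _]/(_ * _) mulr1 exprVn.
Qed.

Lemma isd_comp_inv W (f : R -> W) (s : R) df : s != 0 -> isd f s^-1 df ->
  isd (fun t => f t^-1) s (- s^-1 ^+ 2 *: df).
Proof. by move=> s0 Df; have := isd_comp (isd_inv s0) Df. Qed.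

Lemma derive1n_eq W U n (f g : R -> W) : open U -> (forall t, U t -> f t = g t) ->
  forall t, U t -> derive1n n f t = derive1n n g t.
Proof.
move=> oU; elim: n f g => // n ih f g fg t Ut; rewrite !derive1nS.
apply: near_derive1_eq; have : nbhs t U by exact: open_nbhs_nbhs.
by apply: filterS => s Us; exact: ih.
Qed.

Lemma sm_bounded W (f : R -> W) (a b : R) : sm f ->
  exists C, forall t, a <= t <= b -> `|f t| <= C.
Proof.
move=> sf; have [ab|ba] := leP a b; last first.
  by exists 0 => t /andP[at_ tb]; move: ba; rewrite ltNge (le_trans at_ tb).
have cf : {within `[a, b], continuous (fun t => `|f t|)}.
  apply: continuous_subspaceT => t; apply: continuous_comp.
    exact: (smo_derivable_continuous sf).
  exact: norm_continuous.
have [c _ cP] := EVT_max ab cf; exists `|f c| => t tab.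
by apply: cP; rewrite in_itv.
Qed.

(* Substituting s = 1 / t turns d/ds into the operator - t ^ 2 d/dt. *)
Lemma derive1n_inv_bounded W (f : R -> W) n : sm f ->
  exists C, forall s, 1 <= s -> `|derive1n n (fun t => f t^-1) s| <= C.
Proof.
elim: n f => [|n ih] f sf.
  have [C CP] := sm_bounded 0 1 sf; exists C => s s1; apply: CP.
  by rewrite invr_ge0 (le_trans ler01 s1)/= invf_le1// (lt_le_trans ltr01 s1).
pose f1 t := - t ^+ 2 *: derive1 f t.
have [|C CP] := ih f1.
  apply: smo_scale; [exact: openT| |exact: smo_derive1].
  by apply: smoN; [exact: openT|apply: smoX; [exact: openT|apply: smo_id; exact: openT]].
exists C => s s1; rewrite derive1Sn.
rewrite (@derive1n_eq W _ n _ (fun t => f1 t^-1) open_pos)//=; first exact: CP.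
  move=> t /= t0; apply: isd_eq; apply: isd_comp_inv; first by rewrite gt_eqF.
  exact: (smo_isd sf).
exact: lt_le_trans ltr01 s1.
Qed.

Definition rapid (g : R -> R) :=
  forall m, exists C, forall s, 1 <= s -> `|s ^+ m * g s| <= C.

(** The Schwartz condition at +oo for derivatives up to order [k]. Existence of the derivatives is
    asked on the whole half-line, because [flat] evaluates [g] at every 1 / t with t > 0. *)
Fixpoint rdk k (g : R -> R) : Prop := rapid g /\
  if k is k'.+1 then (forall s, 0 < s -> derivable g s 1) /\ rdk k' (derive1 g)
  else True.

Lemma rdkS k (g dg : R -> R) : rapid g -> (forall s, 0 < s -> isd g s (dg s)) ->
  rdk k dg -> rdk k.+1 g.
Proof.
move=> rg gdg rdg; split=> //; split=> [s /gdg[]//|].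
have {gdg} : forall s, 0 < s -> dg s = derive1 g s by move=> s /gdg /isd_eq.
elim: k dg (derive1 g) rdg => [|k ih] dg h rdg E.
  split=> // m; have [C CP] := rdg.1 m; exists C => s s1.
  by rewrite -E ?CP// (lt_le_trans ltr01 s1).
have [r [d rd]] := rdg; split.
  move=> m; have [C CP] := r m; exists C => s s1.
  by rewrite -E ?CP// (lt_le_trans ltr01 s1).
have nE (s : R) : 0 < s -> \near s, dg s = h s.
  move=> s0; have : nbhs s [set t : R | 0 < t].
    by apply: open_nbhs_nbhs; split=> //; exact: open_pos.
  by apply: filterS => t; exact: E.
split=> [s s0|]; first by apply: near_eq_derivable (d s s0); exact: nE.
by apply: ih rd _ => s s0; apply: near_derive1_eq; exact: nE.
Qed.

Lemma rapidD g h : rapid g -> rapid h -> rapid (fun s => g s + h s).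
Proof.
move=> rg rh m; have [C CP] := rg m; have [D DP] := rh m; exists (C + D) => s s1.
by rewrite mulrDr (le_trans (ler_normD _ _))// lerD// ?CP ?DP.
Qed.

Lemma rapidZ a g : rapid g -> rapid (fun s => a * g s).
Proof.
move=> rg m; have [C CP] := rg m; exists (`|a| * C) => s s1.
by rewrite mulrCA normrM ler_wpM2l// CP.
Qed.

Lemma rapidM g : rapid g -> rapid (fun s => s * g s).
Proof.
move=> rg m; have [C CP] := rg m.+1; exists C => s s1.
by rewrite mulrA -exprSr CP.
Qed.

Lemma rdkW k g : rdk k.+1 g -> rdk k g.
Proof. by elim: k g => [|k ih] g [rg [dg rd]]; split=> //; split=> //; exact: ih. Qed.

Lemma rdkD k g h : rdk k g -> rdk k h -> rdk k (fun s => g s + h s).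
Proof.
elim: k g h => [|k ih] g h [rg dg] [rh dh]; first by split=> //; exact: rapidD.
apply: (@rdkS _ _ (fun s => derive1 g s + derive1 h s)); first exact: rapidD.
  move=> s s0; have ? := isd_derive1 (dg.1 s s0); have ? := isd_derive1 (dh.1 s s0).
  exact: is_deriveD.
by apply: ih; [exact: dg.2|exact: dh.2].
Qed.

Lemma rdkZ k a g : rdk k g -> rdk k (fun s => a * g s).
Proof.
elim: k g => [|k ih] g [rg dg]; first by split=> //; exact: rapidZ.
apply: (@rdkS _ _ (fun s => a * derive1 g s)); first exact: rapidZ.
  by move=> s s0; have ? := isd_derive1 (dg.1 s s0); exact: (@is_deriveZ R R R g).
by apply: ih; exact: dg.2.
Qed.

Lemma rdkM k g : rdk k g -> rdk k (fun s => s * g s).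
Proof.
elim: k g => [|k ih] g rg; first by split=> //; apply: rapidM; case: rg.
have [r [d rd]] := rg.
apply: (@rdkS _ _ (fun s => s * derive1 g s + 1 * g s)); first exact: rapidM.
  by move=> s s0; apply: (@isd_scale R R id g) => //; [exact: is_derive_id|exact/isd_derive1/d].
by apply: rdkD; [exact: ih|apply: rdkZ; exact: rdkW].
Qed.

Definition flat (g : R -> R) (t : R) : R := if 0 < t then g t^-1 else 0.

(** Away from 0, the derivative of [flat g] is [flat] of - s ^ 2 g'(s), which is again rapidly
    decreasing, so the induction closes. At 0, rapid decrease with exponent 2 bounds [flat g] by C t
    ^ 2. *)
Lemma flat_sm g : (forall k, rdk k g) -> sm (flat g).
Proof.
move=> rg k; elim: k g rg => // k ih g rg.
pose g1 s := - 1 * (s * (s * derive1 g s)).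
have rg1 j : rdk j g1.
  by apply: rdkZ; apply: rdkM; apply: rdkM; have [_ []] := rg j.+1.
apply: (@smkS _ _ _ _ _ openT (flat g1)); last exact: ih.
move=> t _; have [t0|t0|t0] := ltgtP 0 t.
- have nt : \near t, g t^-1 = flat g t.
    have : nbhs t [set t : R | 0 < t].
      by apply: open_nbhs_nbhs; split=> //; exact: open_pos.
    by apply: filterS => s /= s0; rewrite /flat s0.
  apply: isd_near nt _; rewrite {1}/flat t0 /g1.
  have [_ [dg _]] := rg 1%N.
  have ti : 0 < t^-1 by rewrite invr_gt0.
  have := isd_comp_inv (lt0r_neq0 t0) (isd_derive1 (dg _ ti)).
  by rewrite -[_ *: _]/(_ * _) !mulNr mul1r mulrA expr2.
- have nt : \near t, 0 = flat g t.
    have : nbhs t [set t : R | t < 0].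
      by apply: open_nbhs_nbhs; split=> //; exact: open_lt.
    by apply: filterS => s /= s0; rewrite /flat ltNge (ltW s0).
  by apply: isd_near nt _; rewrite /flat ltNge (ltW t0); exact: is_derive_cst.
- rewrite -t0; have [+ _] := rg 0%N => /(_ 2%N)[C CP].
  apply: (@isd_quad _ _ _ _ _ 1 C) => // h h1.
  rewrite {2 3}/flat ltxx add0r subr0 scaler0 subr0 /flat.
  case: ifPn => h0; last first.
    rewrite normr0 mulr_ge0// ?exprn_ge0//.
    by have := CP 1 (lexx _); apply: le_trans.
  have hi : 1 <= h^-1 by rewrite invf_ge1// ltW// (le_lt_trans (ler_norm _)).
  have hh : `|h| = h by rewrite gtr0_norm.
  have := CP _ hi; rewrite normrM exprVn [X in X * _]ger0_norm.
    by rewrite hh mulrC ler_pdivrMr// exprn_gt0.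
  by rewrite invr_ge0 exprn_ge0// ltW.
Qed.

Lemma expRN_rapid : rapid (fun s => expR (- s)).
Proof.
(* The constant comes from s / m <= exp(s / m), raised to the power m. *)
move=> m; exists (m%:R ^+ m) => s s1.
have s0 : 0 <= s by exact: le_trans s1.
rewrite ger0_norm ?mulr_ge0 ?exprn_ge0 ?expR_ge0//.
rewrite expRN ler_pdivrMr ?expR_gt0//.
case: m => [|m]; first by rewrite !expr0 mul1r -expR0 ler_expR.
have m0 : 0 < m.+1%:R :> R by [].
have -> : s = m.+1%:R * (s / m.+1%:R) by rewrite mulrC divfK// gt_eqF.
rewrite exprMn ler_wpM2l ?exprn_ge0 ?ler0n// expRM_natl.
rewrite lerXn2r ?nnegrE ?expR_ge0 ?divr_ge0//.
by rewrite (le_trans _ (expR_ge1Dx _))// lerDr.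
Qed.

Lemma expRN_rdk k : rdk k (fun s => expR (- s)).
Proof.
elim: k => [|k ih]; first by split=> //; exact: expRN_rapid.
apply: (@rdkS _ _ (fun s => -1 * expR (- s))); first exact: expRN_rapid.
  move=> s _; have H : isd -%R s (-1) by exact: is_deriveNid.
  exact: (isd_comp H (is_derive_expR (- s))).
exact: rdkZ.
Qed.

Lemma bump_exists : exists b : R -> R, [/\ sm b,
  forall u, `|u| <= 6^-1 -> b u = 1, forall u, 3^-1 < `|u| -> b u = 0 &
  forall u, 0 <= b u <= 1].
Proof.
pose E := flat (fun s => expR (- s)).
have sE : sm E by apply: flat_sm; exact: expRN_rdk.
have E0 t : t <= 0 -> E t = 0 by move=> t0; rewrite /E /flat ltNge t0.
have Ep t : 0 < t -> 0 < E t by move=> t0; rewrite /E /flat t0 expR_gt0.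
have Ege t : 0 <= E t.
  by rewrite /E /flat; case: ifP => // _; exact: expR_ge0.
pose D t := E t + E (1 - t).
have D0 t : 0 < D t.
  rewrite /D; have [t0|t0] := ltP 0 t; first by rewrite ltr_pwDl// Ep.
  by rewrite ltr_wpDl// Ep// subr_gt0 (le_lt_trans t0).
have oT := @openT R.
pose S t := E t / D t.
have sS : sm S.
  apply: smoM => //; apply: smoV => //.
    by move=> t _; rewrite gt_eqF.
  apply: smoD => //; apply: sm_comp => //; apply: smoB => //; [exact: smo_cst|exact: smo_id].
have S1 t : 1 <= t -> S t = 1.
  move=> t1; rewrite /S /D (E0 (1 - t)) ?subr_le0// addr0 divff// gt_eqF// Ep//.
  exact: lt_le_trans ltr01 t1.
have S0 t : t <= 0 -> S t = 0 by move=> t0; rewrite /S E0// mul0r.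
have Sb t : 0 <= S t <= 1.
  rewrite divr_ge0 ?(ltW (D0 _))//= ler_pdivrMr// mul1r /D lerDl//.
(* [S] is a smooth step from 0 to 1. Both arguments are at least 1 when |u| <= 1/6, and one of them
   is nonpositive when |u| >= 1/3. The support thus has room inside a cell of radius 1/2. *)
exists (fun u => S (2 - 6 * u) * S (2 + 6 * u)); split.
- apply: smoM => //; apply: sm_comp => //; [apply: smoB => //|apply: smoD => //];
    do ?[exact: smo_cst]; apply: smoM => //; do ?[exact: smo_cst]; exact: smo_id.
- move=> u; rewrite ler_norml => u6.
  by rewrite !S1 ?mulr1//; move: u6; lra.
- move=> u u3; have [u0|u0] := leP 0 u.
    by rewrite [X in X * _]S0 ?mul0r//; move: u3; rewrite ger0_norm//; lra.
  by rewrite [X in _ * X]S0 ?mulr0//; move: u3; rewrite ltr0_norm//; lra.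
- move=> u; have /andP[a0 a1] := Sb (2 - 6 * u); have /andP[b0 b1] := Sb (2 + 6 * u).
  by rewrite mulr_ge0//= mulr_ile1.
Qed.

Definition bumpf := sval (cid bump_exists).

Lemma sm_bump : sm bumpf. Proof. by rewrite /bumpf; case: cid => ? []. Qed.

Lemma bump1 u : `|u| <= 6^-1 -> bumpf u = 1.
Proof. by rewrite /bumpf; case: cid => ? [? + ? ?] /=; apply. Qed.

Lemma bump0 u : 3^-1 < `|u| -> bumpf u = 0.
Proof. by rewrite /bumpf; case: cid => ? [? ? + ?] /=; apply. Qed.

Lemma bump01 u : 0 <= bumpf u <= 1.
Proof. by rewrite /bumpf; case: cid => ? [? ? ?] /=; apply. Qed.

Section cells.
Variables s : nat -> R.
Hypothesis s1 : 1 <= s 0%N.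
Hypothesis sS : forall k, s k + 1 <= s k.+1.

(* At most one index [k] satisfies the condition; if there is none, [theta]
   vanishes at [x - s 0]. *)
Definition cell (p : nat -> R) (theta : R -> R) (x : R) : R :=
  let k := xget 0%N [set k | `|x - s k| < 2^-1] in p k * theta (x - s k).

Lemma s_lt j k : (j < k)%N -> s j + 1 <= s k.
Proof.
elim: k => // k ih; rewrite ltnS leq_eqVlt => /orP[/eqP->//|/ih jk].
by rewrite (le_trans jk)// (le_trans _ (sS k))// lerDl.
Qed.

Lemma s_ge1 k : 1 <= s k.
Proof.
by case: k => // k; have := @s_lt 0 k.+1 isT; move: s1; lra.
Qed.

Lemma cell_near p th x k : `|x - s k| < 2^-1 -> cell p th x = p k * th (x - s k).
Proof.
move=> xk; rewrite /cell; case: xgetP => [j _ /= xj|/(_ k)//].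
suff -> : j = k by [].
move: xk xj; rewrite !ltr_norml => xk xj; apply/eqP; rewrite eqn_leq.
by apply/andP; split; rewrite leqNgt; apply/negP => /s_lt; move: xk xj; lra.
Qed.

Definition vanishing (th : R -> R) := forall u, 3^-1 < `|u| -> th u = 0.

Lemma cell_out p th x : vanishing th -> (forall k, 3^-1 < `|x - s k|) -> cell p th x = 0.
Proof. by move=> v H; rewrite /cell v ?mulr0. Qed.

Lemma vanishing_derive1 th : vanishing th -> vanishing (derive1 th).
Proof.
move=> v u u3; rewrite (near_derive1_eq (g := cst 0)) ?derive1_cst//.
have := nbhs_norm_lt u (d := `|u| - 3^-1); rewrite subr_gt0 => /(_ u3).
apply: filterS => w wu; apply: v.
by have := ler_normD (u - w) w; rewrite subrK distrC; move: wu; lra.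
Qed.

Lemma cell_isd p th x : sm th -> vanishing th ->
  isd (cell p th) x (cell p (derive1 th) x).
Proof.
move=> sth v; have [[k xk]|nk] := pselect (exists k, `|x - s k| < 2^-1).
  have nx : \near x, p k * th (x - s k) = cell p th x.
    have := nbhs_norm_lt x (d := 2^-1 - `|x - s k|); rewrite subr_gt0 => /(_ xk).
    apply: filterS => y yx; rewrite (@cell_near p th y k)//.
    by have := ler_normD (y - x) (x - s k); rewrite addrA subrK; move: yx; lra.
  apply: isd_near nx _; rewrite (cell_near _ _ xk).
  have Hs : isd (fun y => y - s k) x 1.
    by rewrite -[1]subr0; apply: (@is_deriveB R R R id (cst (s k)) x 1).
  have Hc := isd_comp Hs (smo_isd sth (t := x - s k) I).
  by have := @is_deriveZ R R R _ (p k) x 1 _ Hc; rewrite scale1r.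
have nk' k : 2^-1 <= `|x - s k| by rewrite leNgt; apply/negP => H; apply: nk; exists k.
(* Moving by less than 1/12 from a point at distance at least 1/2 from all centres stays outside
   radius 1/3, where the profile vanishes. *)
have nx : \near x, 0 = cell p th x.
  have := nbhs_norm_lt x (d := 12^-1); rewrite invr_gt0 => /(_ _)/wrap[//|].
  apply: filterS => y yx; rewrite cell_out// => k.
  have := ler_normD (x - y) (y - s k); rewrite addrA subrK.
  by have := nk' k; move: yx; rewrite distrC; lra.
apply: isd_near nx _; rewrite cell_out; first exact: is_derive_cst.
  exact: vanishing_derive1.
by move=> k; have := nk' k; lra.
Qed.

Lemma vanishing_bounded th : sm th -> vanishing th -> exists2 C, 0 <= C & forall u, `|th u| <= C.
Proof.
move=> sth v; have [C CP] := sm_bounded (-1) 1 sth.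
exists `|C| => // u; have [u1|u1] := leP `|u| 1.
  by rewrite (le_trans _ (ler_norm C))// CP// -ler_norml.
by rewrite v ?normr0//; move: u1; lra.
Qed.

Definition rapidseq (p : nat -> R) := forall m, exists C, forall k, `|p k| * s k ^+ m <= C.

Lemma cell_rapid p th : rapidseq p -> sm th -> vanishing th -> rapid (cell p th).
Proof.
move=> rp sth v m; have [C CP] := rp m; have [D D0 DP] := vanishing_bounded sth v.
have C0 : 0 <= C by apply: le_trans (CP 0%N); rewrite mulr_ge0// exprn_ge0// (le_trans ler01 s1).
(* Within a cell x < s j + 1/2 <= 2 s j, which lets the decay of [p j] in [s j] pay for the powers
   of x. *)
exists (2 ^+ m * C * D) => x x1.
have [[j xj]|nk] := pselect (exists k, `|x - s k| < 2^-1); last first.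
  rewrite cell_out// ?mulr0 ?normr0 ?mulr_ge0// ?exprn_ge0// => j.
  by have : 2^-1 <= `|x - s j|; [rewrite leNgt; apply/negP => H; apply: nk; exists j|lra].
rewrite (cell_near _ _ xj) mulrA normrM; apply: ler_pM; rewrite ?normr_ge0 ?DP//.
have x0 : 0 <= x by exact: le_trans x1.
have s0 : 0 <= 2 * s j by have := s_ge1 j; lra.
have xs : x <= 2 * s j by have := s_ge1 j; move: xj; rewrite ltr_norml; lra.
have H : x ^+ m <= (2 * s j) ^+ m by apply: lerXn2r; rewrite ?nnegrE.
rewrite exprMn in H.
rewrite normrM mulrC [`|x ^+ m|]ger0_norm ?exprn_ge0//.
apply: (@le_trans _ _ (`|p j| * (2 ^+ m * s j ^+ m))); first by rewrite ler_wpM2l.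
by rewrite mulrCA ler_wpM2l// exprn_ge0.
Qed.

Lemma cell_rdk p th : rapidseq p -> sm th -> vanishing th -> forall k, rdk k (cell p th).
Proof.
move=> rp sth v k; elim: k th sth v => [|k ih] th sth v.
  by split=> //; exact: cell_rapid.
apply: (@rdkS _ _ (cell p (derive1 th))); first exact: cell_rapid.
  by move=> x _; exact: cell_isd.
by apply: ih; [exact: smo_derive1|exact: vanishing_derive1].
Qed.

Lemma cell_smo p th : sm th -> vanishing th -> sm (cell p th).
Proof.
move=> sth v k; elim: k th sth v => // k ih th sth v.
apply: (@smkS _ _ _ _ _ openT (cell p (derive1 th))) => [t _|]; first exact: cell_isd.
by apply: ih; [exact: smo_derive1|exact: vanishing_derive1].
Qed.

(* A rapidly decreasing sum of bumps around the points s k becomes flat at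
   t = 0 in the variable 1 / t. *)
Lemma special_curve p w : rapidseq p -> rapidseq w -> exists F : R -> R,
  [/\ sm F, forall k u, `|u| <= 6^-1 -> F (s k + u)^-1 = p k + u * w k,
      forall t, t <= 0 -> F t = 0 &
      (forall k, w k = 0) -> forall t, F t = 0 \/ exists k a, [/\ 0 <= a, a <= 1 & F t = a * p k]].
Proof.
move=> rp rw.
(* This profile is the identity near 0 and provides the velocity [w k] at the k-th point, while
   [bumpf] provides the position [p k]. *)
pose ub (u : R) := u * bumpf u.
have sub : sm ub by apply: smoM; [exact: openT|apply: smo_id; exact: openT|exact: sm_bump].
have vub : vanishing ub by move=> u u3; rewrite /ub bump0 ?mulr0.
pose g x := cell p bumpf x + cell w ub x.
exists (flat g); split.
- apply: flat_sm => k; apply: rdkD; apply: cell_rdk => //; first exact: sm_bump.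
  exact: bump0.
- move=> k u u6; have su : 0 < s k + u.
    by have := s_ge1 k; move: u6; rewrite ler_norml; lra.
  have E : `|s k + u - s k| < 2^-1 by rewrite addrAC subrr add0r; move: u6; lra.
  rewrite /flat invr_gt0 su invrK /g !(cell_near _ _ E) addrAC subrr add0r /ub bump1//.
  by rewrite !mulr1 mulrC.
- by move=> t t0; rewrite /flat ltNge t0.
- move=> w0 t; rewrite /flat; case: ifP => [_|]; last by left.
  right; rewrite /g {2}/cell w0 mul0r addr0 /cell.
  set k := xget _ _; exists k, (bumpf (t^-1 - s k)).
  by have /andP[? ?] := bump01 (t^-1 - s k); split=> //; rewrite mulrC.
Qed.

End cells.
End special_curves.

(** * Boman's theorem in the plane *)

Section local_bound.
Variables (R : realType) (W : normedModType R).

Lemma derive1nD n (f g : R -> W) : sm f -> sm g ->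
  derive1n n (fun t => f t + g t) = fun t => derive1n n f t + derive1n n g t.
Proof.
move=> sf sg; elim: n => // n ih; rewrite derive1nS ih; apply/funext => t.
apply: isd_eq; have ? := smo_isd (smo_derive1n n sf) (t := t) I.
have ? := smo_isd (smo_derive1n n sg) (t := t) I.
by rewrite !derive1nS; exact: is_deriveD.
Qed.

Lemma derive1nZ n a (f : R -> W) : sm f ->
  derive1n n (fun t => a *: f t) = fun t => a *: derive1n n f t.
Proof.
move=> sf; elim: n => // n ih; rewrite derive1nS ih; apply/funext => t.
apply: isd_eq; have ? := smo_isd (smo_derive1n n sf) (t := t) I.
by rewrite derive1nS; exact: (@is_deriveZ R R W).
Qed.

Lemma derive1nB n (f g : R -> W) : sm f -> sm g ->
  derive1n n (fun t => f t - g t) = fun t => derive1n n f t - derive1n n g t.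
Proof.
move=> sf sg; have sNg : sm (fun t => -1 *: g t) by apply: smoZ => //; exact: openT.
have -> : (fun t => f t - g t) = (fun t => f t + -1 *: g t).
  by apply/funext => t; rewrite scaleN1r.
by rewrite derive1nD// derive1nZ//; apply/funext => t; rewrite scaleN1r.
Qed.

Lemma sm_affine a b : sm (fun t : R => a * t + b).
Proof.
apply: smoD; [exact: openT| |exact/smo_cst/openT].
by apply: smoM; [exact: openT|exact/smo_cst/openT|exact/smo_id/openT].
Qed.

Lemma isd_affine (a b t : R) : isd (fun t : R => a * t + b) t a.
Proof.
have := @is_deriveD R R R _ (cst b) t 1 _ _ (@is_deriveZ R R R id a t 1 _ (is_derive_id t 1)) (is_derive_cst b t 1).
by rewrite addr0 [a *: 1]mulr1.
Qed.

Lemma derive1n_affine n a b (f : R -> W) : sm f ->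
  derive1n n (fun t => f (a * t + b)) = fun t => a ^+ n *: derive1n n f (a * t + b).
Proof.
move=> sf; elim: n => [|n ih]; first by apply/funext => t; rewrite scale1r.
rewrite derive1nS ih; apply/funext => t; apply: isd_eq.
have H := isd_comp (isd_affine a b t) (smo_isd (smo_derive1n n sf) (t := a * t + b) I).
by rewrite derive1nS exprSr -scalerA; exact: (@is_deriveZ R R W _ (a ^+ n) _ _ _ H).
Qed.

Lemma nat_gt (x : R) : exists k, x < k%:R.
Proof.
exists (Num.bound `|x|); rewrite (le_lt_trans (ler_norm x))//.
exact: archi_boundP.
Qed.

Lemma rapidseq_exp (p : nat -> R) M :
  (forall k, `|p k| <= M * expR (- k.+1%:R)) -> rapidseq (fun k => k.+1%:R) p.
Proof.
move=> pM m; have [C CP] := expRN_rapid R m; exists (M * C) => k.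
have k1 : 1 <= k.+1%:R :> R by rewrite ler1n.
have M0 : 0 <= M.
  have := le_trans (normr_ge0 _) (pM 0%N).
  by rewrite pmulr_lge0// expR_gt0.
apply: (@le_trans _ _ (M * expR (- k.+1%:R) * k.+1%:R ^+ m)).
  by rewrite ler_wpM2r// exprn_ge0.
by rewrite -mulrA ler_wpM2l// mulrC (le_trans (ler_norm _))// CP.
Qed.

(** Coordinates are indexed by an arbitrary type so that one local bound serves the plane ([bool]),
    R^n (['I_n]) and time together with space ([option 'I_n]). *)
Definition cvs (I : Type) (f : (I -> R) -> W) :=
  forall c : I -> R -> R, (forall i, sm (c i)) -> sm (fun t => f (fun i => c i t)).

(* If the bound failed, a smooth curve could run through a fast converging
   sequence of points with slowly decreasing speeds, along which the n-th
   derivative of f would be unbounded. *)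
Lemma cvs_local_bound (I : Type) (f : (I -> R) -> W) (x0 : I -> R) n (M : R) :
  cvs f -> exists d C : R, 0 < d /\ forall x v,
    (forall i, `|x i - x0 i| < d) -> (forall i, `|v i| <= M) ->
    `|derive1n n (fun t => f (fun i => x i + t * v i)) 0| <= C.
Proof.
move=> sf; apply: contrapT => nb.
pose lam k : R := expR (- k.+1%:R).
have lam0 k : 0 < lam k by exact: expR_gt0.
(* The curve will pass the k-th point with velocity [lam k] times the k-th direction, which
   multiplies the n-th derivative by [lam k ^+ n]. The factor [(lam k)^-1 ^+ n] compensates for
   this, and [k.+1] remains. *)
have Hk k : exists xv : (I -> R) * (I -> R), [/\
    forall i, `|xv.1 i - x0 i| < lam k, forall i, `|xv.2 i| <= M &
    k.+1%:R * (lam k)^-1 ^+ n < `|derive1n n (fun t => f (fun i => xv.1 i + t * xv.2 i)) 0|].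
  apply: contrapT => nE; apply: nb; exists (lam k), (k.+1%:R * (lam k)^-1 ^+ n).
  split=> // x v hx hv; rewrite leNgt; apply/negP => H.
  by apply: nE; exists (x, v).
have [xv xvP] := choice Hk.
have s1 : 1 <= (fun k => k.+1%:R : R) 0%N by [].
have sS k : (fun k => k.+1%:R : R) k + 1 <= (fun k => k.+1%:R : R) k.+1 by rewrite /= natr1.
have FP i : exists F : R -> R, sm F /\ forall k u, `|u| <= 6^-1 ->
    F (k.+1%:R + u)^-1 = (xv k).1 i - x0 i + u * (lam k * (xv k).2 i).
  have [||F [sF FE _ _]] := special_curve s1 sS (p := fun k => (xv k).1 i - x0 i)
    (w := fun k => lam k * (xv k).2 i).
  - apply: (@rapidseq_exp _ 1) => k; rewrite mul1r.
    by have [/(_ i)/ltW] := xvP k.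
  - apply: (@rapidseq_exp _ M) => k; rewrite normrM mulrC [`|lam k|]gtr0_norm//.
    by rewrite ler_wpM2r ?(ltW (lam0 k))//; have [_ /(_ i)] := xvP k.
  by exists F.
have [F {}FP] := choice FP.
pose c i t := x0 i + F i t.
have sc i : sm (c i).
  by apply: smoD; [exact: openT|exact/smo_cst/openT|have [] := FP i].
have sg := sf c sc.
have [C CP] := derive1n_inv_bounded n sg.
have [k kC] := nat_gt C.
have [xk vk] := xvP k; apply/negP; rewrite -leNgt.
set h := (fun t => f (fun i => (xv k).1 i + t * (xv k).2 i)).
have sh : sm h.
  apply: (sf (fun i t => (xv k).1 i + t * (xv k).2 i)) => i.
  apply: sm_ext (sm_affine ((xv k).2 i) ((xv k).1 i)) => t.
  by rewrite addrC mulrC.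
pose U := [set s : R | `|s - k.+1%:R| < 6^-1].
have oU : open U.
  have -> : U = ball (k.+1%:R : R) (6^-1 : R).
    by apply/seteqP; split=> s; rewrite /U /ball/= distrC.
  exact: ball_open.
have kU : U k.+1%:R by rewrite /U/= subrr normr0 invr_gt0.
have E : forall s, U s -> f (fun i => c i s^-1) = h (lam k * s + - (lam k * k.+1%:R)).
  move=> s Us; rewrite /h /c; congr f; apply/funext => i.
  have -> : s = k.+1%:R + (s - k.+1%:R) by rewrite addrC subrK.
  have [_ ->] := FP i; last exact: ltW.
  by rewrite addrA [x0 i + _]addrC subrK -mulrBr mulrA [_ * lam k]mulrC [k.+1%:R + _]addrC subrK.
have := CP k.+1%:R; rewrite ler1n => /(_ isT).
rewrite (derive1n_eq n oU E kU) derive1n_affine// subrr normrZ.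
have lamn : 0 <= lam k ^+ n by rewrite exprn_ge0// ltW.
rewrite (ger0_norm lamn) => H.
rewrite exprVn ler_pdivlMr ?exprn_gt0// mulrC (le_trans H)//.
apply/ltW/(lt_trans kC).
by rewrite ltr_nat.
Qed.

End local_bound.

(** * Mixed finite differences from differences along lines *)

Section finite_differences.
Variables (R : realType) (W : normedModType R).

Fixpoint fdiff n (a : nat -> W) : W :=
  if n is n'.+1 then fdiff n' (fun j => a j.+1 - a j) else a 0%N.

Lemma fdiffB n a b : fdiff n (fun j => a j - b j) = fdiff n a - fdiff n b.
Proof.
elim: n a b => //= n ih a b; rewrite -ih; congr fdiff; apply/funext => j.
by rewrite !opprD !opprK addrACA.
Qed.

(** The coefficient of [a 0] in the n-th difference is 1 or -1. Applied to [mdiff], which vanishes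
    for j = 1, ..., n, this isolates the mixed difference at j = 0. *)
Lemma fdiff_single n a : (forall j, (0 < j <= n)%N -> a j = 0) ->
  `|fdiff n a| = `|a 0%N|.
Proof.
elim: n a => //= n ih a a0; rewrite ih => [|j /andP[j0 jn]].
  by rewrite a0// sub0r normrN.
by rewrite !a0 ?subrr// ?j0/= ?ltnS// ltnW.
Qed.

(** Induction on the order: the n-th derivative of f(t + 1) - f(t) is bounded by that of order n + 1
    of f, through [mvi]. *)
Lemma fdiff_bound n (f : R -> W) x C : sm f ->
  (forall t, x <= t <= x + n%:R -> `|derive1n n f t| <= C) ->
  `|fdiff n (fun j => f (x + j%:R))| <= C.
Proof.
elim: n f x => [|n ih] f x sf fC /=.
  by apply: fC; rewrite !addr0 lexx.
have sf1 : sm (fun t => f (1 * t + 1)) by apply: (sm_comp (f := f)) => //; exact: sm_affine.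
have := ih (fun t => f (1 * t + 1) - f t) x.
have -> : (fun j : nat => f (1 * (x + j%:R) + 1) - f (x + j%:R)) =
          (fun j : nat => f (x + j.+1%:R) - f (x + j%:R)).
  by apply/funext => j; rewrite mul1r -addrA natr1.
apply=> [|t /andP[xt tx]]; first by apply: smoB => //; exact: openT.
rewrite derive1nB// derive1n_affine//= expr1n scale1r mul1r.
have t1 : t <= t + 1 by rewrite lerDl.
have H := @mvi R W (derive1n n f) t (t + 1) 0 C t1.
rewrite scaler0 subr0 [t + 1 - t]addrAC subrr add0r mulr1 in H.
apply: H => u /andP[tu ut]; first exact: (smo_derivable (smo_derive1n n sf)).
rewrite subr0 -derive1nS fC// (le_trans xt tu)/= (le_trans ut)//.
by rewrite -natr1 addrA lerD2r.
Qed.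

(* The product of the difference operators (1 - T_(i - j)) with T_i the shift
   by i h in the first or second variable, for (i, d) in l. *)
Fixpoint mdiff (g : R -> R -> W) (h : R) (l : seq (nat * bool)) (j : nat)
    (x y : R) : W :=
  if l is (i, d) :: l' then
    mdiff g h l' j x y -
    mdiff g h l' j (x + (i%:R - j%:R) * h * d%:R) (y + (i%:R - j%:R) * h * (~~ d)%:R)
  else g x y.

Lemma mdiff_eq0 g h l j d x y : (j, d) \in l -> mdiff g h l j x y = 0.
Proof.
elim: l x y => //= -[i b] l ih x y; rewrite inE => /orP[/eqP[<- _]|jl].
  by rewrite subrr !mul0r !addr0 subrr.
by rewrite !ih// subrr.
Qed.

(* Expanding the product over the summands reduces alternating sums of mdiff
   to unidirectional differences of g. *)
Lemma mdiff_bound g h n r B x0 y0 : 0 <= h ->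
  (forall x y a b, `|x - x0| <= r -> `|y - y0| <= r -> 0 <= a <= n%:R -> 0 <= b <= n%:R ->
     `|fdiff n (fun j => g (x - j%:R * h * a) (y - j%:R * h * b))| <= B) ->
  forall l x y a b, `|x - x0| <= r - (\sum_(p <- l) p.1)%:R * h ->
    `|y - y0| <= r - (\sum_(p <- l) p.1)%:R * h ->
    0 <= a -> a + (size l)%:R <= n%:R -> 0 <= b -> b + (size l)%:R <= n%:R ->
  `|fdiff n (fun j => mdiff g h l j (x - j%:R * h * a) (y - j%:R * h * b))| <= 2 ^+ size l * B.
Proof.
move=> h0 H; elim=> [|[i d] l ih] x y a b; rewrite ?big_nil ?big_cons /=.
  rewrite mul0r subr0 !addr0 mul1r => xr yr a0 an b0 bn.
  by apply: H; rewrite ?a0 ?b0.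
rewrite natrD mulrDl opprD addrA -natr1 => xr yr a0 an b0 bn.
have ih0 : 0 <= i%:R * h by rewrite mulr_ge0.
rewrite fdiffB exprS -mulrA mulrDl mul1r (le_trans (ler_normB _ _))// lerD//.
  apply: ih => //; last 2 [by move: an; lra|by move: bn; lra].
  - by move: xr ih0; lra.
  - by move: yr ih0; lra.
have E (j : nat) : mdiff g h l j (x - j%:R * h * a + (i%:R - j%:R) * h * d%:R)
   (y - j%:R * h * b + (i%:R - j%:R) * h * (~~ d)%:R) =
   mdiff g h l j (x + i%:R * h * d%:R - j%:R * h * (a + d%:R))
     (y + i%:R * h * (~~ d)%:R - j%:R * h * (b + (~~ d)%:R)).
  by congr mdiff; ring.
under [X in fdiff n X]eq_fun do rewrite E.
have nb (z z0 : R) (c : bool) : `|z - z0| <= r - i%:R * h - (\sum_(p <- l) p.1)%:R * h ->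
    `|z + i%:R * h * c%:R - z0| <= r - (\sum_(p <- l) p.1)%:R * h.
  move=> zr; rewrite addrAC (le_trans (ler_normD _ _))//.
  rewrite [`|_ * c%:R|]ger0_norm; last by rewrite mulr_ge0.
  have : i%:R * h * c%:R <= i%:R * h by case: c => /=; rewrite ?mulr1 ?mulr0.
  by move: zr; lra.
apply: ih.
- by apply: nb; move: xr; lra.
- by apply: nb; move: yr; lra.
- by rewrite addr_ge0.
- by move: an; case: (d) => /=; lra.
- by rewrite addr_ge0.
- by move: bn; case: (d) => /=; lra.
Qed.

Fixpoint sdiff (h : R) (l : seq nat) (f : R -> W) (t : R) : W :=
  if l is i :: l' then sdiff h l' f t - sdiff h l' f (t + i%:R * h) else f t.

Lemma sdiffB h l f g t : sdiff h l (fun s => f s - g s) t = sdiff h l f t - sdiff h l g t.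
Proof.
elim: l t => //= i l ih t; rewrite !ih.
by rewrite !opprD !opprK addrACA.
Qed.

Lemma sdiff_shift h l f c t : sdiff h l (fun s => f (s + c)) t = sdiff h l f (t + c).
Proof. by elim: l t => //= i l ih t; rewrite !ih addrAC. Qed.

Lemma mdiff_sdiff g h l x y :
  mdiff g h [seq (i, true) | i <- l] 0 x y = sdiff h l (g^~ y) x.
Proof.
by elim: l x => //= i l ih x; rewrite subr0 mulr1 mulr0 addr0 !ih.
Qed.

(** Up to the mean value error, each factor 1 - T_(i h) replaces one derivative by multiplication
    with -(i h). The total is thus (- h)^p times the product of the shifts times the p-th
    derivative, p being the length of [l]. *)
Lemma sdiff_deriv h l f t w K : 0 <= h -> 0 <= K -> sm f ->
  (forall s, t <= s <= t + (\sum_(i <- l) i)%:R * h -> `|derive1n (size l) f s - w| <= K) ->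
  `|sdiff h l f t - ((- h) ^+ size l * (\prod_(i <- l) i)%:R) *: w| <=
    h ^+ size l * (\prod_(i <- l) i)%:R * K.
Proof.
move=> h0; elim: l f t w K => [|i l ih] f t w K K0 sf fK.
  rewrite !big_nil /= !mul1r scale1r; apply: fK.
  by rewrite big_nil mul0r addr0 lexx.
have ih0 : 0 <= i%:R * h by rewrite mulr_ge0.
pose f1 s := f s - f (s + i%:R * h).
have E1 : (fun s => f (s + i%:R * h)) = (fun s => f (1 * s + i%:R * h)).
  by apply/funext => s; rewrite mul1r.
have sfi : sm (fun s => f (s + i%:R * h)).
  by rewrite E1; apply: (sm_comp (f := f)) => //; exact: sm_affine.
have sf1 : sm f1 by apply: smoB => //; exact: openT.
have -> : sdiff h (i :: l) f t = sdiff h l f1 t by rewrite /f1 sdiffB sdiff_shift.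
have := ih f1 t (- (i%:R * h) *: w) (i%:R * h * K) (mulr_ge0 ih0 K0) sf1.
rewrite !big_cons /= natrM scalerA !exprS.
have -> : (- h) ^+ size l * (\prod_(j <- l) j)%:R * - (i%:R * h) =
  - h * (- h) ^+ size l * (i%:R * (\prod_(j <- l) j)%:R) by ring.
have -> : h ^+ size l * (\prod_(j <- l) j)%:R * (i%:R * h * K) =
  h * h ^+ size l * (i%:R * (\prod_(j <- l) j)%:R) * K by ring.
apply=> s /andP[ts st].
rewrite derive1nB// E1 derive1n_affine// expr1n scale1r mul1r.
have ssi : s <= s + i%:R * h by rewrite lerDl.
have := @mvi R W (derive1n (size l) f) s (s + i%:R * h) w K ssi.
rewrite [s + _ - s]addrAC subrr add0r => H.
rewrite -normrN opprB scaleNr opprD !opprK addrC.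
rewrite [- _ + _]addrC [i%:R * h * K]mulrC; apply: H => u /andP[su us]; first exact: (smo_derivable (smo_derive1n _ sf)).
rewrite -derive1nS; apply: fK; rewrite (le_trans ts su)/= (le_trans us)//.
by rewrite big_cons natrD mulrDl [i%:R * h + _]addrC addrA lerD2r.
Qed.

End finite_differences.

(** * Smoothness of the partial derivatives in the plane *)

Section two_variables.
Variables (R : realType) (W : normedModType R).

(* By Boman's theorem these are the smooth functions of two variables. *)
Definition cs2 (g : R -> R -> W) :=
  forall a b : R -> R, sm a -> sm b -> sm (fun t => g (a t) (b t)).

Lemma cs2_cvs g : cs2 g -> cvs (fun c : bool -> R => g (c true) (c false)).
Proof. by move=> sg c sc; apply: sg. Qed.

Lemma cs2_l g y : cs2 g -> sm (g^~ y).
Proof. by move=> sg; apply: (sg (fun t => t) (fun=> y)); [exact/smo_id/openT|exact/smo_cst/openT]. Qed.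

Lemma cs2_r g x : cs2 g -> sm (g x).
Proof. by move=> sg; apply: (sg (fun=> x) (fun t => t)); [exact/smo_cst/openT|exact/smo_id/openT]. Qed.

Lemma cs2_fdiff_bound n g t0 : cs2 g -> exists d C : R, [/\ 0 < d, 0 <= C &
  forall h x y a b, 0 <= h -> h * (n%:R * n%:R) <= d -> `|x - t0| <= d -> `|y| <= d ->
    0 <= a <= n%:R -> 0 <= b <= n%:R ->
    `|fdiff n (fun j => g (x - j%:R * h * a) (y - j%:R * h * b))| <= h ^+ n * C].
Proof.
move=> sg; have [d [C [d0 dC]]] :=
  cvs_local_bound (fun i : bool => if i then t0 else 0) n n%:R (cs2_cvs sg).
(* With t, a, b <= n the points move by at most h n ^ 2 <= d / 4, so they stay within distance d of
   the centre, where the bound on unit-speed derivatives along directions of size n holds. *)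
exists (d / 4), `|C|; split=> // [|h x y a b h0 hd xd yd /andP[a0 an] /andP[b0 bn]].
  by rewrite divr_gt0.
pose f (s : R) := g (x - s * h * a) (y - s * h * b).
have sf : sm f.
  apply: sg; [apply: sm_ext (sm_affine (- (h * a)) x) => t|
    apply: sm_ext (sm_affine (- (h * b)) y) => t]; ring.
have := fdiff_bound (n := n) (x := 0) (C := h ^+ n * `|C|) sf.
under [X in fdiff _ X]eq_fun do rewrite add0r.
apply=> t; rewrite add0r => /andP[t0' tn].
pose psi u := g (x - t * h * a + u * (- a)) (y - t * h * b + u * (- b)).
have spsi : sm psi.
  by apply: sg; [apply: sm_ext (sm_affine (- a) (x - t * h * a)) => u|
    apply: sm_ext (sm_affine (- b) (y - t * h * b)) => u]; ring.
have -> : f = (fun s => psi (h * s + (- (h * t)))).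
  by apply/funext => s; rewrite /f /psi; congr g; ring.
rewrite derive1n_affine// subrr normrZ ger0_norm ?exprn_ge0//.
rewrite ler_wpM2l ?exprn_ge0//.
have tha c : 0 <= c -> c <= n%:R -> 0 <= t * h * c <= d / 4.
  move=> c0 cn; rewrite !mulr_ge0//= (le_trans _ hd)// [t * h]mulrC -mulrA ler_wpM2l//.
  exact: ler_pM.
have /andP[ta0 ta] := tha a a0 an; have /andP[tb0 tb] := tha b b0 bn.
have := dC (fun i : bool => if i then x - t * h * a else y - t * h * b)
   (fun i : bool => if i then - a else - b).
rewrite -/psi => H; apply: le_trans (ler_norm C); apply: H => -[].
- by rewrite addrAC (le_lt_trans (ler_normB _ _))// [`|t * h * a|]ger0_norm//; lra.
- by rewrite subr0 (le_lt_trans (ler_normB _ _))// [`|t * h * b|]ger0_norm//; lra.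
- by rewrite normrN ger0_norm.
- by rewrite normrN ger0_norm.
Qed.

(** The core of Boman's theorem. A difference of order p in x and 1 in y is a combination of
    differences of order p + 1 along lines, hence O(h^(p+1)). About e / h of them telescope to the
    increment in y from 0 to e, giving O(e h^p). Division by h^p and h -> 0 turn the x-differences
    into the p-th derivative. *)
Lemma cs2_increment_bound p g t0 : cs2 g -> exists d C : R, 0 < d /\
  forall t e, `|t - t0| < d -> 0 < e < d ->
    `|derive1n p (fun t => g t 0 - g t e) t| <= C * e.
Proof.
move=> sg; pose n := p.+1.
have [d [C [d0 C0 H]]] := cs2_fdiff_bound n t0 sg.
exists (d / 4), (2 ^+ n * C); split=> [|t e td /andP[e0 ed]]; first by rewrite divr_gt0.
(* The shifts 1, ..., p in x and n = p + 1 in y exhaust 1, ..., n, so every j in this range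
   annihilates one factor of [mdiff]. *)
pose lx := iota 1 p.
pose S : R := (n + \sum_(i <- lx) i)%N%:R.
pose P : R := (\prod_(i <- lx) i)%N%:R.
have S0 : 0 <= S by [].
have P1 : 1 <= P.
  rewrite ler1n big_seq_cond; elim/big_ind : _ => // [x y x0 y0|i].
    by rewrite muln_gt0 x0.
  by rewrite mem_iota => /andP[/andP[]].
have szl : size lx = p by rewrite size_iota.
have step h y : 0 <= h -> h * (n%:R * n%:R) <= d -> S * h <= d / 4 -> `|y| <= d / 4 ->
    `|sdiff h lx (g^~ y) t - sdiff h lx (g^~ (y + n%:R * h)) t| <= 2 ^+ n * (h ^+ n * C).
  move=> h0 hd Sh yd.
  pose l0 := (n, false) :: [seq (i, true) | i <- lx].
  have szl0 : size l0 = n by rewrite /= size_map szl.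
  have sml0 : (\sum_(q <- l0) q.1)%:R = S by rewrite /S big_cons big_map.
  have H1 := @mdiff_bound R W g h n d (h ^+ n * C) t0 0 h0.
  have /H1{}H1 : forall x y a b, `|x - t0| <= d -> `|y - 0| <= d ->
      0 <= a <= n%:R -> 0 <= b <= n%:R ->
      `|fdiff n (fun j => g (x - j%:R * h * a) (y - j%:R * h * b))| <= h ^+ n * C.
    by move=> x' y' a b xd' yd' an bn; apply: H => //; rewrite subr0 in yd'.
  have := H1 l0 t y 0 0; rewrite szl0 sml0 subr0 lexx add0r lexx.
  move=> /(_ _ _ isT isT isT isT); rewrite fdiff_single; last first.
    move=> j /andP[j0 jn].
    have [->|jn'] := eqVneq j n; first by apply: (@mdiff_eq0 _ _ _ _ _ _ false); rewrite inE eqxx.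
    apply: (@mdiff_eq0 _ _ _ _ _ _ true); rewrite inE map_f ?orbT// mem_iota j0/=.
    by rewrite add1n ltn_neqAle jn'.
  rewrite !mulr0 !subr0 /l0 /= !mdiff_sdiff subr0 mulr1 mulr0 addr0.
  apply; last by rewrite (le_trans yd)//; move: Sh d0; lra.
  by move: td Sh d0; lra.
have tele h N : 0 <= h -> h * (n%:R * n%:R) <= d -> S * h <= d / 4 -> N%:R * (n%:R * h) <= d / 4 ->
    `|sdiff h lx (g^~ 0) t - sdiff h lx (g^~ (N%:R * (n%:R * h))) t| <= N%:R * (2 ^+ n * (h ^+ n * C)).
  move=> h0 hd Sh; elim: N => [_|N ih]; first by rewrite !mul0r subrr normr0.
  have nh : 0 <= n%:R * h by rewrite mulr_ge0.
  rewrite -natr1 !mulrDl !mul1r => Nd.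
  rewrite -[sdiff _ _ (g^~ 0) t](subrK (sdiff h lx (g^~ (N%:R * (n%:R * h))) t)) -addrA.
  have Nd' : N%:R * (n%:R * h) <= d / 4 by move: Nd nh; lra.
  rewrite (le_trans (ler_normD _ _))// lerD ?ih//; apply: step => //.
  by rewrite ger0_norm// mulr_ge0.
pose q s := g s 0 - g s e.
have sq : sm q by apply: smoB; [exact: openT|exact: cs2_l|exact: cs2_l].
apply/ler_addgt0Pr => e1 e10.
have [d1 d10 qc] : exists2 d1 : R, 0 < d1 & forall s, `|s - t| < d1 ->
    `|derive1n p q s - derive1n p q t| <= e1.
  have /cvgrPdist_le/(_ e1 e10)/nbhs_ballP[d1 /= d10 d1P] :=
    smo_derivable_continuous (smo_derive1n p sq) (t := t) I.
  by exists d1 => // s st; rewrite distrC; apply: d1P; rewrite /ball/= distrC.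
pose m := Num.min d1 (d / 4).
have m0 : 0 < m by rewrite lt_min d10 divr_gt0.
(* N is the number of steps in y. It is taken so large that h = e / (N n) keeps all shifts inside
   the domain of the bound and inside the interval where the p-th derivative varies by at most
   [e1]. *)
have [N NP] := nat_gt ((S + n%:R * n%:R) * e / m).
have nn0 : 0 <= n%:R * n%:R :> R by [].
have N0 : 0 < N%:R :> R.
  by rewrite (le_lt_trans _ NP)// !mulr_ge0 ?invr_ge0 ?addr_ge0// ltW.
have n0 : 0 < n%:R :> R by [].
have n1 : 1 <= n%:R :> R by rewrite ler1n.
pose h := e / N%:R / n%:R.
have h0 : 0 < h by rewrite !divr_gt0.
have Nh : N%:R * (n%:R * h) = e by rewrite /h; field; rewrite !gt_eqF.
have hm : (S + n%:R * n%:R) * h < m.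
  move: NP; rewrite ltr_pdivrMr// => NP.
  have := ltr_pM2r h0 ((S + n%:R * n%:R) * e) (N%:R * m).
  rewrite NP => /idP NP2.
  have hN : h * N%:R <= e by rewrite /h mulrAC divfK ?gt_eqF// ler_pdivrMr// ler_peMr// ltW.
  have : (S + n%:R * n%:R) * h * e < m * e.
    rewrite mulrAC (lt_le_trans NP2)// mulrAC mulrC ler_wpM2l ?(ltW m0)//.
    by rewrite mulrC.
  by rewrite ltr_pM2r.
have [hm1 hm2] : (S + n%:R * n%:R) * h < d1 /\ (S + n%:R * n%:R) * h < d / 4.
  by move: hm; rewrite lt_min => /andP[].
rewrite mulrDl in hm1; rewrite mulrDl in hm2.
have Sh0 : 0 <= S * h by rewrite mulr_ge0// ltW.
have nh0 : 0 <= n%:R * n%:R * h by rewrite mulr_ge0// ltW.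
have T1 := tele h N (ltW h0).
rewrite Nh [h * _]mulrC in T1.
have {}T1 : `|sdiff h lx q t| <= N%:R * (2 ^+ n * (h ^+ n * C)).
  by rewrite /q sdiffB; apply: T1; move: hm2 ed; lra.
have := @sdiff_deriv R W h lx q t (derive1n p q t) e1 (ltW h0) (ltW e10) sq.
rewrite szl -/P => T2.
have {}T2 : `|sdiff h lx q t - ((- h) ^+ p * P) *: derive1n p q t| <= h ^+ p * P * e1.
  apply: T2 => s /andP[ts st]; apply: qc; rewrite ger0_norm ?subr_ge0//.
  have SS : (\sum_(i <- lx) i)%N%:R * h <= S * h.
    by rewrite ler_wpM2r ?(ltW h0)// ler_nat leq_addl.
  by move: st SS hm1; lra.
have hp0 : 0 < h ^+ p by rewrite exprn_gt0.
have P0 : 0 < P by rewrite (lt_le_trans ltr01).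
have hP : 0 < h ^+ p * P by rewrite mulr_gt0.
have T3 : h ^+ p * P * `|derive1n p q t| <= N%:R * (2 ^+ n * (h ^+ n * C)) + h ^+ p * P * e1.
  have -> : h ^+ p * P * `|derive1n p q t| = `|((- h) ^+ p * P) *: derive1n p q t|.
    by rewrite normrZ normrM normrX normrN !ger0_norm// ltW.
  rewrite -[X in `|X|](subKr (sdiff h lx q t)) (le_trans (ler_normB _ _))//.
  by rewrite lerD.
rewrite -(ler_pM2l hP) (le_trans T3)// mulrDr lerD2r.
have -> : N%:R * (2 ^+ n * (h ^+ n * C)) = h ^+ p * (2 ^+ n * C) * (e / n%:R).
  have -> : h ^+ n = h * h ^+ p by rewrite exprS.
  rewrite -[X in _ = _ * (X / _)]Nh; set c := 2 ^+ n.
  by field; rewrite gt_eqF.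
rewrite -!mulrA ler_wpM2l ?(ltW hp0)//.
have CC : 0 <= 2 ^+ n * C by rewrite mulr_ge0// exprn_ge0.
rewrite !mulrA -[2 ^+ n * C * e * _]mulrA.
have X1 : e / n%:R <= e by rewrite ler_pdivrMr// ler_peMr// ltW.
have X2 : 2 ^+ n * C * (e / n%:R) <= 2 ^+ n * C * e by rewrite ler_wpM2l.
rewrite (le_trans X2)// -!mulrA ler_peMl// !mulr_ge0 ?exprn_ge0//.
by rewrite ltW.
Qed.

Lemma mvi_abs (f : R -> W) (a h : R) (w : W) (M : R) : sm f ->
  (forall t, `|t - a| <= `|h| -> `|derive1 f t - w| <= M) ->
  `|f (a + h) - f a - h *: w| <= M * `|h|.
Proof.
move=> sf H; have [h0|h0] := leP 0 h.
  have E : a + h - a = h by rewrite addrAC subrr add0r.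
  have := @mvi R W f a (a + h) w M; rewrite E.
  rewrite (ger0_norm h0); apply; first by rewrite lerDl.
    by move=> t _; exact: (smo_derivable sf).
  move=> t /andP[at_ th]; apply: H; rewrite !ger0_norm ?subr_ge0//.
  by rewrite lerBlDl.
have E : a - (a + h) = - h by rewrite opprD addrA subrr add0r.
have := @mvi R W f (a + h) a w M; rewrite E.
rewrite (ltr0_norm h0) scaleNr opprK => H1.
have -> : f (a + h) - f a - h *: w = - (f a - f (a + h) + h *: w).
  by rewrite !opprD opprK [- f a + _]addrC.
rewrite normrN; apply: H1.
- by rewrite gerDl ltW.
- by move=> t _; exact: (smo_derivable sf).
- move=> t /andP[at_ th]; apply: H; rewrite (ltr0_norm h0) distrC ger0_norm ?subr_ge0//.
  by move: at_; lra.
Qed.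

Lemma taylor1 (f : R -> W) (t0 d C : R) : sm f ->
  (forall t, `|t - t0| < d -> `|derive1n 2 f t| <= C) ->
  forall h, `|h| < d -> `|f (t0 + h) - f t0 - h *: derive1 f t0| <= C * `|h| ^+ 2.
Proof.
move=> sf fC h hd; rewrite expr2 mulrA; apply: mvi_abs => // t th.
have C0 : 0 <= C.
  by rewrite (le_trans _ (fC t0 _)) ?subrr ?normr0// (le_lt_trans _ hd).
have := @mvi_abs (derive1 f) t0 (t - t0) 0 C (smo_derive1 sf).
have E : t0 + (t - t0) = t by rewrite addrC subrK.
rewrite E scaler0 subr0 => H.
apply: (le_trans (H _)); last by rewrite ler_wpM2l.
move=> s st; rewrite subr0; apply: fC.
by rewrite (le_lt_trans st)// (le_lt_trans th).
Qed.

Definition tends (u : nat -> W) (l : W) :=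
  forall e, 0 < e -> exists N, forall n, (N <= n)%N -> `|u n - l| <= e.

Definition seq_complete := forall u : nat -> W,
  (forall e, 0 < e -> exists N, forall m n, (N <= m)%N -> (N <= n)%N -> `|u m - u n| <= e) ->
  exists l, tends u l.

Hypothesis Wc : seq_complete.

(** A common bound on second derivatives makes the difference quotients approximate the derivatives
    uniformly in n. Pointwise convergence of [F n] therefore makes the derivatives at [t0] a Cauchy
    sequence, and the Taylor estimate passes to the limit. *)
Lemma limit_derive (F : nat -> R -> W) (f : R -> W) t0 (d C : R) N :
  (forall n, sm (F n)) -> (forall t, tends (F^~ t) (f t)) -> 0 < d ->
  (forall n t, (N <= n)%N -> `|t - t0| < d -> `|derive1n 2 (F n) t| <= C) ->
  exists l, tends (fun n => derive1 (F n) t0) l /\ isd f t0 l.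
Proof.
move=> sF Ff d0 FC.
have T n h : (N <= n)%N -> `|h| < d ->
    `|F n (t0 + h) - F n t0 - h *: derive1 (F n) t0| <= C * `|h| ^+ 2.
  by move=> Nn; apply: taylor1 => // t; exact: FC.
have C0 : 0 <= C by apply: le_trans (FC N t0 (leqnn _) _); rewrite ?subrr ?normr0.
have [l lP] : exists l, tends (fun n => derive1 (F n) t0) l.
  apply: Wc => e e0.
  (* With this h the Taylor error C h ^ 2 is at most e h / 4. Two such errors and four pointwise
     errors of e h / 8 add up to e h. *)
  pose h := Num.min (d / 2) (e / (4 * (C + 1))).
  have C1 : 0 < 4 * (C + 1) by rewrite mulr_gt0// ltr_wpDl.
  have h0 : 0 < h by rewrite lt_min !divr_gt0.
  have hd : `|h| < d by rewrite gtr0_norm// gt_min ltr_pdivrMr// ltr_pMr// ltr1n.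
  have hC : C * h <= e / 4.
    have : h <= e / (4 * (C + 1)) by rewrite ge_min lexx orbT.
    rewrite ler_pdivlMr// => H; rewrite ler_pdivlMr//.
    by move: H (ltW h0); lra.
  have eh : 0 < e * h / 8 by rewrite divr_gt0// mulr_gt0.
  have [N1 N1P] := Ff (t0 + h) _ eh; have [N2 N2P] := Ff t0 _ eh.
  exists (maxn N (maxn N1 N2)) => m n.
  rewrite !geq_max => /andP[Nm /andP[N1m N2m]] /andP[Nn /andP[N1n N2n]].
  rewrite -(ler_pM2r h0).
  have -> : `|derive1 (F m) t0 - derive1 (F n) t0| * h =
            `|h *: derive1 (F m) t0 - h *: derive1 (F n) t0|.
    by rewrite -scalerBr normrZ gtr0_norm// mulrC.
  have X (x y z x' y' z' u v : W) : `|x - y - z| <= C * `|h| ^+ 2 ->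
     `|x' - y' - z'| <= C * `|h| ^+ 2 -> `|x - u| <= e * h / 8 -> `|y - v| <= e * h / 8 ->
     `|x' - u| <= e * h / 8 -> `|y' - v| <= e * h / 8 -> `|z - z'| <= e * h.
    move=> H1 H2 H3 H4 H5 H6.
    have -> : z - z' = (x' - y' - z') - (x - y - z) + ((x - u) - (x' - u)) - ((y - v) - (y' - v)).
      rewrite !opprD !opprK !addrA.
      rewrite (ACl ((3*6)*(1*9)*(2*13)*(4*7)*(5*11)*(8*10)*(12*14)))/=.
      rewrite [- z' + z]addrC [x' - x']subrr.
      by rewrite ![- _ + _]addrC !subrr !addr0.
    have hh : C * `|h| ^+ 2 <= e * h / 4.
      rewrite gtr0_norm// expr2 mulrA.
      have : C * h * h <= e / 4 * h by rewrite ler_wpM2r// ltW.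
      by lra.
    have A1 := ler_normB (x' - y' - z') (x - y - z).
    have A2 := ler_normB (x - u) (x' - u).
    have A3 := ler_normB (y - v) (y' - v).
    have A4 := ler_normB ((x' - y' - z') - (x - y - z) + ((x - u) - (x' - u))) ((y - v) - (y' - v)).
    have A5 := ler_normD ((x' - y' - z') - (x - y - z)) ((x - u) - (x' - u)).
    move: H1 H2 H3 H4 H5 H6 A1 A2 A3 A4 A5 hh; lra.
  exact: (X _ _ _ _ _ _ _ _ (T m h Nm hd) (T n h Nn hd) (N1P _ N1m) (N2P _ N2m) (N1P _ N1n) (N2P _ N2n)).
exists l; split=> //; apply: (@isd_quad _ _ _ _ _ d C) => // h hd.
apply/ler_addgt0Pr => e e0.
have e30 : 0 < e / 3 by rewrite divr_gt0.
have eh0 : 0 < e / 3 / (`|h| + 1) by rewrite divr_gt0// ltr_wpDl.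
have [N1 N1P] := Ff (t0 + h) _ e30; have [N2 N2P] := Ff t0 _ e30; have [N3 N3P] := lP _ eh0.
pose n := maxn N (maxn N1 (maxn N2 N3)).
have [Nn /andP[N1n /andP[N2n N3n]]] : (N <= n)%N /\ (N1 <= n)%N && ((N2 <= n)%N && (N3 <= n)%N).
  by rewrite /n !leq_max !leqnn !orbT.
have := T n h Nn hd; have := N1P n N1n; have := N2P n N2n; have := N3P n N3n.
set A := derive1 _ _; set x := F n _; set y := F n _; set x' := f _; set y' := f _.
move=> H3 H2 H1 H0.
have -> : y' - x' - h *: l = (y - x - h *: A) - (y - y') + (x - x') + h *: (A - l).
  rewrite scalerBr !opprD !opprK !addrA.
  rewrite (ACl ((5*7*9)*(1*4)*(2*6)*(3*8)))/= ![- _ + _]addrC !subrr !addr0.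
  by [].
have H4 : `|h *: (A - l)| <= e / 3.
  rewrite normrZ; apply: (@le_trans _ _ ((`|h| + 1) * (e / 3 / (`|h| + 1)))).
    by apply: ler_pM => //; rewrite lerDl.
  by rewrite mulrC divfK// gt_eqF// ltr_wpDl.
have A1 := ler_normD ((y - x - h *: A) - (y - y') + (x - x')) (h *: (A - l)).
have A2 := ler_normD ((y - x - h *: A) - (y - y')) (x - x').
have A3 := ler_normB (y - x - h *: A) (y - y').
move: H0 H1 H2 H4 A1 A2 A3; lra.
Qed.

Lemma limit_smooth (F : nat -> R -> W) (f : R -> W) :
  (forall n, sm (F n)) -> (forall t, tends (F^~ t) (f t)) ->
  (forall p t0, exists d C N, 0 < d /\ forall n t, (N <= n)%N -> `|t - t0| < d ->
     `|derive1n p (F n) t| <= C) -> sm f.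
Proof.
move=> sF Ff FC k; elim: k F f sF Ff FC => // k ih F f sF Ff FC.
have Hl t0 : exists l, tends (fun n => derive1 (F n) t0) l /\ isd f t0 l.
  by have [d [C [N [d0 H]]]] := FC 2%N t0; exact: (@limit_derive F f t0 d C N).
have [df dfP] := choice Hl.
apply: (smkS openT (df := df)) => [t _|]; first by have [] := dfP t.
apply: (ih (fun n => derive1 (F n))) => [n|t|p t0].
- exact: (smo_derive1 (sF n)).
- by have [] := dfP t.
- have [d [C [N [d0 H]]]] := FC p.+1 t0; exists d, C, N; split=> // n t.
  by have := H n t; rewrite derive1Sn.
Qed.

(** The difference quotients in the second variable converge pointwise, and [cs2_increment_bound]
    bounds all their t-derivatives uniformly in the step, so [limit_smooth] applies. *)
Lemma cs2_d2_0 g : cs2 g -> sm (fun t => derive1 (g t) 0).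
Proof.
move=> sg; pose eta n : R := n.+1%:R^-1.
have eta0 n : 0 < eta n by rewrite invr_gt0.
have etaN (d : R) : 0 < d -> exists N, forall n, (N <= n)%N -> eta n < d.
  move=> d0; have [N NP] := nat_gt d^-1; exists N => n Nn.
  rewrite /eta invf_plt ?posrE// (lt_le_trans NP)// ler_nat.
  exact: leq_trans Nn _.
pose F n t := n.+1%:R *: (g t (eta n) - g t 0).
have sF1 n : sm (fun t => g t 0 - g t (eta n)) by apply: smoB; [exact: openT|exact: cs2_l|exact: cs2_l].
have sF n : sm (F n) by apply: smoZ; [exact: openT|apply: smoB; [exact: openT|exact: cs2_l|exact: cs2_l]].
apply: (limit_smooth sF) => [t e e0|p t0].
  have /isd_eps/(_ e e0)[d d0 dP] := smo_isd (cs2_r t sg) (t := 0) I.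
  have [N NP] := etaN _ d0; exists N => n /NP nd.
  have := dP (eta n); rewrite gtr0_norm// => /(_ nd); rewrite add0r => H.
  have n0 : 0 < n.+1%:R :> R by [].
  have -> : F n t - derive1 (g t) 0 = n.+1%:R *: (g t (eta n) - g t 0 - eta n *: derive1 (g t) 0).
    by rewrite [RHS]scalerBr scalerA divff ?scale1r// gt_eqF.
  by rewrite normrZ gtr0_norm// mulrC -ler_pdivlMr.
have [d [C [d0 H]]] := cs2_increment_bound p t0 sg.
have [N NP] := etaN _ d0; exists d, C, N; split=> // n t /NP nd td.
have -> : F n = (fun t => - n.+1%:R *: (g t 0 - g t (eta n))).
  by apply/funext => s; rewrite /F scaleNr -scalerN opprB.
rewrite derive1nZ// normrZ normrN ger0_norm// mulrC -ler_pdivlMr//.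
by apply: H => //; rewrite eta0.
Qed.

(** Shifting the second variable by [b t] moves the base point of the derivative to 0. *)
Lemma cs2_d2 g : cs2 g -> cs2 (fun x y => derive1 (g x) y).
Proof.
move=> sg a b sa sb.
have sg' : cs2 (fun t s => g (a t) (s + b t)).
  move=> c e sc se; apply: (sg (fun t => a (c t)) (fun t => e t + b (c t))).
    exact: sm_comp.
  by apply: smoD => //; [exact: openT|exact: sm_comp].
apply: sm_ext (cs2_d2_0 sg') => t.
have E : (fun s => g (a t) (s + b t)) = (fun s => g (a t) (1 * s + b t)).
  by apply/funext => s; rewrite mul1r.
have := derive1n_affine 1 1 (b t) (cs2_r (a t) sg).
rewrite -E derive1n1 => /(congr1 (fun f => f 0)) ->.
by rewrite expr1n scale1r mulr0 add0r derive1n1.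
Qed.

End two_variables.

Section completeness.
Variable R : realType.

Lemma real_seq_complete : seq_complete (R : normedModType R).
Proof.
move=> u cu.
have cvu : cvgn u.
  apply/cauchy_cvgP/cauchy_exP => e e0.
  have e20 : 0 < e / 2 by rewrite divr_gt0.
  have [N NP] := cu _ e20; exists (u N); exists N => // n Nn.
  rewrite /ball/= (le_lt_trans (NP _ _ (leqnn N) Nn))//.
  by rewrite ltr_pdivrMr// ltr_pMr// ltr1n.
have /cvg_ex[l ul] := cvu; exists l => e e0.
have /cvgrPdist_le/(_ e e0)[N _ NP] := ul.
by exists N => n Nn; rewrite distrC; exact: NP.
Qed.

Lemma Rcomplex_norm_le (z : Rcomplex R) : `|z| <= `|complex.Re z| + `|complex.Im z|.
Proof.
case: z => x y; rewrite /Num.norm/= /Normc.normc/=.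
rewrite -(ger0_norm (addr_ge0 (normr_ge0 x) (normr_ge0 y))) -sqrtr_sqr ler_wsqrtr//.
by rewrite sqrrD !real_normK ?num_real// lerD2r lerDl mulrn_wge0// mulr_ge0.
Qed.

Lemma Rcomplex_Re_le (z : Rcomplex R) : `|complex.Re z| <= `|z|.
Proof.
case: z => x y; change (`|x| <= Num.sqrt (x ^+ 2 + y ^+ 2)).
by rewrite -sqrtr_sqr ler_wsqrtr// lerDl sqr_ge0.
Qed.

Lemma Rcomplex_Im_le (z : Rcomplex R) : `|complex.Im z| <= `|z|.
Proof.
case: z => x y; change (`|y| <= Num.sqrt (x ^+ 2 + y ^+ 2)).
by rewrite -sqrtr_sqr ler_wsqrtr// lerDr sqr_ge0.
Qed.

Lemma scalars_complete F : seq_complete (scalars R F).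
Proof.
case: F => /=; first exact: real_seq_complete.
move=> u cu.
have [|a aP] := @real_seq_complete (fun n => complex.Re (u n)).
  move=> e /cu[N NP]; exists N => m n Nm Nn.
  by have := NP _ _ Nm Nn; apply: le_trans; rewrite -raddfB; exact: Rcomplex_Re_le.
have [|b bP] := @real_seq_complete (fun n => complex.Im (u n)).
  move=> e /cu[N NP]; exists N => m n Nm Nn.
  by have := NP _ _ Nm Nn; apply: le_trans; rewrite -raddfB; exact: Rcomplex_Im_le.
exists (Complex a b) => e e0.
have e20 : 0 < e / 2 by rewrite divr_gt0.
have [N1 N1P] := aP _ e20; have [N2 N2P] := bP _ e20.
exists (maxn N1 N2) => n; rewrite geq_max => /andP[/N1P H1 /N2P H2].
apply: le_trans (Rcomplex_norm_le _) _; rewrite [leRHS]splitr lerD//.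
  by move: H1; case: (u n).
by move: H2; case: (u n).
Qed.
End completeness.

Lemma compact_uniform (T : topologicalType) (A : set T) (P : nat -> T -> Prop) :
  compact A -> (forall i j y, (i <= j)%N -> P i y -> P j y) ->
  (forall y, A y -> exists N, \forall z \near y, P N z) ->
  exists N, forall y, A y -> P N y.
Proof.
move=> /compact_near_coveringP cA mP H.
have [N _ NP] : \forall N \near \oo, A `<=` P N.
  apply: (cA nat \oo P) => y /H[N NP].
  exists ([set z | P N z], [set i | (N <= i)%N]).
    by split=> //; exists N.
  by move=> [z i] [/= Pz Ni]; exact: mP Ni Pz.
by exists N => y; apply: NP => /=.
Qed.

(** * Hadamard's lemma, the chain rule and symmetry of second derivatives *)

Section plane_calculus.
Variables (R : realType) (W : normedModType R).
Hypothesis Wc : seq_complete W.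
Implicit Types g : R -> R -> W.

Definition d1 g x y := derive1 (g^~ y) x.
Definition d2 g x y := derive1 (g x) y.

Lemma cs2_swap g : cs2 g -> cs2 (fun x y => g y x).
Proof. by move=> sg a b sa sb; exact: sg. Qed.

Lemma cs2_d1 g : cs2 g -> cs2 (d1 g).
Proof. by move=> sg; apply: cs2_swap; exact: (cs2_d2 Wc (cs2_swap sg)). Qed.

Lemma cs2_derive1n n g : cs2 g -> cs2 (fun x y => derive1n n (g^~ y) x).
Proof.
move=> sg; elim: n => // n ih.
have -> : (fun x y => derive1n n.+1 (g^~ y) x) = d1 (fun x y => derive1n n (g^~ y) x).
  by apply/funext => x; apply/funext => y; rewrite derive1nS.
exact: cs2_d1.
Qed.

Lemma cs2_bounded g x0 y0 : cs2 g -> exists d C : R, 0 < d /\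
  forall x y, `|x - x0| < d -> `|y - y0| < d -> `|g x y| <= C.
Proof.
move=> sg; have [d [C [d0 dC]]] :=
  cvs_local_bound (fun i : bool => if i then x0 else y0) 0 0 (cs2_cvs sg).
exists d, C; split=> // x y xd yd.
have := dC (fun i : bool => if i then x else y) (fun=> 0).
by rewrite /= !mul0r !addr0; apply=> [[]//|i]; rewrite normr0.
Qed.

Lemma cs2_bounded_strip g x0 a b : cs2 g -> exists d C : R, 0 < d /\
  forall x y, `|x - x0| < d -> a <= y <= b -> `|g x y| <= C.
Proof.
move=> sg.
have [|i j y ij|y _|N NP] := @compact_uniform R `[a, b]
  (fun N y => forall x, `|x - x0| < N.+1%:R^-1 -> `|g x y| <= N%:R).
- exact: segment_compact.
- move=> H x xj; apply: (le_trans (H _ _)); last by rewrite ler_nat.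
  by rewrite (lt_le_trans xj)// lef_pV2 ?posrE// ler_nat.
- have [d [C [d0 dC]]] := cs2_bounded x0 y sg.
  have [N1 N1P] := nat_gt d^-1; have [N2 N2P] := nat_gt C.
  exists (maxn N1 N2); have := nbhs_norm_lt y d0; apply: filterS => z zy x xd.
  rewrite (le_trans (dC x z _ zy))//; last by rewrite (le_trans (ltW N2P))// ler_nat leq_maxr.
  rewrite (lt_trans xd)// invf_plt ?posrE// (lt_le_trans N1P)// ler_nat.
  by rewrite (leq_trans (leq_maxl N1 N2))// leqnSn.
- exists N.+1%:R^-1, N%:R; split=> [|x y xd yab]; first by rewrite invr_gt0.
  by apply: NP => //; rewrite /= in_itv.
Qed.

(** The divided difference of [g x] between 0 and y, that is, the integral of [d2 g x (r y)] over r
    in [0, 1]. *)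
Definition hadamard g x y : W :=
  if y == 0 then d2 g x 0 else y^-1 *: (g x y - g x 0).

Lemma hadamardE g x y : g x y = g x 0 + y *: hadamard g x y.
Proof.
rewrite /hadamard; case: eqVneq => [->|y0]; first by rewrite scale0r addr0.
by rewrite scalerA divff// scale1r addrC subrK.
Qed.

Lemma riemann_sum (f : R -> W) (h : R) : sm f -> exists C : R, forall N, (0 < N)%N ->
  `|f h - f 0 - (h / N%:R) *: \sum_(j < N) derive1 f (j%:R / N%:R * h)| <= C / N%:R.
Proof.
move=> sf.
have [C CP] := sm_bounded (- (`|h| + 1)) (`|h| + 1) (smo_derive1n 2 sf).
exists (C * `|h| ^+ 2) => N N0.
have N0' : 0 < N%:R :> R by rewrite ltr0n.
pose x (j : nat) : R := j%:R / N%:R * h.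
have -> : f h - f 0 = \sum_(j < N) (f (x j.+1) - f (x j)).
  rewrite -(big_mkord xpredT (fun j => f (x j.+1) - f (x j))) telescope_sumr//.
  by rewrite /x mul0r mul0r divff ?gt_eqF// mul1r.
rewrite scaler_sumr -sumrB (le_trans (ler_norm_sum _ _ _))//.
apply: (@le_trans _ _ (\sum_(j < N) (C * `|h / N%:R| ^+ 2))); last first.
  rewrite sumr_const card_ord -[leLHS]mulr_natl normrM normfV [`|N%:R|]gtr0_norm//.
  by rewrite le_eqVlt; apply/orP; left; apply/eqP; field; rewrite gt_eqF.
apply: ler_sum => j _.
have -> : x j.+1 = x j + h / N%:R by rewrite /x -natr1; field; rewrite gt_eqF.
apply: (@taylor1 R W f (x j) (`|h / N%:R| + 1)) => //; last by rewrite ltrDl.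
move=> t tx; apply: CP; rewrite -ler_norml.
have : `|x j| + `|h / N%:R| <= `|h|.
  rewrite /x !normrM normfV [`|j%:R|]ger0_norm// [`|N%:R|]gtr0_norm//.
  rewrite mulrC -mulrDr -[leRHS]mulr1 ler_wpM2l//.
  by rewrite -[X in _ + X]mul1r -mulrDl ler_pdivrMr// mul1r natr1 ler_nat.
have := ler_normD (t - x j) (x j); rewrite subrK.
by move: tx; lra.
Qed.

Lemma derive1n_sum (I : Type) (r : seq I) (f : I -> R -> W) n :
  (forall i, sm (f i)) ->
  derive1n n (fun t => \sum_(i <- r) f i t) = fun t => \sum_(i <- r) derive1n n (f i) t.
Proof.
move=> sf; elim: r => [|i r ih].
  have -> : (fun t => \sum_(i <- [::]) f i t) = (fun t : R => 0 *: (0 : W)).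
    by apply/funext => t; rewrite big_nil scale0r.
  rewrite derive1nZ; last exact/smo_cst/openT.
  by apply/funext => t; rewrite big_nil scale0r.
have -> : (fun t => \sum_(j <- i :: r) f j t) = (fun t => f i t + \sum_(j <- r) f j t).
  by apply/funext => t; rewrite big_cons.
rewrite derive1nD//; last by apply: smo_sum => //; exact: openT.
by apply/funext => t; rewrite big_cons ih.
Qed.

(** Riemann sums of the integral representation are smooth along curves, with derivatives bounded
    uniformly by compactness of [0, 1]. They converge pointwise by [riemann_sum], so the limit is
    smooth and no vector-valued integral is needed. *)
Lemma cs2_hadamard g : cs2 g -> cs2 (hadamard g).
Proof.
move=> sg a b sa sb.
pose w t r := d2 g (a t) (r * b t).
have sw : cs2 w.
  move=> u v su sv; apply: (cs2_d2 Wc sg (a := fun t => a (u t)) (b := fun t => v t * b (u t))).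
    exact: sm_comp.
  by apply: smoM => //; [exact: openT|exact: sm_comp].
pose F N t := N.+1%:R^-1 *: \sum_(j < N.+1) w t (j%:R / N.+1%:R).
have sF N : sm (F N).
  apply: smoZ; first exact: openT.
  by apply: smo_sum => [|j]; [exact: openT|exact: cs2_l].
apply: (limit_smooth Wc sF) => [t e e0|p t0].
  have [C CP] := riemann_sum (b t) (cs2_r (a t) sg).
  rewrite /hadamard; case: eqVneq => [bt0|bt0].
    exists 0%N => n _; rewrite /F /w bt0.
    under eq_bigr do rewrite mulr0.
    rewrite big_const_ord iter_addr addr0 -[X in _ *: X]scaler_nat scalerA.
    by rewrite mulVf ?pnatr_eq0// scale1r subrr normr0 ltW.
  have bt1 : 0 < `|b t| by rewrite normr_gt0.
  have [N NP] := nat_gt (`|C| / `|b t| / e); exists N => n Nn.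
  have n0 : 0 < n.+1%:R :> R by [].
  have {CP} := CP n.+1 isT; set S := \sum_(j < _) _.
  rewrite -/(F _ _) => H.
  have -> : F n t - (b t)^-1 *: (g (a t) (b t) - g (a t) 0) =
    - (b t)^-1 *: (g (a t) (b t) - g (a t) 0 - (b t / n.+1%:R) *: S).
    rewrite scaleNr [in RHS]scalerBr opprB scalerA mulrA mulVf// mul1r; congr (_ - _).
  rewrite normrZ normrN normfV mulrC ler_pdivrMr// (le_trans H)//.
  rewrite ler_pdivrMr// (le_trans (ler_norm C))//.
  move: NP; rewrite ltr_pdivrMr// ltr_pdivrMr// => /ltW/le_trans; apply.
  rewrite -mulrA mulrC ler_wpM2l ?mulr_ge0 ?(ltW e0)// ler_nat.
  exact: leq_trans Nn _.
have [d [C [d0 dC]]] := cs2_bounded_strip t0 0 1 (cs2_derive1n p sw).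
exists d, C, 0%N; split=> // n t _ td.
have n0 : 0 < n.+1%:R :> R by [].
have -> : derive1n p (F n) t = n.+1%:R^-1 *: \sum_(j < n.+1) derive1n p (w^~ (j%:R / n.+1%:R)) t.
  rewrite derive1nZ; last by apply: smo_sum => [|j]; [exact: openT|exact: cs2_l].
  by rewrite (derive1n_sum _ _ (fun j : 'I_n.+1 => cs2_l (j%:R / n.+1%:R) sw)).
rewrite normrZ gtr0_norm ?invr_gt0// mulrC ler_pdivrMr//.
rewrite (le_trans (ler_norm_sum _ _ _))//.
apply: (@le_trans _ _ (\sum_(j < n.+1) C)).
  apply: ler_sum => j _; apply: dC => //.
  by rewrite divr_ge0//= ler_pdivrMr// mul1r ler_nat ltnW.
by rewrite sumr_const card_ord -[leLHS]mulr_natr.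
Qed.

Lemma derive1_shift (f : R -> W) c x : sm f -> derive1 (fun y => f (c + y)) x = derive1 f (c + x).
Proof.
move=> sf; have -> : (fun y => f (c + y)) = (fun y => f (1 * y + c)).
  by apply/funext => y; rewrite mul1r addrC.
have := derive1n_affine 1 1 c sf; rewrite derive1n1 => ->.
by rewrite expr1n scale1r mul1r derive1n1 addrC.
Qed.

Lemma cs2_shift g x y : cs2 g -> cs2 (fun s r => g (x + s) (y + r)).
Proof.
by move=> sg a b sa sb; apply: sg; apply: smoD => //; do ?[exact: openT]; exact/smo_cst/openT.
Qed.

Lemma isd_scale0 (f : R -> W) : sm f -> isd (fun s => s *: f s) 0 (f 0).
Proof.
move=> sf; have := isd_scale (is_derive_id (0 : R) 1) (smo_isd sf (t := 0) I).
by rewrite scale0r add0r scale1r.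
Qed.

(** After translation, g(s, s) = g(s, 0) + s h(s, s) with h smooth along curves; the product rule at
    s = 0 gives both partial derivatives without any total derivative. *)
Lemma cs2_diag g t : cs2 g -> isd (fun s => g s s) t (d1 g t t + d2 g t t).
Proof.
move=> sg; have sG := cs2_shift t t sg.
pose G s r := g (t + s) (t + r).
have sH := cs2_hadamard sG.
have E1 : (fun s => G s s) = (fun s => G s 0 + s *: hadamard G s s).
  by apply/funext => s; exact: hadamardE.
have D1 : isd (fun s => G s 0) 0 (d1 g t t).
  have -> : (fun s => G s 0) = (fun s => g (t + s) t).
    by apply/funext => s; rewrite /G addr0.
  have sgt : sm (fun s => g (t + s) t).
    by apply: sg; [apply: smoD; [exact: openT|exact/smo_cst/openT|exact/smo_id/openT]|exact/smo_cst/openT].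
  have := smo_isd sgt (t := 0) I.
  by rewrite (derive1_shift t 0 (cs2_l t sg)) addr0.
have D2 : isd (fun s => s *: hadamard G s s) 0 (d2 g t t).
  have := isd_scale0 (sH _ _ (smo_id openT) (smo_id openT)).
  have -> // : hadamard G 0 0 = d2 g t t.
  rewrite /hadamard eqxx /d2 /G addr0.
  by rewrite (derive1_shift t 0 (cs2_r t sg)) addr0.
have D : isd (fun s => G s s) 0 (d1 g t t + d2 g t t).
  by rewrite E1; exact: isdD.
have -> : (fun s => g s s) = (fun s => G s s) \o (fun s => 1 * s + - t).
  by apply/funext => s; rewrite /G/= mul1r addrC subrK.
have := @isd_comp _ _ _ _ _ _ _ (isd_affine 1 (- t) t) _.
by rewrite mul1r subrr => /(_ _ _ _ D); rewrite scale1r.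
Qed.

Lemma cs2_chain g (a b : R -> R) t : cs2 g -> sm a -> sm b ->
  isd (fun t => g (a t) (b t)) t
    (derive1 a t *: d1 g (a t) (b t) + derive1 b t *: d2 g (a t) (b t)).
Proof.
move=> sg sa sb.
have sG : cs2 (fun s r => g (a s) (b r)).
  by move=> c e sc se; apply: sg; apply: sm_comp.
have := cs2_diag t sG; congr isd; congr (_ + _).
  apply: isd_eq; exact: (isd_comp (smo_isd sa (t := t) I) (smo_isd (cs2_l (b t) sg) (t := a t) I)).
apply: isd_eq; exact: (isd_comp (smo_isd sb (t := t) I) (smo_isd (cs2_r (a t) sg) (t := b t) I)).
Qed.

(** With G(s, r) = G(s, 0) + r h(s, r), differentiating in s and then in r at 0 leaves the
    s-derivative of h(s, 0), and h(s, 0) is the r-derivative of G at r = 0. *)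
Lemma cs2_schwarz g x y : cs2 g -> d1 (d2 g) x y = d2 (d1 g) x y.
Proof.
move=> sg.
pose G s r := g (x + r) s.
have sG : cs2 G.
  by move=> a b sa sb; apply: sg => //; apply: smoD => //; [exact: openT|exact/smo_cst/openT].
have sH := cs2_hadamard sG.
have dG r : d1 G y r = d1 G y 0 + r *: d1 (hadamard G) y r.
  rewrite {1}/d1; apply: isd_eq.
  have -> : G^~ r = (fun s => G s 0 + r *: hadamard G s r).
    by apply/funext => s; exact: hadamardE.
  apply: isdD; first exact: (smo_isd (cs2_l 0 sG) (t := y) I).
  exact: (isdZ r (smo_isd (cs2_l r sH) (t := y) I)).
have E1 : (fun r => d2 g (x + r) y) = (fun r => d1 G y 0 + r *: d1 (hadamard G) y r).
  by apply/funext => r; rewrite -dG.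
have sd2 := cs2_d2 Wc sg.
have -> : d1 (d2 g) x y = derive1 (fun r => d2 g (x + r) y) 0.
  by rewrite (derive1_shift x 0 (cs2_l y sd2)) addr0.
rewrite E1; apply: isd_eq; rewrite -[d2 _ _ _]add0r.
apply: isdD; first exact: isd_cst.
have := isd_scale0 (cs2_r y (cs2_d1 sH)).
congr isd; rewrite /d1 /d2; congr (derive1 _ _); apply/funext => s.
rewrite /hadamard eqxx /d2 /G.
by have := derive1_shift x 0 (cs2_l s sg); rewrite addr0.
Qed.

(** A smooth truncation, equal to the identity near 0 and with values in (-r, r). Composition with
    it extends a function from a ball to the whole space without changing its germ at the centre. *)
Definition clamp (r u : R) : R := u * bumpf (u / r).

Lemma sm_clamp r : sm (clamp r).
Proof.
apply: smoM; [exact: openT|exact/smo_id/openT|].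
apply: sm_ext (sm_comp (sm_affine r^-1 0) (@sm_bump R)) => u.
by rewrite addr0 mulrC.
Qed.

Lemma clamp_id r u : 0 < r -> `|u| <= r / 6 -> clamp r u = u.
Proof.
move=> r0 ur; rewrite /clamp bump1 ?mulr1//.
by rewrite normrM normfV [`|r|]gtr0_norm// ler_pdivrMr// mulrC.
Qed.

Lemma clamp_lt r u : 0 < r -> `|clamp r u| < r.
Proof.
move=> r0; rewrite /clamp; have [ur|ur] := leP (`|u / r|) 3^-1; last first.
  by rewrite bump0// mulr0 normr0.
have /andP[b0 b1] := bump01 (u / r).
rewrite normrM (ger0_norm b0); apply: (@le_lt_trans _ _ `|u|); first by rewrite ler_piMr.
move: ur; rewrite normrM normfV [`|r|]gtr0_norm// ler_pdivrMr//.
by move: r0; lra.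
Qed.

Definition cs2_on (A : R -> R -> Prop) g := forall a b : R -> R, sm a -> sm b ->
  (forall t, A (a t) (b t)) -> sm (fun t => g (a t) (b t)).

Definition open2 (A : R -> R -> Prop) := forall x y, A x y -> exists2 r : R, 0 < r &
  forall x' y', `|x' - x| < r -> `|y' - y| < r -> A x' y'.

Lemma cs2_on_loc A g x y : open2 A -> cs2_on A g -> A x y -> exists G, cs2 G /\
  exists2 r : R, 0 < r & forall x' y', `|x' - x| < r -> `|y' - y| < r ->
    A x' y' /\ G x' y' = g x' y'.
Proof.
move=> oA sg /oA[r r0 rA].
pose cl z u := z + clamp r (u - z).
have scl z : sm (cl z).
  apply: smoD; [exact: openT|exact/smo_cst/openT|].
  by apply: sm_ext (sm_comp (sm_affine 1 (- z)) (sm_clamp r)) => u; rewrite mul1r.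
have clr z u : `|cl z u - z| < r by rewrite /cl addrAC subrr add0r clamp_lt.
exists (fun x' y' => g (cl x x') (cl y y')); split.
  by move=> a b sa sb; apply: sg => [||t]; [exact: sm_comp|exact: sm_comp|exact: rA].
exists (r / 6) => [|x' y' xr yr]; first by rewrite divr_gt0.
have r6 : r / 6 <= r by move: r0; lra.
split; first by apply: rA; apply: lt_le_trans r6.
by rewrite /cl !clamp_id ?(ltW xr) ?(ltW yr)// ![_ + (_ - _)]addrC !subrK.
Qed.

Lemma sm_near (a : R -> R) t (d : R) : sm a -> 0 < d -> \forall s \near t, `|a s - a t| < d.
Proof.
move=> sa d0; have := smo_derivable_continuous sa (t := t) I.
move=> /cvgrPdist_lt/(_ d d0); apply: filterS => s.
by rewrite distrC.
Qed.

Lemma sm_of_near (f : R -> W) :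
  (forall t : R, exists2 h, sm h & \forall s \near t, h s = f s) -> sm f.
Proof.
move=> H; apply: sm_local; first exact: openT.
move=> t _; have [h sh hf] := H t.
have /nbhs_ballP[d /= d0 dP] := hf.
exists (ball t d); first by split; [exact: ball_open|exact: ballxx].
apply: (@smo_eq _ _ _ h); [exact: ball_open|by move=> s; exact: dP|].
exact: smo_sub (@subsetT _ _) sh.
Qed.

Lemma cs2_on_sm A g a b t : open2 A -> cs2_on A g -> sm a -> sm b -> A (a t) (b t) ->
  exists G, [/\ cs2 G, \forall s \near t, A (a s) (b s) /\ G (a s) (b s) = g (a s) (b s),
    \forall s \near t, d1 G (a s) (b s) = d1 g (a s) (b s) &
    \forall s \near t, d2 G (a s) (b s) = d2 g (a s) (b s)].
Proof.
move=> oA sg sa sb At; have [G [sG [r r0 rP]]] := cs2_on_loc oA sg At.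
have na := sm_near t sa r0; have nb := sm_near t sb r0.
exists G; split=> //.
- by near=> s; apply: rP; near: s.
- near=> s; apply: near_derive1_eq.
  have bs : `|b s - b t| < r by near: s.
  have : `|a s - a t| < r by near: s.
  rewrite -subr_gt0 => /(nbhs_norm_lt (a s)); apply: filterS => z zs.
  by apply: (rP z (b s) _ bs).2; have := ler_normD (z - a s) (a s - a t); rewrite addrA subrK; move: zs; lra.
- near=> s; apply: near_derive1_eq.
  have bs : `|a s - a t| < r by near: s.
  have : `|b s - b t| < r by near: s.
  rewrite -subr_gt0 => /(nbhs_norm_lt (b s)); apply: filterS => z zs.
  by apply: (rP (a s) z bs _).2; have := ler_normD (z - b s) (b s - b t); rewrite addrA subrK; move: zs; lra.
Unshelve. all: by end_near. Qed.

Lemma cs2_on_d2 A g : open2 A -> cs2_on A g -> cs2_on A (d2 g).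
Proof.
move=> oA sg a b sa sb At; apply: sm_of_near => t.
have [G [sG _ _ dG]] := cs2_on_sm oA sg sa sb (At t).
by exists (fun s => d2 G (a s) (b s)) => //; exact: cs2_d2.
Qed.

Lemma cs2_on_chain A g (a b : R -> R) t : open2 A -> cs2_on A g -> sm a -> sm b ->
  A (a t) (b t) -> isd (fun t => g (a t) (b t)) t
    (derive1 a t *: d1 g (a t) (b t) + derive1 b t *: d2 g (a t) (b t)).
Proof.
move=> oA sg sa sb At; have [G [sG gG dG1 dG2]] := cs2_on_sm oA sg sa sb At.
rewrite -(nbhs_singleton dG1) -(nbhs_singleton dG2).
apply: isd_near (cs2_chain t sG sa sb).
by apply: filterS gG => s [].
Qed.

Lemma cs2_on_schwarz A g x y : open2 A -> cs2_on A g -> A x y ->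
  d1 (d2 g) x y = d2 (d1 g) x y.
Proof.
move=> oA sg Axy; have [G [sG [r r0 rP]]] := cs2_on_loc oA sg Axy.
have gG x' y' : `|x' - x| < r -> `|y' - y| < r -> \forall z \near x', G z y' = g z y'.
  move=> xr yr; have := xr; rewrite -subr_gt0 => /(nbhs_norm_lt x'); apply: filterS => z zs.
  by apply: (rP z y' _ yr).2; have := ler_normD (z - x') (x' - x); rewrite addrA subrK; move: zs; lra.
have gG2 x' y' : `|x' - x| < r -> `|y' - y| < r -> \forall z \near y', G x' z = g x' z.
  move=> xr yr; have := yr; rewrite -subr_gt0 => /(nbhs_norm_lt y'); apply: filterS => z zs.
  by apply: (rP x' z xr _).2; have := ler_normD (z - y') (y' - y); rewrite addrA subrK; move: zs; lra.
have := cs2_schwarz x y sG.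
have y0 : `|y - y| < r by rewrite subrr normr0.
have x0 : `|x - x| < r by rewrite subrr normr0.
have -> : d1 (d2 G) x y = d1 (d2 g) x y.
  apply: near_derive1_eq; have := nbhs_norm_lt x r0; apply: filterS => z zx.
  by apply: near_derive1_eq; exact: gG2.
have -> // : d2 (d1 G) x y = d2 (d1 g) x y.
apply: near_derive1_eq; have := nbhs_norm_lt y r0; apply: filterS => z zx.
by apply: near_derive1_eq; exact: gG.
Qed.

End plane_calculus.

(** * Smooth functions of several variables *)

Section several_variables.
Variables (R : realType) (n : nat).
Local Notation V := 'rV[R]_n.
Implicit Types W : normedModType R.

Lemma coord_le (x : V) i : `|x 0 i| <= `|x|.
Proof.
rewrite -[`|x|]/(mx_norm x) mx_normrE.
exact: (le_bigmax _ (fun ij : 'I_1 * 'I_n => `|x ij.1 ij.2|) (0, i)).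
Qed.

Lemma norm_lt (x : V) (r : R) : 0 < r -> (forall i, `|x 0 i| < r) -> `|x| < r.
Proof.
move=> r0 H; rewrite -[`|x|]/(mx_norm x) mx_normrE.
by apply: bigmax_lt => // -[j i] _; rewrite (ord1 j).
Qed.

Lemma norm_le (x : V) (r : R) : 0 <= r -> (forall i, `|x 0 i| <= r) -> `|x| <= r.
Proof.
move=> r0 H; rewrite -[`|x|]/(mx_norm x) mx_normrE.
by apply: bigmax_le => // -[j i] _; rewrite (ord1 j).
Qed.

Lemma isd_bounded_linear W W' (L : W -> W') (C : R) (c : R -> W) t l :
  (forall u v, L (u - v) = L u - L v) -> (forall a u, L (a *: u) = a *: L u) ->
  (forall u, `|L u| <= C * `|u|) -> isd c t l -> isd (fun s => L (c s)) t (L l).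
Proof.
move=> LB LZ LC /isd_eps cl; apply/isd_eps => e e0.
have C0 : 0 < `|C| + 1 by rewrite ltr_wpDl.
have [d d0 dP] := cl (e / (`|C| + 1)) (divr_gt0 e0 C0).
exists d => // h /dP H; rewrite -LB -LZ -LB (le_trans (LC _))//.
apply: (@le_trans _ _ ((`|C| + 1) * `|c (t + h) - c t - h *: l|)).
  by rewrite ler_wpM2r// (le_trans (ler_norm C))// lerDl.
by rewrite mulrC -ler_pdivlMr// mulrAC.
Qed.

Lemma sm_bounded_linear W W' (L : W -> W') (C : R) (c : R -> W) :
  (forall u v, L (u - v) = L u - L v) -> (forall a u, L (a *: u) = a *: L u) ->
  (forall u, `|L u| <= C * `|u|) -> sm c -> sm (fun s => L (c s)).
Proof.
move=> LB LZ LC sc k; elim: k c sc => // k ih c sc.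
apply: (@smkS _ _ _ _ _ openT (fun s => L (derive1 c s))) => [t _|].
  by apply: (isd_bounded_linear LB LZ LC); exact: (smo_isd sc).
by apply: ih; exact: smo_derive1.
Qed.

Lemma sm_coord (c : R -> V) i : sm c -> sm (fun t => c t 0 i).
Proof.
apply: (@sm_bounded_linear _ _ (fun u : V => u 0 i) 1) => [u v|a u|u].
- by rewrite !mxE.
- by rewrite !mxE.
- by rewrite mul1r coord_le.
Qed.

Lemma sm_row (c : 'I_n -> R -> R) : (forall i, sm (c i)) -> sm (fun t => \row_i c i t : V).
Proof.
move=> sc.
apply: (@sm_ext _ _ (fun t => \sum_i c i t *: (delta_mx 0 i : V))) => [t|].
  rewrite [RHS]row_sum_delta; apply: eq_bigr => i _; by rewrite mxE.
apply: smo_sum => [|i]; first exact: openT.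
by apply: smo_scale (sc i) _; [exact: openT|exact: (smo_cst _ openT)].
Qed.

Lemma sm_rowP (c : R -> V) : (forall i, sm (fun t => c t 0 i)) -> sm c.
Proof.
move=> /sm_row; apply: sm_ext => t; apply/rowP => i; by rewrite mxE.
Qed.

Lemma eq_derive1 W (f g : R -> W) x : f =1 g -> derive1 f x = derive1 g x.
Proof. by move=> /funext ->. Qed.

Lemma derive1_line W (f : V -> W) x v s :
  derive1 (fun r => f (x + r *: v)) s = 'D_v f (x + s *: v).
Proof.
rewrite /derive1 /derive; apply: (congr1 (fun g : R -> W => lim (g @ 0^'))).
apply/funext => h /=.
by rewrite scalerDl addrCA.
Qed.

Lemma derive1_line0 W (f : V -> W) x v : derive1 (fun r => f (x + r *: v)) 0 = 'D_v f x.
Proof. by rewrite derive1_line scale0r addr0. Qed.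

(** Smoothness in the sense of convenient calculus. For open [A] and complete [W] it agrees with
    [smooth_on], by [csV_smooth_on] and [smooth_on_csV]. *)
Definition csV W (A : set V) (f : V -> W) :=
  forall c : R -> V, sm c -> (forall t, A (c t)) -> sm (fun t => f (c t)).

Lemma sm_line (x v : V) : sm (fun t : R => x + t *: v).
Proof.
apply: smoD; [exact: openT|exact/smo_cst/openT|].
by apply: smo_scale; [exact: openT|exact/smo_id/openT|exact/smo_cst/openT].
Qed.

Section open_domain.
Variables (W : normedModType R).
Hypothesis Wc : seq_complete W.
Variables (A : set V).
Hypothesis oA : open A.

Lemma sm_near_open (c : R -> V) t (B : set V) : open B -> sm c -> B (c t) -> \forall s \near t, B (c s).
Proof.
move=> oB sc Bt; have := smo_derivable_continuous sc (t := t) I.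
by apply; exact: open_nbhs_nbhs.
Qed.

Lemma csV_line (f : V -> W) (c : R -> V) (v : R -> V) : csV A f -> sm c -> sm v ->
  open2 (fun t s => A (c t + s *: v t)) /\
  cs2_on (fun t s => A (c t + s *: v t)) (fun t s => f (c t + s *: v t)).
Proof.
move=> sf sc sv; split; last first.
  move=> a b sa sb Aab; apply: (sf (fun t => c (a t) + b t *: v (a t))) => //.
  apply: smoD; [exact: openT|exact: sm_comp|].
  by apply: smo_scale; [exact: openT| |exact: sm_comp].
move=> t s Ats.
have cc : {for t, continuous c} by exact: (smo_derivable_continuous sc).
have cv : {for t, continuous v} by exact: (smo_derivable_continuous sv).
have : \forall p \near (t, s), A (c p.1 + p.2 *: v p.1).
  have H : (fun p : R * R => c p.1 + p.2 *: v p.1) @ (t, s) --> c t + s *: v t.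
    apply: cvgD.
      by apply: (@cvg_comp _ _ _ fst c _ (nbhs t)) => //; exact: (@cvg_fst _ _ (nbhs t) (nbhs s)).
    apply: cvgZ; first exact: (@cvg_snd _ _ (nbhs t) (nbhs s)).
    by apply: (@cvg_comp _ _ _ fst v _ (nbhs t)) => //; exact: (@cvg_fst _ _ (nbhs t) (nbhs s)).
  by apply: (H A); exact: open_nbhs_nbhs.
move=> /nbhs_ballP[d /= d0 dP]; exists d => // x' y' xd yd.
by apply: (dP (x', y')); split; rewrite /ball/= distrC.
Qed.

Lemma csV_derive (f : V -> W) (v : V) : csV A f -> csV A ('D_v f).
Proof.
move=> sf c sc Ac.
have sv : sm (fun=> v : V) by exact/smo_cst/openT.
have [ho hs] := csV_line sf sc sv.
have := cs2_on_d2 Wc ho hs (smo_id openT) (smo_cst 0 openT).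
have A0 t : A (c t + 0 *: v) by rewrite scale0r addr0.
move=> /(_ A0); apply: sm_ext => t.
by rewrite /d2 derive1_line0.
Qed.

Lemma csV_isd_line (f : V -> W) x v : csV A f -> A x ->
  isd (fun s => f (x + s *: v)) 0 ('D_v f x).
Proof.
move=> sf Ax.
have sx : sm (fun=> x : V) by exact/smo_cst/openT.
have sv : sm (fun=> v : V) by exact/smo_cst/openT.
have [ho hs] := csV_line sf sx sv.
have A0 : A (x + (fun t : R => t) 0 *: v) by rewrite scale0r addr0.
have := cs2_on_chain Wc (t := 0) ho hs (smo_cst 0 openT) (smo_id openT) A0.
rewrite derive1_cst scale0r add0r derive1_id scale1r /d2 derive1_line0.
by [].
Qed.

Lemma csV_derivable (f : V -> W) x v : csV A f -> A x -> derivable f x v.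
Proof.
move=> sf Ax; have [+ _] := csV_isd_line v sf Ax.
have E : (fun h : R => h^-1 *: (((fun s : R => f (x + s *: v)) \o shift 0) (h *: 1) - f (x + 0 *: v)))
  = (fun h : R => h^-1 *: ((f \o shift x) (h *: v) - f x)).
  by apply/funext => h /=; rewrite [_ *: 1]mulr1 addr0 scale0r addr0 [x + _]addrC.
by rewrite /derivable E.
Qed.

Lemma csV_derive_lin (f : V -> W) x (a b : R) u v : csV A f -> A x ->
  'D_(a *: u + b *: v) f x = a *: 'D_u f x + b *: 'D_v f x.
Proof.
move=> sf Ax.
have [ho hs] : open2 (fun t s => A (x + t *: u + s *: v)) /\
    cs2_on (fun t s => A (x + t *: u + s *: v)) (fun t s => f (x + t *: u + s *: v)).
  by apply: csV_line sf (sm_line x u) _; exact/smo_cst/openT.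
have A0 : A (x + (a * 0 + 0) *: u + (b * 0 + 0) *: v).
  by rewrite !mulr0 !addr0 !scale0r !addr0.
have := cs2_on_chain Wc (t := 0) ho hs (sm_affine a 0) (sm_affine b 0) A0.
rewrite !(isd_eq (isd_affine _ _ _)) !mulr0 !addr0 /d1 /d2.
have -> : (fun t : R => f (x + (a * t + 0) *: u + (b * t + 0) *: v)) =
          (fun t : R => f (x + t *: (a *: u + b *: v))).
  apply/funext => t; rewrite !addr0 scalerDr !scalerA addrA.
  by rewrite [t * a]mulrC [t * b]mulrC.
move=> /isd_eq; rewrite derive1_line0 => ->.
rewrite -(derive1_line0 f x u) -(derive1_line0 f x v).
have -> : (fun r : R => f (x + r *: u + 0 *: v)) = (fun r : R => f (x + r *: u)).
  by apply/funext => s; rewrite scale0r addr0.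
have -> // : (fun r : R => f (x + 0 *: u + r *: v)) = (fun r : R => f (x + r *: v)).
by apply/funext => s; rewrite scale0r addr0.
Qed.

Lemma csV_schwarz (f : V -> W) x u v : csV A f -> A x ->
  'D_u ('D_v f) x = 'D_v ('D_u f) x.
Proof.
move=> sf Ax.
have [ho hs] : open2 (fun t s => A (x + t *: u + s *: v)) /\
    cs2_on (fun t s => A (x + t *: u + s *: v)) (fun t s => f (x + t *: u + s *: v)).
  by apply: csV_line sf (sm_line x u) _; exact/smo_cst/openT.
have A0 : A (x + 0 *: u + 0 *: v) by rewrite !scale0r !addr0.
have := cs2_on_schwarz Wc ho hs A0.
rewrite /d1 /d2.
have -> : (fun x0 : R => derive1 (fun s : R => f (x + x0 *: u + s *: v)) 0) = (fun t : R => 'D_v f (x + t *: u)).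
  by apply/funext => t; rewrite derive1_line0.
rewrite (derive1_line0 ('D_v f) x u) => ->; rewrite -(derive1_line0 ('D_u f) x v).
apply: eq_derive1 => s; rewrite -(derive1_line0 f (x + s *: v) u).
by apply: eq_derive1 => t; rewrite addrAC.
Qed.

Lemma csV_loc (f : V -> W) x : csV A f -> A x -> exists F : V -> W,
  csV setT F /\ \forall y \near x, A y /\ F y = f y.
Proof.
move=> sf Ax; have /nbhs_ballP[r /= r0 rA] : nbhs x A by exact: open_nbhs_nbhs.
pose cl (y : V) : V := \row_i (x 0 i + clamp r (y 0 i - x 0 i)).
exists (fun y => f (cl y)); split.
  move=> c sc _; apply: (sf (fun t => cl (c t))).
    apply: sm_row => i; apply: smoD; [exact: openT|exact/smo_cst/openT|].
    have := sm_comp (sm_affine 1 (- x 0 i)) (sm_clamp r) => H.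
    apply: sm_ext (sm_comp (sm_coord i sc) H) => t /=.
    by rewrite mul1r.
  move=> t; apply: rA; rewrite -ball_normE /=; apply: norm_lt => // i; rewrite !mxE.
  by rewrite opprD addrA subrr add0r normrN clamp_lt.
have r60 : 0 < r / 6 by rewrite divr_gt0.
apply/nbhs_ballP; exists (r / 6) => //= y; rewrite -ball_normE /= => xy; split.
  apply: rA; rewrite -ball_normE /= (lt_le_trans xy)//.
  by move: r0; lra.
congr f; apply/rowP => i; rewrite !mxE clamp_id//; first by rewrite addrC subrK.
rewrite distrC; have := coord_le (x - y) i; rewrite !mxE => H.
by rewrite (le_trans H)// ltW.
Qed.

(** The uniformity over directions that Frechet differentiability needs: [cvs_local_bound] bounds
    the second derivatives at once for all base points near [x] and all directions of norm at most
    1. *)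
Lemma csV_near_quad (f : V -> W) x : csV A f -> A x -> exists d C : R, [/\ 0 < d, 0 <= C &
  forall h, `|h| < d -> `|f (x + h) - f x - 'D_h f x| <= C * `|h| ^+ 2].
Proof.
move=> sf Ax; have [F [sF nF]] := csV_loc sf Ax.
have sFc : cvs (fun c : 'I_n -> R => F (\row_i c i)).
  by move=> c sc; apply: sF => //; exact: sm_row.
have [d [C [d0 dC]]] := cvs_local_bound (fun i => x 0 i) 2 1 sFc.
have /nbhs_ballP[r /= r0 rP] := nF.
exists (Num.min d r / 2), `|C|; split=> // [|h hd].
  by rewrite divr_gt0// lt_min d0.
have [dr1 dr2] : `|h| < d / 2 /\ `|h| < r / 2.
  have : Num.min d r <= d /\ Num.min d r <= r by rewrite !ge_min !lexx orbT.
  by move: hd; split; lra.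
have [->|h0] := eqVneq h 0.
  by rewrite addr0 subrr derive0 subr0 !(normr0, mulr0, expr0n).
have hn : 0 < `|h| by rewrite normr_gt0.
pose v := `|h|^-1 *: h.
have v1 : `|v| = 1 by rewrite normrZ normfV normr_id mulVf// gt_eqF.
have hE : h = `|h| *: v by rewrite scalerA divff ?scale1r// gt_eqF.
pose phi t := F (x + t *: v).
have sphi : sm phi by apply: sF => //; exact: sm_line.
have Fx y : `|y| < r -> F (x + y) = f (x + y).
  by move=> yr; apply: (rP (x + y) _).2; rewrite -ball_normE /= opprD addrA subrr add0r normrN.
have Fx0 : F x = f x by have := Fx 0; rewrite normr0 addr0; apply.
have := @taylor1 R W phi 0 (d / 2 + `|h| / 2) `|C| sphi _ `|h|.
rewrite normr_id add0r /phi -hE scale0r addr0 Fx; last first.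
  by move: dr2 r0; lra.
rewrite Fx0 derive1_line0.
have -> : 'D_v F x = 'D_v f x by apply: near_eq_derive; apply: filterS nF => y [].
have -> : `|h| *: 'D_v f x = 'D_h f x.
  by have := csV_derive_lin `|h| 0 v 0 sf Ax; rewrite !scale0r !addr0 -hE => ->.
apply; last by move: dr1 hn; lra.
move=> t; rewrite subr0 => td.
pose psi u := F (\row_i ((x + t *: v) 0 i + u * v 0 i)).
have spsi : sm psi.
  have := sF (fun u => (x + t *: v) + u *: v) (sm_line _ _) (fun=> I).
  apply: sm_ext => u; congr F; apply/rowP => i; by rewrite !mxE.
have E : phi = (fun s => psi (1 * s + - t)).
  apply/funext => s; rewrite /phi /psi mul1r; congr F; apply/rowP => i; rewrite !mxE.
  by ring.
change (`|derive1n 2 phi t| <= `|C|).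
rewrite E derive1n_affine// expr1n scale1r mul1r subrr; apply: (le_trans _ (ler_norm C)).
apply: dC => i; last by rewrite -v1 coord_le.
rewrite !mxE addrAC subrr add0r normrM.
have := coord_le v i; rewrite v1 mxE => H.
apply: (@le_lt_trans _ _ `|t|); first by rewrite ler_piMr.
by move: td dr1; lra.
Qed.

Lemma csV_differentiable (f : V -> W) x : csV A f -> A x -> differentiable f x.
Proof.
move=> sf Ax.
pose L (h : V) := 'D_h f x.
have Llin : linear L.
  by move=> a u v; rewrite /L -[v in LHS]scale1r csV_derive_lin// scale1r.
pose l : {linear V -> W} := HB.pack L (GRing.isLinear.Build R V W *:%R L Llin).
have lE h : l h = \sum_i h 0 i *: 'D_(delta_mx 0 i) f x.
  rewrite [in LHS](row_sum_delta h) linear_sum; apply: eq_bigr => i _.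
  by rewrite linearZ.
have cl : continuous l.
  have -> : (l : V -> W) = \sum_i (fun h : V => h 0 i *: 'D_(delta_mx 0 i) f x).
    by apply/funext => h; rewrite lE fct_sumE.
  elim/big_ind : _ => [|g1 g2 c1 c2 h|i _ h]; first exact: cst_continuous.
    by apply: continuousD; [exact: c1|exact: c2].
  by apply: (@cvgZr_tmp R W V (nbhs h) _ (fun k : V => k 0 i)); exact: coord_continuous.
have [d [C [d0 C0 dC]]] := csV_near_quad sf Ax.
have H : f \o shift x = cst (f x) + (l : V -> W) +o_ (0 : V) (id : V -> V).
  apply/eqaddoP => e e0.
  have C1 : 0 < C + 1 by rewrite ltr_wpDl.
  have m0 : 0 < Num.min d (e / (C + 1)) by rewrite lt_min d0 divr_gt0.
  apply/nbhs_ballP; exists (Num.min d (e / (C + 1))) => //= h.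
  rewrite -ball_normE /= sub0r normrN lt_min => /andP[hd he].
  have := dC h hd; rewrite !fctE /= [h + x]addrC opprD addrA => H; apply: (le_trans H).
  rewrite expr2 mulrA ler_wpM2r//.
  apply: (@le_trans _ _ ((C + 1) * `|h|)); first by rewrite ler_wpM2r// lerDl.
  by rewrite mulrC -ler_pdivlMr// ltW.
apply/diff_locallyP.
by have -> : 'd f x = l :> (V -> W) by exact: diff_unique.
Qed.

Lemma csV_pderivs (f : V -> W) s : csV A f -> csV A (pderivs s f).
Proof. by move=> sf; elim: s => // i s ih; exact: csV_derive. Qed.

Lemma csV_smooth_on (f : V -> W) : csV A f -> smooth_on A f.
Proof. by move=> sf s x Ax; apply: csV_differentiable => //; exact: csV_pderivs. Qed.

End open_domain.

Lemma differentiable_isd W (f : V -> W) (c : R -> V) t dc : isd c t dc ->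
  differentiable f (c t) -> isd (fun s => f (c s)) t (\sum_i dc 0 i *: pderiv i f (c t)).
Proof.
move=> Dc df.
have dfc : differentiable c t by apply/derivable1_diffP; case: Dc.
apply: DeriveDef; first exact/derivable1_diffP/differentiable_comp.
rewrite deriveE; last exact: differentiable_comp.
rewrite diff_comp//= -(deriveE _ dfc) (@derive_val _ _ _ _ _ _ _ Dc).
rewrite [in LHS](row_sum_delta dc) linear_sum.
by apply: eq_bigr => i _; rewrite linearZ /pderiv deriveE.
Qed.

Lemma smooth_on_csV W (A : set V) (f : V -> W) : smooth_on A f -> csV A f.
Proof.
move=> sf c sc Ac k; elim: k f sf => // k ih f sf.
apply: (@smkS _ _ _ _ _ openT (fun t => \sum_i derive1 c t 0 i *: pderiv i f (c t))) => [t _|].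
  apply: differentiable_isd; first exact: (smo_isd sc).
  exact: (sf [::]).
have : forall r : seq 'I_n, smk setT k (fun t => \sum_(i <- r) derive1 c t 0 i *: pderiv i f (c t)).
  elim=> [|i r ihr].
    have -> : (fun t => \sum_(i <- [::]) derive1 c t 0 i *: pderiv i f (c t)) = fun=> 0.
      by apply/funext => t; rewrite big_nil.
    exact/smk_cst/openT.
  have -> : (fun t => \sum_(j <- i :: r) derive1 c t 0 j *: pderiv j f (c t)) =
      (fun t => derive1 c t 0 i *: pderiv i f (c t) + \sum_(j <- r) derive1 c t 0 j *: pderiv j f (c t)).
    by apply/funext => t; rewrite big_cons.
  apply: smkD => //; first exact: openT.
  apply: smk_scale; first exact: openT.
    by apply: sm_coord; exact: smo_derive1.
  apply: ih => s x Ax; have := sf (rcons s i) x Ax.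
  by rewrite /pderivs foldr_rcons.
exact.
Qed.

Lemma csV_sub W (A B : set V) (f : V -> W) : B `<=` A -> csV A f -> csV B f.
Proof. by move=> BA sf c sc Bc; apply: sf => // t; exact: BA. Qed.

End several_variables.

Section derivatives_of_smooth_functions.
Variables (R : realType) (n : nat) (W : normedModType R).
Hypothesis Wc : seq_complete W.
Local Notation V := 'rV[R]_n.
Implicit Types f g : V -> W.

Lemma pderivs_eq_open (B : set V) f g s x : open B -> (forall y, B y -> f y = g y) ->
  B x -> pderivs s f x = pderivs s g x.
Proof.
move=> oB fg; elim: s x => [|i s ih] x Bx; first exact: fg.
apply: near_eq_derive; have : nbhs x B by exact: open_nbhs_nbhs.
by apply: filterS => y; exact: ih.
Qed.

Lemma csVD (A : set V) f g : csV A f -> csV A g -> csV A (fun x => f x + g x).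
Proof. by move=> sf sg c sc Ac; apply: smoD; [exact: openT|exact: sf|exact: sg]. Qed.

Lemma csVZ (A : set V) a f : csV A f -> csV A (fun x => a *: f x).
Proof. by move=> sf c sc Ac; apply: smoZ; [exact: openT|exact: sf]. Qed.

Lemma csV_scale (A : set V) (a : V -> R) f : csV A a -> csV A f -> csV A (fun x => a x *: f x).
Proof. by move=> sa sf c sc Ac; apply: smo_scale; [exact: openT|exact: sa|exact: sf]. Qed.

Lemma csV_cst (A : set V) (w : W) : csV A (fun=> w).
Proof. by move=> c sc Ac; exact/smo_cst/openT. Qed.

Lemma csV_sum (A : set V) (I : Type) (r : seq I) (P : pred I) (f : I -> V -> W) :
  (forall i, csV A (f i)) -> csV A (fun x => \sum_(i <- r | P i) f i x).
Proof. by move=> sf c sc Ac; apply: smo_sum => [|i]; [exact: openT|exact: sf]. Qed.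

Lemma csV_coordinate (A : set V) i : @csV R n R A (fun x => x 0 i).
Proof. by move=> c sc Ac; exact: sm_coord. Qed.

Section on_open.
Variable A : set V.
Hypothesis oA : open A.

Lemma pderivD i f g x : csV A f -> csV A g -> A x ->
  pderiv i (fun y => f y + g y) x = pderiv i f x + pderiv i g x.
Proof. by move=> sf sg Ax; apply: deriveD; exact: csV_derivable Ax. Qed.

Lemma pderivZ i a f x : csV A f -> A x ->
  pderiv i (fun y => a *: f y) x = a *: pderiv i f x.
Proof. by move=> sf Ax; apply: deriveZ; exact: csV_derivable Ax. Qed.

Lemma pderiv_scale i (a : V -> R) f x : csV A a -> csV A f -> A x ->
  pderiv i (fun y => a y *: f y) x = a x *: pderiv i f x + pderiv i a x *: f x.
Proof.
move=> sa sf Ax; rewrite /pderiv -!derive1_line0; apply: isd_eq.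
have := isd_scale (csV_isd_line (@real_seq_complete R) oA (basisv R i) sa Ax)
                  (csV_isd_line Wc oA (basisv R i) sf Ax).
by rewrite scale0r addr0 !derive1_line0.
Qed.

Lemma csV_pderiv i f : csV A f -> csV A (pderiv i f).
Proof. exact: csV_derive. Qed.

Lemma pderivs_lin s a b f g x : csV A f -> csV A g -> A x ->
  pderivs s (fun y => a *: f y + b *: g y) x = a *: pderivs s f x + b *: pderivs s g x.
Proof.
move=> sf sg; elim: s x => [|i s ih] x Ax //=.
have -> : pderiv i (pderivs s (fun y => a *: f y + b *: g y)) x =
   pderiv i (fun y => a *: pderivs s f y + b *: pderivs s g y) x.
  apply: near_eq_derive; have : nbhs x A by exact: open_nbhs_nbhs.
  by apply: filterS => y; exact: ih.
have sfs := csV_pderivs Wc oA s sf; have sgs := csV_pderivs Wc oA s sg.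
by rewrite pderivD ?pderivZ//; exact: csVZ.
Qed.

End on_open.
End derivatives_of_smooth_functions.

(** * Smooth curves of test functions *)

Section test_function_curves.
Variables (R : realType) (n : nat) (W : normedModType R) (Om : set 'rV[R]_n).
Hypothesis Wc : seq_complete W.
Hypothesis oOm : open Om.
Local Notation V := 'rV[R]_n.
Local Notation D := (testfun W Om).
Implicit Types (f g : D) (c : R -> D).

Lemma tf_csV f : csV setT f.
Proof. by apply: smooth_on_csV; have [] := testfunP f. Qed.

Lemma tfB f g x : (f - g : D) x = f x - g x.
Proof. by []. Qed.

Lemma tfZ (a : R) f x : (a *: f : D) x = a *: f x.
Proof. by []. Qed.

Lemma tfD f g x : (f + g : D) x = f x + g x.
Proof. by []. Qed.

Lemma tf_eq f g : (forall x, f x = g x) -> f = g.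
Proof. by move=> fg; apply: val_inj; apply/funext. Qed.

Lemma tf_bounded f : exists C : R, forall x, `|f x| <= C.
Proof.
have [sf cf _] := testfunP f.
have cnf : continuous (fun x => `|f x|).
  move=> x; apply: continuous_comp; last exact: norm_continuous.
  by apply: differentiable_continuous; exact: (sf [::]).
have [[x0 fx0]|nx] := pselect (exists x, supp f x); last first.
  by exists 0 => x; rewrite supp0 ?normr0// => fx; apply: nx; exists x.
have [x _ xP] := @EVT_max_rV R n (fun x => `|f x|) (supp f) (ex_intro _ x0 fx0) cf
  (continuous_subspaceT cnf).
exists `|f x| => y; have [fy|fy] := pselect (supp f y); first by apply: xP; exact/mem_set.
by rewrite supp0// normr0.
Qed.

(** A continuous seminorm on D(Om) that controls all evaluations: it transfers limits in D(Om) to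
    values and shows that such limits are unique. *)
Definition sup_norm f : R := sup [set `|f x| | x in setT].

Lemma sup_norm_ge f x : `|f x| <= sup_norm f.
Proof.
apply: ub_le_sup; last by exists x.
by have [C CP] := tf_bounded f; exists C => _ [y _ <-].
Qed.

Lemma sup_norm_le f C : (forall x, `|f x| <= C) -> sup_norm f <= C.
Proof.
by move=> fC; apply: ge_sup => [|_ [y _ <-]//]; exists `|f 0|, 0.
Qed.

Lemma sup_norm_seminorm : lf_seminorm sup_norm.
Proof.
have pZ a f : sup_norm (a *: f) <= `|a| * sup_norm f.
  by apply: sup_norm_le => x; rewrite tfZ normrZ ler_wpM2l// sup_norm_ge.
split=> [f g|a f|A cA AO].
- apply: sup_norm_le => x; rewrite tfD (le_trans (ler_normD _ _))//.
  by rewrite lerD// sup_norm_ge.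
- apply/eqP; rewrite eq_le pZ/=; have [->|a0] := eqVneq a 0.
    by rewrite normr0 mul0r (le_trans _ (sup_norm_ge _ 0)).
  have a0' : 0 < `|a| by rewrite normr_gt0.
  have := pZ a^-1 (a *: f); rewrite scalerA mulVf// scale1r normfV.
  by rewrite mulrC ler_pdivlMr// mulrC.
- exists 0%N, 1 => f M _ fM; rewrite mul1r; apply: sup_norm_le => x.
  exact: (fM [::]).
Qed.

Lemma tf_derivable f x v : derivable f x v.
Proof. by apply: diff_derivable; have [sf _ _] := testfunP f; exact: (sf [::]). Qed.

Lemma testfun_pderivB i f g : testfun_pderiv i (f - g) = testfun_pderiv i f - testfun_pderiv i g.
Proof.
apply: tf_eq => x; rewrite tfB /=; apply: deriveB; exact: tf_derivable.
Qed.

Lemma testfun_pderivZ i a f : testfun_pderiv i (a *: f) = a *: testfun_pderiv i f.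
Proof.
apply: tf_eq => x; rewrite tfZ /=; apply: deriveZ; exact: tf_derivable.
Qed.

Lemma testfun_pderivD i f g : testfun_pderiv i (f + g) = testfun_pderiv i f + testfun_pderiv i g.
Proof.
apply: tf_eq => x; rewrite tfD /=; apply: deriveD; exact: tf_derivable.
Qed.

Lemma supp_closed f : closed (supp f).
Proof. exact: closed_closure. Qed.

Lemma supp_sub f (A : set V) : closed A -> (forall x, f x != 0 -> A x) -> supp f `<=` A.
Proof.
by move=> clA fA; rewrite /supp [A](closure_id A).1//; apply: closure_subset.
Qed.

Lemma supp_pderiv i f : supp (testfun_pderiv i f) `<=` supp f.
Proof.
apply: supp_sub; first exact: supp_closed.
move=> x; apply: contraPP => /near_supp0 fx; apply/negP; rewrite negbK /=.
by rewrite /pderiv (near_eq_derive (g := cst 0))// derive_cst.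
Qed.

Lemma pderiv_seminorm i p : lf_seminorm p -> lf_seminorm (fun f => p (testfun_pderiv i f)).
Proof.
move=> [pD pZ pA]; split=> [f g|a f|A cA AO].
- by rewrite testfun_pderivD pD.
- by rewrite testfun_pderivZ pZ.
- have [m [C H]] := pA A cA AO; exists m.+1, C => f M fA fM; apply: H.
    by apply: subset_trans fA; exact: supp_pderiv.
  move=> s x sm; have := fM (rcons s i) x; rewrite size_rcons ltnS => /(_ sm).
  by rewrite /pderivs foldr_rcons.
Qed.

Definition tderiv c c' := forall (t : R), h^-1 *: (c (t + h) - c t) @[h --> 0^'] --> c' t.

Lemma tderivP c c' : tderiv c c' <-> forall t p e, lf_seminorm p -> 0 < e ->
  exists2 d : R, 0 < d & forall h, `|h| < d -> p (c (t + h) - c t - h *: c' t) <= e * `|h|.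
Proof.
split=> [cc' t p e hp e0|H t].
  have [pD pZ _] := hp.
  have := cc' t _ (lf_nbhs_ball (c' t) hp e0) => /nbhs_ballP[d /= d0 dP].
  exists d => // h hd; have [->|h0] := eqVneq h 0.
    by rewrite addr0 subrr scale0r subr0 lf_seminorm0// normr0 mulr0.
  have := dP h; rewrite /ball/= sub0r normrN => /(_ hd h0) H.
  rewrite -[_ - h *: _]scale1r -(divff h0) -scalerA pZ mulrC.
  by rewrite ler_wpM2r// scalerBr scalerA mulVf// scale1r ltW.
move=> U [p [hp [e e0 pU]]]; have [pD pZ _] := hp.
have e20 : 0 < e / 2 by rewrite divr_gt0.
have [d d0 dP] := H t p _ hp e20.
apply/nbhs_ballP; exists d => //= h; rewrite /ball/= sub0r normrN => hd h0.
apply: pU; rewrite /lf_ball/=.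
have hn0 : 0 < `|h| by rewrite normr_gt0.
rewrite -(ltr_pM2r hn0); apply: (@le_lt_trans _ _ (e / 2 * `|h|)).
  apply: le_trans (dP h hd).
  by rewrite mulrC -pZ scalerBr scalerA divff// scale1r.
by rewrite ltr_pM2r// ltr_pdivrMr// ltr_pMr// ltr1n.
Qed.

Lemma smooth_curve_tderiv c : smooth_curve c -> exists2 c', smooth_curve c' & tderiv c c'.
Proof.
move=> [d [<- dd]]; exists (d 1%N); last exact: dd.
by exists (fun k => d k.+1); split=> // k; exact: dd.
Qed.

Lemma smooth_curve_pderiv i c : smooth_curve c -> smooth_curve (fun t => testfun_pderiv i (c t)).
Proof.
move=> [d [<- dd]]; exists (fun k t => testfun_pderiv i (d k t)); split=> // k.
apply/tderivP => t p e hp e0.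
have /tderivP/(_ t _ e (pderiv_seminorm i hp) e0)[d0 d00 dP] := dd k.
exists d0 => // h /dP.
by rewrite !testfun_pderivB testfun_pderivZ.
Qed.

Lemma curve_eval_isd c c' (a : R -> R) (y : R -> V) t : tderiv c c' -> sm a -> sm y ->
  isd (fun s => c (a s) (y s)) t
   (derive1 a t *: c' (a t) (y t) + \sum_i derive1 y t 0 i *: testfun_pderiv i (c (a t)) (y t)).
Proof.
move=> /tderivP cc' sa sy.
have -> : (fun s => c (a s) (y s)) = (fun s => (c (a s) - c (a t)) (y s) + c (a t) (y s)).
  by apply/funext => s; rewrite tfB subrK.
apply: isdD; last first.
  apply: differentiable_isd; first exact: (smo_isd sy).
  by apply: (csV_differentiable Wc openT) => //; exact: tf_csV.
(* c (a s) - c (a t) is (a s - a t) c' (a t) up to an error which is small in the sup norm *)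
have [a1 [Ba [a10 Ba0 BaP]]] : exists a1 Ba : R, [/\ 0 < a1, 0 < Ba & forall h, `|h| < a1 -> `|a (t + h) - a t| <= Ba * `|h|].
  have /isd_eps/(_ 1 ltr01)[d d0 dP] := smo_isd sa (t := t) I.
  exists d, (1 + `|derive1 a t|); split=> // h /dP H.
  rewrite mulrDl -normrM -[a (t + h) - a t](subrK (h *: derive1 a t)) (le_trans (ler_normD _ _))//.
  by rewrite lerD// mulrC.
apply/isd_eps => e e0.
have e30 : 0 < e / 3 by rewrite divr_gt0.
have [d d0 dP] := cc' (a t) _ _ sup_norm_seminorm (divr_gt0 e30 Ba0).
have sF : sm (fun s => c' (a t) (y s)) by apply: tf_csV.
have /isd_eps/(_ (e / 3) e30)[d2 d20 d2P] := smo_isd sa (t := t) I.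
have [Cf CfP] := tf_bounded (c' (a t)).
have Cf1 : 0 < `|Cf| + 1 by rewrite ltr_wpDl.
have [d3 d30 d3P] : exists2 d3 : R, 0 < d3 & forall h, `|h| < d3 ->
    `|c' (a t) (y (t + h)) - c' (a t) (y t)| <= e / 3 / Ba.
  have /cvgrPdist_le/(_ _ (divr_gt0 e30 Ba0))/nbhs_ballP[r /= r0 rP] :=
    smo_derivable_continuous sF (t := t) I.
  exists r => // h hr; rewrite distrC; apply: rP.
  by rewrite /ball/= opprD addrA subrr add0r normrN.
have /isd_eps/(_ _ (divr_gt0 e30 Cf1))[d4 d40 d4P] := smo_isd sa (t := t) I.
exists (Num.min (Num.min a1 (d / Ba)) (Num.min d3 d4)) => [|h].
  by rewrite !lt_min a10 d30 d40 divr_gt0.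
rewrite !lt_min => /andP[/andP[ha hd] /andP[h3 h4]].
rewrite subrr -[(0 : D) _]/(0 : W) subr0 tfB.
have Bh := BaP h ha.
have hd' : `|a (t + h) - a t| < d.
  by rewrite (le_lt_trans Bh)// mulrC -ltr_pdivlMr.
have := dP _ hd'; rewrite [a t + (_ - _)]addrC subrK => H1.
have {H1} := le_trans (sup_norm_ge _ (y (t + h))) H1; rewrite !tfB tfZ => H1.
have H2 := d3P h h3; have H3 := d4P h h4.
set C1 := c (a (t + h)) _ in H1 *; set C2 := c (a t) _ in H1 *.
set p := c' (a t) (y (t + h)) in H1 H2; set q := c' (a t) (y t) in H2 *.
have -> : C1 - C2 - h *: (derive1 a t *: q) = (C1 - C2 - (a (t + h) - a t) *: p) +
   (a (t + h) - a t) *: (p - q) + (a (t + h) - a t - h *: derive1 a t) *: q.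
  by rewrite scalerBr [X in _ = _ + X]scalerBl scalerA addrA subrKA subrK.
have K1 : `|C1 - C2 - (a (t + h) - a t) *: p| <= e / 3 * `|h|.
  apply: (le_trans H1); rewrite -(mulrA (e / 3)) ler_wpM2l ?(ltW e30)//.
  by rewrite mulrC ler_pdivrMr// mulrC.
have K2 : `|(a (t + h) - a t) *: (p - q)| <= e / 3 * `|h|.
  rewrite normrZ; apply: (@le_trans _ _ (Ba * `|h| * (e / 3 / Ba))).
    by apply: ler_pM.
  by rewrite mulrAC mulrC [Ba * _]mulrC divfK ?gt_eqF// mulrC.
have K3 : `|(a (t + h) - a t - h *: derive1 a t) *: q| <= e / 3 * `|h|.
  rewrite normrZ; apply: (@le_trans _ _ (e / 3 / (`|Cf| + 1) * `|h| * (`|Cf| + 1))).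
    apply: ler_pM => //; rewrite (le_trans (CfP _))// (le_trans (ler_norm _))//.
    by rewrite lerDl.
  by rewrite mulrAC divfK ?gt_eqF.
have L1 := ler_normD (C1 - C2 - (a (t + h) - a t) *: p + (a (t + h) - a t) *: (p - q))
   ((a (t + h) - a t - h *: derive1 a t) *: q).
have L2 := ler_normD (C1 - C2 - (a (t + h) - a t) *: p) ((a (t + h) - a t) *: (p - q)).
by move: K1 K2 K3 L1 L2; lra.
Qed.

Definition joint (U : R -> V -> W) := forall (a : R -> R) (y : R -> V),
  sm a -> sm y -> sm (fun t => U (a t) (y t)).

(** The derivative found in [curve_eval_isd] is composed of evaluations of the curves [c'] and
    [testfun_pderiv i c], which are smooth too. Hence the induction on the order is over all smooth
    curves. *)
Lemma smooth_curve_joint c : smooth_curve c -> joint (fun t => c t).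
Proof.
move=> sc a y sa sy k; elim: k c sc => // k ih c sc.
have [c' sc' cc'] := smooth_curve_tderiv sc.
apply: (@smkS _ _ _ _ _ openT (fun t => derive1 a t *: c' (a t) (y t) +
    \sum_i derive1 y t 0 i *: testfun_pderiv i (c (a t)) (y t))) => [t _|].
  exact: curve_eval_isd.
apply: smkD; first exact: openT.
  by apply: smk_scale; [exact: openT|exact: smo_derive1|exact: ih].
have : forall r : seq 'I_n, smk setT k (fun t => \sum_(i <- r)
    derive1 y t 0 i *: testfun_pderiv i (c (a t)) (y t)).
  elim=> [|i r ihr].
    have -> : (fun t => \sum_(i <- [::]) derive1 y t 0 i *: testfun_pderiv i (c (a t)) (y t)) = fun=> 0.
      by apply/funext => t; rewrite big_nil.
    exact/smk_cst/openT.
  have -> : (fun t => \sum_(j <- i :: r) derive1 y t 0 j *: testfun_pderiv j (c (a t)) (y t)) =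
      (fun t => derive1 y t 0 i *: testfun_pderiv i (c (a t)) (y t) +
         \sum_(j <- r) derive1 y t 0 j *: testfun_pderiv j (c (a t)) (y t)).
    by apply/funext => t; rewrite big_cons.
  apply: smkD => //; first exact: openT.
  apply: smk_scale; first exact: openT.
    by apply: sm_coord; exact: smo_derive1.
  exact: (ih _ (smooth_curve_pderiv i sc)).
exact.
Qed.

End test_function_curves.

(** * Functions of time and space that are smooth along curves *)

Section joint_smoothness.
Variables (R : realType) (n : nat) (W : normedModType R).
Hypothesis Wc : seq_complete W.
Local Notation V := 'rV[R]_n.
Implicit Types (U : R -> V -> W).

Definition dt U : R -> V -> W := fun t y => derive1 (U^~ y) t.

Lemma joint_cs2 U (y : R -> V) : joint U -> sm y -> cs2 (fun s r => U s (y r)).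
Proof. by move=> sU sy a b sa sb; apply: (sU a (fun t => y (b t))) => //; exact: sm_comp. Qed.

Lemma joint_dt U : joint U -> joint (dt U).
Proof. by move=> sU a y sa sy; exact: (cs2_d1 Wc (joint_cs2 sU sy) sa (smo_id openT)). Qed.

Lemma joint_pderiv i U : joint U -> joint (fun t => pderiv i (U t)).
Proof.
move=> sU a y sa sy.
have sg : cs2 (fun r s => U (a r) (y r + s *: basisv R i)).
  move=> b c sb sc; apply: (sU (fun t => a (b t)) (fun t => y (b t) + c t *: basisv R i)).
    exact: sm_comp.
  apply: smoD; [exact: openT|exact: sm_comp|].
  by apply: smo_scale sc _; [exact: openT|exact: (smo_cst _ openT)].
apply: sm_ext (cs2_d2 Wc sg (smo_id openT) (smo_cst 0 openT)) => t.
by rewrite derive1_line0.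
Qed.

Lemma joint_pderivs (s : seq 'I_n) U : joint U -> joint (fun t => pderivs s (U t)).
Proof. by move=> sU; elim: s => //= i s ih; exact: joint_pderiv. Qed.

Lemma joint_csV U t : joint U -> csV setT (U t).
Proof. by move=> sU c sc _; apply: (sU (fun=> t)) => //; exact/smo_cst/openT. Qed.

Lemma joint_sm U y : joint U -> sm (U^~ y).
Proof. by move=> sU; apply: (sU (fun t => t) (fun=> y)); [exact/smo_id/openT|exact/smo_cst/openT]. Qed.

Lemma pderiv_dt i U t y : joint U -> pderiv i (dt U t) y = dt (fun t => pderiv i (U t)) t y.
Proof.
move=> sU.
have sg : cs2 (fun s r => U s (y + r *: basisv R i)) by apply: joint_cs2 => //; exact: sm_line.
rewrite /pderiv -(derive1_line0 (dt U t)).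
apply: etrans (esym (cs2_schwarz Wc t 0 sg)) _; apply: eq_derive1 => s.
exact: (derive1_line0 (U s)).
Qed.

Lemma pderivs_dt (s : seq 'I_n) U t y : joint U -> pderivs s (dt U t) y = dt (fun t => pderivs s (U t)) t y.
Proof.
move=> sU; elim: s y => //= i s ih y.
have -> : pderivs s (dt U t) = dt (fun t => pderivs s (U t)) t by apply/funext.
by rewrite pderiv_dt//; exact: joint_pderivs.
Qed.

Lemma joint_bounded U t0 y0 : joint U -> exists d C : R, 0 < d /\
  forall t y, `|t - t0| < d -> `|y - y0| < d -> `|U t y| <= C.
Proof.
move=> sU.
have sF : cvs (fun c : option 'I_n -> R => U (c None) (\row_i c (Some i))).
  by move=> c sc; apply: sU => //; apply: sm_row => i.
have [d [C [d0 dC]]] := cvs_local_bound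
  (fun i => if i is Some j then y0 0 j else t0) 0 0 sF.
exists d, C; split=> // t y td yd.
have := dC (fun i => if i is Some j then y 0 j else t) (fun=> 0); rewrite /= mul0r addr0.
have -> : \row_i (y 0 i + 0) = y by apply/rowP => i; rewrite mxE addr0.
apply=> [[i|]//|i]; last by rewrite normr0.
by have := coord_le (y - y0) i; rewrite !mxE => H; exact: le_lt_trans H yd.
Qed.

Lemma joint_bounded_compact U t0 (A : set V) : joint U -> compact A -> exists d C : R, 0 < d /\
  forall t y, `|t - t0| < d -> A y -> `|U t y| <= C.
Proof.
move=> sU cA.
have [| |N NP] := @compact_uniform V A
  (fun N y => forall x, `|x - t0| < N.+1%:R^-1 -> `|U x y| <= N%:R) cA.
- move=> i j y ij H x xj; apply: (le_trans (H _ _)); last by rewrite ler_nat.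
  by rewrite (lt_le_trans xj)// lef_pV2 ?posrE// ler_nat.
- move=> y _; have [d [C [d0 dC]]] := joint_bounded t0 y sU.
  have [N1 N1P] := nat_gt d^-1; have [N2 N2P] := nat_gt C.
  exists (maxn N1 N2); apply/nbhs_ballP; exists d => //= z.
  rewrite -ball_normE /= distrC => zy x xd.
  rewrite (le_trans (dC x z _ zy))//; last by rewrite (le_trans (ltW N2P))// ler_nat leq_maxr.
  rewrite (lt_trans xd)// invf_plt ?posrE// (lt_le_trans N1P)// ler_nat.
  by rewrite (leq_trans (leq_maxl N1 N2))// leqnSn.
- exists N.+1%:R^-1, N%:R; split=> [|x y xd yab]; first by rewrite invr_gt0.
  exact: NP.
Qed.

(** There are finitely many words of each length. Besides uniform Taylor constants, this yields the
    single order [q] that serves all derivatives up to a given order. *)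
Lemma words_uniform (P : nat -> seq 'I_n -> Prop) :
  (forall i j s, (i <= j)%N -> P i s -> P j s) -> (forall s, exists N, P N s) ->
  forall m, exists N, forall s, (size s <= m)%N -> P N s.
Proof.
move=> + + m; elim: m P => [|m ih] P mP H.
  by have [N NP] := H [::]; exists N => s; rewrite leqn0 size_eq0 => /eqP ->.
have Hi i : exists N, forall s, (size s <= m)%N -> P N (i :: s).
  by apply: (ih (fun N s => P N (i :: s))) => [j k s|s]; [exact: mP|exact: H].
have [N NP] := choice Hi; have [N0 N0P] := H [::].
exists (maxn N0 (\max_i N i)) => -[_|i s]; first by apply: mP N0P; exact: leq_maxl.
move=> /= sm; apply: mP (NP i s sm); rewrite leq_max; apply/orP; right.
exact: (leq_bigmax i).
Qed.

Lemma joint_taylor U t0 (A : set V) m : joint U -> compact A ->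
  exists d C : R, [/\ 0 < d, 0 <= C & forall s h y, (size s <= m)%N -> `|h| < d -> A y ->
   `|pderivs s (U (t0 + h)) y - pderivs s (U t0) y - h *: pderivs s (dt U t0) y| <= C * `|h| ^+ 2].
Proof.
move=> sU cA.
pose P N s := forall h y, `|h| < N.+1%:R^-1 -> A y ->
   `|pderivs s (U (t0 + h)) y - pderivs s (U t0) y - h *: pderivs s (dt U t0) y| <= N%:R * `|h| ^+ 2.
have [||N NP] := @words_uniform P _ _ m.
- move=> i j s ij H h y hj Ay; apply: (le_trans (H _ _ _ Ay)).
    by rewrite (lt_le_trans hj)// lef_pV2 ?posrE// ler_nat.
  by rewrite ler_wpM2r ?exprn_ge0// ler_nat.
- move=> s; have sUs := joint_pderivs s sU.
  have [d [C [d0 dC]]] := joint_bounded_compact t0 (joint_dt (joint_dt sUs)) cA.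
  have [N1 N1P] := nat_gt d^-1; have [N2 N2P] := nat_gt C.
  exists (maxn N1 N2) => h y hd Ay.
  have C0 : C <= (maxn N1 N2)%:R by rewrite (le_trans (ltW N2P))// ler_nat leq_maxr.
  rewrite pderivs_dt//.
  apply: (@taylor1 R W (fun t => pderivs s (U t) y) t0 d) => //.
  + exact: (joint_sm y sUs).
  + by move=> t td; apply: le_trans C0; exact: dC.
  + rewrite (lt_trans hd)// invf_plt ?posrE// (lt_le_trans N1P)// ler_nat.
    by rewrite (leq_trans (leq_maxl N1 N2))// leqnSn.
- exists N.+1%:R^-1, N%:R; split=> // s h y sm hd Ay.
  exact: NP.
Qed.

End joint_smoothness.

(** * Smooth curves in D(Om) as jointly smooth functions with locally bounded support *)

Section test_function_curves.
Variables (R : realType) (n : nat) (W : normedModType R) (Om : set 'rV[R]_n).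
Hypothesis Wc : seq_complete W.
Hypothesis oOm : open Om.
Local Notation V := 'rV[R]_n.
Local Notation D := (testfun W Om).
Implicit Types (f g : D) (c : R -> D).

(** An increasing compact exhaustion of [Om] whose members keep distance at least 1 / (k + 1) from
    the complement. *)
Definition exh (k : nat) : set V :=
  [set x | `|x| <= k%:R /\ forall y, `|y - x| < k.+1%:R^-1 -> Om y].

Lemma exh_closed k : closed (exh k).
Proof.
move=> x clx.
have H e : 0 < e -> exists2 z, exh k z & `|x - z| < e.
  by move=> e0; have [z [Ez]] := clx _ (nbhsx_ballx x e e0); rewrite -ball_normE; exists z.
split.
  apply/ler_addgt0Pr => e /H[z [zk _] xz].
  rewrite -[x](subrK z) addrC (le_trans (ler_normD _ _))// lerD// ltW//.
move=> y yx; have : 0 < k.+1%:R^-1 - `|y - x| by rewrite subr_gt0.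
move=> /H[z [_ zO] xz]; apply: zO.
by rewrite (le_lt_trans (ler_distD x y z))// -ltrBrDl.
Qed.

Lemma exh_compact k : compact (exh k).
Proof.
apply: bounded_closed_compact; last exact: exh_closed.
exists k%:R; split; first exact: num_real.
by move=> M kM x [xk _]; exact: le_trans xk (ltW kM).
Qed.

Lemma exh_sub k : exh k `<=` Om.
Proof. by move=> x [_]; apply; rewrite subrr normr0 invr_gt0. Qed.

Lemma exh_mono i j : (i <= j)%N -> exh i `<=` exh j.
Proof.
move=> ij x [xi xO]; split; first by rewrite (le_trans xi)// ler_nat.
by move=> y yj; apply: xO; rewrite (lt_le_trans yj)// lef_pV2 ?posrE// ler_nat.
Qed.

Lemma exh_cover (A : set V) : compact A -> A `<=` Om -> exists k, A `<=` exh k.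
Proof.
move=> cA AO; apply: (@compact_uniform V A exh cA); first by move=> i j y /exh_mono; exact.
move=> y /AO Oy; have /nbhs_ballP[r /= r0 rO] : nbhs y Om by exact: open_nbhs_nbhs.
have [N1 N1P] := nat_gt (2 / r); have [N2 N2P] := nat_gt (`|y| + r).
exists (maxn N1 N2); apply/nbhs_ballP; exists (r / 2) => /=; first by rewrite divr_gt0.
move=> z; rewrite -ball_normE /= => yz; split.
  apply: (@le_trans _ _ N2%:R); last by rewrite ler_nat leq_maxr.
  rewrite (le_trans _ (ltW N2P))// -[z](subrK y) addrC (le_trans (ler_normD _ _))// lerD2l.
  by rewrite distrC ltW// (lt_trans yz)// ltr_pdivrMr// ltr_pMr// ltr1n.
move=> x xz; apply: rO; rewrite -ball_normE /=.
have : (maxn N1 N2).+1%:R^-1 < r / 2.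
  rewrite invf_plt ?posrE ?divr_gt0// invf_div (lt_le_trans N1P)// ler_nat.
  by rewrite (leq_trans (leq_maxl N1 N2))// leqnSn.
move=> Nr; rewrite (le_lt_trans (ler_distD z y x))// [ltRHS]splitr ltrD//.
by rewrite distrC (lt_trans xz).
Qed.

Section escaping_seminorm.
Variables (y : nat -> V) (w : nat -> R).
Hypotheses (yk : forall k, ~ exh k (y k)) (w0 : forall k, 0 <= w k).

Definition wsum f N := \sum_(k < N) w k * `|f (y k)|.

Lemma wsum_stable f N M : supp f `<=` exh N -> (N <= M)%N -> wsum f M = wsum f N.
Proof.
move=> fN; elim: M => [|M ih]; first by rewrite leqn0 => /eqP ->.
rewrite leq_eqVlt => /orP[/eqP -> //|]; rewrite ltnS => NM.
rewrite /wsum big_ord_recr /= -/(wsum f M) ih// supp0 ?normr0 ?mulr0 ?addr0//.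
by move=> /fN/(exh_mono NM); exact: yk.
Qed.

Lemma supp_exh f : exists k, supp f `<=` exh k.
Proof. by have [_ cf fO] := testfunP f; exact: exh_cover. Qed.

(** The seminorm sum_k w_k |f(y_k)|. Since [y k] leaves [exh k], only finitely many terms are
    nonzero for each f; the sum is cut at an index beyond which they vanish, and by [escapingE] the
    choice is immaterial. *)
Definition escaping f := wsum f (sval (cid (supp_exh f))).

Lemma escapingE f N : supp f `<=` exh N -> escaping f = wsum f N.
Proof.
move=> fN; rewrite /escaping; case: cid => M /= fM.
by rewrite -(wsum_stable fM (leq_maxl M N)) -(wsum_stable fN (leq_maxr M N)).
Qed.

Lemma escaping_ge f k : w k * `|f (y k)| <= escaping f.
Proof.
have [N fN] := supp_exh f.
have fM : supp f `<=` exh (maxn N k.+1).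
  by apply: subset_trans fN _; apply: exh_mono; exact: leq_maxl.
have kM : (k < maxn N k.+1)%N by rewrite leq_max leqnn orbT.
rewrite (escapingE fM) /wsum (bigD1 (Ordinal kM))//= lerDl sumr_ge0// => i _.
by rewrite mulr_ge0.
Qed.

(** On test functions supported in a fixed compact set the sum has a fixed finite length, so the sup
    norm bounds it however fast the weights grow. *)
Lemma escaping_seminorm : lf_seminorm escaping.
Proof.
split=> [f g|a f|A cA AO].
- have [N1 H1] := supp_exh f; have [N2 H2] := supp_exh g; have [N3 H3] := supp_exh (f + g).
  pose N := maxn N1 (maxn N2 N3).
  have K M (h : D) : supp h `<=` exh M -> (M <= N)%N -> escaping h = wsum h N.
    by move=> hM MN; apply: escapingE; apply: subset_trans hM _; exact: exh_mono.
  rewrite (K _ _ H1) ?(K _ _ H2) ?(K _ _ H3) ?/N ?leq_max ?leqnn ?orbT//.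
  rewrite /wsum -big_split /=; apply: ler_sum => k _.
  by rewrite -mulrDr ler_wpM2l//; exact: ler_normD.
- have [N1 H1] := supp_exh f; have [N2 H2] := supp_exh (a *: f).
  pose N := maxn N1 N2.
  have K M (h : D) : supp h `<=` exh M -> (M <= N)%N -> escaping h = wsum h N.
    by move=> hM MN; apply: escapingE; apply: subset_trans hM _; exact: exh_mono.
  rewrite (K _ _ H1) ?(K _ _ H2) ?/N ?leq_max ?leqnn ?orbT//.
  rewrite /wsum mulr_sumr; apply: eq_bigr => k _.
  by rewrite tfZ normrZ mulrCA.
- have [N AN] := exh_cover cA AO; exists 0%N, (\sum_(k < N) w k) => f M fA fM.
  rewrite (@escapingE f N); last exact: subset_trans AN.
  rewrite /wsum mulr_suml; apply: ler_sum => k _; rewrite ler_wpM2l//.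
  exact: (fM [::]).
Qed.
End escaping_seminorm.

Lemma smooth_curve_seminorm c t0 p : smooth_curve c -> lf_seminorm p ->
  exists2 d : R, 0 < d & forall h, `|h| < d -> p (c (t0 + h)) <= p (c t0) + 1.
Proof.
move=> /smooth_curve_tderiv[c' _ /tderivP cc'] hp; have [pD pZ _] := hp.
have [d d0 dP] := cc' t0 p 1 hp ltr01.
have pc0 := lf_seminorm_ge0 (c' t0) hp.
have pc1 : 0 < 1 + p (c' t0) by rewrite ltr_pwDl.
exists (Num.min d (1 + p (c' t0))^-1) => [|h]; first by rewrite lt_min d0 invr_gt0.
rewrite lt_min => /andP[/dP H hd].
have E : c (t0 + h) = (c (t0 + h) - c t0 - h *: c' t0) + (c t0 + h *: c' t0).
  by rewrite [c t0 + _]addrC addrA !subrK.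
rewrite E (le_trans (pD _ _))// addrC.
have H2 : p (c t0 + h *: c' t0) <= p (c t0) + `|h| * p (c' t0) by rewrite -pZ pD.
have H3 : `|h| * (1 + p (c' t0)) <= 1.
  by rewrite -ler_pdivlMr// mul1r ltW.
by move: H H2 H3; lra.
Qed.

Lemma smooth_curve_escape c t0 (tau : nat -> R) (y : nat -> V) : smooth_curve c ->
  (forall d, 0 < d -> exists N, forall k, (N <= k)%N -> `|tau k - t0| < d) ->
  (forall k, ~ exh k (y k)) -> exists k, c (tau k) (y k) = 0.
Proof.
move=> sc taut yk; apply: contrapT => nE.
have c0 k : 0 < `|c (tau k) (y k)|.
  by rewrite normr_gt0; apply/eqP => E; apply: nE; exists k.
(* These weights make the seminorm of [c (tau k)] at least k, whereas it stays bounded along a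
   differentiable curve near [t0]. *)
pose w k := k%:R / `|c (tau k) (y k)|.
have w0 k : 0 <= w k by rewrite divr_ge0.
have hp := escaping_seminorm yk w0.
have [d d0 dP] := smooth_curve_seminorm t0 sc hp.
have [N NP] := taut _ d0; have [M MP] := nat_gt (escaping y w (c t0) + 1).
have := dP _ (NP _ (leq_maxl N M)); rewrite [t0 + _]addrC subrK => H.
have := escaping_ge yk w0 (c (tau (maxn N M))) (maxn N M).
rewrite /w divfK ?gt_eqF// => H2.
have := le_trans H2 H; apply/negP; rewrite -ltNge (lt_le_trans MP)// ler_nat.
exact: leq_maxr.
Qed.

Definition loc_supp c := forall t0, exists2 d : R, 0 < d & exists A : set V,
  [/\ compact A, A `<=` Om & forall t, `|t - t0| < d -> supp (c t) `<=` A].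

Lemma not_supp_exh f k : ~ supp f `<=` exh k -> exists y, ~ exh k y /\ f y != 0.
Proof.
move=> nf; apply: contrapT => nE; apply: nf.
apply: supp_sub; first exact: exh_closed.
by move=> x fx; apply: contrapT => ex; apply: nE; exists x.
Qed.

Lemma inv_nat_small (d : R) : 0 < d -> exists N, forall k, (N <= k)%N -> k.+1%:R^-1 < d.
Proof.
move=> d0; have [N NP] := nat_gt d^-1; exists N => k Nk.
rewrite invf_plt ?posrE// (lt_le_trans NP)// ler_nat.
exact: leq_trans Nk _.
Qed.

Lemma smooth_curve_loc_supp c : smooth_curve c -> loc_supp c.
Proof.
move=> sc t0; apply: contrapT => nE.
have H k : exists ty : R * V, [/\ `|ty.1 - t0| < k.+1%:R^-1, ~ exh k ty.2 & c ty.1 ty.2 != 0].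
  apply: contrapT => nk; apply: nE; exists k.+1%:R^-1; first by rewrite invr_gt0.
  exists (exh k); split=> [||t tk]; [exact: exh_compact|exact: exh_sub|].
  apply: contrapT => /not_supp_exh[y [yk cy]]; apply: nk.
  by exists (t, y).
have [ty tyP] := choice H.
have [||k E] := @smooth_curve_escape c t0 (fun k => (ty k).1) (fun k => (ty k).2) sc.
- move=> d /inv_nat_small[N NP]; exists N => k /NP.
  by have [h _ _] := tyP k; exact: lt_trans.
- by move=> k; have [] := tyP k.
- by have [_ _] := tyP k; rewrite E eqxx.
Qed.

Definition good_curve c := joint (fun t => c t : V -> W) /\ loc_supp c.

(** Near each time all supports lie in one compact set, where every continuous seminorm is dominated
    by some C^m norm. There [joint_taylor] bounds the remainder of the difference quotient
    quadratically. *)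
Lemma good_curve_deriv c : good_curve c -> exists c', [/\ good_curve c', tderiv c c' &
  forall t y, c' t y = dt (fun t => c t : V -> W) t y].
Proof.
move=> [jc lc].
have mem t : dt (fun t => c t : V -> W) t \in testfuns Om.
  have [d d0 [A [cA AO cAt]]] := lc t.
  apply: (@testfuns_sub _ _ _ _ A) => //.
    by apply: (csV_smooth_on Wc openT); apply: joint_csV; exact: joint_dt.
  move=> x; apply: contraPP => Ax; apply/negP; rewrite negbK /dt.
  rewrite (near_derive1_eq (g := cst 0)) ?derive1_cst//.
  have := nbhs_norm_lt t d0; apply: filterS => s st.
  by apply: supp0 => /(cAt s st).
pose c' t := TestFun (mem t).
have supp' t A (d : R) : 0 < d -> compact A -> (forall s, `|s - t| < d -> supp (c s) `<=` A) ->
    supp (c' t) `<=` A.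
  move=> d0 cA cAt; apply: supp_sub.
    by apply: compact_closed => //; exact: norm_hausdorff.
  move=> x; apply: contraPP => Ax; apply/negP; rewrite negbK /= /dt.
  rewrite (near_derive1_eq (g := cst 0)) ?derive1_cst//.
  have := nbhs_norm_lt t d0; apply: filterS => s st.
  by apply: supp0 => /(cAt s st).
exists c'; split=> //.
  split; first exact: joint_dt.
  move=> t0; have [d d0 [A [cA AO cAt]]] := lc t0.
  exists (d / 2); first by rewrite divr_gt0.
  exists A; split=> // t td; apply: (@supp' t A (d / 2)) => //; first by rewrite divr_gt0.
  move=> s st; apply: cAt.
  by have := ler_normD (s - t) (t - t0); rewrite addrA subrK; move: st td; lra.
apply/tderivP => t p e hp e0; have [pD pZ pA] := hp.
have [d d0 [A [cA AO cAt]]] := lc t.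
have [m [C H]] := pA A cA AO.
have [d1 [K [d10 K0 KP]]] := joint_taylor Wc t m jc cA.
have CK : 0 < `|C| * K + 1 by rewrite ltr_wpDl// mulr_ge0.
exists (Num.min (Num.min d d1) (e / (`|C| * K + 1))) => [|h].
  by rewrite !lt_min d0 d10 divr_gt0.
rewrite !lt_min => /andP[/andP[hd hd1] he].
have clA : closed A by apply: compact_closed => //; exact: norm_hausdorff.
have sub3 : supp (c (t + h) - c t - h *: c' t) `<=` A.
  apply: supp_sub => // x; apply: contraPP => Ax; apply/negP; rewrite negbK.
  rewrite !tfB tfZ !supp0 ?scaler0 ?subr0//.
  - by move=> /(supp' t A d d0 cA cAt).
  - by apply: contra_not Ax; apply: cAt; rewrite subrr normr0.
  - by apply: contra_not Ax; apply: cAt; rewrite addrAC subrr add0r.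
apply: (@le_trans _ _ (`|C| * (K * `|h| ^+ 2))).
  apply: (@le_trans _ _ (C * (K * `|h| ^+ 2))); last first.
    by rewrite ler_wpM2r ?ler_norm// mulr_ge0// exprn_ge0.
  apply: H => // s x sm.
  have [Ax|Ax] := pselect (A x); last first.
    rewrite (@pderivs_eq_open _ _ _ (~` A) _ (cst 0))//.
    - have -> : pderivs s (cst 0 : V -> W) = cst 0.
        by elim: s {sm} => //= i s ->; apply/funext => z; rewrite /pderiv derive_cst.
      by rewrite normr0 mulr_ge0// exprn_ge0.
    - exact: closed_openC.
    - by move=> z Az; apply: supp0 => /sub3.
  have E : (c (t + h) - c t - h *: c' t : D) =
     (fun z => 1 *: (1 *: c (t + h) z + -1 *: c t z) + - h *: c' t z) :> (V -> W).
    by apply/funext => z; rewrite !scale1r scaleN1r scaleNr.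
  rewrite E (pderivs_lin Wc openT)//; [|apply: csVD; apply: csVZ; exact: tf_csV|exact: tf_csV].
  rewrite (pderivs_lin Wc openT)//; [|exact: tf_csV|exact: tf_csV].
  by rewrite !scale1r scaleN1r scaleNr; exact: KP.
rewrite expr2 !mulrA ler_wpM2r//.
apply: (@le_trans _ _ ((`|C| * K + 1) * `|h|)); first by rewrite ler_wpM2r// lerDl.
by rewrite mulrC -ler_pdivlMr// ltW.
Qed.

Lemma good_curve_smooth c : good_curve c -> smooth_curve c.
Proof.
move=> gc.
pose T := {c | good_curve c}.
have step (x : T) : exists x' : T, tderiv (sval x) (sval x').
  by case: x => b /= /good_curve_deriv[c' [gc' cc' _]]; exists (exist _ c' gc').
have [nxt nxtP] := choice step.
exists (fun k => sval (iter k nxt (exist _ c gc))); split=> // k.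
exact: nxtP.
Qed.

Lemma smooth_curve_good c : smooth_curve c <-> good_curve c.
Proof.
split; last exact: good_curve_smooth.
by move=> sc; split; [exact: smooth_curve_joint|exact: smooth_curve_loc_supp].
Qed.

End test_function_curves.

(** * Smoothing kernels *)

Section product_curves.
Variables (R : realType) (E F : tvsType R).

Lemma smooth_curve_pair (c : R -> E) (d : R -> F) :
  smooth_curve c -> smooth_curve d -> smooth_curve (fun t => (c t, d t) : E * F).
Proof.
move=> [c' [<- cc']] [d' [<- dd']]; exists (fun k t => (c' k t, d' k t)); split=> // k t.
exact: (cvg_pair (cc' k t) (dd' k t)).
Qed.

Lemma smooth_curve_fst (c : R -> E * F) : smooth_curve c -> smooth_curve (fun t => (c t).1).
Proof.
move=> [c' [<- cc']]; exists (fun k t => (c' k t).1); split=> // k t.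
move=> U nU; apply: (cc' k t [set p | U p.1]).
by exists (U, setT) => [|p []//]; split=> //; exact: filterT.
Qed.

Lemma smooth_curve_snd (c : R -> E * F) : smooth_curve c -> smooth_curve (fun t => (c t).2).
Proof.
move=> [c' [<- cc']]; exists (fun k t => (c' k t).2); split=> // k t.
move=> U nU; apply: (cc' k t [set p | U p.2]).
by exists (setT, U) => [|p []//]; split=> //; exact: filterT.
Qed.

End product_curves.

Section kernels.
Variables (R : realType) (n : nat) (F : scalar_kind) (Om : set 'rV[R]_n).
Hypothesis oOm : open Om.
Local Notation V := 'rV[R]_n.
Local Notation K := (scalars R F).
Local Notation D := (testfun K Om).
Let Wc := @scalars_complete R F.
Implicit Types (phi psi : R -> V -> D) (S : D * V -> K).

Lemma hat_basicP S : hat_basic S <-> forall (f : R -> D) (x : R -> V),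
  smooth_curve f -> sm x -> (forall t, Om (x t)) -> sm (fun t => S (f t, x t)).
Proof.
split=> [sS f x sf sx xO|H c sc cO].
  apply/smooth_curveP; apply: (sS (fun t => (f t, x t))) => [|t]; last by split=> //=.
  by apply: smooth_curve_pair => //; exact/smooth_curveP.
apply/smooth_curveP.
apply: sm_ext (H (fun t => (c t).1) (fun t => (c t).2) (smooth_curve_fst sc) _ _) => [t||t].
- by rewrite /= -surjective_pairing.
- by apply/smooth_curveP; exact: smooth_curve_snd.
- by have [] := cO t.
Qed.

Definition kdom (e : R) (x : V) := [/\ 0 < e, e <= 1 & Om x].

Lemma kernel_smooth_curve phi : kernel_smooth phi <-> forall e x,
  sm e -> sm x -> (forall t, kdom (e t) (x t)) -> smooth_curve (fun t => phi (e t) (x t)).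
Proof.
split=> [sphi e x se sx ex|H c sc cO].
  apply: (sphi (fun t => (e t, x t))) => //.
  by apply: smooth_curve_pair; exact/smooth_curveP.
apply: (H (fun t => (c t).1) (fun t => (c t).2)) => //.
- by apply/smooth_curveP; exact: smooth_curve_fst.
- by apply/smooth_curveP; exact: smooth_curve_snd.
Qed.

(** [KA] and [KB] together express smoothness of a kernel without the topology of D(Om)
    ([kernel_smoothP]): joint smoothness in all variables, and supports locally contained in a fixed
    compact set. Constructions on kernels verify these two. *)
Definition KA phi := forall e x y, sm e -> sm x -> sm y ->
  (forall t, kdom (e t) (x t)) -> sm (fun t => phi (e t) (x t) (y t)).

Definition KB phi := forall e0 x0, kdom e0 x0 -> exists2 d : R, 0 < d & exists A : set V,
  [/\ compact A, A `<=` Om & forall e x, kdom e x -> `|e - e0| < d -> `|x - x0| < d ->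
     supp (phi e x) `<=` A].

Definition KS phi := KA phi /\ KB phi.

Lemma sm_close (c : R -> V) t (d : R) : sm c -> 0 < d -> exists2 r : R, 0 < r &
  forall s, `|s - t| < r -> `|c s - c t| < d.
Proof.
move=> sc d0; have /cvgrPdist_lt/(_ d d0)/nbhs_ballP[r /= r0 rP] :=
  smo_derivable_continuous sc (t := t) I.
by exists r => // s st; rewrite distrC; apply: rP; rewrite /ball/= distrC.
Qed.

Lemma sm_closeR (c : R -> R) t (d : R) : sm c -> 0 < d -> exists2 r : R, 0 < r &
  forall s, `|s - t| < r -> `|c s - c t| < d.
Proof.
move=> sc d0; have /nbhs_ballP[r /= r0 rP] := sm_near t sc d0.
by exists r => // s st; apply: rP; rewrite /ball/= distrC.
Qed.

Lemma KS_kernel_smooth phi : KS phi -> kernel_smooth phi.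
Proof.
move=> [ka kb]; apply/kernel_smooth_curve => e x se sx ex.
apply: (good_curve_smooth Wc); split.
  move=> a y sa sy; apply: (ka (fun t => e (a t)) (fun t => x (a t)) y) => //; exact: sm_comp.
move=> t0; have [d d0 [A [cA AO dA]]] := kb _ _ (ex t0).
have [r1 r10 r1P] := sm_closeR t0 se d0; have [r2 r20 r2P] := sm_close t0 sx d0.
exists (Num.min r1 r2); first by rewrite lt_min r10.
exists A; split=> // t; rewrite lt_min => /andP[t1 t2].
by apply: dA; [exact: ex|exact: r1P|exact: r2P].
Qed.

(** Otherwise a smooth curve in (e, x) would run through points where the support escapes from all
    compact sets, against [smooth_curve_escape]. The parameter domain is not open at e = 1. The
    curve stays in it because each coordinate is displaced by a fraction in [0, 1] of a displacement
    towards one of the chosen points. *)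
Lemma kernel_smooth_KB phi : kernel_smooth phi -> KB phi.
Proof.
move=> /kernel_smooth_curve sphi e0 x0 ex0; apply: contrapT => nE.
have [e00 e01 Ox0] := ex0.
have /nbhs_ballP[r /= r0 rO] : nbhs x0 Om by exact: open_nbhs_nbhs.
(* The exponential makes the displacements rapidly decreasing, and [r] keeps x in a ball inside
   [Om]. *)
pose del k : R := Num.min (expR (- k.+1%:R)) r.
have del0 k : 0 < del k by rewrite lt_min expR_gt0.
have H k : exists q : R * V * V, [/\ kdom q.1.1 q.1.2, `|q.1.1 - e0| < del k,
    `|q.1.2 - x0| < del k, ~ exh Om k q.2 & phi q.1.1 q.1.2 q.2 != 0].
  apply: contrapT => nk; apply: nE; exists (del k) => //.
  exists (exh Om k); split=> [||e x ex ek xk]; [exact: exh_compact|exact: exh_sub|].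
  apply: contrapT => /not_supp_exh[y [yk py]]; apply: nk.
  by exists (e, x, y).
have [q qP] := choice H.
have s1 : 1 <= (fun k => k.+1%:R : R) 0%N by [].
have sS k : (fun k => k.+1%:R : R) k + 1 <= (fun k => k.+1%:R : R) k.+1 by rewrite /= natr1.
have rp0 : rapidseq (fun k => k.+1%:R) (fun=> 0 : R).
  by move=> m; exists 0 => k; rewrite normr0 mul0r.
have curve (p : nat -> R) : (forall k, `|p k| < del k) -> exists G : R -> R, [/\ sm G,
    forall k, G k.+1%:R^-1 = p k, G 0 = 0 &
    forall t, G t = 0 \/ exists k a, [/\ 0 <= a, a <= 1 & G t = a * p k]].
  move=> pd; have [|G [sG GE G0 Gc]] := special_curve s1 sS (p := p) (w := fun=> 0) _ rp0.
    apply: (@rapidseq_exp _ _ 1) => k; rewrite mul1r.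
    by have := pd k; rewrite lt_min => /andP[/ltW].
  exists G; split=> // [k||]; last by apply: Gc.
    by have := GE k 0; rewrite normr0 addr0 mul0r addr0; apply; rewrite invr_ge0.
  exact: G0.
have [G [sG GE G0 Gc]] := curve (fun k => (q k).1.1 - e0) (fun k => let: And5 _ h _ _ _ := qP k in h).
have Hx i : exists G : R -> R, [/\ sm G,
    forall k, G k.+1%:R^-1 = (q k).1.2 0 i - x0 0 i, G 0 = 0 &
    forall t, G t = 0 \/ exists k a, [/\ 0 <= a, a <= 1 & G t = a * ((q k).1.2 0 i - x0 0 i)]].
  apply: curve => k; have [_ _ + _ _] := qP k; apply: le_lt_trans.
  by have := coord_le ((q k).1.2 - x0) i; rewrite !mxE.
have [Gx GxP] := choice Hx.
pose e t := e0 + G t; pose x t : V := \row_i (x0 0 i + Gx i t).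
have se : sm e by apply: smoD => //; [exact: openT|exact/smo_cst/openT].
have sx : sm x.
  apply: sm_row => i; apply: smoD; [exact: openT|exact/smo_cst/openT|].
  by have [] := GxP i.
have ex t : kdom (e t) (x t).
  split.
  - rewrite /e; have [->|[k [a [a0 a1 ->]]]] := Gc t; first by rewrite addr0.
    have [[q0 q1 _] _ _ _ _] := qP k.
    have -> : e0 + a * ((q k).1.1 - e0) = (1 - a) * e0 + a * (q k).1.1 by ring.
    have [->|an] := eqVneq a 0; first by rewrite subr0 mul1r mul0r addr0.
    by rewrite ltr_wpDl// ?mulr_ge0 ?subr_ge0 ?(ltW e00)// mulr_gt0// lt_neqAle eq_sym an.
  - rewrite /e; have [->|[k [a [a0 a1 ->]]]] := Gc t; first by rewrite addr0.
    have [[q0 q1 _] _ _ _ _] := qP k.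
    have -> : e0 + a * ((q k).1.1 - e0) = (1 - a) * e0 + a * (q k).1.1 by ring.
    have : (1 - a) * e0 <= (1 - a) by rewrite ler_piMr// subr_ge0.
    have : a * (q k).1.1 <= a by rewrite ler_piMr.
    by lra.
  - apply: rO; rewrite -ball_normE /=; apply: norm_lt => // i; rewrite !mxE.
    rewrite opprD addrA subrr add0r normrN.
    have [_ _ _ /(_ t)[->|[k [a [a0 a1 ->]]]]] := GxP i; first by rewrite normr0.
    have [_ _ qx _ _] := qP k.
    rewrite normrM (ger0_norm a0); apply: (@le_lt_trans _ _ `|(q k).1.2 0 i - x0 0 i|).
      by rewrite ler_piMl.
    have := coord_le ((q k).1.2 - x0) i; rewrite !mxE => H1.
    by rewrite (le_lt_trans H1)// (lt_le_trans qx)// ge_min lexx orbT.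
have sc := sphi e x se sx ex.
have [||k Ek] := smooth_curve_escape oOm (t0 := 0) (tau := fun k => k.+1%:R^-1) (y := fun k => (q k).2) sc.
- move=> d /inv_nat_small[N NP]; exists N => k /NP.
  by rewrite subr0 ger0_norm// invr_ge0.
- by move=> k; have [] := qP k.
- have [_ _ _ _] := qP k; rewrite -Ek => /eqP; apply; congr (tf_val (phi _ _) _).
    by rewrite /e GE addrC subrK.
  apply/rowP => i; rewrite mxE; have [_ -> _ _] := GxP i.
  by rewrite addrC subrK.
Qed.

Lemma kernel_smoothP phi : kernel_smooth phi <-> KS phi.
Proof.
split; last exact: KS_kernel_smooth.
move=> sphi; split; last exact: kernel_smooth_KB.
move=> e x y se sx sy ex.
have sc := (kernel_smooth_curve phi).1 sphi e x se sx ex.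
exact: (smooth_curve_joint Wc sc (smo_id openT) sy).
Qed.

Definition keq phi psi := forall e x, kdom e x -> phi e x = psi e x.

Lemma KS_eq phi psi : keq phi psi -> KS phi -> KS psi.
Proof.
move=> pp [ka kb]; split=> [e x y se sx sy ex|e0 x0 ex0].
  by apply: sm_ext (ka e x y se sx sy ex) => t; rewrite pp.
have [d d0 [A [cA AO dA]]] := kb e0 x0 ex0; exists d => //; exists A; split=> // e x ex.
by rewrite -pp//; exact: dA.
Qed.

(** The sup norm separates points of D(Om), so limits are unique and [xget] has no choice. *)
Lemma tderiveE (f : V -> D) x v (l : D) :
  h^-1 *: (f (x + h *: v) - f x) @[h --> 0^'] --> l -> tderive f x v = l.
Proof.
move=> fl; rewrite /tderive; case: xgetP => [l' _ /= fl'|/(_ l)//].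
apply: tf_eq => y; apply/eqP; rewrite -subr_eq0 -normr_le0.
apply/ler_addgt0Pr => e e0; rewrite add0r.
have e20 : 0 < e / 2 by rewrite divr_gt0.
have hp := sup_norm_seminorm K Om.
pose q h : D := h^-1 *: (f (x + h *: v) - f x).
have H1 : \forall h \near (0 : R)^', lf_ball (@sup_norm _ _ _ _) l (e / 2) (q h) := fl _ (lf_nbhs_ball l hp e20).
have H2 : \forall h \near (0 : R)^', lf_ball (@sup_norm _ _ _ _) l' (e / 2) (q h) := fl' _ (lf_nbhs_ball l' hp e20).
have [h [h1 h2]] := filter_ex (filterI H1 H2).
rewrite (le_trans (ler_distD (q h y) _ _))//.
rewrite [leRHS]splitr lerD//.
  by rewrite distrC -tfB (le_trans (sup_norm_ge _ _))// ltW.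
by rewrite -tfB (le_trans (sup_norm_ge _ _))// ltW.
Qed.

Lemma basisv_le1 i : `|basisv R i : V| <= 1.
Proof.
apply: norm_le => // j; rewrite mxE.
by case: (_ && _); rewrite ?normr1 ?normr0.
Qed.

Lemma ball_line x r s i : `|s| < r -> ball (x : V) r (x + s *: basisv R i).
Proof.
move=> sr; rewrite -ball_normE /= opprD addrA subrr add0r normrN normrZ.
by rewrite (le_lt_trans _ sr)// ler_piMr// basisv_le1.
Qed.

Lemma open2_line (x : R -> V) (v : V) : sm x -> open2 (fun t s => Om (x t + s *: v)).
Proof.
move=> sx; have sv : sm (fun=> v) by exact/smo_cst/openT.
exact: (csV_line oOm (@csV_cst R n R Om 0) sx sv).1.
Qed.

Lemma kernel_cs2 phi e x y i : KA phi -> sm e -> sm x -> sm y ->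
  (forall t, kdom (e t) (x t)) ->
  cs2_on (fun t s => Om (x t + s *: basisv R i)) (fun t s => phi (e t) (x t + s *: basisv R i) (y t)).
Proof.
move=> ka se sx sy ex a b sa sb ab.
apply: (ka (fun t => e (a t)) (fun t => x (a t) + b t *: basisv R i) (fun t => y (a t))).
- exact: sm_comp.
- apply: smoD; [exact: openT|exact: sm_comp|].
  by apply: smo_scale sb _; [exact: openT|exact: (smo_cst _ openT)].
- exact: sm_comp.
- by move=> t; have [? ? _] := ex (a t); split.
Qed.

Lemma dx_limit phi e x i : KS phi -> kdom e x -> exists l : D,
  h^-1 *: (phi e (x + h *: basisv R i) - phi e x) @[h --> 0^'] --> l /\
  forall y, l y = pderiv i (fun x' => phi e x' y) x.
Proof.
move=> ks [e0 e1 Ox].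
have /nbhs_ballP[r /= r0 rO] : nbhs x Om by exact: open_nbhs_nbhs.
pose c s := phi e (x + clamp r s *: basisv R i).
have sc : smooth_curve c.
  have /kernel_smoothP/kernel_smooth_curve H := ks; apply: (H (fun=> e)).
  - exact/smo_cst/openT.
  - apply: smoD; [exact: openT|exact: (smo_cst _ openT)|].
    apply: smo_scale; [exact: openT|exact: sm_clamp|exact: (smo_cst _ openT)].
  - by move=> t; split=> //; apply: rO; apply: ball_line; exact: clamp_lt.
have [c' [_ cc' c'E]] := good_curve_deriv Wc ((smooth_curve_good Wc oOm c).1 sc).
have r60 : 0 < r / 6 by rewrite divr_gt0.
have cE h : `|h| < r / 6 -> c h = phi e (x + h *: basisv R i).
  by move=> hr; rewrite /c clamp_id// ltW.
have c0 : c 0 = phi e x by rewrite cE ?normr0// scale0r addr0.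
exists (c' 0); split=> [U nU|y].
  have := cc' 0 U nU; rewrite c0 /= !near_simpl => H.
  have : \forall h \near (0 : R)^', `|h| < r / 6.
    apply/nbhs_ballP; exists (r / 6) => //= h.
    by rewrite /ball/= sub0r normrN.
  by move: H; apply: filterS2 => h /=; rewrite add0r => Uh /cE <-.
rewrite c'E /dt /pderiv -(derive1_line0 (fun x' => phi e x' y)).
apply: near_derive1_eq; have := nbhs_norm_lt 0 r60; apply: filterS => s.
by rewrite subr0 => /cE ->.
Qed.

(** The limit in D(Om) is computed pointwise in y, which reduces identities between kernels to
    identities between partial derivatives of ordinary functions. *)
Lemma dxE phi e x y i : KS phi -> kdom e x ->
  kernel_dx i phi e x y = pderiv i (fun x' => phi e x' y) x.
Proof.
by move=> ks ex; have [l [/tderiveE + lE]] := dx_limit i ks ex; rewrite /kernel_dx => ->.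
Qed.

Lemma kernel_csV phi e y : KA phi -> 0 < e -> e <= 1 -> csV Om (fun x => phi e x y).
Proof.
by move=> ka e0 e1 c sc Oc; apply: (ka (fun=> e) c (fun=> y)) => //; exact/smo_cst/openT.
Qed.

Lemma KS_dx phi i : KS phi -> KS (kernel_dx i phi).
Proof.
move=> ks; have [ka kb] := ks; split=> [e x y se sx sy ex|e0 x0 ex0].
  have Ox t : Om (x t + 0 *: basisv R i) by rewrite scale0r addr0; have [] := ex t.
  have := cs2_on_d2 Wc (open2_line sx) (kernel_cs2 (i := i) ka se sx sy ex) (smo_id openT) (smo_cst 0 openT) Ox.
  apply: sm_ext => t; rewrite dxE// /d2.
  exact: (derive1_line0 (fun x' => phi (e t) x' (y t))).
have [d d0 [A [cA AO dA]]] := kb _ _ ex0.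
exists d => //; exists A; split=> // e x ex ed xd.
apply: supp_sub; first by apply: compact_closed => //; exact: norm_hausdorff.
move=> y; apply: contraPP => Ay; apply/negP; rewrite negbK dxE// /pderiv.
have [ex0' ex1 Ox] := ex.
rewrite (near_eq_derive (g := cst 0)) ?derive_cst//.
have nO : nbhs x Om by exact: open_nbhs_nbhs.
have nx : nbhs x [set z | `|z - x0| < d].
  apply/nbhs_ballP; exists (d - `|x - x0|) => /=; first by rewrite subr_gt0.
  move=> z; rewrite -ball_normE /= distrC => zx.
  by rewrite (le_lt_trans (ler_distD x z x0))// -ltrBrDr.
by apply: filterS2 nO nx => z Oz zd; apply: supp0; apply: contra_not Ay; apply: dA.
Qed.

Lemma KS_dy phi i : KS phi -> KS (kernel_dy i phi).
Proof.
move=> [ka kb]; split=> [e x y se sx sy ex|e0 x0 ex0].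
  have sg : cs2 (fun t s => phi (e t) (x t) (y t + s *: basisv R i)).
    move=> a b sa sb.
    apply: (ka (fun t => e (a t)) (fun t => x (a t)) (fun t => y (a t) + b t *: basisv R i)) => //.
    - exact: sm_comp.
    - exact: sm_comp.
    - apply: smoD; [exact: openT|exact: sm_comp|].
      by apply: smo_scale sb _; [exact: openT|exact: (smo_cst _ openT)].
  have := cs2_d2 Wc sg (smo_id openT) (smo_cst 0 openT).
  apply: sm_ext => t; exact: (derive1_line0 (phi (e t) (x t))).
have [d d0 [A [cA AO dA]]] := kb _ _ ex0.
exists d => //; exists A; split=> // e x ex ed xd.
by apply: subset_trans (dA e x ex ed xd); exact: supp_pderiv.
Qed.

Definition kplus phi psi : R -> V -> D := fun e x => phi e x + psi e x.
Definition kscale (a : R -> V -> R) phi : R -> V -> D := fun e x => a e x *: phi e x.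

Definition coef (a : R -> V -> R) := forall e x, sm e -> sm x ->
  (forall t, kdom (e t) (x t)) -> sm (fun t => a (e t) (x t)).

Lemma KS_add phi psi : KS phi -> KS psi -> KS (kplus phi psi).
Proof.
move=> [ka kb] [la lb]; split=> [e x y se sx sy ex|e0 x0 ex0].
  by apply: smoD; [exact: openT|exact: ka|exact: la].
have [d d0 [A [cA AO dA]]] := kb _ _ ex0; have [d' d0' [A' [cA' AO' dA']]] := lb _ _ ex0.
exists (Num.min d d'); first by rewrite lt_min d0.
exists (A `|` A'); split=> [||e x ex]; [exact: compactU|by rewrite subUset|].
rewrite !lt_min => /andP[ed ed'] /andP[xd xd'].
apply: supp_sub.
  by apply: compact_closed; [exact: norm_hausdorff|exact: compactU].
move=> y; apply: contraPP => /not_orP[Ay Ay']; apply/negP; rewrite negbK /kplus tfD.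
rewrite supp0; last by apply: contra_not Ay; exact: dA.
by rewrite supp0 ?addr0//; apply: contra_not Ay'; exact: dA'.
Qed.

Lemma KS_scale a phi : coef a -> KS phi -> KS (kscale a phi).
Proof.
move=> sa [ka kb]; split=> [e x y se sx sy ex|e0 x0 ex0].
  by apply: smo_scale; [exact: openT|exact: sa|exact: ka].
have [d d0 [A [cA AO dA]]] := kb _ _ ex0.
exists d => //; exists A; split=> // e x ex ed xd.
apply: supp_sub; first by apply: compact_closed => //; exact: norm_hausdorff.
move=> y; apply: contraPP => Ay; apply/negP; rewrite negbK /kscale tfZ.
by rewrite (supp0 (f := phi e x) (x := y)) ?scaler0//; apply: contra_not Ay; exact: dA.
Qed.

Lemma KS_dxy phi i : KS phi -> KS (kernel_dxy i phi).
Proof. by move=> ks; apply: KS_add; [exact: KS_dx|exact: KS_dy]. Qed.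

Lemma near_Om x (P : V -> Prop) : Om x -> (forall y, Om y -> P y) -> \forall y \near x, P y.
Proof. by move=> Ox OP; have : nbhs x Om by [exact: open_nbhs_nbhs]; apply: filterS. Qed.

Lemma keq_dx phi psi i : KS phi -> keq phi psi -> keq (kernel_dx i phi) (kernel_dx i psi).
Proof.
move=> ks pp e x ex; have ks' := KS_eq pp ks; apply: tf_eq => y; rewrite !dxE//.
have [e0 e1 Ox] := ex; apply: near_eq_derive; apply: near_Om => // z Oz.
by rewrite pp.
Qed.

Lemma keq_dy phi psi i : keq phi psi -> keq (kernel_dy i phi) (kernel_dy i psi).
Proof. by move=> pp e x ex; rewrite /kernel_dy pp. Qed.

Lemma keq_dxy phi psi i : KS phi -> keq phi psi -> keq (kernel_dxy i phi) (kernel_dxy i psi).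
Proof. by move=> ks pp e x ex; rewrite /kernel_dxy (keq_dx i ks pp ex) (keq_dy i pp ex). Qed.

Lemma keq_trans phi psi chi : keq phi psi -> keq psi chi -> keq phi chi.
Proof. by move=> pq qr e x ex; rewrite pq// qr. Qed.

Lemma keq_sym phi psi : keq phi psi -> keq psi phi.
Proof. by move=> pq e x ex; rewrite pq. Qed.

Lemma dx_add phi psi i : KS phi -> KS psi ->
  keq (kernel_dx i (kplus phi psi)) (kplus (kernel_dx i phi) (kernel_dx i psi)).
Proof.
move=> ks ls e x ex; apply: tf_eq => y; have [e0 e1 Ox] := ex.
rewrite tfD !dxE//; last exact: KS_add.
apply: (pderivD Wc oOm) => //; [exact: kernel_csV ks.1 e0 e1|exact: kernel_csV ls.1 e0 e1].
Qed.

Lemma dy_add phi psi i e x :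
  kernel_dy i (kplus phi psi) e x = kplus (kernel_dy i phi) (kernel_dy i psi) e x.
Proof. exact: testfun_pderivD. Qed.

Lemma coef_csV a e : coef a -> 0 < e -> e <= 1 -> csV Om (a e).
Proof. by move=> sa e0 e1 c sc Oc; apply: (sa (fun=> e)) => //; exact/smo_cst/openT. Qed.

Lemma dx_scale a phi i : coef a -> KS phi ->
  keq (kernel_dx i (kscale a phi))
      (kplus (kscale a (kernel_dx i phi)) (kscale (fun e => pderiv i (a e)) phi)).
Proof.
move=> sa ks e x ex; apply: tf_eq => y; have [e0 e1 Ox] := ex.
rewrite tfD !tfZ !dxE//; last exact: KS_scale.
by apply: (pderiv_scale Wc oOm) => //; [exact: coef_csV|exact: kernel_csV ks.1 e0 e1].
Qed.

Lemma dy_scale a phi i e x :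
  kernel_dy i (kscale a phi) e x = kscale a (kernel_dy i phi) e x.
Proof. exact: testfun_pderivZ. Qed.

Lemma coef_pderiv a i : coef a -> coef (fun e => pderiv i (a e)).
Proof.
move=> sa e x se sx ex.
have hs : cs2_on (fun t s => Om (x t + s *: basisv R i)) (fun t s => a (e t) (x t + s *: basisv R i)).
  move=> b c sb sc bc; apply: (sa (fun t => e (b t)) (fun t => x (b t) + c t *: basisv R i)).
  - exact: sm_comp.
  - apply: smoD; [exact: openT|exact: sm_comp|].
    by apply: smo_scale sc _; [exact: openT|exact: (smo_cst _ openT)].
  - by move=> t; have [? ? _] := ex (b t); split.
have Ox t : Om (x t + 0 *: basisv R i) by rewrite scale0r addr0; have [] := ex t.
have := cs2_on_d2 (@real_seq_complete R) (open2_line sx) hs (smo_id openT) (smo_cst 0 openT) Ox.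
by apply: sm_ext => t; exact: (derive1_line0 (a (e t))).
Qed.

Lemma dx_comm phi i j : KS phi ->
  keq (kernel_dx i (kernel_dx j phi)) (kernel_dx j (kernel_dx i phi)).
Proof.
move=> ks e x ex; apply: tf_eq => y; have [e0 e1 Ox] := ex.
have H k l : kernel_dx k (kernel_dx l phi) e x y = pderiv k (pderiv l (fun x' => phi e x' y)) x.
  rewrite dxE//; last exact: KS_dx.
  by apply: near_eq_derive; apply: near_Om => // z Oz; rewrite dxE.
apply: etrans (H i j) _; apply: etrans _ (esym (H j i)).
exact: (csV_schwarz Wc oOm (basisv R i) (basisv R j) (kernel_csV y ks.1 e0 e1) Ox).
Qed.

Lemma dy_comm phi i j e x : kernel_dy i (kernel_dy j phi) e x = kernel_dy j (kernel_dy i phi) e x.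
Proof.
apply: tf_eq => y.
exact: (csV_schwarz Wc openT (basisv R i) (basisv R j) (tf_csV (phi e x)) I).
Qed.

Lemma dxdy_comm phi i j : KS phi ->
  keq (kernel_dx i (kernel_dy j phi)) (kernel_dy j (kernel_dx i phi)).
Proof.
move=> ks e x ex; apply: tf_eq => y; have [e0 e1 Ox] := ex.
rewrite dxE//; last exact: KS_dy.
pose A (s r : R) := Om (x + s *: basisv R i).
pose g s r := phi e (x + s *: basisv R i) (y + r *: basisv R j).
have oA : open2 A.
  have oL : open2 (fun t s => Om ((fun=> x) t + s *: basisv R i)) := open2_line (smo_cst x openT).
  move=> s r Asr; have [d d0 dP] := oL r s Asr.
  by exists d => // s' r' sd rd; exact: (dP r' s').
have sg : cs2_on A g.
  move=> a b sa sb ab; apply: (ks.1 (fun=> e) (fun t => x + a t *: basisv R i) (fun t => y + b t *: basisv R j)).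
  - exact/smo_cst/openT.
  - apply: smoD; [exact: openT|exact: (smo_cst _ openT)|].
    by apply: smo_scale sa _; [exact: openT|exact: (smo_cst _ openT)].
  - apply: smoD; [exact: openT|exact: (smo_cst _ openT)|].
    by apply: smo_scale sb _; [exact: openT|exact: (smo_cst _ openT)].
  - by move=> t; split=> //; exact: ab.
have A0 : A 0 0 by rewrite /A scale0r addr0.
have := cs2_on_schwarz Wc oA sg A0; rewrite /d1 /d2 /g.
have -> : (fun s : R => derive1 (fun r : R => phi e (x + s *: basisv R i) (y + r *: basisv R j)) 0)
   = (fun s : R => (fun x' => kernel_dy j phi e x' y) (x + s *: basisv R i)).
  by apply/funext => s; exact: (derive1_line0 (phi e (x + s *: basisv R i))).
rewrite (derive1_line0 (fun x' => kernel_dy j phi e x' y) x) => H; apply: etrans H _.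
have -> : (fun r : R => derive1 (fun s : R => phi e (x + s *: basisv R i) (y + r *: basisv R j)) 0)
   = (fun r : R => kernel_dx i phi e x (y + r *: basisv R j)).
  apply/funext => r; rewrite dxE//.
  exact: (derive1_line0 (fun x' => phi e x' (y + r *: basisv R j))).
exact: (derive1_line0 (kernel_dx i phi e x)).
Qed.

Lemma dxy_add phi psi i : KS phi -> KS psi ->
  keq (kernel_dxy i (kplus phi psi)) (kplus (kernel_dxy i phi) (kernel_dxy i psi)).
Proof.
move=> ks ls e x ex; rewrite /kernel_dxy (dx_add i ks ls ex) dy_add.
by rewrite /kplus addrACA.
Qed.

Lemma dxy_scale a phi i : coef a -> KS phi ->
  keq (kernel_dxy i (kscale a phi))
      (kplus (kscale a (kernel_dxy i phi)) (kscale (fun e => pderiv i (a e)) phi)).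
Proof.
move=> sa ks e x ex; rewrite /kernel_dxy (dx_scale i sa ks ex) dy_scale.
by rewrite /kplus /kscale scalerDr addrAC.
Qed.

Lemma dxydy_comm phi i j : KS phi ->
  keq (kernel_dxy i (kernel_dy j phi)) (kernel_dy j (kernel_dxy i phi)).
Proof.
move=> ks e x ex; rewrite /kernel_dxy (dxdy_comm i j ks ex) dy_comm.
by rewrite /kernel_dy testfun_pderivD.
Qed.

Lemma dxy_comm phi i j : KS phi ->
  keq (kernel_dxy i (kernel_dxy j phi)) (kernel_dxy j (kernel_dxy i phi)).
Proof.
move=> ks e x ex.
have E k l : kernel_dxy k (kernel_dxy l phi) e x =
    (kernel_dx k (kernel_dx l phi) e x + kernel_dx k (kernel_dy l phi) e x) +
    kernel_dy k (kernel_dxy l phi) e x.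
  by rewrite {1}/kernel_dxy (dx_add k (KS_dx l ks) (KS_dy l ks) ex).
rewrite !E (dx_comm i j ks ex) -!(dxydy_comm _ _ ks ex) /kernel_dxy dy_comm.
exact: addrACA.
Qed.

End kernels.

(** * Iterated derivatives indexed by words *)

Section words.
Variable n : nat.
Implicit Types (s : seq 'I_n) (al : 'I_n -> nat).

(** Words let inductions add one derivative at a time; this one lists the directions in the fixed
    order of [mindex_iter]. *)
Definition word al : seq 'I_n := flatten [seq nseq (al i) i | i <- enum 'I_n].

Lemma mindex_iter_word (T : Type) (D : 'I_n -> T -> T) al f :
  mindex_iter D al f = foldr D f (word al).
Proof.
rewrite /mindex_iter /word; elim: (enum 'I_n) => //= i r ->.
by rewrite foldr_cat; elim: (al i) => //= k ->.
Qed.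

Lemma count_word al i : count_mem i (word al) = al i.
Proof.
rewrite /word count_flatten -map_comp sumnE big_map big_enum /=.
rewrite (bigD1 i)//= count_nseq /= eqxx mul1n big1 ?addn0// => j ji.
by rewrite count_nseq /= (negbTE ji).
Qed.

Lemma perm_word s : perm_eq s (word (fun i => count_mem i s)).
Proof.
apply/allP => i _ /=; by rewrite count_word.
Qed.

Lemma size_word al : size (word al) = mindex_order al.
Proof.
rewrite /word size_flatten /shape -map_comp sumnE big_map big_enum /=.
by apply: eq_bigr => i _; rewrite /= size_nseq.
Qed.

Section commuting.
Variables (T : Type) (P : T -> Prop) (eqv : T -> T -> Prop) (D : 'I_n -> T -> T).
Hypotheses (eqvxx : forall f, eqv f f) (eqvC : forall f g, eqv f g -> eqv g f)
  (eqvT : forall f g h, eqv f g -> eqv g h -> eqv f h)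
  (PD : forall i f, P f -> P (D i f))
  (eqvD : forall i f g, P f -> P g -> eqv f g -> eqv (D i f) (D i g))
  (DC : forall i j f, P f -> eqv (D i (D j f)) (D j (D i f))).

Lemma foldr_P f s : P f -> P (foldr D f s).
Proof. by move=> Pf; elim: s => //= i s; exact: PD. Qed.

Lemma foldr_pull f s1 i s2 : P f ->
  eqv (foldr D f (s1 ++ i :: s2)) (D i (foldr D f (s1 ++ s2))).
Proof.
move=> Pf; elim: s1 => [|j s1 ih] /=; first exact: eqvxx.
apply: (eqvT (g := D j (D i (foldr D f (s1 ++ s2))))).
  by apply: eqvD => //; [exact: foldr_P|apply: PD; exact: foldr_P].
by apply: DC; exact: foldr_P.
Qed.

(** The derivatives in question commute only on smooth objects and only up to equality on the
    domain, hence the invariant [P] and the relation [eqv]. *)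
Lemma foldr_perm f s1 s2 : P f -> perm_eq s1 s2 -> eqv (foldr D f s1) (foldr D f s2).
Proof.
move=> Pf; elim: s1 s2 => [|i s1 ih] s2 p12.
  by move: p12; rewrite perm_sym => /perm_nilP ->.
have is2 : i \in s2 by rewrite -(perm_mem p12) mem_head.
move: p12; case/path.splitPr: is2 => a b p12.
apply: eqvT (eqvC (foldr_pull a i b Pf)) => /=.
apply: eqvD; [exact: foldr_P|exact: foldr_P|apply: ih].
by move: p12; rewrite perm_sym -cat1s perm_catCA perm_cons perm_sym.
Qed.
End commuting.
End words.

(** * Multiplication of kernels by functions of y *)

Section multiplication.
Variables (R : realType) (n : nat) (F : scalar_kind) (Om : set 'rV[R]_n).
Hypothesis oOm : open Om.
Local Notation V := 'rV[R]_n.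
Local Notation K := (scalars R F).
Local Notation D := (testfun K Om).
Let Wc := @scalars_complete R F.
Implicit Types (phi psi : R -> V -> D) (b : V -> R).

(** The factor [b] is smooth on [Om] only, while [y] may leave [Om]. Near a time when it is outside,
    the supports lie in a compact subset of [Om] that [y] avoids, so the product vanishes. *)
Lemma mul_curve b (c : R -> D) y : csV Om b -> smooth_curve c -> sm y ->
  sm (fun t => b (y t) *: c t (y t)).
Proof.
move=> sb sc sy; apply: sm_of_near => t.
have sct : sm (fun t => c t (y t)) by exact: (smooth_curve_joint Wc sc (smo_id openT) sy).
have [Oy|Oy] := pselect (Om (y t)).
  have [B [sB nB]] := csV_loc oOm sb Oy.
  exists (fun t => B (y t) *: c t (y t)).
    by apply: smo_scale => //; [exact: openT|exact: sB].
  have nBy : \forall s \near t, Om (y s) /\ B (y s) = b (y s) :=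
    smo_derivable_continuous sy (t := t) I nB.
  by apply: filterS nBy => s [_ ->].
exists (fun=> 0); first exact: (smo_cst _ openT).
have [d d0 [A [cA AO dA]]] := smooth_curve_loc_supp oOm sc t.
have clA : closed A by apply: compact_closed => //; exact: norm_hausdorff.
have nA' : nbhs (y t) (~` A).
  by apply: open_nbhs_nbhs; split; [exact: closed_openC|apply: contra_not Oy; exact: AO].
have nA : \forall s \near t, ~ A (y s) := smo_derivable_continuous sy (t := t) I nA'.
have nt := nbhs_norm_lt t d0.
apply: filterS2 nA nt => s As st; rewrite (supp0 (f := c s) (x := y s)) ?scaler0//.
by apply: contra_not As; exact: dA.
Qed.

Lemma smooth_curve_cst (f : D) : smooth_curve (fun=> f : D).
Proof.
apply: (good_curve_smooth Wc); split=> [a y sa sy|t0].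
  exact: (tf_csV f sy).
by exists 1 => //; exists (supp f); have [_ cf fO] := testfunP f; split=> // t _.
Qed.

Lemma tf_mulP b (f : D) : csV Om b -> (fun y => b y *: f y) \in testfuns Om.
Proof.
move=> sb; have [_ cf fO] := testfunP f.
apply: (@testfuns_sub _ _ _ _ (supp f)) => //; last first.
  move=> x; apply: contraPP => fx; apply/negP.
  by rewrite negbK (supp0 (f := f) (x := x))// scaler0.
apply: (csV_smooth_on Wc openT) => c sc _.
exact: (mul_curve sb (smooth_curve_cst f) sc).
Qed.

Definition tf_mul b (sb : csV Om b) (f : D) : D := TestFun (tf_mulP f sb).

Lemma supp_mul b (sb : csV Om b) f : supp (tf_mul sb f) `<=` supp f.
Proof.
apply: supp_sub; first exact: supp_closed.
move=> x; apply: contraPP => fx; apply/negP.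
by rewrite negbK /= (supp0 (f := f) (x := x))// scaler0.
Qed.

Definition kmul b (sb : csV Om b) phi : R -> V -> D := fun e x => tf_mul sb (phi e x).

Lemma KS_mul b (sb : csV Om b) phi : KS phi -> KS (kmul sb phi).
Proof.
move=> ks; have [ka kb] := ks; split=> [e x y se sx sy ex|e0 x0 ex0].
  have /(kernel_smoothP oOm)/kernel_smooth_curve sc := ks.
  exact: (mul_curve sb (sc e x se sx ex) sy).
have [d d0 [A [cA AO dA]]] := kb _ _ ex0; exists d => //; exists A; split=> // e x ex ed xd.
by apply: subset_trans (dA e x ex ed xd); exact: supp_mul.
Qed.

Lemma dx_mul b (sb : csV Om b) phi i : KS phi ->
  keq (kernel_dx i (kmul sb phi)) (kmul sb (kernel_dx i phi)).
Proof.
move=> ks e x ex; apply: tf_eq => y; have [e0 e1 Ox] := ex.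
rewrite (dxE oOm)//; last exact: KS_mul.
rewrite /= (dxE oOm)//.
exact: (pderivZ Wc oOm i (b y) (kernel_csV y ks.1 e0 e1) Ox).
Qed.

Lemma dy_mul b (sb : csV Om b) phi i e x :
  kernel_dy i (kmul sb phi) e x =
  kplus (kmul sb (kernel_dy i phi)) (kmul (csV_pderiv (@real_seq_complete R) oOm i sb) phi) e x.
Proof.
apply: tf_eq => y; rewrite tfD /=.
have [Oy|Oy] := pselect (Om y).
  apply: (pderiv_scale Wc oOm i sb _ Oy).
  by apply: csV_sub (tf_csV (phi e x)).
have [_ _ fO] := testfunP (phi e x).
have ny : ~ supp (phi e x) y by apply: contra_not Oy; exact: fO.
have nz := near_supp0 ny.
rewrite /pderiv (near_eq_derive (g := cst 0)); last first.
  by apply: filterS nz => z ->; rewrite scaler0.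
rewrite derive_cst (nbhs_singleton nz) scaler0 addr0.
by rewrite (near_eq_derive (f := phi e x) (g := cst 0))// derive_cst scaler0.
Qed.

Lemma dxy_mul b (sb : csV Om b) phi i : KS phi ->
  keq (kernel_dxy i (kmul sb phi))
   (kplus (kmul sb (kernel_dxy i phi)) (kmul (csV_pderiv (@real_seq_complete R) oOm i sb) phi)).
Proof.
move=> ks e x ex; rewrite /kernel_dxy (dx_mul sb i ks ex) dy_mul /kplus addrA; congr (_ + _).
by apply: tf_eq => y; exact: esym (scalerDr (b y) (kernel_dx i phi e x y) (kernel_dy i phi e x y)).
Qed.

Lemma compact_nbhd (A : set V) : compact A -> A `<=` Om -> exists2 d : R, 0 < d &
  exists B : set V, [/\ compact B, B `<=` Om & forall x z, A x -> `|z - x| < d -> B z].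
Proof.
move=> cA AO; have [k Ak] := exh_cover oOm cA AO.
(* Half of the distance to the complement that [exh] grants; the other half remains for the
   neighbourhood. The index 2 (k + 1) meets both conditions of [exh]. *)
exists (2 * k.+1%:R)^-1; first by rewrite invr_gt0 mulr_gt0.
exists (exh Om (2 * k.+1)); split; [exact: exh_compact|exact: exh_sub|].
move=> x z /Ak[xk xO] zx.
have k1 : (2 * k.+1%:R)^-1 <= 1 :> R.
  by rewrite invf_le1 ?mulr_gt0// -natrM ler1n.
split.
  have := ler_normD (z - x) x; rewrite subrK => H; apply: (le_trans H).
  have : (2 * k.+1)%:R = 2 * k%:R + 2 :> R by rewrite natrM -natr1; ring.
  move=> ->; have k0 : 0 <= k%:R :> R by [].
  have H2 := lt_le_trans zx k1.
  by rewrite (le_trans (lerD (ltW H2) xk))//; lra.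
move=> y yz; apply: xO; rewrite (le_lt_trans (ler_distD z y x))//.
have -> : k.+1%:R^-1 = (2 * k.+1%:R)^-1 + (2 * k.+1%:R)^-1 :> R by field.
rewrite ltrD// (lt_le_trans yz)// lef_pV2 ?posrE ?mulr_gt0// -natrM ler_nat.
exact: leqnSn.
Qed.

Lemma csV_bounded b (A : set V) : csV Om b -> compact A -> A `<=` Om ->
  exists2 C : R, 0 <= C & forall x, A x -> `|b x| <= C.
Proof.
move=> sb cA AO.
have [|y /AO Oy|N NP] := @compact_uniform V A (fun N y => `|b y| <= N%:R) cA.
- by move=> i j y ij /le_trans; apply; rewrite ler_nat.
- have cb : {for y, continuous b}.
    by apply/differentiable_continuous/(csV_differentiable (@real_seq_complete R) oOm).
  have [N NP] := nat_gt (`|b y| + 1); exists N.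
  have /cvgrPdist_lt/(_ 1 ltr01) := cb; apply: filterS => z bz.
  rewrite (le_trans _ (ltW NP))//; have := ler_normD (b z - b y) (b y).
  by rewrite subrK distrC; move: bz; lra.
- by exists N%:R.
Qed.

Lemma csV_lipschitz b (A : set V) : csV Om b -> compact A -> A `<=` Om ->
  exists d L : R, [/\ 0 < d, 0 <= L & forall x y, A x -> `|y - x| < d -> Om y /\ `|b y - b x| <= L * `|y - x|].
Proof.
move=> sb cA AO; have [d d0 [B [cB BO AB]]] := compact_nbhd cA AO.
have Hi i : exists C : R, 0 <= C /\ forall x, B x -> `|pderiv i b x| <= C.
  have [C C0 CP] := csV_bounded (csV_pderiv (@real_seq_complete R) oOm i sb) cB BO.
  by exists C.
have [C CP] := choice Hi.
exists d, (\sum_i C i); split=> // [|x y Ax yx].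
  by apply: sumr_ge0 => i _; have [] := CP i.
split; first by apply: BO; exact: AB Ax yx.
have zB t : 0 <= t <= 1 -> B (x + t *: (y - x)).
  move=> /andP[t0 t1]; apply: AB Ax _; rewrite addrAC subrr add0r normrZ ger0_norm//.
  by rewrite (le_lt_trans _ yx)// ler_piMl.
have Dz t : 0 <= t <= 1 -> isd (fun s => b (x + s *: (y - x))) t
    (\sum_i (y - x) 0 i *: pderiv i b (x + t *: (y - x))).
  move=> t01; apply: differentiable_isd.
    have := smo_isd (sm_line x (y - x)) (t := t) I.
    have -> // : derive1 (fun s : R => x + s *: (y - x)) t = y - x.
    rewrite (derive1_line id) derive_id //.
  apply: (csV_differentiable (@real_seq_complete R) oOm) => //.
  by apply: BO; exact: zB.
have := @mvi R R (fun s => b (x + s *: (y - x))) 0 1 0 ((\sum_i C i) * `|y - x|) ler01.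
have -> : x + 1 *: (y - x) = y by rewrite scale1r addrC subrK.
rewrite scale0r addr0 scaler0 !subr0 mulr1; apply.
  by move=> t /Dz[].
move=> t t01; rewrite subr0 (isd_eq (Dz t t01)) (le_trans (ler_norm_sum _ _ _))//.
rewrite mulr_suml; apply: ler_sum => i _; rewrite normrZ mulrC.
have [C0 CB] := CP i.
by apply: ler_pM => //; [exact: CB (zB _ t01)|exact: coord_le].
Qed.

End multiplication.

Section eventually_small.
Variable R : realType.
Implicit Types P Q : R -> Prop.

Definition near0 P := exists2 e0 : R, 0 < e0 & forall e, 0 < e -> e <= 1 -> e <= e0 -> P e.

Lemma near0W P Q : (forall e, 0 < e -> e <= 1 -> P e -> Q e) -> near0 P -> near0 Q.
Proof. by move=> PQ [e0 e00 Pe]; exists e0 => // e e1 e2 e3; exact/PQ/Pe. Qed.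

Lemma near0I P Q : near0 P -> near0 Q -> near0 (fun e => P e /\ Q e).
Proof.
move=> [a a0 Pa] [b b0 Qb]; exists (Num.min a b); first by rewrite lt_min a0.
by move=> e e0 e1; rewrite le_min => /andP[ea eb]; split; [exact: Pa|exact: Qb].
Qed.

Lemma near0_all P : (forall e, 0 < e -> e <= 1 -> P e) -> near0 P.
Proof. by move=> PP; exists 1 => // e e0 e1 _; exact: PP. Qed.

Lemma near0_small C d : 0 <= C -> 0 < d -> near0 (fun e => C * e < d).
Proof.
move=> C0 d0; exists (d / (2 * (C + 1))); first by rewrite divr_gt0// mulr_gt0// ltr_wpDl.
move=> e e0 _; rewrite ler_pdivlMr ?mulr_gt0// ?ltr_wpDl// => H.
by apply: lt_le_trans H; rewrite mulrC ltr_pM2l//; lra.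
Qed.

End eventually_small.

(** * The support and growth conditions under operations on kernels *)

Section support_and_growth.
Variables (R : realType) (n : nat) (F : scalar_kind) (Om : set 'rV[R]_n).
Hypothesis oOm : open Om.
Local Notation V := 'rV[R]_n.
Local Notation K := (scalars R F).
Local Notation D := (testfun K Om).
Local Notation dxy := (@kernel_dxy R n F Om).
Local Notation dy := (@kernel_dy R n F Om).
Let Rc := @real_seq_complete R.
Implicit Types (phi psi : R -> V -> D) (b : V -> R) (a : R -> V -> R) (A : set V).

Lemma ccompactP A : ccompact Om A <-> compact A /\ A `<=` Om.
Proof. by rewrite /ccompact; have /interior_id -> := oOm. Qed.

Lemma kdomW A e x : ccompact Om A -> 0 < e -> e <= 1 -> A x -> kdom Om e x.
Proof. by move=> /ccompactP[_ AO] e0 e1 Ax; split=> //; exact: AO. Qed.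

Lemma sup_eucl (x y : V) : `|y - x| <= Num.sqrt (\sum_i (y 0 i - x 0 i) ^+ 2).
Proof.
apply: norm_le => [|i]; first exact: sqrtr_ge0.
rewrite !mxE -sqrtr_sqr ler_sqrt ?sumr_ge0//; last by move=> j _; exact: sqr_ge0.
by rewrite (bigD1 i)//= lerDl sumr_ge0// => j _; exact: sqr_ge0.
Qed.

Lemma eucl_sup (x y : V) : Num.sqrt (\sum_i (y 0 i - x 0 i) ^+ 2) <= n%:R * `|y - x|.
Proof.
rewrite -[leRHS]ger0_norm ?mulr_ge0// -sqrtr_sqr ler_sqrt ?sqr_ge0// exprMn.
apply: (@le_trans _ _ (\sum_(i < n) `|y - x| ^+ 2)).
  apply: ler_sum => i _; rewrite -[leLHS]real_normK ?num_real// ler_pXn2r ?nnegrE//.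
  by have := coord_le (y - x) i; rewrite !mxE.
rewrite sumr_const card_ord -[leLHS]mulr_natl; apply: ler_wpM2r; first exact: sqr_ge0.
by rewrite -natrX ler_nat; case: (n) => // k; rewrite leq_pmulr.
Qed.

Definition near_diag phi := forall A, ccompact Om A -> exists2 C : R, 0 < C &
  near0 (fun e => forall x y, A x -> phi e x y != 0 -> `|y - x| <= C * e).

Lemma LSK1P phi : LSK1 phi <-> near_diag phi.
Proof.
split=> H A cA.
  have [e0 [C [e00 C0 HA]]] := H A cA; exists C => //.
  exists (e0 / 2); first by rewrite divr_gt0.
  move=> e ep e1 ee x y Ax yx; apply: le_trans (sup_eucl x y) _; apply: ltW.
  have ee0 : e < e0 by lra.
  by apply: (HA x e Ax ep e1 ee0 y); exact: subset_closure.
have [C C0 [e0 e00 HA]] := H A cA.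
(* Passing from the nonvanishing points to their closure costs an extra e, hence C + 1. The
   Euclidean norm is at most n times the sup norm, and n + 1 makes the inequality strict. *)
exists e0, (n.+1%:R * (C + 1)); split=> //; first by rewrite mulr_gt0// ltr_wpDl// ltW.
move=> x e Ax ep e1 ee y /(_ (ball y e)) [|z [/= zx yz]].
  exact: nbhsx_ballx.
have := HA e ep e1 (ltW ee) x z Ax zx => zxC.
rewrite /eball /=; apply: le_lt_trans (eucl_sup x y) _.
move: yz; rewrite -ball_normE /= => yz.
have H1 : `|y - x| <= (C + 1) * e.
  by rewrite (le_trans (ler_distD z y x))// mulrDl mul1r addrC lerD// ltW.
apply: le_lt_trans (ler_wpM2l (ler0n R n) H1) _.
by rewrite -mulrA ltr_pM2r ?ltr_nat// mulr_gt0// ltr_wpDl// ltW.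
Qed.

Lemma near_diag_eq phi psi : keq phi psi -> near_diag phi -> near_diag psi.
Proof.
move=> pq H A cA; have [C C0 HA] := H A cA; exists C => //.
apply: near0W HA => e e0 e1 HA x y Ax; rewrite -pq; [exact: HA|exact: kdomW cA e0 e1 Ax].
Qed.

Lemma near_diag_add phi psi : near_diag phi -> near_diag psi -> near_diag (kplus phi psi).
Proof.
move=> H1 H2 A cA; have [C C0 HA] := H1 A cA; have [C' C0' HA'] := H2 A cA.
exists (C + C'); first exact: addr_gt0.
apply: near0W (near0I HA HA') => e e0 e1 [Ha Hb] x y Ax; rewrite /kplus tfD => nz.
have [E|/(Ha x y Ax) H] := eqVneq (phi e x y) 0.
  apply: (@le_trans _ _ (C' * e)); first by apply: Hb => //; move: nz; rewrite E add0r.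
  by rewrite mulrDl lerDr mulr_ge0// ltW.
by rewrite (le_trans H)// mulrDl lerDl mulr_ge0// ltW.
Qed.

Lemma near_diag_sub phi psi : (forall e x y, psi e x y != 0 -> phi e x y != 0) ->
  near_diag phi -> near_diag psi.
Proof.
move=> pq H A cA; have [C C0 HA] := H A cA; exists C => //.
by apply: near0W HA => e e0 e1 HA x y Ax /pq; exact: HA.
Qed.

Lemma near_diag_scale a phi : near_diag phi -> near_diag (kscale a phi).
Proof.
apply: near_diag_sub => e x y; rewrite /kscale tfZ.
by apply: contraNneq => ->; rewrite scaler0.
Qed.

Lemma near_diag_mul b (sb : csV Om b) phi : near_diag phi -> near_diag (kmul oOm sb phi).
Proof.
apply: near_diag_sub => e x y /=.
by apply: contraNneq => ->; rewrite scaler0.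
Qed.

Lemma near_diag_dy phi i : near_diag phi -> near_diag (kernel_dy i phi).
Proof.
move=> /LSK1P H; apply/LSK1P => A /H[e0 [C [e00 C0 HA]]].
by exists e0, C; split=> // x e Ax p1 p2 p3; move=> z /supp_pderiv; exact: HA.
Qed.

(** A derivative at a point of A involves kernels at nearby points, so the support condition is used
    on a compact neighbourhood of A. *)
Lemma near_diag_dx phi i : KS phi -> near_diag phi -> near_diag (kernel_dx i phi).
Proof.
move=> ks H A cA; have /ccompactP[cA' AO] := cA.
have [d d0 [B [cB BO AB]]] := compact_nbhd oOm cA' AO.
have [|C C0 HB] := H B; first by apply/ccompactP.
exists C => //; apply: near0W HB => e e0 e1 HB x y Ax; apply: contraNle => yx.
have ex := kdomW cA e0 e1 Ax; rewrite (dxE oOm)// /pderiv.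
rewrite (near_eq_derive (g := cst 0)) ?derive_cst//.
have r0 : 0 < Num.min d (`|y - x| - C * e) by rewrite lt_min d0 subr_gt0.
apply/nbhs_ballP; exists (Num.min d (`|y - x| - C * e)) => //= z.
rewrite -ball_normE /= lt_min => /andP[zd zx]; apply/eqP; apply: contraLR zx => nz.
have := HB z y (AB x z Ax _) nz; rewrite distrC => /(_ zd) H1.
by rewrite -leNgt lerBlDr [leRHS]addrC (le_trans (ler_distD z y x))// lerD// distrC.
Qed.

Lemma near_diag_dxy phi i : KS phi -> near_diag phi -> near_diag (kernel_dxy i phi).
Proof. by move=> ks H; apply: near_diag_add; [exact: near_diag_dx|exact: near_diag_dy]. Qed.

Definition growth r phi := forall A, ccompact Om A -> exists2 C : R, 0 <= C &
  near0 (fun e => forall x y, A x -> `|phi e x y| <= C * e ^- r).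

(** An inductive form of (LSK2): [r] is the allowed negative power of e, kept by d_(x+y) and raised
    by one by d_y. It can be checked on sums and products without expanding iterated derivatives. *)
Fixpoint growths k r phi : Prop :=
  growth r phi /\
  if k is k'.+1 then
    (forall i, growths k' r (kernel_dxy i phi)) /\ (forall i, growths k' r.+1 (kernel_dy i phi))
  else True.

Lemma growths_S k r phi : growths k.+1 r phi <-> [/\ growth r phi,
  forall i, growths k r (kernel_dxy i phi) & forall i, growths k r.+1 (kernel_dy i phi)].
Proof. by split=> [[? []]|[]]. Qed.

Lemma growthsW k r phi : growths k.+1 r phi -> growths k r phi.
Proof.
elim: k r phi => [|k ih] r phi; first by case.
move=> /growths_S[g gx gy]; split=> //; split=> i; exact: ih.
Qed.

Lemma growth_eq r phi psi : keq phi psi -> growth r phi -> growth r psi.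
Proof.
move=> pq H A cA; have [C C0 HA] := H A cA; exists C => //.
apply: near0W HA => e e0 e1 HA x y Ax; rewrite -pq; [exact: HA|exact: kdomW cA e0 e1 Ax].
Qed.

Lemma growths_eq k r phi psi : KS phi -> keq phi psi -> growths k r phi -> growths k r psi.
Proof.
elim: k r phi psi => [|k ih] r phi psi ks pq; first by move=> [g _]; split=> //; exact: growth_eq g.
move=> /growths_S[g gx gy]; split; first exact: growth_eq g.
split=> i; first by apply: ih (gx i); [exact: KS_dxy|exact: keq_dxy].
by apply: ih (gy i); [exact: KS_dy|exact: keq_dy].
Qed.

Lemma growth_add r phi psi : growth r phi -> growth r psi -> growth r (kplus phi psi).
Proof.
move=> H1 H2 A cA; have [C C0 HA] := H1 A cA; have [C' C0' HA'] := H2 A cA.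
exists (C + C'); first exact: addr_ge0.
apply: near0W (near0I HA HA') => e e0 e1 [Ha Hb] x y Ax.
by rewrite /kplus tfD mulrDl (le_trans (ler_normD _ _))// lerD//; [exact: Ha|exact: Hb].
Qed.

Lemma growths_add k r phi psi : KS phi -> KS psi ->
  growths k r phi -> growths k r psi -> growths k r (kplus phi psi).
Proof.
elim: k r phi psi => [|k ih] r phi psi ks ls; first by move=> [g _] [h _]; split=> //; exact: growth_add.
move=> /growths_S[g gx gy] /growths_S[h hx hy]; split; first exact: growth_add.
split=> i.
  apply: growths_eq (keq_sym (dxy_add oOm i ks ls)) _.
    by apply: KS_add; exact: KS_dxy.
  by apply: ih; [exact: KS_dxy|exact: KS_dxy|exact: gx|exact: hx].
have E : keq (kplus (kernel_dy i phi) (kernel_dy i psi)) (kernel_dy i (kplus phi psi)).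
  by move=> e x _; rewrite dy_add.
apply: growths_eq E _; first by apply: KS_add; exact: KS_dy.
by apply: ih; [exact: KS_dy|exact: KS_dy|exact: gy|exact: hy].
Qed.

(** Only x-derivatives are bounded, so a coefficient may oscillate arbitrarily fast as e tends to
    0. *)
Fixpoint bounded_coef k a : Prop :=
  (forall A, ccompact Om A -> exists2 C : R, 0 <= C &
     forall e x, 0 < e -> e <= 1 -> A x -> `|a e x| <= C) /\
  if k is k'.+1 then forall i, bounded_coef k' (fun e => pderiv i (a e)) else True.

Lemma bounded_coefW k a : bounded_coef k.+1 a -> bounded_coef k a.
Proof.
elim: k a => [|k ih] a; first by case.
by move=> [g h]; split=> // i; exact: ih.
Qed.

Lemma bounded_coef_csV k b : csV Om b -> bounded_coef k (fun=> b).
Proof.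
elim: k b => [|k ih] b sb; split=> //.
- move=> A /ccompactP[cA AO]; have [C C0 CP] := csV_bounded oOm sb cA AO.
  by exists C => // e x _ _; exact: CP.
- move=> A /ccompactP[cA AO]; have [C C0 CP] := csV_bounded oOm sb cA AO.
  by exists C => // e x _ _; exact: CP.
by move=> i; apply: ih; exact: csV_pderiv.
Qed.

Lemma growth_scale r a phi : bounded_coef 0 a -> growth r phi -> growth r (kscale a phi).
Proof.
move=> [Ha _] H A cA; have [C C0 HA] := H A cA; have [C' C0' HA'] := Ha A cA.
exists (C' * C); first exact: mulr_ge0.
apply: near0W HA => e e0 e1 HA x y Ax.
by rewrite /kscale tfZ normrZ -mulrA ler_pM//; [exact: HA'|exact: HA].
Qed.

Lemma growths_scale k r a phi : coef Om a -> bounded_coef k a -> KS phi ->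
  growths k r phi -> growths k r (kscale a phi).
Proof.
elim: k r a phi => [|k ih] r a phi sa ba ks.
  by move=> [g _]; split=> //; exact: growth_scale.
have b0 : bounded_coef 0 a by split=> //; case: ba.
move=> /growths_S[g gx gy]; split; first exact: growth_scale.
have ba' := ba.2; split=> i.
  apply: growths_eq (keq_sym (dxy_scale oOm i sa ks)) _.
    apply: KS_add; apply: KS_scale => //; [exact: KS_dxy|exact: coef_pderiv].
  apply: growths_add.
  - by apply: KS_scale => //; exact: KS_dxy.
  - by apply: KS_scale => //; exact: coef_pderiv.
  - by apply: ih => //; [exact: bounded_coefW|exact: KS_dxy].
  - apply: ih => //; [exact: coef_pderiv|exact: ba'|].
    by apply: growthsW; split.
have E : keq (kscale a (kernel_dy i phi)) (kernel_dy i (kscale a phi)).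
  by move=> e x _; rewrite dy_scale.
apply: growths_eq E _; first by apply: KS_scale => //; exact: KS_dy.
by apply: ih => //; [exact: bounded_coefW|exact: KS_dy].
Qed.

(** The factor need not be bounded on [Om]; the support condition confines y to a compact
    neighbourhood of A for small e. *)
Lemma growth_mul r b (sb : csV Om b) phi : near_diag phi -> growth r phi ->
  growth r (kmul oOm sb phi).
Proof.
move=> nd H A cA; have /ccompactP[cA' AO] := cA.
have [d d0 [B [cB BO AB]]] := compact_nbhd oOm cA' AO.
have [M M0 MP] := csV_bounded oOm sb cB BO.
have [C C0 HC] := H A cA; have [C' C0' HC'] := nd A cA.
exists (M * C); first exact: mulr_ge0.
apply: near0W (near0I HC (near0I HC' (near0_small (ltW C0') d0))) => e e0 e1 [H1 [H2 H3]] x y Ax /=.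
have [->|nz] := eqVneq (phi e x y) 0.
  by rewrite scaler0 normr0 !mulr_ge0// invr_ge0 exprn_ge0// ltW.
rewrite normrZ -mulrA ler_pM//; last exact: H1.
by apply: MP; apply: (AB x y Ax); apply: le_lt_trans (H2 x y Ax nz) H3.
Qed.

Lemma growth_mono r phi : growth r phi -> growth r.+1 phi.
Proof.
move=> H A cA; have [C C0 HA] := H A cA; exists C => //.
apply: near0W HA => e e0 e1 HA x y Ax; rewrite (le_trans (HA x y Ax))// ler_wpM2l//.
by rewrite lef_pV2 ?posrE ?exprn_gt0// exprS ler_piMl// exprn_ge0// ltW.
Qed.

Lemma growths_mono k r phi : growths k r phi -> growths k r.+1 phi.
Proof.
elim: k r phi => [|k ih] r phi; first by move=> [g _]; split=> //; exact: growth_mono.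
by move=> /growths_S[g gx gy]; split; [exact: growth_mono|split=> i; exact: ih].
Qed.

Lemma growths_mul k r b (sb : csV Om b) phi : KS phi -> near_diag phi ->
  growths k r phi -> growths k r (kmul oOm sb phi).
Proof.
elim: k r b sb phi => [|k ih] r b sb phi ks nd.
  by move=> [g _]; split=> //; exact: growth_mul.
move=> /[dup]/growthsW g0 /growths_S[g gx gy]; split; first exact: growth_mul.
split=> i.
  apply: growths_eq (keq_sym (dxy_mul oOm sb i ks)) _.
    by apply: KS_add; apply: KS_mul => //; exact: KS_dxy.
  apply: growths_add.
  - by apply: KS_mul; exact: KS_dxy.
  - exact: KS_mul.
  - by apply: ih => //; [exact: KS_dxy|exact: near_diag_dxy].
  - exact: ih.
have E := fun e x (_ : kdom Om e x) => esym (dy_mul oOm sb phi i e x).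
apply: growths_eq E _; first by apply: KS_add; apply: KS_mul => //; exact: KS_dy.
apply: growths_add.
- by apply: KS_mul; exact: KS_dy.
- exact: KS_mul.
- by apply: ih => //; [exact: KS_dy|exact: near_diag_dy].
- by apply: ih => //; exact: growths_mono.
Qed.

Lemma coef_cst b : csV Om b -> coef Om (fun=> b).
Proof. by move=> sb e x _ sx ex; apply: sb => // t; have [] := ex t. Qed.

Lemma csVN b : csV Om b -> csV Om (fun x => - b x).
Proof. by move=> sb c sc Oc; apply: smoN; [exact: openT|exact: sb]. Qed.

(* The kernel (b(y) - b(x)) phi_(e,x)(y), which gains one power of e near the diagonal. *)
Definition kdiff b (sb : csV Om b) phi :=
  kplus (kmul oOm sb phi) (kscale (fun=> fun x => - b x) phi).

Lemma kdiffE b (sb : csV Om b) phi e x y : kdiff sb phi e x y = (b y - b x) *: phi e x y.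
Proof. by rewrite /kdiff /kplus tfD /kscale tfZ /= scalerBl scaleNr. Qed.

Lemma KS_diff b (sb : csV Om b) phi : KS phi -> KS (kdiff sb phi).
Proof.
move=> ks; apply: KS_add; [exact: KS_mul|apply: KS_scale => //].
exact: coef_cst (csVN sb).
Qed.

Lemma dxy_diff b (sb : csV Om b) phi i : KS phi -> keq (kernel_dxy i (kdiff sb phi))
  (kplus (kdiff sb (kernel_dxy i phi)) (kdiff (csV_pderiv Rc oOm i sb) phi)).
Proof.
move=> ks e x ex; have sn := coef_cst (csVN sb).
rewrite (dxy_add oOm i (KS_mul oOm sb ks) (KS_scale sn ks) ex).
rewrite /kplus (dxy_mul oOm sb i ks ex) (dxy_scale oOm i sn ks ex) /kplus.
rewrite /kdiff /kplus addrACA; congr (_ + (_ + _)).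
apply: tf_eq => y; rewrite /kscale !tfZ; congr (_ *: _).
have [_ _ Ox] := ex.
have -> : (fun x => - b x) = (fun x => (-1) *: b x) by apply/funext => z; rewrite scaleN1r.
by rewrite (pderivZ Rc oOm) // scaleN1r.
Qed.

Lemma dy_diff b (sb : csV Om b) phi i e x : kernel_dy i (kdiff sb phi) e x =
  kplus (kdiff sb (kernel_dy i phi)) (kmul oOm (csV_pderiv Rc oOm i sb) phi) e x.
Proof.
rewrite /kdiff dy_add /kplus dy_mul dy_scale /kplus.
exact: addrAC.
Qed.

Lemma growth_diff r b (sb : csV Om b) phi : near_diag phi -> growth r.+1 phi ->
  growth r (kdiff sb phi).
Proof.
move=> nd H A cA; have /ccompactP[cA' AO] := cA.
have [d [L [d0 L0 dL]]] := csV_lipschitz oOm sb cA' AO.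
have [C C0 HC] := H A cA; have [C' C0' HC'] := nd A cA.
exists (L * C' * C); first by rewrite !mulr_ge0// ltW.
apply: near0W (near0I HC (near0I HC' (near0_small (ltW C0') d0))) => e e0 e1 [H1 [H2 H3]] x y Ax.
rewrite kdiffE; have [->|nz] := eqVneq (phi e x y) 0.
  by rewrite scaler0 normr0 !mulr_ge0// ?invr_ge0 ?exprn_ge0// ltW.
have yx := H2 x y Ax nz; have [_ Lb] := dL x y Ax (le_lt_trans yx H3).
rewrite normrZ.
have -> : L * C' * C * e ^- r = (L * (C' * e)) * (C * e ^- r.+1).
  by rewrite exprS; field; rewrite expf_neq0 ?gt_eqF.
apply: ler_pM => //; last exact: H1.
by rewrite (le_trans Lb)// ler_wpM2l.
Qed.

Lemma growths_diff k r b (sb : csV Om b) phi : KS phi -> near_diag phi ->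
  growths k r.+1 phi -> growths k r (kdiff sb phi).
Proof.
elim: k r b sb phi => [|k ih] r b sb phi ks nd.
  by move=> [g _]; split=> //; exact: growth_diff.
move=> /[dup]/growthsW g0 /growths_S[g gx gy]; split; first exact: growth_diff.
split=> i.
  apply: growths_eq (keq_sym (dxy_diff sb i ks)) _.
    by apply: KS_add; apply: KS_diff => //; exact: KS_dxy.
  apply: growths_add.
  - by apply: KS_diff; exact: KS_dxy.
  - exact: KS_diff.
  - by apply: ih => //; [exact: KS_dxy|exact: near_diag_dxy].
  - exact: ih.
have E := fun e x (_ : kdom Om e x) => esym (dy_diff sb phi i e x).
apply: growths_eq E _.
  by apply: KS_add; [apply: KS_diff; exact: KS_dy|exact: KS_mul].
apply: growths_add.
- by apply: KS_diff; exact: KS_dy.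
- exact: KS_mul.
- by apply: ih => //; [exact: KS_dy|exact: near_diag_dy].
- exact: growths_mul.
Qed.

Lemma keqxx phi : keq phi phi. Proof. by []. Qed.

Lemma dxy_word_perm phi s1 s2 : KS phi -> perm_eq s1 s2 ->
  keq (foldr dxy phi s1) (foldr dxy phi s2).
Proof.
apply: (@foldr_perm n _ (@KS R n F Om) _ _ keqxx (@keq_sym _ _ _ _) (@keq_trans _ _ _ _)).
- by move=> i f; exact: KS_dxy.
- by move=> i f g ks _ fg; exact: keq_dxy.
- by move=> i j f ks; exact: dxy_comm.
Qed.

Lemma dy_word_perm phi s1 s2 : KS phi -> perm_eq s1 s2 ->
  keq (foldr dy phi s1) (foldr dy phi s2).
Proof.
apply: (@foldr_perm n _ (@KS R n F Om) _ _ keqxx (@keq_sym _ _ _ _) (@keq_trans _ _ _ _)).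
- by move=> i f; exact: KS_dy.
- by move=> i f g ks _ fg; exact: keq_dy.
- by move=> i j f ks e x _; exact: dy_comm.
Qed.

Lemma KS_dxys phi s : KS phi -> KS (foldr dxy phi s).
Proof. by move=> ks; elim: s => //= i s; exact: KS_dxy. Qed.

Lemma KS_dys phi s : KS phi -> KS (foldr dy phi s).
Proof. by move=> ks; elim: s => //= i s; exact: KS_dy. Qed.

Lemma keq_dxys phi psi s : KS phi -> keq phi psi ->
  keq (foldr dxy phi s) (foldr dxy psi s).
Proof.
by move=> ks pp; elim: s => //= i s; apply: keq_dxy => //; exact: KS_dxys.
Qed.

Lemma dxys_dy phi i s : KS phi ->
  keq (foldr dxy (kernel_dy i phi) s) (kernel_dy i (foldr dxy phi s)).
Proof.
move=> ks; elim: s => //= j s ih.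
apply: (keq_trans (psi := kernel_dxy j (kernel_dy i (foldr dxy phi s)))).
  by apply: keq_dxy => //; apply: KS_dxys; exact: KS_dy.
by apply: dxydy_comm => //; exact: KS_dxys.
Qed.

(** (LSK2) has all d_y inside all d_(x+y), sorted by direction, whereas [growths] meets them in any
    order; the operators commute, so the words may be rearranged. *)
Lemma LSK2_growths phi : KS phi -> (LSK2 phi <-> forall k, growths k n phi).
Proof.
move=> ks; split=> H.
  have Hw u w : growth (n + size u) (foldr dxy (foldr dy phi u) w).
    move=> A cA.
    have [e0 [C [e00 C0 HA]]] := H A cA (fun i => count_mem i w) (fun i => count_mem i u).
    exists C; first exact: ltW.
    exists e0 => // e ep e1 ee x y Ax; have ex := kdomW cA ep e1 Ax.
    (* (LSK2) speaks of y in [Om] only; elsewhere test functions vanish. *)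
    have [Oy|Oy] := pselect (Om y); last first.
      set g := foldr _ _ _ e x; have [_ _ gO] := testfunP g.
      rewrite supp0 ?normr0; last by apply: contra_not Oy; exact: gO.
      by rewrite mulr_ge0 ?invr_ge0 ?exprn_ge0// ltW.
    have := HA e (x, y) ep e1 ee (conj Ax Oy); rewrite !mindex_iter_word /=.
    rewrite -size_word -(perm_size (perm_word u)).
    rewrite -(dxy_word_perm (KS_dys _ ks) (perm_word w) ex).
    by rewrite -(keq_dxys w (KS_dys u ks) (dy_word_perm ks (perm_word u)) ex).
  move=> k; suff : forall u w, growths k (n + size u) (foldr dxy (foldr dy phi u) w).
    by move=> /(_ [::] [::]); rewrite addn0.
  elim: k => [|k ih] u w; first by split=> //; exact: Hw.
  split; [exact: Hw|split=> i]; first exact: (ih u (i :: w)).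
  have := ih (i :: u) w; rewrite /= addnS; apply: growths_eq.
    by apply: KS_dxys; apply: KS_dy; exact: KS_dys.
  by apply: dxys_dy; exact: KS_dys.
move=> A cA al be; rewrite !mindex_iter_word -size_word.
set u := word be; set w := word al.
have Hu k : growths k (n + size u) (foldr dy phi u).
  elim: u k => [|i u ih] k /=; first by rewrite addn0.
  by rewrite addnS; have /growths_S[_ _] := ih k.+1; exact.
have Hw k : growths k (n + size u) (foldr dxy (foldr dy phi u) w).
  by elim: w k => //= i w ih k; have /growths_S[_ + _] := ih k.+1; exact.
have [C C0 [e0 e00 HC]] := (Hw 0%N).1 A cA.
exists e0, (C + 1); split=> //; first by rewrite ltr_wpDl.
move=> e [x y] ep e1 ee [/= Ax Oy]; rewrite (le_trans (HC e ep e1 ee x y Ax))//.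
by rewrite ler_wpM2r ?invr_ge0 ?exprn_ge0 ?lerDl// ltW.
Qed.

End support_and_growth.

(** * Integrals of test functions and moments of kernels *)

Section line_integrals.
Variable R : realType.
Implicit Types (f g : R -> R) (M C : R).
Local Notation mu := (@lebesgue_measure R).
Local Notation I f := (Rintegral mu setT f).

Lemma int_itv f M : (forall t, M < `|t| -> f t = 0) ->
  I f = \int[mu]_(t in `[- M, M]) f t.
Proof.
move=> f0; rewrite [RHS]Rintegral_mkcond; congr Rintegral; apply/funext => t.
rewrite patchE; case: ifPn => //; rewrite notin_setE /= in_itv /= -ler_norml => /negP.
by rewrite -ltNge => /f0.
Qed.

Lemma sm_integrable f M : sm f -> mu.-integrable `[- M, M] (EFin \o f).
Proof.
move=> sf; apply: continuous_compact_integrable; first exact: segment_compact.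
by apply: continuous_subspaceT => t; exact: (smo_derivable_continuous sf).
Qed.

Lemma int_lin f g M a b : sm f -> sm g ->
  (forall t, M < `|t| -> f t = 0) -> (forall t, M < `|t| -> g t = 0) ->
  I (fun t => a * f t + b * g t) = a * I f + b * I g.
Proof.
move=> sf sg f0 g0; rewrite (int_itv f0) (int_itv g0) (int_itv (M := M)); last first.
  by move=> t Mt; rewrite f0// g0// !mulr0 addr0.
have saf : sm (fun t => a * f t) by apply: smoM => //; [exact: openT|exact/smo_cst/openT].
have sbg : sm (fun t => b * g t) by apply: smoM => //; [exact: openT|exact/smo_cst/openT].
rewrite RintegralD//; try exact: sm_integrable.
by rewrite !RintegralZl//; exact: sm_integrable.
Qed.

Lemma int_bound f M C : 0 <= M -> sm f -> (forall t, M < `|t| -> f t = 0) ->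
  (forall t, `|f t| <= C) -> `|I f| <= C * (2 * M).
Proof.
move=> M0 sf f0 fC; rewrite (int_itv f0).
have mI : measurable (`[- M, M] : set R) by exact: measurable_itv.
have cstE : \int[mu]_(t in `[- M, M]) C = C * (2 * M).
  rewrite Rintegral_cst//; congr (_ * _); apply: etrans (congr1 fine (lebesgue_measure_itv `[- M, M])) _.
  by rewrite /= lte_fin; case: ltP => //= H; lra.
have iC : mu.-integrable `[- M, M] (EFin \o (fun=> C)).
  by apply: sm_integrable; exact/smo_cst/openT.
rewrite ler_norml -cstE; apply/andP; split; last first.
  apply: le_Rintegral => //; first exact: sm_integrable.
  by move=> t _; exact: le_trans (ler_norm _) (fC t).
have -> : - (\int[mu]_(t in `[- M, M]) C) = \int[mu]_(t in `[- M, M]) (- C).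
  rewrite -mulN1r -RintegralZl//.
  by apply: eq_Rintegral => t _; rewrite mulN1r.
apply: le_Rintegral => //; [|exact: sm_integrable|].
  by apply: sm_integrable; exact/smo_cst/openT.
by move=> t _; have := fC t; rewrite ler_norml => /andP[].
Qed.

Lemma int_derive1 f M : 0 <= M -> sm f -> (forall t, M < `|t| -> f t = 0) ->
  I (derive1 f) = 0.
Proof.
move=> M0 sf f0.
have f0' t : M + 1 < `|t| -> derive1 f t = 0.
  move=> Mt; rewrite (near_derive1_eq (g := cst 0)) ?derive1_cst//.
  apply: filterS (nbhs_norm_lt t ltr01) => s st; apply: f0.
  by have := lerB_dist t s; rewrite distrC; move: st; lra.
rewrite (int_itv f0') /Rintegral (@continuous_FTC2 _ _ f)//.
- have f1 s : `|s| = M + 1 -> f s = 0 by move=> sM; apply: f0; rewrite sM; lra.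
  rewrite f1 ?ger0_norm//; last lra.
  have -> : f (- (M + 1)) = 0 by rewrite f1// normrN ger0_norm//; lra.
  by rewrite /= subr0.
- by lra.
- by apply: continuous_subspaceT => t; apply: (smo_derivable_continuous (smo_derive1 sf)).
- have cf t : {for t, continuous f} by exact: (smo_derivable_continuous sf).
  split; first by move=> t _; exact: (smo_derivable sf).
    by apply: cvg_at_right_filter; exact: cf.
  by apply: cvg_at_left_filter; exact: cf.
Qed.

End line_integrals.

Section iterated_integrals.
Variable R : realType.
Let Rc := @real_seq_complete R.
Implicit Types (M C : R).

Definition in_box n M (f : 'rV[R]_n -> R) := forall y, M < `|y| -> f y = 0.

Definition row_cons n (t : R) (y : 'rV[R]_n) : 'rV[R]_n.+1 := row_mx (t%:M : 'rV_1) y.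

Lemma row_cons0 n t (y : 'rV[R]_n) : row_cons t y 0 (lshift n (0 : 'I_1)) = t.
Proof. by apply: etrans (row_mxEl _ _ _ _) _; rewrite mxE eqxx. Qed.

Lemma row_consS n t (y : 'rV[R]_n) j : row_cons t y 0 (rshift 1 j) = y 0 j.
Proof. exact: row_mxEr. Qed.

Lemma row_consP n (v w : 'rV[R]_n.+1) : v 0 (lshift n (0 : 'I_1)) = w 0 (lshift n (0 : 'I_1)) ->
  (forall j, v 0 (rshift 1 j) = w 0 (rshift 1 j)) -> v = w.
Proof.
move=> e0 eS; apply/rowP => i; have [j ->|j ->//] := @split_ordP 1 n i.
by rewrite (ord1 j).
Qed.

Lemma sm_row_cons n (a : R -> R) (y : R -> 'rV[R]_n) : sm a -> sm y ->
  sm (fun t => row_cons (a t) (y t)).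
Proof.
move=> sa sy; apply: sm_rowP => i; have [j ->|j ->] := @split_ordP 1 n i.
  by apply: sm_ext sa => t; rewrite (ord1 j) row_cons0.
by apply: sm_ext (sm_coord j sy) => t; rewrite row_consS.
Qed.

Lemma in_box_t n M (f : 'rV[R]_n.+1 -> R) t y : in_box M f -> M < `|t| -> f (row_cons t y) = 0.
Proof.
move=> bf tM; apply: bf; apply: lt_le_trans tM _.
by rewrite -{1}(row_cons0 t y) coord_le.
Qed.

Lemma in_box_y n M (f : 'rV[R]_n.+1 -> R) t : in_box M f -> in_box M (fun y => f (row_cons t y)).
Proof.
move=> bf y yM; apply: bf; apply: lt_le_trans yM _.
by apply: norm_le => // j; rewrite -(row_consS t) coord_le.
Qed.

Lemma joint_row_cons n (f : 'rV[R]_n.+1 -> R) : csV setT f ->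
  joint (fun t y => f (row_cons t y)).
Proof. by move=> sf a y sa sy; apply: sf => //; exact: sm_row_cons. Qed.

Lemma coord_line n (v : 'rV[R]_n) s i j : (v + s *: basisv R j) 0 i = v 0 i + s * (i == j)%:R.
Proof. by rewrite !mxE eqxx. Qed.

Lemma pderiv_row_cons0 n (f : 'rV[R]_n.+1 -> R) t y :
  pderiv (lshift n (0 : 'I_1)) f (row_cons t y) = dt (fun t y => f (row_cons t y)) t y.
Proof.
have E s : row_cons s y = row_cons 0 y + s *: basisv R (lshift n (0 : 'I_1)).
  apply: row_consP => [|j].
    by rewrite coord_line !row_cons0 eqxx mulr1 add0r.
  by rewrite coord_line !row_consS (_ : (_ == _) = false) ?mulr0 ?addr0//; apply/negbTE/eqP => /(congr1 val).
rewrite [in LHS]E /pderiv -(derive1_line f) /dt.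
by apply: eq_derive1 => s; rewrite [in RHS]E.
Qed.

Lemma pderiv_row_consS n (f : 'rV[R]_n.+1 -> R) t y j :
  pderiv (rshift 1 j) f (row_cons t y) = pderiv j (fun y => f (row_cons t y)) y.
Proof.
rewrite /pderiv -(derive1_line0 f) -(derive1_line0 (fun y => f (row_cons t y))).
apply: eq_derive1 => s; congr f; apply: row_consP => [|k].
  by rewrite coord_line !row_cons0 (_ : (_ == _) = false) ?mulr0 ?addr0//; apply/negbTE/eqP => /(congr1 val).
by rewrite coord_line !row_consS coord_line (_ : (rshift 1 k == rshift 1 j :> 'I_n.+1) = (k == j)).
Qed.

Lemma compact_sup_ball n M : compact [set y : 'rV[R]_n | `|y| <= M].
Proof.
apply: bounded_closed_compact.
  exists M; split; first exact: num_real.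
  by move=> N MN y /= yM; exact: le_trans yM (ltW MN).
move=> y cly; apply/ler_addgt0Pr => e e0.
have [z [/= zM]] := cly _ (nbhsx_ballx y e e0); rewrite -ball_normE /= => yz.
by rewrite -[y](subrK z) addrC (le_trans (ler_normD _ _))// lerD// ltW.
Qed.

(** Linearity and the bound go through the induction on the dimension together: the next
    one-dimensional integral needs a smooth inner integral, and its smoothness is derived from
    both. *)
Definition int_spec n := forall M, 0 <= M ->
  (forall (f g : 'rV[R]_n -> R) a b, csV setT f -> csV setT g -> in_box M f -> in_box M g ->
    Rn_integral (fun y => a * f y + b * g y) = a * Rn_integral f + b * Rn_integral g) /\
  (forall (f : 'rV[R]_n -> R) C, csV setT f -> in_box M f -> (forall y, `|f y| <= C) ->
    `|Rn_integral f| <= C * (2 * M) ^+ n).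

(** Differentiation under the integral sign without limit theorems: by linearity the remainder is
    the integral of the pointwise Taylor remainder, which is O(h ^ 2) on the box and 0 outside. *)
Lemma int_isd n M (U : R -> 'rV[R]_n -> R) t : int_spec n -> 0 <= M -> joint U ->
  (forall t, in_box M (U t)) ->
  isd (fun t => Rn_integral (U t)) t (Rn_integral (dt U t)).
Proof.
move=> sp M0 sU bU; have [lin bnd] := sp M M0.
have bd s : in_box M (dt U s).
  by move=> y yM; rewrite /dt (eq_derive1 (g := cst 0)) ?derive1_cst// => r; exact: bU.
have [d [C [d0 C0 HC]]] := joint_taylor Rc t 0 sU (@compact_sup_ball n M).
apply: (isd_quad (d := d) (C := C * (2 * M) ^+ n)) => // h hd.
have sV s : csV setT (U s) := joint_csV s sU.
have sd : csV setT (dt U t) := joint_csV t (joint_dt Rc sU).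
pose g y := 1 * U (t + h) y + (-1) * U t y.
have sg : csV setT g by apply: csVD; apply: csVZ; exact: sV.
have bg : in_box M g by move=> y yM; rewrite /g !bU// !mulr0 addr0.
have -> : Rn_integral (U (t + h)) - Rn_integral (U t) - h *: Rn_integral (dt U t) =
    Rn_integral (fun y => 1 * g y + (- h) * dt U t y).
  by rewrite lin// lin// !mul1r mulN1r mulNr.
rewrite mulrAC; apply: bnd => [||y].
- by apply: csVD; apply: csVZ.
- by move=> y yM; rewrite bg// bd// !mulr0 addr0.
have [yM|yM] := leP `|y| M; last first.
  by rewrite bg// bd// !mulr0 addr0 normr0 mulr_ge0// sqr_ge0.
have := HC [::] h y isT hd yM; rewrite /= /g !mul1r mulN1r mulNr; exact.
Qed.

Lemma int_sm n M (U : R -> 'rV[R]_n -> R) : int_spec n -> 0 <= M -> joint U ->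
  (forall t, in_box M (U t)) -> sm (fun t => Rn_integral (U t)).
Proof.
move=> sp M0 sU bU.
have H k : joint (iter k (@dt R n R) U) /\ forall t, in_box M (iter k (@dt R n R) U t).
  elim: k => [//|k [sk bk]]; split; first exact: joint_dt.
  move=> t y yM; rewrite /= /dt (eq_derive1 (g := cst 0)) ?derive1_cst// => r; exact: bk.
apply: (smk_seq (d := fun k t => Rn_integral (iter k (@dt R n R) U t)) openT) => k t _.
by have [sk bk] := H k; exact: int_isd bk.
Qed.

Lemma int_specP n : int_spec n.
Proof.
elim: n => [|n ih] M M0.
  split=> [//|f C _ _ fC]; by rewrite expr0 mulr1; exact: fC.
have F (f : 'rV[R]_n.+1 -> R) : csV setT f -> in_box M f ->
    sm (fun t => Rn_integral (fun y => f (row_cons t y))) /\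
    forall t, M < `|t| -> Rn_integral (fun y => f (row_cons t y)) = 0.
  move=> sf bf; split.
    apply: (int_sm (U := fun t y => f (row_cons t y)) ih M0).
      exact: joint_row_cons.
    by move=> t; exact: in_box_y.
  move=> t tM; apply/eqP; rewrite -normr_le0.
  (* The inner integrand vanishes identically, so the bound is used with constant 0. *)
  have [_ bnd] := ih M M0; rewrite -[leRHS](mul0r ((2 * M) ^+ n)); apply: bnd => [||y].
  - by apply: (joint_csV t (joint_row_cons sf)).
  - exact: in_box_y.
  - by rewrite (in_box_t y bf tM) normr0.
split=> [f g a b sf sg bf bg|f C sf bf fC].
  have [sF F0] := F f sf bf; have [sG G0] := F g sg bg.
  rewrite /= -(int_lin a b sF sG F0 G0); congr Rintegral; apply/funext => t.
  have [lin _] := ih M M0; apply: lin.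
  - exact: (joint_csV t (joint_row_cons sf)).
  - exact: (joint_csV t (joint_row_cons sg)).
  - exact: in_box_y.
  - exact: in_box_y.
have [sF F0] := F f sf bf.
rewrite exprSr mulrA; apply: (int_bound M0 sF F0) => t.
have [_ bnd] := ih M M0; apply: bnd => //.
- exact: (joint_csV t (joint_row_cons sf)).
- exact: in_box_y.
Qed.

(** In the first coordinate the derivative passes outside the inner integral, and the fundamental
    theorem of calculus applies to the outer one. In the other coordinates the inner integral
    already vanishes by induction. *)
Lemma int_pderiv n M (f : 'rV[R]_n -> R) i : 0 <= M -> csV setT f -> in_box M f ->
  Rn_integral (pderiv i f) = 0.
Proof.
elim: n f i => [f []//|n ih] f i M0 sf bf.
have sU := joint_row_cons sf.
have bU t : in_box M (fun y => f (row_cons t y)) by exact: in_box_y.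
have [j ->|j ->] := @split_ordP 1 n i => /=.
  rewrite (ord1 j).
  rewrite -(int_derive1 (f := fun t => Rn_integral (fun y => f (row_cons t y))) M0); first last.
  - move=> t tM; have [lin _] := int_specP n M0.
    have := lin _ _ 0 0 (joint_csV t sU) (joint_csV t sU) (bU t) (bU t); rewrite !mul0r addr0 => <-.
    by congr Rn_integral; apply/funext => y; rewrite !mul0r addr0 (in_box_t y bf tM).
  - exact: int_sm (int_specP n) M0 sU bU.
  congr Rintegral; apply/funext => t.
  rewrite (isd_eq (int_isd t (int_specP n) M0 sU bU)).
  by congr Rn_integral; apply/funext => y; rewrite -pderiv_row_cons0.
transitivity (\int[@lebesgue_measure R]_t (0 : R)); last by rewrite Rintegral_cst ?mul0r.
congr Rintegral; apply/funext => t.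
rewrite -(ih (fun y => f (row_cons t y)) j M0 (joint_csV t sU) (bU t)).
by congr Rn_integral; apply/funext => y; rewrite -pderiv_row_consS.
Qed.

End iterated_integrals.

(** * Real and imaginary parts, uniformly for both scalar fields *)

Section scalar_components.
Variable R : realType.

(** Every scalar is [reK u *: oneK + imK u *: iK] ([K_eq]). For real scalars [imK] and [iK] are 0,
    so both fields are treated by the same formulas. *)
Definition reK F : scalars R F -> R :=
  match F with RealScalars => fun v : R => v | ComplexScalars => @complex.Re R end.
Definition imK F : scalars R F -> R :=
  match F with RealScalars => fun=> 0 | ComplexScalars => @complex.Im R end.
Definition oneK F : scalars R F :=
  match F with RealScalars => (1 : R) | ComplexScalars => (Complex 1 0 : Rcomplex R) end.
Definition iK F : scalars R F :=
  match F with RealScalars => (0 : R) | ComplexScalars => (Complex 0 1 : Rcomplex R) end.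

Variable F : scalar_kind.
Implicit Types u v : scalars R F.

Lemma reB u v : reK (u - v) = reK u - reK v.
Proof. by move: u v; rewrite /reK; case: F => // [[a b] [c d]]. Qed.
Lemma imB u v : imK (u - v) = imK u - imK v.
Proof. by move: u v; rewrite /imK; case: F => [_ _|[a b] [c d]//]; rewrite subrr. Qed.
Lemma reZ (a : R) u : reK (a *: u) = a * reK u.
Proof. by move: u; rewrite /reK; case: F => // [[b c]]. Qed.
Lemma imZ (a : R) u : imK (a *: u) = a * imK u.
Proof. by move: u; rewrite /imK; case: F => [_|[b c]//]; rewrite mulr0. Qed.
Lemma re_le u : `|reK u| <= 1 * `|u|.
Proof. by rewrite mul1r; move: u; rewrite /reK; case: F => // u; exact: Rcomplex_Re_le. Qed.
Lemma im_le u : `|imK u| <= 1 * `|u|.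
Proof.
rewrite mul1r; move: u; rewrite /imK; case: F => u; last exact: Rcomplex_Im_le.
by rewrite normr0.
Qed.
Lemma K_eq u : u = reK u *: oneK F + imK u *: iK F.
Proof.
move: u; rewrite /reK /imK /oneK /iK; case: F => [u|[a b]].
  by rewrite scaler0 addr0; rewrite -[RHS]/(u * 1) mulr1.
apply/eqP; rewrite eq_complex; apply/andP; split; apply/eqP.
  by rewrite -[RHS]/(a * 1 + b * 0) mulr1 mulr0 addr0.
by rewrite -[RHS]/(a * 0 + b * 1) mulr1 mulr0 add0r.
Qed.
Lemma reM u v : reK (scalar_mul u v) = reK u * reK v - imK u * imK v.
Proof. by move: u v; rewrite /reK /imK /scalar_mul; case: F => [u v|[a b] [c d]//]; rewrite mulr0 subr0. Qed.
Lemma imM u v : imK (scalar_mul u v) = reK u * imK v + imK u * reK v.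
Proof. by move: u v; rewrite /reK /imK /scalar_mul; case: F => [u v|[a b] [c d]//]; rewrite mulr0 mul0r addr0. Qed.
Lemma scalar_mul_one (a : R) v : scalar_mul (a *: oneK F) v = a *: v.
Proof.
move: v; rewrite /scalar_mul /oneK; case: F => [v|[b c]].
  by rewrite -[a *: 1]/(a * 1) mulr1.
apply/eqP; rewrite eq_complex; apply/andP; split; apply/eqP.
  by rewrite -[LHS]/(a * 1 * b - a * 0 * c) mulr1 mulr0 mul0r subr0.
by rewrite -[LHS]/(a * 1 * c + a * 0 * b) mulr1 mulr0 mul0r addr0.
Qed.

Lemma scalar_integralE n (Om : set 'rV[R]_n) (g : 'rV[R]_n -> scalars R F) :
  scalar_integral Om g = Rn_integral_on Om (fun y => reK (g y)) *: oneK F +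
    (if F is RealScalars then 0 else Rn_integral_on Om (fun y => imK (g y))) *: iK F.
Proof.
move: g; rewrite /scalar_integral /reK /imK /oneK /iK; case: F => g.
  by rewrite scaler0 addr0; rewrite -[RHS]/(_ * 1) mulr1.
set a := Rn_integral_on _ _; set b := Rn_integral_on _ _.
apply/eqP; rewrite eq_complex; apply/andP; split; apply/eqP.
  by rewrite -[RHS]/(a * 1 + b * 0) mulr1 mulr0 addr0.
by rewrite -[RHS]/(a * 0 + b * 1) mulr1 mulr0 add0r.
Qed.

Lemma re_comb (a b : R) : reK (a *: oneK F + b *: iK F) = a.
Proof.
rewrite /reK /oneK /iK; case: F.
  by rewrite scaler0 addr0; exact: mulr1.
by rewrite -[LHS]/(a * 1 + b * 0) mulr1 mulr0 addr0.
Qed.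
Lemma im_comb (a b : R) : imK (a *: oneK F + b *: iK F) = if F is RealScalars then 0 else b.
Proof.
rewrite /imK /oneK /iK; case: F => //.
by rewrite -[LHS]/(a * 0 + b * 1) mulr1 mulr0 add0r.
Qed.

Lemma iK_if (u : R) : (if F is RealScalars then 0 else u) *: iK F = u *: iK F.
Proof. by rewrite /iK; case: F => //; rewrite !scaler0. Qed.
Lemma im_real u : F = RealScalars -> imK u = 0.
Proof. by move: u; rewrite /imK; case: F. Qed.
Lemma if_real (u : R) : (F = RealScalars -> u = 0) -> (if F is RealScalars then 0 else u) = u.
Proof. by case: F => // ->. Qed.

Lemma sm_re (c : R -> scalars R F) : sm c -> sm (fun t => reK (c t)).
Proof. exact: (sm_bounded_linear reB reZ re_le). Qed.
Lemma sm_im (c : R -> scalars R F) : sm c -> sm (fun t => imK (c t)).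
Proof. exact: (sm_bounded_linear imB imZ im_le). Qed.

End scalar_components.

(** * Linearity of the integral on D(Om) and integration by parts *)

Section integration_by_parts.
Variables (R : realType) (n : nat) (F : scalar_kind) (Om : set 'rV[R]_n).
Hypothesis oOm : open Om.
Local Notation V := 'rV[R]_n.
Local Notation K := (scalars R F).
Local Notation D := (testfun K Om).
Let Wc := @scalars_complete R F.
Let Rc := @real_seq_complete R.
Implicit Types (g h : D) (b : V -> R).

Lemma tf_box g : exists2 M : R, 0 <= M & forall y, M < `|y| -> g y = 0.
Proof.
have [k gk] := supp_exh oOm g; exists k%:R => // y ky.
by apply: supp0 => /gk[/(lt_le_trans ky)]; rewrite ltxx.
Qed.

Definition intD h : K := scalar_integral Om h.

Lemma patch_tf (L : K -> R) h : L 0 = 0 -> (fun y => L (h y)) \_ Om = (fun y => L (h y)).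
Proof.
move=> L0; apply/funext => y; rewrite patchE; case: ifPn => //.
rewrite notin_setE => Oy; rewrite supp0 ?L0//.
by have [_ _ hO] := testfunP h; apply: contra_not Oy; exact: hO.
Qed.

Lemma reK0 : reK (0 : K) = 0. Proof. by rewrite -(scale0r 0) reZ mul0r. Qed.
Lemma imK0 : imK (0 : K) = 0. Proof. by rewrite -(scale0r 0) imZ mul0r. Qed.

Lemma csV_re A (f : V -> K) : csV A f -> csV A (fun y => reK (f y)).
Proof. by move=> sf c sc Ac; apply: sm_re; exact: sf. Qed.
Lemma csV_im A (f : V -> K) : csV A f -> csV A (fun y => imK (f y)).
Proof. by move=> sf c sc Ac; apply: sm_im; exact: sf. Qed.

Lemma Rn_integral0 : Rn_integral (fun _ : V => 0 : R) = 0.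
Proof.
have [lin _] := @int_specP R n 0 (lexx 0).
have sc : csV setT (fun _ : V => 0 : R) by exact: csV_cst.
have := lin _ _ 0 0 sc sc (fun y _ => erefl) (fun y _ => erefl).
by rewrite !mul0r !addr0.
Qed.

Lemma intDE h : intD h = Rn_integral (fun y => reK (h y)) *: oneK R F +
   Rn_integral (fun y => imK (h y)) *: iK R F.
Proof.
rewrite /intD scalar_integralE /Rn_integral_on !patch_tf ?reK0 ?imK0//; congr (_ + _).
exact: iK_if.
Qed.

Lemma re_intD h : reK (intD h) = Rn_integral (fun y => reK (h y)).
Proof. by rewrite intDE re_comb. Qed.

Lemma im_intD h : imK (intD h) = Rn_integral (fun y => imK (h y)).
Proof.
rewrite intDE im_comb if_real// => FE.
by rewrite -Rn_integral0; congr Rn_integral; apply/funext => y; exact: im_real.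
Qed.

Lemma Rn_integral_lin (f g : V -> R) (a b M N : R) : csV setT f -> csV setT g ->
  0 <= M -> 0 <= N -> in_box M f -> in_box N g ->
  Rn_integral (fun y => a * f y + b * g y) = a * Rn_integral f + b * Rn_integral g.
Proof.
move=> sf sg M0 N0 bf bg; have MN0 : 0 <= Num.max M N by rewrite le_max M0.
have [lin _] := @int_specP R n _ MN0; apply: lin => // y; rewrite gt_max => /andP[yM yN].
  exact: bf.
exact: bg.
Qed.

Lemma intD_lin (a b : R) g h : intD (a *: g + b *: h) = a *: intD g + b *: intD h.
Proof.
have [M M0 gM] := tf_box g; have [N N0 hN] := tf_box h.
have sg := tf_csV g; have sh := tf_csV h.
have E (L : K -> R) : (forall u v, L (u - v) = L u - L v) -> (forall (c : R) u, L (c *: u) = c * L u) ->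
   (forall A (f : V -> K), csV A f -> csV A (fun y => L (f y))) ->
   Rn_integral (fun y => L ((a *: g + b *: h : D) y)) = a * Rn_integral (fun y => L (g y)) + b * Rn_integral (fun y => L (h y)).
  move=> LB LZ Ls.
  have L0 : L 0 = 0 by rewrite -(scale0r 0) LZ mul0r.
  have LD u v : L (u + v) = L u + L v.
    rewrite -{1}[v]opprK LB (_ : L (- v) = - L v) ?opprK//.
    by rewrite -scaleN1r LZ mulN1r.
  rewrite -(@Rn_integral_lin _ _ a b M N) //; try exact: Ls.
  - by congr Rn_integral; apply/funext => y; rewrite tfD !tfZ LD !LZ.
  - by move=> y /gM ->.
  - by move=> y /hN ->.
rewrite !intDE (E _ (@reB R F) (@reZ R F) csV_re) (E _ (@imB R F) (@imZ R F) csV_im).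
rewrite !scalerDr !scalerDl !scalerA; exact: addrACA.
Qed.

Lemma intD_add g h : intD (g + h) = intD g + intD h.
Proof. by have := intD_lin 1 1 g h; rewrite !scale1r. Qed.

Lemma intDZ a h : intD (a *: h) = a *: intD h.
Proof. by have := intD_lin a 0 h h; rewrite !scale0r !addr0. Qed.

Lemma pderiv_comp_linear (L : K -> R) i h y :
  (forall u v, L (u - v) = L u - L v) -> (forall (c : R) u, L (c *: u) = c * L u) ->
  (forall u, `|L u| <= 1 * `|u|) -> pderiv i (fun y => L (h y)) y = L (pderiv i h y).
Proof.
move=> LB LZ Ln; rewrite /pderiv -(derive1_line0 (fun y => L (h y))).
apply: isd_eq; apply: (isd_bounded_linear LB LZ Ln).
exact: (csV_isd_line Wc openT (basisv R i) (tf_csV h) I).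
Qed.

Lemma intD_pderiv i h : intD (testfun_pderiv i h) = 0.
Proof.
have [M M0 hM] := tf_box h.
have E (L : K -> R) : (forall u v, L (u - v) = L u - L v) -> (forall (c : R) u, L (c *: u) = c * L u) ->
   (forall u, `|L u| <= 1 * `|u|) -> (forall A (f : V -> K), csV A f -> csV A (fun y => L (f y))) ->
   Rn_integral (fun y => L (testfun_pderiv i h y)) = 0.
  move=> LB LZ Ln Ls; rewrite -(@int_pderiv R n M (fun y => L (h y)) i) //.
  - by congr Rn_integral; apply/funext => y; rewrite pderiv_comp_linear.
  - by apply: Ls; exact: tf_csV.
  - by move=> y /hM ->; rewrite -(scale0r 0) LZ mul0r.
rewrite intDE (E _ (@reB R F) (@reZ R F) (@re_le R F) csV_re).
by rewrite (E _ (@imB R F) (@imZ R F) (@im_le R F) csV_im) !scale0r addr0.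
Qed.

Lemma testfun_pderiv_mul i b (sb : csV Om b) h :
  testfun_pderiv i (tf_mul oOm sb h) =
  tf_mul oOm sb (testfun_pderiv i h) + tf_mul oOm (csV_pderiv Rc oOm i sb) h.
Proof. exact: (dy_mul oOm sb (fun _ _ => h) i 0 0). Qed.

Lemma intD_by_parts i b (sb : csV Om b) h :
  intD (tf_mul oOm sb (testfun_pderiv i h)) = - intD (tf_mul oOm (csV_pderiv Rc oOm i sb) h).
Proof.
by apply/eqP; rewrite -addr_eq0 -intD_add -testfun_pderiv_mul intD_pderiv.
Qed.

(** Multiplication by the imaginary unit for complex scalars, and 0 for real ones. *)
Definition turnK (u : K) : K := reK u *: iK R F - imK u *: oneK R F.

Lemma turnKB u v : turnK (u - v) = turnK u - turnK v.
Proof. by rewrite /turnK reB imB !scalerBl !opprB addrACA [RHS]addrACA; congr (_ + _); exact: addrC. Qed.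

Lemma turnK_one (a : R) : turnK (a *: oneK R F) = a *: iK R F.
Proof.
have := re_comb F a 0; have := im_comb F a 0; rewrite scale0r addr0 /turnK => -> ->.
by case: F; rewrite ?scale0r subr0.
Qed.

Lemma turnK_le u : `|turnK u| <= (`|iK R F| + `|oneK R F|) * `|u|.
Proof.
rewrite /turnK (le_trans (ler_normB _ _))// !normrZ mulrDl.
have := re_le u; have := im_le u; rewrite !mul1r => iu ru.
by rewrite lerD// mulrC ler_wpM2l.
Qed.

Lemma int_mul (f : V -> K) (sre : csV Om (fun y => reK (f y))) (sim : csV Om (fun y => imK (f y))) h :
  scalar_integral Om (fun y => scalar_mul (f y) (h y)) =
  intD (tf_mul oOm sre h) + turnK (intD (tf_mul oOm sim h)).
Proof.
have [M M0 hM] := tf_box h.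
have zero (L : K -> R) : L 0 = 0 -> (L = @reK R F \/ L = @imK R F) ->
   (fun y => L (scalar_mul (f y) (h y))) \_ Om = (fun y => L (scalar_mul (f y) (h y))).
  move=> L0 LL; apply/funext => y; rewrite patchE; case: ifPn => //.
  rewrite notin_setE => Oy; rewrite (supp0 (f := h) (x := y)).
    by case: LL => ->; rewrite ?reM ?imM reK0 imK0 !mulr0 ?subr0 ?addr0.
  by have [_ _ hO] := testfunP h; apply: contra_not Oy; exact: hO.
rewrite scalar_integralE /Rn_integral_on (zero _ reK0 (or_introl erefl)) (zero _ imK0 (or_intror erefl)).
rewrite /turnK re_intD im_intD intDE.
pose ff (c L : K -> R) y := c (f y) * L (h y).
have sff (c L : K -> R) : csV Om (fun y => c (f y)) ->
  (forall (a : R) u, L (a *: u) = a * L u) -> (forall A (f : V -> K), csV A f -> csV A (fun y => L (f y))) ->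
  csV setT (ff c L) /\ in_box M (ff c L).
  move=> sc LZ Ls; split.
    have -> : ff c L = fun y => L (tf_mul oOm sc h y) by apply/funext => y; rewrite /= LZ.
    by apply: Ls; exact: tf_csV.
  by move=> y /hM; rewrite /ff => ->; rewrite -(scale0r 0) LZ mul0r mulr0.
have [s1 b1] := sff _ _ sre (@reZ R F) csV_re; have [s2 b2] := sff _ _ sre (@imZ R F) csV_im.
have [s3 b3] := sff _ _ sim (@reZ R F) csV_re; have [s4 b4] := sff _ _ sim (@imZ R F) csV_im.
have -> : (fun y => reK (scalar_mul (f y) (h y))) =
    fun y => 1 * ff (@reK R F) (@reK R F) y + (-1) * ff (@imK R F) (@imK R F) y.
  by apply/funext => y; rewrite reM mul1r mulN1r.
have -> : (fun y => imK (scalar_mul (f y) (h y))) =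
    fun y => 1 * ff (@reK R F) (@imK R F) y + 1 * ff (@imK R F) (@reK R F) y.
  by apply/funext => y; rewrite imM !mul1r.
rewrite !(@Rn_integral_lin _ _ _ _ M M)// !mul1r mulN1r.
have E (c L : K -> R) (sc : csV Om (fun y => c (f y))) : (forall (a : R) u, L (a *: u) = a * L u) ->
    Rn_integral (fun y => L (tf_mul oOm sc h y)) = Rn_integral (ff c L).
  by move=> LZ; congr Rn_integral; apply/funext => y; rewrite /= LZ.
rewrite (E _ _ sre (@reZ R F)) (E _ _ sre (@imZ R F)) (E _ _ sim (@reZ R F)) (E _ _ sim (@imZ R F)).
set a := Rn_integral _; set b := Rn_integral _; set c := Rn_integral _; set d := Rn_integral _.
rewrite scalerBl.
have -> : (if F is RealScalars then 0 else c + d) *: iK R F = c *: iK R F + d *: iK R F.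
  by rewrite iK_if scalerDl.
by rewrite addrACA; congr (_ + _); exact: addrC.
Qed.

End integration_by_parts.

(** * Moment conditions and admissible perturbations of kernels *)

Section moments.
Variables (R : realType) (n : nat) (F : scalar_kind) (Om : set 'rV[R]_n).
Hypothesis oOm : open Om.
Local Notation V := 'rV[R]_n.
Local Notation K := (scalars R F).
Local Notation D := (testfun K Om).
Local Notation dx := (@kernel_dx R n F Om).
Local Notation dxy := (@kernel_dxy R n F Om).
Local Notation dy := (@kernel_dy R n F Om).
Let Wc := @scalars_complete R F.
Let Rc := @real_seq_complete R.
Implicit Types (phi psi : R -> V -> D) (b : V -> R) (a h : R -> V -> R) (A : set V).

Lemma tf_mul_lin b (sb : csV Om b) (f g : D) : tf_mul oOm sb (f + g) = tf_mul oOm sb f + tf_mul oOm sb g.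
Proof. by apply: tf_eq => y; exact: (scalerDr (b y) (f y) (g y)). Qed.

Lemma tf_mulZ b (sb : csV Om b) c (f : D) : tf_mul oOm sb (c *: f) = c *: tf_mul oOm sb f.
Proof.
apply: tf_eq => y.
have E : b y *: (c *: f y) = c *: (b y *: f y) by rewrite !scalerA mulrC.
exact: E.
Qed.

Definition moment q b (sb : csV Om b) phi h := forall A, ccompact Om A -> exists2 C : R, 0 <= C &
  near0 (fun e => forall x, A x ->
    `|intD (tf_mul oOm sb (phi e x)) - h e x *: oneK R F| <= C * e ^+ q.+1).

(** An inductive form of (LSK3) for a real weight [b], with a variable target [h]: the target is [b]
    itself for a smoothing kernel and 0 for an admissible perturbation. *)
Fixpoint moments q b (sb : csV Om b) k phi h : Prop :=
  moment q sb phi h /\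
  if k is k'.+1 then
    forall i, moments q sb k' (dx i phi) (fun e => pderiv i (h e))
  else True.

Definition ceq h h' := forall e x, kdom Om e x -> h e x = h' e x.

Lemma ceq_pderiv i h h' : ceq h h' -> ceq (fun e => pderiv i (h e)) (fun e => pderiv i (h' e)).
Proof.
move=> hh e x [e0 e1 Ox]; apply: near_eq_derive; apply: (near_Om oOm) => // z Oz.
exact: hh.
Qed.

Section fixed_order.
Variable q : nat.

Lemma moment_eq b (sb : csV Om b) phi psi h h' : keq phi psi -> ceq h h' ->
  moment q sb phi h -> moment q sb psi h'.
Proof.
move=> pp hh H A cA; have [C C0 HA] := H A cA; exists C => //.
apply: near0W HA => e e0 e1 HA x Ax; have ex := kdomW oOm cA e0 e1 Ax.
by rewrite -pp// -hh//; exact: HA.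
Qed.

Lemma moments_eq b (sb : csV Om b) k phi psi h h' : KS phi -> keq phi psi -> ceq h h' ->
  moments q sb k phi h -> moments q sb k psi h'.
Proof.
elim: k phi psi h h' => [|k ih] phi psi h h' ks pp hh [m0 mS]; split => //; try exact: moment_eq m0.
by move=> i; apply: ih (mS i); [exact: KS_dx|exact: keq_dx|exact: ceq_pderiv].
Qed.

Lemma moment_add b (sb : csV Om b) phi psi h h' :
  moment q sb phi h -> moment q sb psi h' -> moment q sb (kplus phi psi) (fun e x => h e x + h' e x).
Proof.
move=> H1 H2 A cA; have [C C0 HA] := H1 A cA; have [C' C0' HA'] := H2 A cA.
exists (C + C'); first exact: addr_ge0.
apply: near0W (near0I HA HA') => e e0 e1 [Ha Hb] x Ax.
rewrite /kplus tf_mul_lin (intD_add oOm) scalerDl opprD addrACA mulrDl.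
by rewrite (le_trans (ler_normD _ _))// lerD//; [exact: Ha|exact: Hb].
Qed.

Lemma moments_add b (sb : csV Om b) k phi psi h h' : KS phi -> KS psi -> coef Om h -> coef Om h' ->
  moments q sb k phi h -> moments q sb k psi h' ->
  moments q sb k (kplus phi psi) (fun e x => h e x + h' e x).
Proof.
elim: k phi psi h h' => [|k ih] phi psi h h' ks ls sh sh' [m0 mS] [l0 lS]; split; try exact: moment_add.
  by [].
move=> i; apply: moments_eq (ih _ _ _ _ _ _ _ _ (mS i) (lS i)).
- by apply: KS_add; exact: KS_dx.
- by apply: keq_sym; exact: dx_add.
- move=> e x [e0 e1 Ox]; apply/esym; apply: (pderivD Rc oOm) => //; exact: coef_csV.
- exact: KS_dx.
- exact: KS_dx.
- exact: coef_pderiv.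
- exact: coef_pderiv.
Qed.

Lemma moment_scale a b (sb : csV Om b) phi h : bounded_coef Om 0 a ->
  moment q sb phi h -> moment q sb (kscale a phi) (fun e x => a e x * h e x).
Proof.
move=> [Ha _] H A cA; have [C C0 HA] := H A cA; have [C' C0' HA'] := Ha A cA.
exists (C' * C); first exact: mulr_ge0.
apply: near0W HA => e e0 e1 HA x Ax.
rewrite /kscale tf_mulZ (intDZ oOm) -scalerA -scalerBr normrZ -mulrA.
by rewrite ler_pM//; [exact: HA'|exact: HA].
Qed.

Lemma coefM a h : coef Om a -> coef Om h -> coef Om (fun e x => a e x * h e x).
Proof. by move=> sa sh e x se sx ex; apply: smoM; [exact: openT|exact: sa|exact: sh]. Qed.

Lemma momentsW b (sb : csV Om b) k phi h : moments q sb k.+1 phi h -> moments q sb k phi h.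
Proof.
elim: k phi h => [|k ih] phi h; first by case.
by move=> [m mS]; split=> // i; exact: ih.
Qed.

Lemma moments_scale a b (sb : csV Om b) k phi h : coef Om a -> bounded_coef Om k a ->
  KS phi -> coef Om h -> moments q sb k phi h ->
  moments q sb k (kscale a phi) (fun e x => a e x * h e x).
Proof.
elim: k a phi h => [|k ih] a phi h sa ba ks sh.
  by move=> [m _]; split=> //; exact: moment_scale.
have b0 : bounded_coef Om 0 a by split=> //; case: ba.
move=> /[dup]/momentsW mW [m mS]; split; first exact: moment_scale.
move=> i; apply: moments_eq (moments_add _ _ _ _ (ih a _ _ sa (bounded_coefW ba) _ _ (mS i))
    (ih _ phi h _ (ba.2 i) ks sh mW)).
- by apply: KS_add; apply: KS_scale => //; [exact: KS_dx|exact: coef_pderiv].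
- by apply: keq_sym; exact: dx_scale.
- move=> e x [e0 e1 Ox]; apply/esym.
  apply: (pderiv_scale Rc oOm i) => //; exact: coef_csV.
- by apply: KS_scale => //; exact: KS_dx.
- by apply: KS_scale => //; exact: coef_pderiv.
- by apply: coefM => //; exact: coef_pderiv.
- by apply: coefM => //; exact: coef_pderiv.
- exact: KS_dx.
- exact: coef_pderiv.
- exact: coef_pderiv.
Qed.

Lemma csVM b c : csV Om b -> csV Om c -> csV Om (fun x => b x * c x).
Proof. by move=> sb sc y sy Oy; apply: smoM; [exact: openT|exact: sb|exact: sc]. Qed.

Lemma tf_mul_mul b c (sb : csV Om b) (sc : csV Om c) (sbc : csV Om (fun x => b x * c x)) (f : D) :
  tf_mul oOm sb (tf_mul oOm sc f) = tf_mul oOm sbc f.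
Proof. by apply: tf_eq => y /=; rewrite scalerA. Qed.

Lemma moments_mul b c (sb : csV Om b) (sc : csV Om c) k phi h : KS phi ->
  moments q (csVM sb sc) k phi h -> moments q sb k (kmul oOm sc phi) h.
Proof.
have M0 psi h' : moment q (csVM sb sc) psi h' -> moment q sb (kmul oOm sc psi) h'.
  move=> m A cA; have [C C0 HA] := m A cA; exists C => //.
  apply: near0W HA => e e0 e1 HA x Ax.
  by rewrite /kmul (tf_mul_mul sb sc (csVM sb sc)); exact: HA.
elim: k phi h => [|k ih] phi h ks [m mS]; first by split=> //; exact: M0.
split; first exact: M0.
move=> i; apply: moments_eq (ih _ _ _ (mS i)) => //; last exact: KS_dx.
  by apply: KS_mul; exact: KS_dx.
by apply: keq_sym; exact: dx_mul.
Qed.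

(** Integration by parts moves d_y to the weight with a change of sign. *)
Lemma moments_dy b (sb : csV Om b) i k phi h : KS phi -> coef Om h ->
  moments q (csV_pderiv Rc oOm i sb) k phi h ->
  moments q sb k (dy i phi) (fun e x => - h e x).
Proof.
have M0 psi h' : moment q (csV_pderiv Rc oOm i sb) psi h' -> moment q sb (dy i psi) (fun e x => - h' e x).
  move=> m A cA; have [C C0 HA] := m A cA; exists C => //.
  apply: near0W HA => e e0 e1 HA x Ax.
  rewrite /kernel_dy (intD_by_parts oOm) scaleNr opprK -normrN opprD opprK.
  exact: HA.
elim: k phi h => [|k ih] phi h ks sh [m mS]; first by split=> //; exact: M0.
split; first exact: M0.
move=> j; apply: moments_eq (ih _ _ _ _ (mS j)).
- by apply: KS_dy; exact: KS_dx.
- by apply: keq_sym; exact: dxdy_comm.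
- move=> e x [e0 e1 Ox]; apply/esym.
  have -> : (fun x => - h e x) = (fun x => (-1) *: h e x) by apply/funext => z; rewrite scaleN1r.
  by rewrite (pderivZ Rc oOm) ?scaleN1r//; exact: coef_csV.
- exact: KS_dx.
- exact: coef_pderiv.
Qed.

End fixed_order.

Lemma pderiv_scale_cst i b (w : K) x : csV Om b -> Om x ->
  pderiv i (fun y => b y *: w) x = pderiv i b x *: w.
Proof.
move=> sb Ox; rewrite (pderiv_scale Wc oOm i sb (csV_cst _) Ox).
have -> : pderiv i (fun _ : V => w) x = 0 by exact: derive_cst.
by rewrite scaler0 add0r.
Qed.

Lemma pderivs_scale_cst s b (w : K) x : csV Om b -> Om x ->
  pderivs s (fun y => b y *: w) x = pderivs s b x *: w.
Proof.
move=> sb; elim: s x => //= i s ih x Ox.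
rewrite -(pderiv_scale_cst i w (csV_pderivs Rc oOm s sb) Ox).
by apply: near_eq_derive; apply: (near_Om oOm) => // z Oz; exact: ih.
Qed.

Lemma pderivs_perm (W : normedModType R) (f : V -> W) s1 s2 x : seq_complete W ->
  csV Om f -> perm_eq s1 s2 -> Om x -> pderivs s1 f x = pderivs s2 f x.
Proof.
move=> Wc' sf s12 Ox.
pose eqv (f g : V -> W) := forall x, Om x -> f x = g x.
have e1 g : eqv g g by [].
have e2 g g2 : eqv g g2 -> eqv g2 g by move=> gh y Oy; rewrite gh.
have e3 g g2 g3 : eqv g g2 -> eqv g2 g3 -> eqv g g3 by move=> gh gk y Oy; rewrite gh// gk.
have e4 i (g : V -> W) : csV Om g -> csV Om (pderiv i g) by move=> sg; exact: (csV_pderiv Wc' oOm i sg).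
have e5 i (g g2 : V -> W) : csV Om g -> csV Om g2 -> eqv g g2 -> eqv (pderiv i g) (pderiv i g2).
  by move=> _ _ gh y Oy; apply: near_eq_derive; exact: (near_Om oOm).
have e6 i j (g : V -> W) : csV Om g -> eqv (pderiv i (pderiv j g)) (pderiv j (pderiv i g)).
  by move=> sg y Oy; exact: (csV_schwarz Wc' oOm).
have H := @foldr_perm n (V -> W) (@csV R n W Om) eqv (@pderiv R n W) e1 e2 e3 e4 e5 e6 f s1 s2 sf s12.
exact: (H x Ox).
Qed.

Lemma dx_word_perm phi s1 s2 : KS phi -> perm_eq s1 s2 ->
  keq (foldr dx phi s1) (foldr dx phi s2).
Proof.
apply: (@foldr_perm n _ (@KS R n F Om) (@keq _ _ _ _) dx (@keqxx _ _ _ _) (@keq_sym _ _ _ _)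
  (@keq_trans _ _ _ _)).
- by move=> i f; exact: KS_dx.
- by move=> i f g ks _ fg; exact: keq_dx.
- by move=> i j f ks; exact: dx_comm.
Qed.

(** Real weights suffice: a scalar weight f is split by [K_eq], and [turnK] carries the moment of
    its imaginary part. *)
Lemma LSK3_moments q phi : KS phi ->
  (LSK3 q phi <-> forall b (sb : csV Om b) k, moments q sb k phi (fun=> b)).
Proof.
move=> ks; split=> H.
  move=> b sb.
  have Hw w : moment q sb (foldr dx phi w) (fun=> pderivs w b).
    move=> A cA.
    pose f y : K := b y *: oneK R F.
    have sf : smooth_on Om f.
      by apply: (csV_smooth_on Wc oOm); apply: csV_scale => //; exact: csV_cst.
    have [e0 [C [e00 C0 HA]]] := H A cA (fun i => count_mem i w) f sf.
    exists C; first exact: ltW.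
    exists e0 => // e ep e1 ee x Ax; have ex := kdomW oOm cA ep e1 Ax.
    have [_ _ Ox] := ex.
    have := HA e x ep e1 ee Ax; rewrite /mpderiv !mindex_iter_word.
    rewrite -[foldr _ f _]/(pderivs _ f) (pderivs_scale_cst _ _ sb Ox).
    rewrite (pderivs_perm Rc sb (perm_word w) Ox) (dx_word_perm ks (perm_word w) ex).
    congr (`|_ - _| <= _); rewrite /intD; congr scalar_integral.
    by apply/funext => y; rewrite /f scalar_mul_one.
  move=> k; suff : forall w, moments q sb k (foldr dx phi w) (fun=> pderivs w b).
    by move=> /(_ [::]).
  elim: k => [|k ih] w; first by split=> //; exact: Hw.
  by split; [exact: Hw|move=> i; exact: (ih (i :: w))].
move=> A cA al f sf; have cf := smooth_on_csV sf.
have sre := csV_re cf; have sim := csV_im cf.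
have Hw b (sb : csV Om b) w : moment q sb (foldr dx phi w) (fun=> pderivs w b).
  suff Hk k : moments q sb k (foldr dx phi w) (fun=> pderivs w b) by have [] := Hk 0%N.
  by elim: w k => [|i w ih] k /=; [exact: H|have [_] := ih k.+1; exact].
have [C C0 HC] := Hw _ sre (word al) A cA; have [C' C0' HC'] := Hw _ sim (word al) A cA.
have [e0 e00 HH] := near0I HC HC'.
pose N := `|iK R F| + `|oneK R F| : R.
exists e0, (C + N * C' + 1); split=> //.
  by rewrite ltr_wpDl// addr_ge0// mulr_ge0// addr_ge0.
move=> e x ep e1 ee Ax; have [H1 H2] := HH e ep e1 ee.
have [_ _ Ox] := kdomW oOm cA ep e1 Ax.
rewrite /mpderiv !mindex_iter_word (int_mul oOm sre sim).
have -> : foldr (@pderiv R n K) f (word al) x =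
    pderivs (word al) (fun y => reK (f y)) x *: oneK R F + turnK (pderivs (word al) (fun y => imK (f y)) x *: oneK R F).
  rewrite turnK_one -[LHS]/(pderivs (word al) f x).
  have fE : f = (fun y => 1 *: (reK (f y) *: oneK R F) + 1 *: (imK (f y) *: iK R F)).
    by apply/funext => y; rewrite !scale1r -K_eq.
  rewrite [in LHS]fE (pderivs_lin Wc oOm)//; try by apply: csV_scale => //; exact: csV_cst.
  by rewrite !scale1r !pderivs_scale_cst.
rewrite opprD addrACA -turnKB mulrDl mulrDl (le_trans (ler_normD _ _))//.
rewrite -[leLHS]addr0 lerD//; last by rewrite mul1r exprn_ge0// ltW.
rewrite lerD//; first exact: H1.
rewrite (le_trans (turnK_le _))// -mulrA ler_wpM2l ?addr_ge0//.
exact: H2.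
Qed.

(** The directions in which smoothing kernels of order [q] may be perturbed: the same support and
    growth conditions, but all moments are O(e^(q+1)). *)
Definition null_kernel q psi := [/\ KS psi, near_diag psi, forall k, growths k n psi &
  forall b (sb : csV Om b) k, moments q sb k psi (fun _ _ => 0)].

Lemma coef0 : coef Om (fun _ _ => 0).
Proof. by move=> e x _ _ _; exact/smo_cst/openT. Qed.

Lemma null_kernel_add q phi psi : null_kernel q phi -> null_kernel q psi -> null_kernel q (kplus phi psi).
Proof.
move=> [k1 n1 g1 m1] [k2 n2 g2 m2]; split.
- exact: KS_add.
- exact: near_diag_add.
- by move=> k; exact: growths_add.
- move=> b sb k; have := moments_add k1 k2 coef0 coef0 (m1 b sb k) (m2 b sb k).
  apply: moments_eq => //; first exact: KS_add.
  by move=> e x _; rewrite addr0.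
Qed.

Definition sound_kernel q phi := [/\ KS phi, near_diag phi, forall k, growths k n phi &
  forall b (sb : csV Om b) k, moments q sb k phi (fun=> b)].

Lemma smoothing_kernelP q phi : smoothing_kernel q phi <-> sound_kernel q phi.
Proof.
split=> [[/(kernel_smoothP oOm) ks /LSK1P ln l2 l3]|[ks ln l2 l3]].
  split=> //; first by apply/(LSK2_growths oOm ks).
  by apply/(LSK3_moments q ks).
by split; [exact/(kernel_smoothP oOm)|exact/LSK1P|exact/(LSK2_growths oOm ks)|exact/(LSK3_moments q ks)].
Qed.

Lemma sound_kernel_perturb q a phi psi : coef Om a -> (forall k, bounded_coef Om k a) ->
  sound_kernel q phi -> null_kernel q psi -> sound_kernel q (kplus phi (kscale a psi)).
Proof.
move=> sa ba [k1 n1 g1 m1] [k2 n2 g2 m2]; have ks := KS_scale sa k2; split.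
- exact: KS_add.
- by apply: near_diag_add => //; exact: near_diag_scale.
- by move=> k; apply: growths_add => //; exact: growths_scale.
- move=> b sb k.
  have := moments_add k1 ks (coef_cst sb) (coefM sa coef0) (m1 b sb k) (moments_scale sa (ba k) k2 coef0 (m2 b sb k)).
  apply: moments_eq => //; first exact: KS_add.
  by move=> e x _; rewrite mulr0 addr0.
Qed.

Definition transport1 i b (sb : csV Om b) phi :=
  kplus (kscale (fun=> b) (dx i phi)) (dy i (kmul oOm sb phi)).

(** The form that shows growth of order n: b(x) d_(x+y) phi, then (b(y) - b(x)) d_y phi, where the
    difference regains the power lost by d_y, and finally (d_i b)(y) phi. *)
Lemma transport1E i b (sb : csV Om b) phi : keq
  (kplus (kplus (kscale (fun=> b) (dxy i phi)) (kdiff oOm sb (dy i phi)))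
    (kmul oOm (csV_pderiv Rc oOm i sb) phi)) (transport1 i sb phi).
Proof.
move=> e x _; apply: tf_eq => y.
have H1 : kscale (fun=> b) (dxy i phi) e x y = b x *: (dx i phi e x y + dy i phi e x y).
  by rewrite /kscale tfZ -(tfD (dx i phi e x)).
have H2 := kdiffE oOm sb (dy i phi) e x y.
apply: etrans (tfD _ _ y) _; apply: etrans (congr1 (fun z => z + _) (tfD _ _ y)) _.
rewrite H1 H2; apply/esym; apply: etrans (tfD _ _ y) _; rewrite /kscale tfZ dy_mul.
apply: etrans (congr1 (fun z => _ + z) (tfD _ _ y)) _; rewrite addrA /=; congr (_ + _).
by rewrite scalerDr scalerBl addrACA subrr addr0 addrC.
Qed.

(** Growth comes from [transport1E]. Against a weight c, the x-derivative gives the moment b d_i c,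
    and integration by parts in y gives - b d_i c, so the moments cancel. *)
Lemma null_transport1 q i b (sb : csV Om b) phi : sound_kernel q phi -> null_kernel q (transport1 i sb phi).
Proof.
move=> [ks nd gr mo]; have sc := coef_cst sb.
have k1 : KS (kscale (fun=> b) (dx i phi)) by apply: KS_scale => //; exact: KS_dx.
have k2 : KS (dy i (kmul oOm sb phi)) by apply: KS_dy; exact: KS_mul.
split.
- exact: KS_add.
- apply: near_diag_add; first by apply: near_diag_scale; exact: near_diag_dx.
  by apply: near_diag_dy; exact: near_diag_mul.
- move=> k; apply: (growths_eq oOm) (@transport1E i b sb phi) _.
    apply: KS_add; last exact: KS_mul.
    by apply: KS_add; [apply: KS_scale => //; exact: KS_dxy|apply: KS_diff => //; exact: KS_dy].
  have /growths_S[_ gx gy] := gr k.+1.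
  apply: (growths_add oOm).
  + by apply: KS_add; [apply: KS_scale => //; exact: KS_dxy|apply: KS_diff => //; exact: KS_dy].
  + exact: KS_mul.
  + apply: (growths_add oOm).
    * by apply: KS_scale => //; exact: KS_dxy.
    * by apply: KS_diff => //; exact: KS_dy.
    * apply: growths_scale => //; [exact: bounded_coef_csV|exact: KS_dxy].
    * by apply: growths_diff => //; [exact: KS_dy|exact: near_diag_dy].
  + exact: growths_mul.
- move=> c scc k.
  have sdc := csV_pderiv Rc oOm i scc.
  have cM : coef Om (fun _ x => pderiv i c x * b x) by apply: (coef_cst (csVM sdc sb)).
  have M1 : moments q scc k (kscale (fun=> b) (dx i phi)) (fun _ x => b x * pderiv i c x).
    apply: (@moments_scale q (fun=> b) c scc k (dx i phi) (fun=> pderiv i c)) => //.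
    - exact: bounded_coef_csV.
    - exact: KS_dx.
    - exact: coef_cst.
    - by have [_] := mo c scc k.+1; exact.
  have M2 : moments q scc k (dy i (kmul oOm sb phi)) (fun _ x => - (pderiv i c x * b x)).
    apply: (@moments_dy q c scc i k _ (fun _ x => pderiv i c x * b x)) => //; first exact: KS_mul.
    by apply: moments_mul => //; exact: mo.
  apply: moments_eq (moments_add k1 k2 _ _ M1 M2) => //.
  + exact: KS_add.
  + by move=> e x _; rewrite mulrC subrr.
  + by apply: (coef_cst (b := fun x => b x * pderiv i c x)); exact: csVM.
  + by apply: (coef_cst (b := fun x => - (pderiv i c x * b x))); apply: csVN; exact: csVM.
Qed.

Definition kzero : R -> V -> D := fun _ _ => 0.

(** The start of the sum in [transport]; the zero kernel inherits its properties from [phi] by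
    scaling with 0. *)
Lemma null_kzero q phi : sound_kernel q phi -> null_kernel q kzero.
Proof.
move=> [ks nd gr mo].
have E : keq (kscale (fun _ _ => 0) phi) kzero by move=> e x _; rewrite /kscale scale0r.
have ks0 : KS (kscale (fun _ _ => 0) phi) by apply: KS_scale => //; exact: coef0.
have b0 k : bounded_coef Om k (fun _ _ => 0) by apply: (bounded_coef_csV oOm); exact: csV_cst.
split.
- exact: KS_eq E ks0.
- by apply: (near_diag_eq oOm) E _; exact: near_diag_scale.
- by move=> k; apply: (growths_eq oOm) E _ => //; apply: growths_scale => //; exact: coef0.
- move=> b sb k; apply: moments_eq (moments_scale coef0 (b0 k) ks (coef_cst sb) (mo b sb k)) => //.
  by move=> e x _; rewrite mul0r.
Qed.

Section transport.
Variable X : V -> V.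
Hypothesis sX : forall i, csV Om (fun x => X x 0 i).

(* The Lie derivative of phi_(e,x)(y) along X acting on both x and y, with y
   transforming as a density: X is nearly cancelled near the diagonal. *)
Definition transport phi : R -> V -> D :=
  foldr (fun i => kplus (transport1 i (sX i) phi)) kzero (enum 'I_n).

Lemma null_transport q phi : sound_kernel q phi -> null_kernel q (transport phi).
Proof.
move=> sp; rewrite /transport; elim: (enum 'I_n) => [|i s ih] /=; first exact: null_kzero sp.
by apply: null_kernel_add => //; exact: null_transport1.
Qed.

Lemma transport_sum phi e x :
  transport phi e x = \sum_i transport1 i (sX i) phi e x.
Proof.
rewrite -big_enum /transport; elim: (enum 'I_n) => [|i s ih]; first by rewrite big_nil.
by rewrite big_cons -ih.
Qed.

End transport.
End moments.

(** * The Lie derivative on the basic space *)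

Section operations_on_curves.
Variables (R : realType) (n : nat) (F : scalar_kind) (Om : set 'rV[R]_n).
Hypothesis oOm : open Om.
Local Notation K := (scalars R F).
Local Notation D := (testfun K Om).
Let Wc := @scalars_complete R F.
Implicit Types (c d : R -> D) (f u v : D).

Lemma smooth_curve_add c d : smooth_curve c -> smooth_curve d -> smooth_curve (fun t => c t + d t).
Proof.
move=> /(smooth_curve_good Wc oOm)[jc lc] /(smooth_curve_good Wc oOm)[jd ld].
apply: (good_curve_smooth Wc); split=> [a y sa sy|t].
  apply: sm_ext (smoD openT (jc a y sa sy) (jd a y sa sy)) => t.
  by rewrite tfD.
have [r r0 [A [cA AO rA]]] := lc t; have [r' r0' [A' [cA' AO' rA']]] := ld t.
exists (Num.min r r'); first by rewrite lt_min r0.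
exists (A `|` A'); split=> [||s]; [exact: compactU|by rewrite subUset|].
rewrite lt_min => /andP[sr sr']; apply: supp_sub.
  by apply: compact_closed; [exact: norm_hausdorff|exact: compactU].
move=> y; apply: contraPP => /not_orP[Ay Ay']; apply/negP; rewrite negbK tfD.
rewrite supp0; last by apply: contra_not Ay; exact: rA.
by rewrite supp0 ?addr0//; apply: contra_not Ay'; exact: rA'.
Qed.

Lemma smooth_curve_scale (a : R -> R) c : sm a -> smooth_curve c -> smooth_curve (fun t => a t *: c t).
Proof.
move=> sa /(smooth_curve_good Wc oOm)[jc lc].
apply: (good_curve_smooth Wc); split=> [b y sb sy|t].
  apply: sm_ext (smo_scale openT (sm_comp sb sa) (jc b y sb sy)) => t.
  by rewrite tfZ.
have [r r0 [A [cA AO rA]]] := lc t; exists r => //; exists A; split=> // s sr.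
apply: supp_sub; first by apply: compact_closed => //; exact: norm_hausdorff.
move=> y; apply: contraPP => Ay; apply/negP; rewrite negbK tfZ.
by rewrite (supp0 (f := c s) (x := y)) ?scaler0//; apply: contra_not Ay; exact: rA.
Qed.

Lemma smooth_curve_comp (a : R -> R) c : sm a -> smooth_curve c -> smooth_curve (fun t => c (a t)).
Proof.
move=> sa /(smooth_curve_good Wc oOm)[jc lc].
apply: (good_curve_smooth Wc); split=> [b y sb sy|t].
  by apply: (jc (fun t => a (b t)) y) => //; exact: sm_comp.
have [r r0 [A [cA AO rA]]] := lc (a t); have [r' r0' r'P] := sm_closeR t sa r0.
by exists r' => //; exists A; split=> // s /r'P; exact: rA.
Qed.

Lemma smooth_curve_mul b (sb : csV Om b) c : smooth_curve c -> smooth_curve (fun t => tf_mul oOm sb (c t)).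
Proof.
move=> sc; apply: (good_curve_smooth Wc); split=> [a y sa sy|t].
  exact: (mul_curve oOm sb (smooth_curve_comp sa sc) sy).
have [r r0 [A [cA AO rA]]] := smooth_curve_loc_supp oOm sc t.
by exists r => //; exists A; split=> // s sr; apply: subset_trans (rA s sr); exact: supp_mul.
Qed.

Lemma smooth_curve_sum (I : Type) (r : seq I) (c : I -> R -> D) :
  (forall i, smooth_curve (c i)) -> smooth_curve (fun t => \sum_(i <- r) c i t).
Proof.
move=> sc; elim: r => [|i r ih].
  have -> : (fun t => \sum_(i <- [::]) c i t) = (fun=> 0) by apply/funext => t; rewrite big_nil.
  exact: smooth_curve_cst.
have -> : (fun t => \sum_(j <- i :: r) c j t) = (fun t => c i t + \sum_(j <- r) c j t).
  by apply/funext => t; rewrite big_cons.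
exact: smooth_curve_add.
Qed.

Lemma tf_sum (I : Type) (r : seq I) (f : I -> D) y : (\sum_(i <- r) f i) y = \sum_(i <- r) f i y.
Proof.
elim: r => [|i r ih]; first by rewrite !big_nil.
by rewrite !big_cons tfD ih.
Qed.

Definition curve_quotient c (c' : D) s : D := if s == 0 then c' else s^-1 *: (c s - c 0).

(** Hadamard's lemma for curves in D(Om): pointwise in y it is [cs2_hadamard], and the support of
    the quotient stays in that of [c s], [c 0] and [c']. *)
Lemma smooth_curve_quotient c : smooth_curve c -> exists c' : D,
  [/\ smooth_curve (curve_quotient c c'), forall s, c s = c 0 + s *: curve_quotient c c' s &
   forall y, c' y = derive1 (fun s => c s y) 0].
Proof.
move=> /(smooth_curve_good Wc oOm) gc.
have [d [gd _ dE]] := good_curve_deriv Wc gc; have [jc lc] := gc.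
exists (d 0); split; last by move=> y; exact: dE.
  apply: (good_curve_smooth Wc); split=> [a y sa sy|t].
    have sg : cs2 (fun t s => c s (y t)).
      by move=> p r sp sr; apply: (jc r (fun t => y (p t))) => //; exact: sm_comp.
    apply: sm_ext (cs2_hadamard Wc sg (smo_id openT) sa) => t.
    rewrite /hadamard /curve_quotient; case: ifP => _; first by rewrite dE.
    by rewrite tfZ tfB.
  have [r r0 [A [cA AO rA]]] := lc t; exists r => //.
  have [_ c0 O0] := testfunP (c 0); have [_ cd Od] := testfunP (d 0).
  exists (A `|` (supp (c 0) `|` supp (d 0))); split=> [||s sr].
  - by apply: compactU => //; exact: compactU.
  - by rewrite !subUset.
  rewrite /curve_quotient; case: ifP => _; first by move=> y dy; right; right.
  apply: supp_sub.
    by apply: compact_closed; [exact: norm_hausdorff|apply: compactU => //; exact: compactU].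
  move=> y; apply: contraPP => /not_orP[Ay /not_orP[cy dy]]; apply/negP; rewrite negbK tfZ tfB.
  rewrite (supp0 cy) (supp0 (f := c s)) ?subrr ?scaler0//.
  by apply: contra_not Ay; exact: rA.
move=> s; rewrite /curve_quotient; have [->|s0] := eqVneq s 0; first by rewrite scale0r addr0.
by rewrite scalerA divff// scale1r addrC subrK.
Qed.

Lemma tderive_line (G : D -> K) f v : sm (fun s => G (f + s *: v)) ->
  tderive G f v = derive1 (fun s => G (f + s *: v)) 0.
Proof.
move=> sG; have /isdP := smo_isd sG (t := 0) I; rewrite scale0r addr0.
set l := derive1 _ _ => Gl.
have Gl' : h^-1 *: (G (f + h *: v) - G f) @[h --> 0^'] --> l.
  by apply: cvg_trans Gl; apply: near_eq_cvg; near=> h; rewrite add0r.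
rewrite /tderive; case: xgetP => [l' _ /= fl'|/(_ l)//].
exact: (cvg_unique (@norm_hausdorff _ _) fl' Gl').
Unshelve. all: by end_near. Qed.

End operations_on_curves.

Section lie_derivative.
Variables (R : realType) (n : nat) (F : scalar_kind) (Om : set 'rV[R]_n).
Hypothesis oOm : open Om.
Local Notation V := 'rV[R]_n.
Local Notation K := (scalars R F).
Local Notation D := (testfun K Om).
Local Notation dx := (@kernel_dx R n F Om).
Let Wc := @scalars_complete R F.
Variables (X : V -> V) (sX : smooth_on Om X).
Implicit Types (f u v : D) (S : D * V -> K).

Lemma csX : csV Om X. Proof. exact: smooth_on_csV. Qed.

Lemma csXi i : csV Om (fun x => X x 0 i).
Proof. by move=> c sc Oc; apply: sm_coord; exact: csX. Qed.

Lemma derive_coord (f : V -> K) (x v : V) : csV Om f -> Om x ->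
  'D_v f x = \sum_i v 0 i *: pderiv i f x.
Proof.
move=> sf Ox; rewrite -(derive1_line0 f x v); apply: isd_eq.
have df : differentiable f (x + 0 *: v).
  by rewrite scale0r addr0; exact: (csV_differentiable Wc oOm).
have := smo_isd (sm_line x v) (t := 0) I; rewrite (derive1_line id) derive_id => H.
by have := differentiable_isd H df; rewrite scale0r addr0.
Qed.

Lemma lie_testfun_sum f : lie_testfun oOm sX f = \sum_i testfun_pderiv i (tf_mul oOm (csXi i) f).
Proof.
apply: tf_eq => y; rewrite tf_sum.
have [Oy|Oy] := pselect (Om y); last first.
  have z (g : D) : g y = 0 by rewrite supp0//; have [_ _ gO] := testfunP g; apply: contra_not Oy; exact: gO.
  by rewrite z big1.
have sf : csV Om f by apply: csV_sub (tf_csV f).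
rewrite /= /lie_fun (derive_coord _ sf Oy) /divergence scaler_suml -big_split /=.
apply: eq_bigr => i _; apply/esym.
exact: (pderiv_scale Wc oOm i (csXi i) sf Oy).
Qed.

Lemma smooth_curve_lie (c : R -> D) : smooth_curve c -> smooth_curve (fun t => lie_testfun oOm sX (c t)).
Proof.
move=> sc; have -> : (fun t => lie_testfun oOm sX (c t)) =
    (fun t => \sum_i testfun_pderiv i (tf_mul oOm (csXi i) (c t))).
  by apply/funext => t; rewrite lie_testfun_sum.
apply: smooth_curve_sum => // i; apply: smooth_curve_pderiv => //; exact: smooth_curve_mul.
Qed.

Lemma hat_line_cs2 S (c d : R -> D) (x : R -> V) : hat_basic S -> smooth_curve c -> smooth_curve d ->
  sm x -> (forall t, Om (x t)) -> cs2 (fun t s => S (c t + s *: d t, x t)).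
Proof.
move=> /hat_basicP bS sc sd sx Ox a b sa sb.
apply: (bS (fun t => c (a t) + b t *: d (a t)) (fun t => x (a t))) => //; last exact: sm_comp.
apply: smooth_curve_add => //; first exact: smooth_curve_comp.
by apply: smooth_curve_scale => //; exact: smooth_curve_comp.
Qed.

Definition dhat S f v x : K := derive1 (fun s => S (f + s *: v, x)) 0.

Lemma hat_line_sm S f v x : hat_basic S -> Om x -> sm (fun s => S (f + s *: v, x)).
Proof.
move=> bS Ox.
have := hat_line_cs2 bS (smooth_curve_cst f) (smooth_curve_cst v) (smo_cst x openT) (fun=> Ox).
by move=> /(_ (fun=> 0) (fun t => t)); apply; [exact/smo_cst/openT|exact/smo_id/openT].
Qed.

Lemma dhat_tderive S f v x : hat_basic S -> Om x -> tderive (fun f => S (f, x)) f v = dhat S f v x.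
Proof. by move=> bS Ox; apply: (tderive_line (G := fun f => S (f, x))); exact: hat_line_sm. Qed.

Lemma dhat_add S f u v x : hat_basic S -> Om x -> dhat S f (u + v) x = dhat S f u x + dhat S f v x.
Proof.
move=> bS Ox.
have sg : cs2 (fun s t => S (f + s *: u + t *: v, x)).
  move=> a b sa sb; move/hat_basicP : bS; apply=> //; last exact/smo_cst/openT.
  apply: smooth_curve_add => //; last by apply: smooth_curve_scale => //; exact: smooth_curve_cst.
  apply: smooth_curve_add => //; first exact: smooth_curve_cst.
  by apply: smooth_curve_scale => //; exact: smooth_curve_cst.
have := isd_eq (cs2_diag Wc 0 sg); rewrite /d1 /d2 /dhat.
have -> : (fun s => S (f + s *: u + s *: v, x)) = (fun s => S (f + s *: (u + v), x)).
  by apply/funext => s; rewrite scalerDr addrA.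
move=> ->; congr (_ + _); apply: eq_derive1 => s; first by rewrite scale0r addr0.
by rewrite scale0r addr0.
Qed.

(** A chain rule for S at a curve in D(Om), obtained from the plane: the curve is written as c(0) +
    s d(s) with a smooth d, and the two occurrences of s are made independent. *)
Lemma dhat_chain S (c : R -> D) (c' : D) (x v : V) : hat_basic S -> Om x -> smooth_curve c ->
  (forall y, c' y = derive1 (fun s => c s y) 0) ->
  derive1 (fun s => S (c s, x + s *: v)) 0 = dhat S (c 0) c' x + 'D_v (fun z => S (c 0, z)) x.
Proof.
move=> bS Ox sc c'E; have [d [sq cE dE]] := smooth_curve_quotient oOm sc.
have {}c'E : c' = d by apply: tf_eq => y; rewrite c'E dE.
have [r r0 rO] : exists2 r : R, 0 < r & forall s, `|s| < r -> Om (x + s *: v).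
  have := sm_near_open oOm (sm_line x v) (t := 0); rewrite scale0r addr0 => /(_ Ox).
  by move=> /nbhs_ballP[r /= r0 rP]; exists r => // s sr; apply: rP; rewrite /ball/= sub0r normrN.
(* The diagonal p = s gives back the curve. At s = 0 only the direction c' remains, and at p = 0 the
   first argument is frozen at [c 0]. *)
pose g (p s : R) := S (c 0 + p *: curve_quotient c d s, x + clamp r s *: v).
have sg : cs2 g.
  move=> a b sa sb; move/hat_basicP : bS; apply.
  - apply: smooth_curve_add => //; first exact: smooth_curve_cst.
    by apply: smooth_curve_scale => //; exact: (smooth_curve_comp oOm sb sq).
  - apply: smoD; [exact: openT|exact: (smo_cst _ openT)|].
    apply: smo_scale; [exact: openT|apply: sm_comp sb _; exact: sm_clamp|exact: (smo_cst _ openT)].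
  - by move=> t; apply: rO; exact: clamp_lt.
have r60 : 0 < r / 6 by rewrite divr_gt0.
have cl s : `|s| < r / 6 -> clamp r s = s by move=> sr; rewrite clamp_id// ltW.
have nt : \forall s \near (0 : R), `|s| < r / 6.
  by have := nbhs_norm_lt 0 r60; apply: filterS => s; rewrite subr0.
have := isd_eq (cs2_diag Wc 0 sg).
have -> : derive1 (fun s => g s s) 0 = derive1 (fun s => S (c s, x + s *: v)) 0.
  by apply: near_derive1_eq; apply: filterS nt => s sr; rewrite /g cl// -cE.
move=> ->; congr (_ + _).
  rewrite /d1 /dhat /g c'E; apply: eq_derive1 => s.
  by rewrite /curve_quotient eqxx cl ?normr0// scale0r addr0.
rewrite /d2 /g -(derive1_line0 (fun z => S (c 0, z))); apply: near_derive1_eq.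
by apply: filterS nt => s sr; rewrite scale0r addr0 cl.
Qed.

Lemma hat_lie_basic S : hat_basic S -> hat_basic (hat_lie oOm sX S).
Proof.
move=> bS; apply/hat_basicP => f x sf sx Ox; rewrite /hat_lie /=.
apply: smoD; first exact: openT.
  apply: smoN; first exact: openT.
  have sg := hat_line_cs2 bS sf (smooth_curve_lie sf) sx Ox.
  apply: sm_ext (cs2_d2 Wc sg (smo_id openT) (smo_cst 0 openT)) => t.
  by rewrite dhat_tderive.
have sv : sm (fun t => X (x t)) by exact: csX.
have oA := (csV_line oOm (@csV_cst R n R Om 0) sx sv).1.
have sg : cs2_on (fun t s => Om (x t + s *: X (x t))) (fun t s => S (f t, x t + s *: X (x t))).
  move=> a b sa sb ab.
  apply: ((hat_basicP S).1 bS (fun t => f (a t)) (fun t => x (a t) + b t *: X (x (a t))) _ _ ab).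
  - exact: smooth_curve_comp.
  - apply: smoD; [exact: openT|exact: sm_comp|].
    by apply: smo_scale => //; [exact: openT|exact: (sm_comp sa sv)].
have Ox0 t : Om (x t + 0 *: X (x t)) by rewrite scale0r addr0.
have := cs2_on_d2 Wc oA sg (smo_id openT) (smo_cst 0 openT) Ox0.
by apply: sm_ext => t; exact: (derive1_line0 (fun z => S (f t, z))).
Qed.

Lemma kernel_hat_csV S (phi : R -> V -> D) e : hat_basic S -> KS phi -> 0 < e -> e <= 1 ->
  csV Om (fun x => S (phi e x, x)).
Proof.
move=> /hat_basicP bS /(kernel_smoothP oOm)/kernel_smooth_curve sphi e0 e1 c sc Oc.
by apply: (bS (fun t => phi e (c t)) c) => //; apply: (sphi (fun=> e)) => //; exact/smo_cst/openT.
Qed.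

Lemma transportE (phi : R -> V -> D) e x : transport oOm csXi phi e x =
  \sum_i X x 0 i *: dx i phi e x + lie_testfun oOm sX (phi e x).
Proof. by rewrite transport_sum lie_testfun_sum -big_split. Qed.

(* Along a kernel, the derivative along X of x |-> S(phi_x, x) contains the term
   dS(D_X phi_x), whereas hat_lie contains - dS(L_X phi_x). *)
Lemma hat_lie_kernel S (phi : R -> V -> D) e x : hat_basic S -> KS phi -> kdom Om e x ->
  hat_lie oOm sX S (phi e x, x) =
  \sum_i X x 0 i *: pderiv i (fun x => S (phi e x, x)) x -
  dhat S (phi e x) (transport oOm csXi phi e x) x.
Proof.
move=> bS ks ex; have [e0 e1 Ox] := ex.
rewrite /hat_lie /= dhat_tderive// transportE dhat_add//.
rewrite -(derive_coord (X x) (kernel_hat_csV bS ks e0 e1) Ox).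
set v := X x; set w := \sum_i _.
have [r r0 rO] : exists2 r : R, 0 < r & forall s, `|s| < r -> Om (x + s *: v).
  have := sm_near_open oOm (sm_line x v) (t := 0); rewrite scale0r addr0 => /(_ Ox).
  by move=> /nbhs_ballP[r /= r0 rP]; exists r => // s sr; apply: rP; rewrite /ball/= sub0r normrN.
have r60 : 0 < r / 6 by rewrite divr_gt0.
have cl s : `|s| < r / 6 -> clamp r s = s by move=> sr; rewrite clamp_id// ltW.
have nt : \forall s \near (0 : R), `|s| < r / 6.
  by have := nbhs_norm_lt 0 r60; apply: filterS => s; rewrite subr0.
pose c s := phi e (x + clamp r s *: v).
have c0 : c 0 = phi e x by rewrite /c cl ?normr0// scale0r addr0.
have sc : smooth_curve c.
  move/(kernel_smoothP oOm)/kernel_smooth_curve : ks => H; apply: (H (fun=> e)).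
  - exact/smo_cst/openT.
  - apply: smoD; [exact: openT|exact: (smo_cst _ openT)|].
    apply: smo_scale; [exact: openT|exact: sm_clamp|exact: (smo_cst _ openT)].
  - by move=> t; split=> //; apply: rO; exact: clamp_lt.
have wE y : w y = derive1 (fun s => c s y) 0.
  rewrite /w tf_sum; transitivity ('D_v (fun x' => phi e x' y) x).
    rewrite (derive_coord _ (kernel_csV y ks.1 e0 e1) Ox); apply: eq_bigr => i _.
    by rewrite tfZ (dxE oOm).
  rewrite -(derive1_line0 (fun x' => phi e x' y)); apply: near_derive1_eq.
  by apply: filterS nt => s sr; rewrite /c cl.
have := dhat_chain v bS Ox sc wE; rewrite c0.
have -> : derive1 (fun s => S (c s, x + s *: v)) 0 = 'D_v (fun x => S (phi e x, x)) x.
  rewrite -(derive1_line0 (fun x => S (phi e x, x))); apply: near_derive1_eq.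
  by apply: filterS nt => s sr; rewrite /c cl.
by move=> ->; rewrite opprD addrACA subrr add0r addrC.
Qed.

End lie_derivative.

(** * Derivatives of a function multiplied by a power of x_i - a *)

Section monomial_factor.
Variables (R : realType) (n : nat) (W : normedModType R) (Om : set 'rV[R]_n).
Hypotheses (oOm : open Om) (Wc : seq_complete W).
Local Notation V := 'rV[R]_n.
Variables (i0 : 'I_n) (a : R).
Implicit Types (f : V -> W) (x : V).

Definition shifted_power m x : R := (x 0 i0 - a) ^+ m.

Lemma isd_power (u : R -> R) t du m : isd u t du ->
  isd (fun s => u s ^+ m) t (du * m%:R * u t ^+ m.-1).
Proof.
move=> hu; elim: m => [|m ih].
  by rewrite mulr0 mul0r; have := isd_cst (1 : R) t; congr isd; apply/funext => s; rewrite expr0.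
have := isd_scale hu ih; congr isd; first by apply/funext => s; rewrite exprS.
case: m {ih} => [|m] /=; first by rewrite !expr0 !mulr1 mulr0 scaler0 add0r -[LHS]/(du * 1) mulr1.
rewrite -[X in X + _]/(u t * _) -[X in _ + X]/(du * _) -(natr1 m.+1) exprS; ring.
Qed.

Lemma pderiv_shifted_power i m x :
  pderiv i (shifted_power m) x = (i == i0)%:R * m%:R * shifted_power m.-1 x.
Proof.
rewrite /pderiv -(derive1_line0 (shifted_power m)); apply: isd_eq.
have H : isd (fun s : R => x 0 i0 - a + s * (i == i0)%:R) 0 ((i == i0)%:R).
  have := isdD (isd_cst (x 0 i0 - a) 0) (isd_scale (isd_derive1 (@derivable_id _ _ _ _)) (isd_cst ((i == i0)%:R : R) 0)).
  rewrite derive1_id scaler0 !add0r; congr isd; exact: mul1r.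
have := isd_power m H; rewrite mul0r addr0 /shifted_power; congr isd.
by apply/funext => s; rewrite coord_line eq_sym addrAC.
Qed.

Lemma csV_shifted_power m : csV Om (shifted_power m).
Proof.
move=> c sc _; apply: smoX; first exact: openT.
by apply: smoB; [exact: openT|exact: sm_coord|exact/smo_cst/openT].
Qed.

Lemma pderivs_power_out w m f x : all (predC1 i0) w -> csV Om f -> Om x ->
  pderivs w (fun y => shifted_power m y *: f y) x = shifted_power m x *: pderivs w f x.
Proof.
move=> + sf; elim: w x => //= i w ih x /andP[ii0 wi0] Ox.
transitivity (pderiv i (fun y => shifted_power m y *: pderivs w f y) x).
  by apply: near_eq_derive; apply: (near_Om oOm) => // z Oz; exact: ih.
rewrite (pderiv_scale Wc oOm i (csV_shifted_power m) (csV_pderivs Wc oOm w sf) Ox).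
by rewrite pderiv_shifted_power (negbTE ii0) !mul0r scale0r addr0.
Qed.

Lemma pderivs_nseqSr N f : pderivs (nseq N.+1 i0) f = pderivs (nseq N i0) (pderiv i0 f).
Proof. by elim: N => //= N ->. Qed.

(** On the hyperplane only the Leibniz term in which the power is differentiated exactly m times
    survives; its coefficient is binomial(N, m) m!. For m > N the coefficient is 0. *)
Lemma pderivs_power N m f x : csV Om f -> Om x -> x 0 i0 = a ->
  pderivs (nseq N i0) (fun y => shifted_power m y *: f y) x =
  (N ^_ m)%:R *: pderivs (nseq (N - m) i0) f x.
Proof.
move=> sf Ox xa; elim: N m f sf => [|N ih] m f sf.
  rewrite /= /shifted_power xa subrr expr0n; case: m => [|m] /=; first by rewrite ffactn0.
  by rewrite ffact0n !scale0r.
have sp k := csV_scale (csV_shifted_power k) sf.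
have sp' k := csV_scale (csV_shifted_power k) (csV_pderiv Wc oOm i0 sf).
rewrite pderivs_nseqSr.
rewrite (pderivs_eq_open (g := fun y => 1 *: (shifted_power m y *: pderiv i0 f y) +
    m%:R *: (shifted_power m.-1 y *: f y)) _ oOm)//; last first.
  move=> y Oy; rewrite (pderiv_scale Wc oOm i0 (csV_shifted_power m) sf Oy).
  by rewrite pderiv_shifted_power eqxx mul1r scale1r scalerA.
rewrite (pderivs_lin Wc oOm)// scale1r !ih//; last exact: csV_pderiv.
rewrite -pderivs_nseqSr scalerA.
case: m => [|m]; first by rewrite mul0r scale0r addr0 !ffactn0 !subn0.
rewrite /= subSS ffactSS -natrM.
(* In the first case the recursion of falling factorials applies. Otherwise the subtraction
   truncates, and terms vanish by their coefficients unless m = N, where both sides coincide. *)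
have [mN|Nm] := ltnP m N.
  rewrite -[pderiv i0 _]/(pderivs (nseq (N - m.+1).+1 i0) f) subnSK// -scalerDl -natrD; congr (_%:R *: _).
  by rewrite ffactnSr; have := ltnW mN; nia.
rewrite (ffact_small (n := N) (m := m.+1))// scale0r add0r.
have [->//|mN] := eqVneq m N.
by rewrite ffact_small ?muln0 ?scale0r// ltn_neqAle eq_sym mN.
Qed.

End monomial_factor.

(** * Expansion of S along a perturbed kernel *)

Section second_order_expansion.
Variables (R : realType) (n : nat) (F : scalar_kind) (Om : set 'rV[R]_n).
Hypothesis oOm : open Om.
Local Notation V := 'rV[R]_n.
Local Notation K := (scalars R F).
Local Notation D := (testfun K Om).
Let Wc := @scalars_complete R F.
Variables (S : D * V -> K) (phi psi : R -> V -> D) (e : R).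
Hypotheses (bS : hat_basic S) (ks : KS phi) (ls : KS psi) (e0 : 0 < e) (e1 : e <= 1).

Definition quotient_at0 (u : R -> K) (t : R) : K :=
  if t == 0 then derive1 u 0 else t^-1 *: (u t - u 0).

Lemma quotient_at0E u t : u t = u 0 + t *: quotient_at0 u t.
Proof. exact: (hadamardE (fun _ : R => u) 0). Qed.

Let H x t := S (phi e x + t *: psi e x, x).

Definition first_variation x := dhat S (phi e x) (psi e x) x.

Lemma H_cs2 (c : R -> V) : sm c -> (forall t, Om (c t)) -> cs2 (fun s t => H (c s) t).
Proof.
move=> sc Oc; apply: hat_line_cs2 => //.
  move/(kernel_smoothP oOm)/kernel_smooth_curve : ks => Hk; apply: (Hk (fun=> e)) => //.
  exact/smo_cst/openT.
move/(kernel_smoothP oOm)/kernel_smooth_curve : ls => Hk; apply: (Hk (fun=> e)) => //.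
exact/smo_cst/openT.
Qed.

Lemma first_variation_csV : csV Om first_variation.
Proof.
move=> c sc Oc; exact: (cs2_d2 Wc (H_cs2 sc Oc) (smo_id openT) (smo_cst 0 openT)).
Qed.

Lemma second_quotient_csV (la : V -> R) : csV Om la ->
  csV Om (fun x => quotient_at0 (quotient_at0 (H x)) (la x)).
Proof.
move=> sl c sc Oc.
have := cs2_hadamard Wc (cs2_hadamard Wc (H_cs2 sc Oc)) (smo_id openT) (sl c sc Oc).
exact.
Qed.

(** Hadamard's lemma applied twice. The second quotient is smooth in x even with a variable l, which
    a Taylor estimate alone would not give. *)
Lemma S_expand (l : R) x : S (phi e x + l *: psi e x, x) =
  S (phi e x, x) + l *: (first_variation x + l *: quotient_at0 (quotient_at0 (H x)) l).
Proof.
rewrite -[LHS]/(H x l) (quotient_at0E (H x) l); congr (_ + _ *: _).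
  by rewrite /H scale0r addr0.
by rewrite [LHS](quotient_at0E (quotient_at0 (H x)) l) {1}/quotient_at0 eqxx.
Qed.

(** By [S_expand] the difference is la f, where f is the first variation plus la times a smooth
    function. On the hyperplane 2k + 1 derivatives of la f leave k derivatives of f, and these
    annihilate the second summand because la vanishes to order k + 1. *)
Lemma pderivs_first_variation i0 (a : R) k w x : all (predC1 i0) w -> Om x -> x 0 i0 = a ->
  pderivs (nseq (k + k.+1) i0 ++ w)
    (fun y => S (phi e y + shifted_power i0 a k.+1 y *: psi e y, y)) x -
  pderivs (nseq (k + k.+1) i0 ++ w) (fun y => S (phi e y, y)) x =
  ((k + k.+1) ^_ k.+1)%:R *: pderivs (nseq k i0 ++ w) first_variation x.
Proof.
move=> wi0 Ox xa.
have sS := kernel_hat_csV oOm bS ks e0 e1.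
have sp m := @csV_shifted_power R n Om i0 a m.
(* The second-order coefficient is evaluated at the moving parameter [shifted_power i0 a k.+1 y]. *)
pose h2 y := quotient_at0 (quotient_at0 (H y)) (shifted_power i0 a k.+1 y).
have s2 : csV Om h2 := second_quotient_csV (sp k.+1).
have sT := first_variation_csV.
pose f y := 1 *: first_variation y + 1 *: (shifted_power i0 a k.+1 y *: h2 y).
have sf : csV Om f by apply: csVD; apply: csVZ => //; exact: csV_scale.
have -> : (fun y => S (phi e y + shifted_power i0 a k.+1 y *: psi e y, y)) =
    (fun y => 1 *: S (phi e y, y) + 1 *: (shifted_power i0 a k.+1 y *: f y)).
  by apply/funext => y; rewrite S_expand /f !scale1r.
rewrite (pderivs_lin Wc oOm)//; last exact: csV_scale.
rewrite !scale1r addrAC subrr add0r.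
have pw N (g : V -> K) y : csV Om g -> Om y ->
   pderivs (nseq N i0 ++ w) (fun y => shifted_power i0 a k.+1 y *: g y) y =
   pderivs (nseq N i0) (fun y => shifted_power i0 a k.+1 y *: pderivs w g y) y.
  move=> sg Oy; rewrite /pderivs foldr_cat -!/(pderivs _ _).
  by apply: (pderivs_eq_open _ oOm) => // z Oz; exact: (pderivs_power_out oOm Wc).
rewrite pw// (pderivs_power oOm Wc)//; last exact: csV_pderivs.
rewrite addnK; congr (_ *: _).
rewrite -[LHS]/(pderivs (nseq k i0) (pderivs w f) x) /pderivs -foldr_cat -/(pderivs _ f).
rewrite /f (pderivs_lin Wc oOm)//; last exact: csV_scale.
rewrite !scale1r pw// (pderivs_power oOm Wc)//; last exact: csV_pderivs.
by rewrite ffact_small// scale0r addr0.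
Qed.

End second_order_expansion.

(** * The moving centre a(e) *)

Section interpolating_centre.
Variable R : realType.

(** The spacing by 1 is imposed on 1 / e, the variable in which the interpolating bumps have to be
    disjoint. *)
Lemma small_sequence (T : Type) (P : nat -> R -> T -> Prop) :
  (forall k e0, 0 < e0 -> exists e y, [/\ 0 < e, e <= 1, e <= e0 & P k e y]) ->
  exists (e : nat -> R) (y : nat -> T), [/\ forall k, 0 < e k <= 1,
    forall k, (e k)^-1 + 1 <= (e k.+1)^-1 & forall k, P k (e k) (y k)].
Proof.
move=> HP.
have H (p : nat * R) : exists q : R * T, 0 < p.2 -> [/\ 0 < q.1, q.1 <= 1, q.1 <= p.2 & P p.1 q.1 q.2].
  have [p0|p0] := ltP 0 p.2; last first.
    by have [e [y _]] := HP 0%N 1 ltr01; exists (e, y).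
  by have [e [y [? ? ? ?]]] := HP p.1 p.2 p0; exists (e, y).
have [pick pickP] := choice H.
pose fix s k := if k is k'.+1 then pick (k'.+1, ((s k').1^-1 + 1)^-1) else pick (0%N, 1).
have sP k : 0 < (s k).1 /\ (s k).1 <= 1.
  elim: k => [|k [s0 s1]] /=; first by have [] := pickP (0%N, 1) ltr01.
  by have [] // := pickP (k.+1, ((s k).1^-1 + 1)^-1) _; rewrite /= invr_gt0 addr_gt0// invr_gt0.
have i0 k : 0 < ((s k).1^-1 + 1)^-1.
  by have [s0 _] := sP k; rewrite invr_gt0 addr_gt0// invr_gt0.
exists (fun k => (s k).1), (fun k => (s k).2); split.
- by move=> k; have [-> ->] := sP k.
- move=> k; have [_ _ + _] := pickP (k.+1, ((s k).1^-1 + 1)^-1) (i0 k).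
  rewrite /= -/(s k.+1) => H1; have [s0 _] := sP k.+1.
  by rewrite -[leLHS]invrK lef_pV2 ?posrE.
- case=> [|k]; first by have [] := pickP (0%N, 1) ltr01.
  by have [] := pickP (k.+1, ((s k).1^-1 + 1)^-1) (i0 k).
Qed.

(** Bumps in the variable 1 / t need no decay of [p] here, because only curves with values t > 0
    matter; [a] may oscillate at 0. *)
Lemma interpolating_curve (e p : nat -> R) (M : R) : (forall k, 0 < e k <= 1) ->
  (forall k, (e k)^-1 + 1 <= (e k.+1)^-1) -> (forall k, `|p k| <= M) ->
  exists a : R -> R, [/\ forall k, a (e k) = p k, forall t, `|a t| <= M &
    forall c : R -> R, sm c -> (forall t, 0 < c t) -> sm (fun t => a (c t))].
Proof.
move=> e01 eS pM; pose s k := (e k)^-1.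
have s1 : 1 <= s 0%N by have /andP[e0 e1] := e01 0%N; rewrite invf_ge1.
have M0 : 0 <= M by apply: le_trans (pM 0%N).
exists (fun t => cell s p (@bumpf R) t^-1); split=> [k|t|c sc c0].
- by rewrite (@cell_near R s eS p (@bumpf R) _ k) subrr ?normr0// bump1 ?normr0// mulr1.
- have [[k kt]|nk] := pselect (exists k, `|t^-1 - s k| <= 3^-1).
    rewrite (@cell_near R s eS p (@bumpf R) _ k); last by rewrite (le_lt_trans kt)//; lra.
    have /andP[b0 b1] := bump01 (t^-1 - s k).
    by rewrite normrM (ger0_norm b0) -[leRHS]mulr1 ler_pM.
  rewrite (cell_out (s := s)) ?normr0// => [u|k]; first exact: bump0.
  by rewrite ltNge; apply/negP => kt; apply: nk; exists k.
- apply: (sm_comp (a := fun t => (c t)^-1)).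
    by apply: smoV => //; [exact: openT|move=> t _; rewrite gt_eqF].
  by apply: (cell_smo eS); [exact: sm_bump|exact: bump0].
Qed.

End interpolating_centre.

(** * Transfer of estimates from S to its Lie derivative *)

Section domination.
Variables (R : realType) (n : nat) (F : scalar_kind) (Om : set 'rV[R]_n).
Hypothesis oOm : open Om.
Local Notation V := 'rV[R]_n.
Local Notation K := (scalars R F).
Local Notation D := (testfun K Om).
Let Wc := @scalars_complete R F.
Let Rc := @real_seq_complete R.
Variables (A : set V) (gb : R -> R).
Hypotheses (cA : ccompact Om A) (gb0 : forall e, 0 < e -> e <= 1 -> 0 < gb e).
Implicit Types (H G : R -> V -> K) (b : V -> R).

(** The gauge [gb] stands for a negative power of e in the moderate case and a positive power in the
    negligible case, so one argument covers both. *)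
Definition dominated H := exists2 C : R, 0 <= C &
  near0 (fun e => forall x, A x -> `|H e x| <= C * gb e).

Fixpoint dominated_upto k H : Prop :=
  dominated H /\ if k is k'.+1 then forall i, dominated_upto k' (fun e => pderiv i (H e)) else True.

Lemma dominated_bigO H : dominated H <-> bigO_unif A H gb.
Proof.
split=> [[C C0 [e0 e00 HC]]|[e0 [C [e00 C0 HC]]]].
  exists e0, (C + 1); split=> //; first by rewrite ltr_wpDl.
  move=> e x ep e1 ee Ax; rewrite (le_trans (HC e ep e1 ee x Ax))//.
  by rewrite ler_wpM2r ?lerDl// ltW// gb0.
by exists C; [exact: ltW|exists e0 => // e ep e1 ee x Ax; exact: HC].
Qed.

Definition Keq H G := forall e x, kdom Om e x -> H e x = G e x.

Lemma Keq_pderivs w H G : Keq H G -> Keq (fun e => pderivs w (H e)) (fun e => pderivs w (G e)).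
Proof.
move=> HG e x [e0 e1 Ox]; apply: (pderivs_eq_open _ oOm) => // y Oy; exact: HG.
Qed.

Lemma dominated_eq H G : Keq H G -> dominated H -> dominated G.
Proof.
move=> HG [C C0 HC]; exists C => //; apply: near0W HC => e e0 e1 HC x Ax.
by rewrite -HG; [exact: HC|exact: kdomW cA e0 e1 Ax].
Qed.

Lemma dominated_upto_eq k H G : Keq H G -> dominated_upto k H -> dominated_upto k G.
Proof.
elim: k H G => [|k ih] H G HG [hH hS]; split; try exact: dominated_eq hH.
  by [].
by move=> i; apply: ih (hS i); exact: (Keq_pderivs [:: i] HG).
Qed.

Lemma dominated_upto_of_words k H :
  (forall w, (size w <= k)%N -> dominated (fun e => pderivs w (H e))) -> dominated_upto k H.
Proof.
elim: k H => [|k ih] H HW; first by split=> //; exact: (HW [::]).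
split; first exact: (HW [::]).
move=> i; apply: ih => w wk.
have := HW (rcons w i); rewrite size_rcons ltnS => /(_ wk).
by congr dominated; apply/funext => e; rewrite /pderivs foldr_rcons.
Qed.

Lemma dominated_word k H w : dominated_upto k H -> (size w <= k)%N -> dominated (fun e => pderivs w (H e)).
Proof.
elim: k H w => [|k ih] H w [hH hS].
  by rewrite leqn0 size_eq0 => /eqP ->.
case/lastP: w => [//|w i]; rewrite size_rcons ltnS => wk.
have := ih _ w (hS i) wk; congr dominated.
by apply/funext => e; rewrite /pderivs foldr_rcons.
Qed.

Lemma dominated_uptoW k H : dominated_upto k.+1 H -> dominated_upto k H.
Proof.
elim: k H => [|k ih] H; first by case.
by move=> [hH hS]; split=> // i; exact: ih.
Qed.

Lemma dominated_add H G : dominated H -> dominated G -> dominated (fun e x => H e x + G e x).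
Proof.
move=> [C C0 HC] [C' C0' HC']; exists (C + C'); first exact: addr_ge0.
apply: near0W (near0I HC HC') => e e0 e1 [Ha Hb] x Ax.
by rewrite mulrDl (le_trans (ler_normD _ _))// lerD//; [exact: Ha|exact: Hb].
Qed.

Definition csVs H := forall e, 0 < e -> e <= 1 -> csV Om (H e).

Lemma dominated_upto_add k H G : csVs H -> csVs G -> dominated_upto k H -> dominated_upto k G ->
  dominated_upto k (fun e x => H e x + G e x).
Proof.
elim: k H G => [|k ih] H G sH sG [hH hS] [hG gS]; split; try exact: dominated_add.
  by [].
move=> i; apply: dominated_upto_eq (ih _ _ _ _ (hS i) (gS i)).
- by move=> e x [e0 e1 Ox]; apply/esym; apply: (pderivD Wc oOm) => //; [exact: sH|exact: sG].
- by move=> e e0 e1; apply: csV_pderiv => //; exact: sH.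
- by move=> e e0 e1; apply: csV_pderiv => //; exact: sG.
Qed.

Lemma dominated_scale b H : csV Om b -> dominated H -> dominated (fun e x => b x *: H e x).
Proof.
move=> sb [C C0 HC]; have /(ccompactP oOm)[cA' AO] := cA.
have [M M0 MP] := csV_bounded oOm sb cA' AO; exists (M * C); first exact: mulr_ge0.
apply: near0W HC => e e0 e1 HC x Ax; rewrite normrZ -mulrA ler_pM//.
  exact: MP.
exact: HC.
Qed.

Lemma dominated_upto_scale k b H : csV Om b -> csVs H -> dominated_upto k H ->
  dominated_upto k (fun e x => b x *: H e x).
Proof.
elim: k b H => [|k ih] b H sb sH; first by move=> [hH _]; split=> //; exact: dominated_scale.
move=> /[dup]/dominated_uptoW hW [hH hS]; split; first exact: dominated_scale.
move=> i.
have sd : csVs (fun e => pderiv i (H e)) by move=> e e0 e1; apply: csV_pderiv => //; exact: sH.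
apply: dominated_upto_eq (dominated_upto_add _ _ (ih b _ sb sd (hS i)) (ih _ _ (csV_pderiv Rc oOm i sb) sH hW)).
- by move=> e x [e0 e1 Ox]; apply/esym; apply: (pderiv_scale Wc oOm) => //; exact: sH.
- by move=> e e0 e1; apply: csV_scale => //; exact: sd.
- by move=> e e0 e1; apply: csV_scale; [exact: csV_pderiv|exact: sH].
Qed.

Section kernel_bounds.
Variables (X : V -> V) (sX : smooth_on Om X) (S : D * V -> K) (q K0 : nat).
Hypothesis bS : hat_basic S.
Let psi (phi : R -> V -> D) := transport oOm (csXi sX) phi.
(** The budget [K0] of derivatives is fixed in advance, with one [q] for all words within it: the
    comparison of two kernels consumes derivatives of higher order than the one to be estimated. *)
Hypothesis HS : forall phi, sound_kernel oOm q phi -> forall w, (size w <= K0)%N ->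
  dominated (fun e => pderivs w (fun x => S (phi e x, x))).

(** The constant [c] is present for the induction: each derivative of the power lowers the exponent
    and contributes a numerical factor. *)
Lemma bounded_shifted_power i0 (a : R -> R) (M c : R) m k : (forall e, `|a e| <= M) ->
  bounded_coef Om k (fun e x => c * shifted_power i0 (a e) m x).
Proof.
move=> aM.
have base j d : bounded_coef Om 0 (fun e x => d * shifted_power i0 (a e) j x).
  split=> // B cB; have /(ccompactP oOm)[cB' BO] := cB.
  have [N N0 NP] := csV_bounded oOm (csV_coordinate i0) cB' BO.
  have M0 : 0 <= M by apply: le_trans (aM 0).
  exists (`|d| * (N + M) ^+ j); first by rewrite mulr_ge0// exprn_ge0// addr_ge0.
  move=> e x _ _ Bx; rewrite normrM ler_wpM2l// normrX lerXn2r ?nnegrE// ?addr_ge0//.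
  by rewrite (le_trans (ler_normB _ _))// lerD//; exact: NP.
elim: k m c => [|k ih] m c; first exact: base.
split; first by have [] := base m c.
move=> i; have := ih m.-1 (c * (i == i0)%:R * m%:R); congr bounded_coef.
apply/funext => e; apply/funext => x.
have -> : (fun x => c * shifted_power i0 (a e) m x) = (fun x => c *: shifted_power i0 (a e) m x) by [].
rewrite (pderivZ Rc openT) ?pderiv_shifted_power//; last exact: csV_shifted_power.
by rewrite -[RHS]/(c * _) !mulrA.
Qed.

Lemma split_word i0 (w : seq 'I_n) :
  perm_eq w (nseq (count_mem i0 w) i0 ++ seq.filter (predC1 i0) w).
Proof.
have <- : seq.filter (pred1 i0) w = nseq (count_mem i0 w) i0.
  by rewrite -size_filter; apply/all_pred1P; exact: filter_all.
by rewrite perm_sym; exact: permEl (perm_filterC _ _).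
Qed.

(* If the bound failed along a sequence (e_j, y_j), then with a smooth a such
   that a(e_j) = (y_j)_i0 the kernel phi + (x_i0 - a(e))^(k+1) psi would violate
   HS: by pderivs_first_variation its derivatives at y_j see the first variation. *)
Lemma first_variation_dominated (i0 : 'I_n) phi w : sound_kernel oOm q phi -> (2 * size w + 1 <= K0)%N ->
  dominated (fun e => pderivs w (first_variation S phi (psi phi) e)).
Proof.
move=> sp wK; apply: contrapT => nb.
pose T e := first_variation S phi (psi phi) e.
have [ks _ _ _] := sp; have np := null_transport (csXi sX) sp.
have [ls _ _ _] : null_kernel oOm q (psi phi) := np.
pose k := count_mem i0 w; pose w' := seq.filter (predC1 i0) w.
have [|e [y [e01 eS eP]]] := @small_sequence R V (fun j e x => A x /\ j.+1%:R * gb e < `|pderivs w (T e) x|).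
  move=> j e0 e00; apply: contrapT => nE; apply: nb; exists j.+1%:R => //.
  exists e0 => // e ep e1 ee x Ax; rewrite leNgt; apply/negP => H.
  by apply: nE; exists e, x.
have /(ccompactP oOm)[cA' AO] := cA.
have [M M0 MP] := csV_bounded oOm (csV_coordinate i0) cA' AO.
have [|a [ae aM sa]] := @interpolating_curve R e (fun j => y j 0 i0) M e01 eS.
  by move=> j; apply: MP; have [] := eP j.
pose la e x : R := shifted_power i0 (a e) k.+1 x.
have sla : coef Om la.
  move=> c x sc sx cx; apply: smoX; first exact: openT.
  apply: smoB; [exact: openT|exact: sm_coord|apply: sa => // t].
  by have [] := cx t.
have bla j : bounded_coef Om j la.
  have := bounded_shifted_power i0 1 k.+1 j aM; congr bounded_coef.
  by apply/funext => t; apply/funext => x; rewrite mul1r.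
have sq := sound_kernel_perturb sla bla sp np.
(* The length is 2k + 1 + (|w| - k), hence at most 2 |w| + 1, which explains the budget in the
   statement. *)
pose be := nseq (k + k.+1) i0 ++ w'.
have bK : (size be <= K0)%N.
  have Ew : size w = (k + size w')%N.
    by rewrite (perm_size (split_word i0 w)) size_cat size_nseq.
  have -> : size be = (k + k.+1 + size w')%N by rewrite size_cat size_nseq.
  by lia.
have [C1 C10 H1] := HS sq bK; have [C2 C20 H2] := HS sp bK.
have [e0 e00 He] := near0I H1 H2.
have ej j : j.+1%:R <= (e j)^-1.
  elim: j => [|j ih]; first by have /andP[? ?] := e01 0%N; rewrite invf_ge1.
  by rewrite -natr1 (le_trans _ (eS j))// lerD2r.
(* For this j both estimates apply at e_j, since 1 / e_j >= j + 1, and j + 1 exceeds the sum of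
   their constants, in contradiction to the choice of y_j. *)
have [j jP] := nat_gt (Num.max (C1 + C2) e0^-1).
move: jP; rewrite gt_max => /andP[jC je].
have /andP[ep e1] := e01 j; have [Ay yP] := eP j.
have ee : e j <= e0.
  rewrite -[leLHS]invrK -[leRHS]invrK lef_pV2 ?posrE ?invr_gt0//.
  by rewrite (le_trans (ltW je))// (le_trans _ (ej j))// ler_nat.
have [Hq Hp] := He _ ep e1 ee; have Oy : Om (y j) by exact: AO.
have wi0 : all (predC1 i0) w' by exact: filter_all.
have := pderivs_first_variation oOm bS ks ls ep e1 k wi0 Oy (esym (ae j)).
set lhs := _ - _; set rhs := pderivs _ _ _ => E.
have Hl : `|lhs| <= (C1 + C2) * gb (e j).
  rewrite /lhs (le_trans (ler_normB _ _))// mulrDl lerD//.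
    exact: (Hq (y j) Ay).
  exact: (Hp (y j) Ay).
have rE : rhs = pderivs w (T (e j)) (y j).
  rewrite /rhs; apply/esym; apply: (pderivs_perm oOm Wc) => //.
    exact: first_variation_csV.
  exact: split_word.
(* The falling factorial in front of the first variation is a positive integer, hence at least 1. *)
have : `|rhs| <= `|lhs|.
  rewrite E normrZ ler_peMl// ger0_norm// ler1n ffact_gt0.
  by rewrite leq_addl.
rewrite rE => H3; have := lt_le_trans yP (le_trans H3 Hl).
rewrite ltNge; apply/negP; rewrite negbK ler_wpM2r ?ltW ?gb0//.
by rewrite (lt_trans jC)// ltr_nat.
Qed.

(** In dimension 0 there is no direction to perturb along, but then the transported kernel is an
    empty sum and the first variation vanishes. *)
Lemma first_variation_dominated0 phi w : sound_kernel oOm q phi -> (2 * size w + 1 <= K0)%N ->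
  dominated (fun e => pderivs w (first_variation S phi (psi phi) e)).
Proof.
move=> sp wK; case: (pickP (@predT 'I_n)) => [i0 _|no]; first exact: (first_variation_dominated i0).
have w0 : w = [::] by case: w wK => // i w _; have := no i.
exists 0 => //; apply: near0_all => e e0 e1 x Ax.
rewrite w0 /= /first_variation /dhat.
have -> : psi phi e x = 0 by rewrite /psi transport_sum big1// => i _; have := no i.
rewrite (eq_derive1 (g := cst (S (phi e x, x)))) ?derive1_cst ?normr0 ?mul0r// => s.
by rewrite scaler0 addr0.
Qed.

Lemma hat_lie_dominated phi w : sound_kernel oOm q phi -> (2 * size w + 1 <= K0)%N ->
  dominated (fun e => pderivs w (fun x => hat_lie oOm sX S (phi e x, x))).
Proof.
move=> sp wK; have [ks _ _ _] := sp.
have [ls _ _ _] := null_transport (csXi sX) sp.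
pose G e x := S (phi e x, x).
have sG : csVs G by move=> e e0 e1; exact: (kernel_hat_csV oOm bS ks e0 e1).
pose H (s : seq 'I_n) e x : K := \sum_(i <- s) X x 0 i *: pderiv i (G e) x.
have sH s : csVs (H s).
  move=> e e0 e1; apply: csV_sum => i; apply: csV_scale; first exact: csXi.
  by apply: csV_pderiv => //; exact: sG.
(* The term D_X [S(phi_x, x)] requires one derivative more than [w]. *)
have wK1 : ((size w).+1 <= K0)%N by lia.
have oG : dominated_upto (size w).+1 G.
  by apply: dominated_upto_of_words => u uw; apply: HS => //; exact: leq_trans uw wK1.
have oH s : dominated_upto (size w) (H s).
  elim: s => [|i s ih].
    apply: dominated_upto_of_words => u uw; exists 0 => //; apply: near0_all => e e0 e1 x Ax.
    have /(ccompactP oOm)[_ AO] := cA.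
    have -> : H [::] e = (fun y => 0 *: G e y + 0 *: G e y).
      by apply/funext => y; rewrite /H big_nil !scale0r addr0.
    rewrite (pderivs_lin Wc oOm); [|exact: sG|exact: sG|exact: AO].
    by rewrite !scale0r addr0 normr0 mul0r.
  have -> : H (i :: s) = (fun e x => X x 0 i *: pderiv i (G e) x + H s e x).
    by apply/funext => e; apply/funext => x; rewrite /H big_cons.
  have sd : csVs (fun e => pderiv i (G e)) by move=> e e0 e1; apply: csV_pderiv => //; exact: sG.
  apply: dominated_upto_add => //.
    by move=> e e0 e1; apply: csV_scale; [exact: csXi|exact: sd].
  by apply: dominated_upto_scale => //; [exact: csXi|have [_] := oG; exact].
pose H0 := H (index_enum 'I_n).
have E : Keq (fun e x => 1 *: H0 e x + (-1) *: first_variation S phi (psi phi) e x)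
    (fun e x => hat_lie oOm sX S (phi e x, x)).
  by move=> e x ex; rewrite (hat_lie_kernel oOm sX bS ks ex) scale1r scaleN1r.
apply: dominated_eq (Keq_pderivs w E) _.
have E2 : Keq (fun e x => pderivs w (H0 e) x + (-1) *: pderivs w (first_variation S phi (psi phi) e) x)
   (fun e => pderivs w (fun x => 1 *: H0 e x + (-1) *: first_variation S phi (psi phi) e x)).
  move=> e x [e0 e1 Ox]; rewrite (pderivs_lin Wc oOm) ?scale1r//; first exact: sH.
  exact: first_variation_csV.
apply: dominated_eq E2 _; apply: dominated_add; first exact: (dominated_word (oH _)).
have [C C0 HC] := first_variation_dominated0 sp wK; exists C => //.
by apply: near0W HC => e e0 e1 HC x Ax; rewrite scaleN1r normrN; exact: HC.
Qed.

End kernel_bounds.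
End domination.

Section main_estimates.
Variables (R : realType) (n : nat) (F : scalar_kind) (Om : set 'rV[R]_n).
Hypothesis oOm : open Om.
Local Notation V := 'rV[R]_n.
Local Notation K := (scalars R F).
Local Notation D := (testfun K Om).
Let Wc := @scalars_complete R F.
Implicit Types (S : D * V -> K) (phi : R -> V -> D).

Lemma moments_le p q b (sb : csV Om b) k phi h : (p <= q)%N ->
  moments oOm q sb k phi h -> moments oOm p sb k phi h.
Proof.
move=> pq.
have M0 phi' h' : moment oOm q sb phi' h' -> moment oOm p sb phi' h'.
  move=> m A cA; have [C C0 HC] := m A cA; exists C => //.
  apply: near0W HC => e e0 e1 HC x Ax; rewrite (le_trans (HC x Ax))// ler_wpM2l//.
  by apply: ler_wiXn2l => //; exact: ltW.
elim: k phi h => [|k ih] phi h [m mS]; first by split=> //; exact: M0.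
by split; [exact: M0|move=> i; apply: ih; exact: mS].
Qed.

Lemma sound_kernel_le p q phi : (p <= q)%N -> sound_kernel oOm q phi -> sound_kernel oOm p phi.
Proof.
by move=> pq [k nd g m]; split=> // b sb j; exact: moments_le (m b sb j).
Qed.

Lemma mpderiv_pderivs S phi (al : 'I_n -> nat) :
  (fun e => mpderiv al (fun x => S (phi e x, x))) = (fun e => pderivs (word al) (fun x => S (phi e x, x))).
Proof. by apply/funext => e; rewrite /mpderiv mindex_iter_word. Qed.

Lemma pderivs_mpderiv S phi w : hat_basic S -> KS phi ->
  Keq Om (fun e => mpderiv (fun i => count_mem i w) (fun x => S (phi e x, x)))
      (fun e => pderivs w (fun x => S (phi e x, x))).
Proof.
move=> bS ks e x [e0 e1 Ox]; rewrite /mpderiv mindex_iter_word.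
apply/esym; apply: (pderivs_perm oOm Wc) => //; last exact: perm_word.
exact: (kernel_hat_csV oOm bS ks e0 e1).
Qed.

Lemma gt0_pow m (e : R) : 0 < e -> e <= 1 -> 0 < e ^+ m.
Proof. by move=> e0 _; exact: exprn_gt0. Qed.

Lemma gt0_powV m (e : R) : 0 < e -> e <= 1 -> 0 < e ^- m.
Proof. by move=> e0 _; rewrite invr_gt0 exprn_gt0. Qed.

Lemma dominated_le A (gb gb' : R -> R) (H : R -> V -> K) :
  (forall e, 0 < e -> e <= 1 -> gb e <= gb' e) -> dominated A gb H -> dominated A gb' H.
Proof.
move=> gg [C C0 HC]; exists C => //; apply: near0W HC => e e0 e1 HC x Ax.
by rewrite (le_trans (HC x Ax))// ler_wpM2l// gg.
Qed.

Lemma powV_le i j (e : R) : (i <= j)%N -> 0 < e -> e <= 1 -> e ^- i <= e ^- j.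
Proof.
move=> ij e0 e1; rewrite lef_pV2 ?posrE ?exprn_gt0//.
by apply: ler_wiXn2l => //; exact: ltW.
Qed.

Lemma hat_lie_moderate S (X : V -> V) (sX : smooth_on Om X) :
  hat_moderate S -> hat_moderate (hat_lie oOm sX S).
Proof.
move=> [bS mS]; split; first exact: hat_lie_basic.
move=> A cA al.
(* Kernel order and exponent are merged into one N, which makes the property monotone in N, as
   [words_uniform] requires. *)
pose P N w := forall phi, sound_kernel oOm N phi ->
  dominated A (fun e => e ^- N) (fun e => pderivs w (fun x => S (phi e x, x))).
have [i j w ij PN phi sp|w|N NP] := @words_uniform n P _ _ (2 * size (word al) + 1).
- apply: dominated_le (PN phi (sound_kernel_le ij sp)) => e e0 e1; exact: powV_le.
- have [q [N [_ H]]] := mS A cA (fun i => count_mem i w).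
  exists (maxn q N) => phi sp; have [ks _ _ _] := sp.
  have /(smoothing_kernelP oOm) sq := sound_kernel_le (leq_maxl q N) sp.
  have /(dominated_bigO A (@gt0_powV N)) := H phi sq.
  move=> /(dominated_eq oOm cA (pderivs_mpderiv w bS ks)).
  by apply: dominated_le => e e0 e1; apply: powV_le => //; exact: leq_maxr.
(* The exponent has to be positive, and N may be 0. *)
exists N, N.+1; split=> // phi /(smoothing_kernelP oOm) sp.
apply/(dominated_bigO A (@gt0_powV N.+1)); rewrite mpderiv_pderivs.
apply: (dominated_le (gb := fun e => e ^- N)); first by move=> e e0 e1; exact: powV_le.
have HS f (sf : sound_kernel oOm N f) w : (size w <= 2 * size (word al) + 1)%N ->
    dominated A (fun e => e ^- N) (fun e => pderivs w (fun x => S (f e x, x))) by move=> wN; exact: NP.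
exact: (hat_lie_dominated cA (@gt0_powV N) sX bS HS sp (leqnn _)).
Qed.

Lemma hat_lie_negligible S (X : V -> V) (sX : smooth_on Om X) :
  hat_negligible S -> hat_negligible (hat_lie oOm sX S).
Proof.
move=> [bS mS]; split; first exact: hat_lie_basic.
move=> A cA al m m0.
(* Here the exponent [m] is prescribed; only the kernel order N varies with the word. *)
pose P N w := forall phi, sound_kernel oOm N phi ->
  dominated A (fun e => e ^+ m) (fun e => pderivs w (fun x => S (phi e x, x))).
have [i j w ij PN phi sp|w|N NP] := @words_uniform n P _ _ (2 * size (word al) + 1).
- exact: PN (sound_kernel_le ij sp).
- have [q H] := mS A cA (fun i => count_mem i w) m m0.
  exists q => phi sp; have [ks _ _ _] := sp.
  have /(smoothing_kernelP oOm) sq := sp.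
  have /(dominated_bigO A (@gt0_pow m)) := H phi sq.
  exact: (dominated_eq oOm cA (pderivs_mpderiv w bS ks)).
exists N => phi /(smoothing_kernelP oOm) sp.
apply/(dominated_bigO A (@gt0_pow m)); rewrite mpderiv_pderivs.
have HS f (sf : sound_kernel oOm N f) w : (size w <= 2 * size (word al) + 1)%N ->
    dominated A (fun e => e ^+ m) (fun e => pderivs w (fun x => S (f e x, x))) by move=> wN; exact: NP.
exact: (hat_lie_dominated cA (@gt0_pow m) sX bS HS sp (leqnn _)).
Qed.

End main_estimates.

Theorem theorem19 (R : realType) (n : nat) (F : scalar_kind)
    (Om : set 'rV[R]_n) (oOm : open Om)
    (Rh : testfun (scalars R F) Om * 'rV[R]_n -> scalars R F)
    (hS : hat_basic Rh)
    (X : 'rV[R]_n -> 'rV[R]_n) (sX : smooth_on Om X) :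
  (hat_moderate Rh -> hat_moderate (hat_lie oOm sX Rh)) /\
  (hat_negligible Rh -> hat_negligible (hat_lie oOm sX Rh)).
Proof. by split; [exact: hat_lie_moderate|exact: hat_lie_negligible]. Qed.
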